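(* Let $\mu$ be a smooth volume form on $M$, let $x\in M$, $\lambda\in T_x^*M$, $\lambda(t)=e^{t\vec H}(\lambda)$, and let $\gamma(t)=\pi(\lambda(t))$, $t\in[0,T]$, be an ample and equiregular geodesic. Then there is a constant $C_\lambda>0$ such that, as $t\to0^+$, $$\left.(\pi\circ e^{t\vec H})^{*}\mu\right|_{\mathcal V_{\lambda}}=C_{\lambda}\,t^{\mathcal N(\lambda)}\,e^{\int_0^t \rho(\lambda(s))\,ds}\left(1-t^2\,\frac{\mathrm{tr}\,\mathcal R_\lambda}{6}+o(t^2)\right)\mu^*_{\lambda}.$$
   Context: Setting. $M$ is a connected smooth $n$-dimensional manifold, $X_0,X_1,\dots,X_k$ ($k\le n$) are smooth vector fields on $M$ and $Q$ is a smooth function on $M$. It is assumed that $X_1,\dots,X_k$ are everywhere linearly independent and that $\mathrm{Lie}\{(\mathrm{ad}\,X_0)^jX_i: i=1,\dots,k,\ j\ge0\}|_x=T_xM$ for all $x\in M$, where $(\mathrm{ad}\,Y)X=[Y,X]$ and $\mathrm{Lie}\,\mathcal{G}$ is the smallest Lie algebra containing the family of vector fields $\mathcal{G}$. $\mathcal D_x=\mathrm{span}\{X_1,\dots,X_k\}|_x$ is endowed with the inner product $\langle\cdot|\cdot\rangle_x$ making $X_1,\dots,X_k$ orthonormal; $\Gamma(\mathcal D)$ denotes smooth sections of $\mathcal D$. The Hamiltonian is $$H(p,x)=\tfrac12\sum_{i=1}^k\langle p,X_i(x)\rangle^2+\langle p,X_0(x)\rangle+\tfrac12Q(x),\qquad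 (p,x)\in T^*M,$$ with Hamiltonian vector field $\vec H=\sum_j \frac{\partial H}{\partial p_j}\frac{\partial}{\partial x_j}-\frac{\partial H}{\partial x_j}\frac{\partial}{\partial p_j}$ and flow $e^{t\vec H}$; $\pi:T^*M\to M$ is the projection. A geodesic with initial covector $\lambda$ is $\gamma(t)=\pi(\lambda(t))$, $\lambda(t)=e^{t\vec H}(\lambda)$. Flag. An admissible extension of $\dot\gamma$ is a vector field $\mathsf T=X_0+X$, $X\in\Gamma(\mathcal D)$, with $\mathsf T(\gamma(t))=\dot\gamma(t)$ for all $t$. The flag of $\gamma$ is $\mathcal F^i_{\gamma(t)}=\mathrm{span}\{\mathcal L^j_{\mathsf T}(X)|_{\gamma(t)}: X\in\Gamma(\mathcal D),\ j\le i-1\}\subseteq T_{\gamma(t)}M$, $i\ge1$, $\mathcal L_{\mathsf T}$ being the Lie derivative (the flag does not depend on $\mathsf T$), and $\mathcal F^0=\{0\}$. $\gamma$ is equiregular if each $\dim\mathcal F^i_{\gamma(t)}$ is independent of $t$, and ample if for every $t$ there is $m$ with $\mathcal F^m_{\gamma(t)}=T_{\gamma(t)}M$. For an ample equiregular geodesic, $m$ is the smallest such integer, $d_i=\dim\mathcal F^i_{\gamma(t)}-\dim\mathcal F^{i-1}_{\gamma(t)}$, and $\mathcal N(\lambda)=\sum_{i=1}^m(2i-1)d_i$. Volumes on fibers. For $\lambda\in T^*_xM$, $\mathcal V_\lambda=\ker\pi_*|_\lambda=T_\lambda(T_x^*M)\simeq T_x^*M$. Given the volume form $\mu$, $\mu_x^*$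 is the volume form on the vector space $T_x^*M$ (i.e. element of $\Lambda^n(T_xM)$) normalized by $\mu_x^*(\mu_x)=1$, and $\mu^*_\lambda$ is the induced volume form on $\mathcal V_\lambda$. Volume geodesic derivative. For $\lambda$ with ample and equiregular geodesic, write $(\pi\circ e^{t\vec H})^*\mu|_{\mathcal V_\lambda}=f_\lambda(t)\mu_\lambda^*$; then $\rho(\lambda)=\frac{d}{dt}\big|_{t=0}\log\big(t^{-\mathcal N(\lambda)}f_\lambda(t)\big)$. Curvature. For $T>0$ let $S_T(x_0,x_1)=\inf\frac12\int_0^T\big(\|u(s)\|^2-Q(x_u(s))\big)ds$, the infimum being over controls $u\in L^\infty([0,T],\mathbb R^k)$ whose trajectory $x_u$, solving $\dot x_u=X_0(x_u)+\sum_i u_iX_i(x_u)$, joins $x_0$ to $x_1$. For an ample geodesic $\gamma$ with initial covector $\lambda\in T^*_{x_0}M$, the geodesic cost $c_t(y)=-S_t(y,\gamma(t))$ is smooth in $y$ near $x_0$ for small $t>0$; $\dot c_t=\partial_tc_t$ has a critical point at $x_0$, and $d^2_{x_0}\dot c_t(v)=\frac{d^2}{ds^2}|_{s=0}\dot c_t(\eta(s))$ for any smooth curve $\eta$ with $\eta(0)=x_0$, $\dot\eta(0)=v$. Define symmetric operators $\mathcal Q_\lambda(t)$ on $\mathcal D_{x_0}$ by $d^2_{x_0}\dot c_t(v)=\langle\mathcal Q_\lambda(t)v|v\rangle_{x_0}$, $v\in\mathcal D_{x_0}$. It is known that $\mathcal Q_\lambda(t)=\frac1{t^2}\mathcal I_\lambda+\frac13\mathcal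 R_\lambda+O(t)$ as $t\to0^+$ for symmetric operators $\mathcal I_\lambda,\mathcal R_\lambda$ on $\mathcal D_{x_0}$; $\mathcal R_\lambda$ is the curvature at $\lambda$. *)

(* Defs.v *)
From HB Require Import structures.
From mathcomp Require Export all_boot all_order all_algebra.
From mathcomp Require Export all_classical all_reals all_analysis.

Set Implicit Arguments.
Unset Strict Implicit.
Unset Printing Implicit Defensive.
Export Order.TTheory GRing.Theory Num.Theory.
Export numFieldNormedType.Exports.

#[export] Set Implicit Arguments.
#[export] Unset Strict Implicit.
#[export] Unset Printing Implicit Defensive.

#[global] Open Scope classical_set_scope.
#[global] Open Scope ring_scope.

Section Calculus.
Context {R : realType}.

(* Meant for V finite dimensional and U open, where existence and continuity
   of all iterated directional derivatives is the usual C^r. *)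
Fixpoint Ck {V W : normedModType R} (r : nat) (U : set V) (f : V -> W) : Prop :=
  if r is r'.+1 then
    forall v : V, (forall y, U y -> derivable f y v) /\ Ck r' U ('D_v f)
  else forall y, U y -> {for y, continuous f}.

Definition smooth {V W : normedModType R} (U : set V) (f : V -> W) : Prop :=
  forall r, Ck r U f.

Definition grad {n} (f : 'rV[R]_n -> R) (y : 'rV[R]_n) : 'rV[R]_n :=
  \row_j 'D_(delta_mx 0 j) f y.

Definition has_second_derivative (g : R -> R) (s l : R) : Prop :=
  (\forall u \near s, derivable g u 1) /\ is_derive s 1 (derive1 g) l.

(* Smallest subspace containing A. *)
Definition vspan {n} (A : set 'rV[R]_n) : {vspace 'rV[R]_n} :=
  xget 0%VS [set U : {vspace 'rV[R]_n} | (forall v, A v -> v \in U) /\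
    (forall U' : {vspace 'rV[R]_n}, (forall v, A v -> v \in U') -> (U <= U')%VS)].

End Calculus.

(* cmap is only meaningful on cdom, cinv only on the image of cdom. *)
Record chart (R : realType) (n : nat) (T : topologicalType) := Chart {
  cdom : set T;
  cmap : T -> 'rV[R]_n;
  cinv : 'rV[R]_n -> T }.

Definition ccod {R n T} (c : @chart R n T) : set 'rV[R]_n := cmap c @` cdom c.

Record is_chart {R n T} (c : @chart R n T) : Prop := {
  cdom_open : open (cdom c);
  ccod_open : open (ccod c);
  cmapK : forall x, cdom c x -> cinv c (cmap c x) = x;
  cmap_continuous : forall x, cdom c x -> {for x, continuous (cmap c)};
  cinv_continuous : forall y, ccod c y -> {for y, continuous (cinv c)} }.

Record manifold (R : realType) (n : nat) := Manifold {
  carrier :> topologicalType;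
  atlas : set (chart R n carrier);
  chart_at : carrier -> chart R n carrier;
  atlas_chart : forall c, atlas c -> is_chart c;
  atlas_compatible : forall c c', atlas c -> atlas c' ->
    smooth (cmap c @` (cdom c `&` cdom c')) (cmap c' \o cinv c);
  chart_at_atlas : forall x, atlas (chart_at x);
  chart_at_dom : forall x, cdom (chart_at x) x;
  manifold_hausdorff : hausdorff_space carrier;
  manifold_second_countable : @second_countable carrier }.

Arguments atlas {R n} m.
Arguments chart_at {R n m} x.

(* A tangent vector at x and a covector at x are given by the row of their
   components in the coordinates of chart_at x; the pairing of p with v is
   (p *m v^T) 0 0.  Thus T^*M is M * 'rV_n as a set.  chart_at need not depend
   continuously on x: every regularity condition on tensors is stated after
   passing to the components in a fixed chart of the atlas. *)
Section Tensors.
Context {R : realType} {n : nat} {M : manifold R n}.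

Local Notation ct := (chart R n M).

Definition vfield := M -> 'rV[R]_n.
Definition cotangent : Type := (M * 'rV[R]_n)%type.

Definition pairing (p v : 'rV[R]_n) : R := (p *m v^T) 0 0.

(* 'J acts on rows from the right: 'd f y v = v *m 'J f y. *)
Definition transition_jac (c c' : ct) (x : M) : 'M[R]_n :=
  'J (cmap c' \o cinv c) (cmap c x).

Definition vec_in (c : ct) (x : M) (v : 'rV[R]_n) : 'rV[R]_n :=
  v *m transition_jac (chart_at x) c x.

(* Chosen so that pairing is preserved. *)
Definition covec_in (c : ct) (l : cotangent) : 'rV[R]_n :=
  l.2 *m (transition_jac c (chart_at l.1) l.1)^T.

(* The point of T^*M with canonical coordinates (q, y) in the chart c. *)
Definition cotangent_of (c : ct) (q y : 'rV[R]_n) : cotangent :=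
  (cinv c y, q *m (transition_jac (chart_at (cinv c y)) c (cinv c y))^T).

Definition field_in (c : ct) (X : vfield) (y : 'rV[R]_n) : 'rV[R]_n :=
  vec_in c (cinv c y) (X (cinv c y)).

Definition smooth_field (X : vfield) : Prop :=
  forall c, atlas M c -> smooth (ccod c) (field_in c X).

Definition smooth_fun_on (O : set M) (f : M -> R) : Prop :=
  forall c, atlas M c -> smooth (cmap c @` (cdom c `&` O)) (f \o cinv c).

Definition smooth_arc (e : R) (eta : R -> M) : Prop :=
  (forall s, -e < s < e -> {for s, continuous eta}) /\
  forall c, atlas M c ->
    smooth [set s : R | -e < s < e /\ cdom c (eta s)] (cmap c \o eta).

Definition velocity (g : R -> M) (t : R) : 'rV[R]_n :=
  derive1 (cmap (chart_at (g t)) \o g) t.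

(* [Y, X] = L_Y X = (ad Y) X, with sign [Y, X] f = Y (X f) - X (Y f). *)
Definition bracket (Y X : vfield) : vfield := fun x =>
  let c := chart_at x in
  'D_(Y x) (field_in c X) (cmap c x) - 'D_(X x) (field_in c Y) (cmap c x).

Definition lie_algebra (L : set vfield) : Prop :=
  [/\ L (fun=> 0),
      (forall (a : R) X Y, L X -> L Y -> L (fun x => a *: X x + Y x)) &
      (forall X Y, L X -> L Y -> L (bracket X Y))].

Definition Lie (G : set vfield) : set vfield := smallest lie_algebra G.

(* An n-form mu is given by its coefficient: mu_x is the determinant of the
   components in chart_at x, multiplied by mu x. *)
Definition volume_form (mu : M -> R) : Prop :=
  (forall x, mu x != 0) /\
  forall c, atlas M c ->
    smooth (ccod c)
      (fun y => mu (cinv c y) *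
                \det (transition_jac c (chart_at (cinv c y)) (cinv c y))).

(* Coefficient of mu_x^* in the dual coordinates of the fiber T_x^*M:
   the normalization mu_x^* (mu_x) = 1. *)
Definition dual_volume (mu : M -> R) (x : M) : R := (mu x)^-1.

End Tensors.

Arguments vfield {R n} M.
Arguments cotangent {R n} M.

Record affine_system {R : realType} {n : nat} (M : manifold R n) (k : nat) :=
  AffineSystem {
    drift : vfield M;
    frame : 'I_k -> vfield M;
    potential : M -> R }.

Section Dynamics.
Context {R : realType} {n k : nat} {M : manifold R n}.
Variable S : affine_system M k.

Definition frame_mx (x : M) : 'M[R]_(k, n) := \matrix_(i < k) frame S i x.

Definition smooth_system : Prop :=
  [/\ smooth_field (drift S), (forall i, smooth_field (frame S i)) &
      smooth_fun_on setT (potential S)].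

Definition bracket_generating : Prop :=
  forall (x : M) (v : 'rV[R]_n), exists2 X : vfield M,
    Lie [set Y | exists (i : 'I_k) (j : nat),
                   Y = iter j (bracket (drift S)) (frame S i)] X & X x = v.

Definition section_D (X : vfield M) : Prop :=
  smooth_field X /\ forall x, exists a : 'rV[R]_k, X x = a *m frame_mx x.

Definition hamiltonian (l : cotangent M) : R :=
  2^-1 * (\sum_(i < k) pairing l.2 (frame S i l.1) ^+ 2)
  + pairing l.2 (drift S l.1) + 2^-1 * potential S l.1.

Definition hamiltonian_curve (a b : R) (l : R -> cotangent M) : Prop :=
  forall t, a < t < b -> {for t, continuous (fun s => (l s).1)} /\
  forall c, atlas M c -> cdom c (l t).1 ->
    let q := covec_in c (l t) in let y := cmap c (l t).1 in
    is_derive t 1 (fun s => cmap c (l s).1)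
      (grad (fun q' => hamiltonian (cotangent_of c q' y)) q) /\
    is_derive t 1 (fun s => covec_in c (l s))
      (- grad (fun y' => hamiltonian (cotangent_of c q y')) y).

Definition flow_rel (t : R) (l l' : cotangent M) : Prop :=
  exists a b (g : R -> cotangent M),
    [/\ a < 0 < b, a < t < b, hamiltonian_curve a b g, g 0 = l & g t = l'].

Definition flow_defined (t : R) (l : cotangent M) : Prop :=
  exists l', flow_rel t l l'.

(* Equal to l outside the domain of the flow. *)
Definition flow (t : R) (l : cotangent M) : cotangent M :=
  xget l (flow_rel t l).

Definition geodesic (l : cotangent M) (t : R) : M := (flow t l).1.

Definition admissible_extension (T : R) (l : cotangent M) (V : vfield M) : Prop :=
  (exists2 X, section_D X & V = (fun x => drift S x + X x)) /\
  forall t, 0 <= t <= T -> V (geodesic l t) = velocity (geodesic l) t.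

(* At the points of a geodesic, this does not depend on the choice of the
   admissible extension V; nor do the invariants below. *)
Definition flag (V : vfield M) (i : nat) (x : M) : {vspace 'rV[R]_n} :=
  vspan [set v | exists X (j : nat),
    [/\ section_D X, (j < i)%N & v = iter j (bracket V) X x]].

Definition equiregular (V : vfield M) (T : R) (l : cotangent M) : Prop :=
  forall i s t, 0 <= s <= T -> 0 <= t <= T ->
    \dim (flag V i (geodesic l s)) = \dim (flag V i (geodesic l t)).

Definition ample (V : vfield M) (T : R) (l : cotangent M) : Prop :=
  forall t, 0 <= t <= T -> exists m, flag V m (geodesic l t) = fullv.

Definition flag_step (V : vfield M) (x : M) : nat :=
  xget 0%N [set m | flag V m x = fullv /\
                    forall m', flag V m' x = fullv -> (m <= m')%N].

(* N(lambda), for x the base point of lambda. *)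
Definition geodesic_dim (V : vfield M) (x : M) : nat :=
  (\sum_(1 <= i < (flag_step V x).+1)
     (2 * i - 1) * (\dim (flag V i x) - \dim (flag V i.-1 x)))%N.

(* Coefficient of (pi o e^{tH})^* mu restricted to the fiber through l, in the
   coordinates of that fiber given by chart_at l.1. *)
Definition pullback_volume (mu : M -> R) (t : R) (l : cotangent M) : R :=
  let z := geodesic l t in
  mu z * \det ('J (fun q => cmap (chart_at z) (geodesic (l.1, q) t)) l.2).

Definition volume_density (mu : M -> R) (l : cotangent M) (t : R) : R :=
  pullback_volume mu t l / dual_volume mu l.1.

(* The function t |-> log (t^-N f(t)) is extended by its limit at t = 0. *)
Definition rho (V : vfield M) (mu : M -> R) (l : cotangent M) : R :=
  let g := fun t => ln (t ^- geodesic_dim V l.1 * volume_density mu l t) in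
  derive1 (fun t => if t == 0 then lim (g s @[s --> 0^']) else g t) 0.

Definition Linfty_control (T : R) (u : R -> 'rV[R]_k) : Prop :=
  (forall i, measurable_fun `[0, T] (fun t => u t 0 i)) /\
  exists B : R, {ae @lebesgue_measure R, forall t, 0 <= t <= T -> `|u t| <= B}.

(* Caratheodory solutions, in integral form inside each chart. *)
Definition trajectory (T : R) (u : R -> 'rV[R]_k) (x : R -> M) : Prop :=
  {within `[0, T], continuous x} /\
  forall (c : chart R n M) (a b : R), atlas M c -> 0 <= a -> a <= b -> b <= T ->
    (forall s, a <= s <= b -> cdom c (x s)) ->
    cmap c (x b) - cmap c (x a) =
      \row_j \int[lebesgue_measure]_(s in `[a, b])
        vec_in c (x s) (drift S (x s) + u s *m frame_mx (x s)) 0 j.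

Definition action (T : R) (u : R -> 'rV[R]_k) (x : R -> M) : R :=
  2^-1 * \int[lebesgue_measure]_(s in `[0, T])
           ((\sum_(i < k) u s 0 i ^+ 2) - potential S (x s)).

Definition value (T : R) (x0 x1 : M) : \bar R :=
  ereal_inf [set z | exists u x,
    [/\ Linfty_control T u, trajectory T u x, x 0 = x0, x T = x1 &
        z = (action T u x)%:E]].

Definition cost (l : cotangent M) (t : R) (y : M) : R :=
  - fine (value t y (geodesic l t)).

Definition cost_dot (l : cotangent M) (t : R) (y : M) : R :=
  derive1 (fun s => cost l s y) t.

(* The geodesic cost is well defined around (t, x0): S is finite there, c_t is
   smooth in y and has a time derivative. *)
Definition cost_regular (l : cotangent M) (t : R) : Prop :=
  (\forall z \near (t, l.1), value z.1 z.2 (geodesic l z.1) \is a fin_num) /\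
  exists O : set M, [/\ open O, O l.1, smooth_fun_on O (cost l t) &
    forall y, O y -> derivable (fun s => cost l s y) t 1].

(* Operators on D_{x0} are given by their matrices in the orthonormal basis
   X_1, ..., X_k at x0. *)
Definition hessian_cost_dot (l : cotangent M) (t : R) (Q : 'M[R]_k) : Prop :=
  Q^T = Q /\
  forall (a : 'rV[R]_k) (e : R) (eta : R -> M), 0 < e -> smooth_arc e eta ->
    eta 0 = l.1 -> velocity eta 0 = a *m frame_mx l.1 ->
    has_second_derivative (cost_dot l t \o eta) 0 ((a *m Q *m a^T) 0 0).

Definition is_curvature (l : cotangent M) (Rl : 'M[R]_k) : Prop :=
  exists (Q : R -> 'M[R]_k) (Il : 'M[R]_k),
    [/\ (\forall t \near 0^'+, cost_regular l t /\ hessian_cost_dot l t (Q t)),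
        Il^T = Il, Rl^T = Rl &
        exists K : R, \forall t \near 0^'+,
          `|Q t - (t ^- 2 *: Il + 3^-1 *: Rl)| <= K * t].

End Dynamics.

(* Main.v *)
Require Import Defs.
From mathcomp Require Import zify perm measurable_realfun ring lra.

(** In the chart at [x] the Hamiltonian flow is an ordinary differential equation for states
    (covector, position), and [Ps t] is its linearization along the extremal, acting on rows. Let
    $D(s,t)$ be the determinant of the upper right block of $P(s)^{-1}P(t)$, the response of the
    position at time $t$ to the covector at time $s$. If $m$ is the coefficient of [mu] in this
    chart along the geodesic, then $f_{\lambda(s)}(t)=m(s)\,m(s+t)\,D(s,s+t)$ ([density_lambda]),
    and the theorem becomes a statement about the two-point function $D$.

    Heuristically, write $D(s,t)=(t-s)^Ne^{g(s,t)}$ with $g$ smooth. Then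
    $\rho(\lambda(s))=\partial_tg(s,s)+(\log m)'(s)$, and $g(0,t)-\int_0^t\partial_tg(s,s)\,ds$ has
    at $t=0$ first derivative $0$ and second derivative $-\partial_s\partial_tg(0,0)$. Also
    $\partial_t\partial_s\log D(0,t)=N/t^2+\partial_s\partial_tg(0,0)+O(t)$. So it is enough to know
    that $\partial_t\partial_s\log D(0,t)=\mathrm{tr}\,\mathcal Q_\lambda(t)$: the constant term is
    then $\mathrm{tr}\,\mathcal R_\lambda/3$, and minus one half of it is the coefficient of $t^2$.
    The proof works with the Taylor coefficients [alpha] of $D(s,s+t)$ in place of $g$
    ([rho_formula], [trace_eq], [asymptotics]).

    Order of vanishing. A covector that annihilates the flag up to level $w-1$ moves the position
    only at order $t^w$. In a dual basis adapted to the flag, the product of the two upper blocks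
    has entries of order $t^{w_a+w_b-1}$, and their leading coefficients form the Gram matrix of
    independent curves $t^{w_a-1}c_a$ in $L^2(0,1)$, whose determinant is positive ([gram_det],
    [det_order]). The link with the flag is a triangular relation between iterated brackets and the
    derivatives [Xs] of the frame along the extremal ([flag_rec], [order_manifold]). Equiregularity
    makes the exponent the same at all nearby times.

    Trace identity. Symplecticity of the linearized flow gives $\partial_t\partial_s\log
    D(0,t)=\mathrm{tr}(YY^T)$, where $Y=X(0)\,b(t)^{-T}X(t)^T$, $X$ is the frame and $b$ the upper
    right block ([trace_identity]).

    Cost. For short times the value from a point near [x] to the geodesic is the action of a nearby
    extremal ([value_eq]). Competitors that stay in a small ball lose by a direct comparison
    ([local_min]). Those that leave it are excluded by surgery: an inexpensive excursion would
    contradict the finiteness of the value at one fixed later time ([excursion_cost]).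
    Differentiating in time gives a Hamilton-Jacobi formula for $\dot c_t$, exactly quadratic in the
    final covector, and the variation of that covector is governed by $b^{-T}$; hence the Hessian of
    $\dot c_t$ has trace $\mathrm{tr}(YY^T)$ ([cost_dot_quadratic], [hessian_trace]). *)

Notation csmooth U F := (forall j, smooth U (fun y => F y 0 j)) (only parsing).

(** Initial states range over the half ball, so that solutions from nearby states can be compared
    without leaving the ball of radius [r]. *)
Notation flow_bounds R h z0 r K T Phi := (forall z, `|z - z0| <= r / 2 ->
    Phi z 0 = z /\ forall t : R, `|t| < T ->
      `|Phi z t - z| <= K * `|t| /\ `|Phi z t - z0| <= r /\ is_derive t 1 (Phi z) (h (Phi z t))) (only parsing).

(** * Calculus on the line: matrix-valued derivatives, mean value bounds, Gronwall *)

Section Basics.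
Context {R : realType}.

Lemma derive_mxP m n (M : R -> 'M[R]_(m, n)) (t : R) (dM : 'M[R]_(m, n)) :
  is_derive t 1 M dM <->
  forall i j, is_derive t 1 (fun x => M x i j) (dM i j).
Proof.
split=> [[dMt <-] i j|H].
  rewrite derive_mx // mxE; apply: derivableP.
  exact: (derivable_mxP _ _ _).1.
have dMt : derivable M t 1.
  by apply/derivable_mxP => i j; have [] := H i j.
by apply: DeriveDef => //; rewrite derive_mx //; apply/matrixP => i j; rewrite mxE; have [] := H i j.
Qed.

Lemma mx_entry_le m n (A : 'M[R]_(m, n)) i j : `|A i j| <= `|A|.
Proof.
by rewrite [leRHS]/Num.Def.normr/= mx_normrE; exact: (le_bigmax _ _ (i, j)).
Qed.

Lemma mx_norm_leP m n (A : 'M[R]_(m, n)) K : 0 <= K ->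
  (forall i j, `|A i j| <= K) -> `|A| <= K.
Proof.
move=> K0 H; rewrite [leLHS]/Num.Def.normr/= mx_normrE.
by apply: bigmax_le => // -[i j] _; exact: H.
Qed.

Lemma mulmx_norm m n p (A : 'M[R]_(m, n)) (B : 'M[R]_(n, p)) :
  `|A *m B| <= n%:R * `|A| * `|B|.
Proof.
apply: mx_norm_leP => [|i j]; first by rewrite !mulr_ge0.
rewrite mxE; apply: (le_trans (ler_norm_sum _ _ _)).
rewrite -mulrA -[n in n%:R]card_ord mulr_natl -sumr_const.
apply: ler_sum => l _; rewrite normrM.
by apply: ler_pM; rewrite ?normr_ge0 ?mx_entry_le.
Qed.

Lemma norm_trmx m n (A : 'M[R]_(m, n)) : `|A^T| = `|A|.
Proof.
apply/eqP; rewrite eq_le; apply/andP; split; apply: mx_norm_leP => // i j.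
  by rewrite mxE mx_entry_le.
by have := mx_entry_le A^T j i; rewrite mxE.
Qed.

Lemma is_derive_cont (V : normedModType R) (f : R -> V) (t : R) (df : V) :
  is_derive t 1 f df -> {for t, continuous f}.
Proof.
by move=> [fd _]; apply: differentiable_continuous; apply/derivable1_diffP.
Qed.

Lemma is_derive_within (V : normedModType R) (f df : R -> V) (a b : R) :
  (forall t, a <= t <= b -> is_derive t 1 f (df t)) ->
  {within `[a, b], continuous f}.
Proof.
move=> H; apply: derivable_within_continuous => t; rewrite in_itv /= => tab.
by have [] := H t tab.
Qed.

(** The closed interval with endpoints in either order; estimates along solutions then cover forward
    and backward time at once. *)
Definition between (a b t : R) : Prop := (t - a) * (t - b) <= 0.

Lemma betweenC a b t : between a b t = between b a t.
Proof. by rewrite /between mulrC. Qed.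

Lemma between_le a b t : a <= b -> between a b t <-> a <= t <= b.
Proof.
move=> ab; rewrite /between; split=> [H|/andP[H1 H2]]; last by nra.
apply/andP; split; rewrite leNgt; apply/negP => h.
  have : 0 < (a - t) * (b - t) by apply: mulr_gt0; lra.
  by lra.
have : 0 < (t - a) * (t - b) by apply: mulr_gt0; lra.
by lra.
Qed.

Lemma between_refl a b : between a b a /\ between a b b.
Proof. by rewrite /between !subrr mul0r mulr0. Qed.

Lemma between_ex (a b : R) : exists lo hi, [/\ lo <= hi,
  (lo = a /\ hi = b) \/ (lo = b /\ hi = a) &
  forall t, between a b t <-> lo <= t <= hi].
Proof.
case: (leP a b) => [ab|/ltW ba].
  by exists a, b; split => //; [left|move=> t; exact: between_le].
exists b, a; split => //; first by right.
by move=> t; rewrite betweenC; exact: between_le.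
Qed.

Lemma between_itv (lo hi a b t : R) : lo <= a <= hi -> lo <= b <= hi ->
  between a b t -> lo <= t <= hi.
Proof.
have [l [h [lh [[-> ->]|[-> ->]] H]]] := between_ex a b => ? ? /H; lra.
Qed.

Lemma between_sub (a b c t : R) : between a b c -> between a c t -> between a b t.
Proof.
have [l [h [lh e H]]] := between_ex a b => /H lc; move=> /between_itv tl.
by apply/H; apply: tl => //; case: e => -[? ?]; subst; rewrite lexx lh.
Qed.

Lemma between_norm (T a b t : R) : `|a| < T -> `|b| < T -> between a b t -> `|t| < T.
Proof.
rewrite !ltr_norml.
have [l [h [lh [[-> ->]|[-> ->]] H]]] := between_ex a b => ? ? /H; lra.
Qed.

Lemma between_normle (T a b t : R) : `|a| <= T -> `|b| <= T -> between a b t -> `|t| <= T.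
Proof. rewrite !ler_norml; exact: between_itv. Qed.

Lemma between_dist (a b t : R) : between a b t -> `|t - a| <= `|b - a|.
Proof.
have [l [h [lh [[-> ->]|[-> ->]] H]]] := between_ex a b => /H /andP[h1 h2].
  by rewrite !ger0_norm ?subr_ge0 //; lra.
by rewrite !ler0_norm ?subr_le0 //; lra.
Qed.

Lemma mvt_norm m n (F dF : R -> 'M[R]_(m, n)) a b K :
  (forall t, between a b t -> is_derive t 1 F (dF t) /\ `|dF t| <= K) ->
  `|F b - F a| <= K * `|b - a|.
Proof.
wlog ab : a b / a <= b.
  move=> W H; case: (leP a b) => [ab|/ltW ba]; first exact: W.
  rewrite distrC [X in _ * X]distrC; apply: W => // t; rewrite betweenC; exact: H.
move=> H.
have K0 : 0 <= K.
  have [_] := H a (between_refl a b).1; apply: le_trans; exact: normr_ge0.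
apply: mx_norm_leP => [|i j]; first by rewrite mulr_ge0.
have Hd t : a <= t <= b -> is_derive t 1 (fun x => F x i j) (dF t i j).
  by move=> /(between_le _ ab) /H [/derive_mxP].
have [c cab] := @MVT_segment R (fun x => F x i j) (fun t => dF t i j) a b ab
  (fun t tab => Hd t (subset_itv_oo_cc tab)) (is_derive_within Hd).
rewrite !mxE => ->; rewrite normrM ler_wpM2r //.
apply: (le_trans (mx_entry_le _ _ _)).
by apply: (H c _).2; apply/(between_le _ ab).
Qed.

Lemma mvt_real (f df : R -> R) a b K :
  (forall t, between a b t -> is_derive t 1 f (df t) /\ `|df t| <= K) ->
  `|f b - f a| <= K * `|b - a|.
Proof.
wlog ab : a b / a <= b.
  move=> W H; case: (leP a b) => [ab|/ltW ba]; first exact: W.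
  rewrite distrC [X in _ * X]distrC; apply: W => // t; rewrite betweenC; exact: H.
move=> H.
have Hd t : a <= t <= b -> is_derive t 1 f (df t).
  by move=> /(between_le _ ab) /H [].
have [c cab ->] := @MVT_segment R f df a b ab
  (fun t tab => Hd t (subset_itv_oo_cc tab)) (is_derive_within Hd).
rewrite normrM ler_wpM2r //.
by apply: (H c _).2; apply/(between_le _ ab).
Qed.

(** No exponential appears: at a maximum point [c] of the norm, the mean value bound gives
    [|w c| <= |w a| + (L |w c| + e) |b - a|], and the smallness of [L |b - a|] absorbs the unknown
    term on the right. *)
Lemma gronwall m n (w dw : R -> 'M[R]_(m, n)) a b L e :
  0 <= L -> 0 <= e -> L * `|b - a| <= 2^-1 ->
  (forall t, between a b t ->
     is_derive t 1 w (dw t) /\ `|dw t| <= L * `|w t| + e) ->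
  `|w b| <= 2 * `|w a| + 2 * e * `|b - a|.
Proof.
move=> L0 e0 Lab H.
have [lo [hi [lohi bt]]] : exists lo hi, lo <= hi /\
    forall t, between a b t <-> lo <= t <= hi.
  case: (leP a b) => [ab|/ltW ba].
    by exists a, b; split => // t; exact: between_le.
  by exists b, a; split => // t; rewrite betweenC; exact: between_le.
have Hd t : lo <= t <= hi -> is_derive t 1 w (dw t) by move=> /bt /H [].
have cw : {within `[lo, hi], continuous (fun t => `|w t|)}.
  move=> t; apply: continuous_comp; last exact: norm_continuous.
  exact: (is_derive_within Hd).
have [c clh cmax] := EVT_max lohi cw.
have cab : between a b c by apply/bt; move: clh; rewrite in_itv.
have wa t : between a b t -> `|w t| <= `|w c|.
  by move=> /bt tl; apply: cmax; rewrite in_itv.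
have H1 : `|w c - w a| <= (L * `|w c| + e) * `|c - a|.
  apply: (@mvt_norm _ _ w dw) => t /(between_sub cab) tab.
  have [? h] := H t tab; split => //; apply: (le_trans h).
  by rewrite lerD2r ler_wpM2l // wa.
have H2 : `|w c| <= `|w a| + (L * `|w c| + e) * `|b - a|.
  have -> : w c = w a + (w c - w a) by rewrite addrC subrK.
  apply: (le_trans (ler_normD _ _)); rewrite lerD2l (addrC (w a)) subrK.
  apply: (le_trans H1); rewrite ler_wpM2l ?between_dist //.
  by rewrite addr_ge0 // mulr_ge0.
have wb : `|w b| <= `|w c| by apply: wa; exact: (between_refl a b).2.
have := ler_wpM2r (normr_ge0 (w c)) Lab.
by nra.
Qed.

End Basics.

(** * Smoothness by iterated directional derivatives *)

Section Smooth.
Context {R : realType}.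

Lemma nbhs_eps (V : normedModType R) (v : V) (P : V -> Prop) :
  (\forall w \near v, P w) <->
  exists2 r : R, 0 < r & forall w, `|w - v| <= r -> P w.
Proof.
split.
  move=> /nbhs_ballP [r r0 H]; exists (r / 2); first exact: divr_gt0.
  move=> w wv; apply: H; rewrite -ball_normE /= distrC.
  by apply: (le_lt_trans wv); rewrite ltr_pdivrMr // ltr_pMr // ltr1n.
move=> [r r0 H]; apply/nbhs_ballP; exists r => // w.
by rewrite -ball_normE /= distrC => /ltW; exact: H.
Qed.

Lemma cont_epsP (V W : normedModType R) (f : V -> W) v :
  {for v, continuous f} <-> forall e, 0 < e -> exists2 r, 0 < r &
    forall w, `|w - v| <= r -> `|f w - f v| <= e.
Proof.
split=> [/cvgrPdistC_le H e e0|H].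
  exact/nbhs_eps/H.
by apply/cvgrPdistC_le => e e0; apply/nbhs_eps; exact: H.
Qed.

Lemma differentiable_est (V W : normedModType R) (F : V -> W) (z : V)
    (df : {linear V -> W}) : continuous df ->
  (forall e : R, 0 < e -> exists2 r : R, 0 < r & forall v : V, `|v| <= r ->
     `|F (z + v) - F z - df v| <= e * `|v|) ->
  differentiable F z /\ 'd F z = df :> (V -> W).
Proof.
move=> cdf H.
have E : F \o shift z = cst (F z) + df +o_ 0 id.
  apply/eqaddoP => e e0.
  have [r r0 rH] := H e e0.
  apply/nbhs_eps; exists r => // v; rewrite subr0 => vr.
  by rewrite /= !fctE opprD addrA [v + z]addrC; exact: rH.
have dE := diff_unique cdf E.
by split => //; apply/diff_locallyP; rewrite dE.
Qed.

Lemma diff_of_est m p (F : 'rV[R]_m -> 'rV[R]_p) (z : 'rV[R]_m) (A : 'M[R]_(m, p)) :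
  (forall e : R, 0 < e -> exists2 r : R, 0 < r & forall v : 'rV[R]_m, `|v| <= r ->
     `|F (z + v) - F z - v *m A| <= e * `|v|) ->
  differentiable F z /\ 'J F z = A.
Proof.
move=> H.
have cA : continuous (mulmxr A : 'rV[R]_m -> 'rV[R]_p).
  move=> v.
  have est (w : 'rV[R]_m) : `|w *m A| <= (m%:R * `|A|) * `|w|.
    by rewrite mulrAC; exact: mulmx_norm.
  apply/cont_epsP => e e0.
  have K0 : 0 < m%:R * `|A| + 1 by rewrite ltr_wpDl // mulr_ge0.
  exists (e / (m%:R * `|A| + 1)) => [|w wv]; first exact: divr_gt0.
  rewrite /= -mulmxBl; apply: (le_trans (est _)).
  rewrite (@le_trans _ _ ((m%:R * `|A| + 1) * `|w - v|)) //.
    by rewrite ler_wpM2r // lerDl.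
  by rewrite mulrC -ler_pdivlMr.
have [dF dE] := differentiable_est cA H.
split => //; apply/row_matrixP => i.
by rewrite !rowE /jacobian mul_rV_lin1 dE.
Qed.

Lemma is_derive_line (V W : normedModType R) (f : V -> W) (z v : V) (s : R) :
  derivable f (z + s *: v) v ->
  is_derive s 1 (fun u => f (z + u *: v)) ('D_v f (z + s *: v)).
Proof.
move=> fd.
have E : (fun h : R => h^-1 *: (((fun u => f (z + u *: v)) \o shift s) (h *: 1) - f (z + s *: v)))
  = (fun h : R => h^-1 *: ((f \o shift (z + s *: v)) (h *: v) - f (z + s *: v))).
  apply/funext => h /=; congr (_ *: (f _ - _)).
  by rewrite [h *: 1]mulr1 scalerDl addrCA.
by apply: DeriveDef; rewrite /derivable /derive E.
Qed.

Section General.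
Context {V W : normedModType R}.
Implicit Types (U : set V) (f g : V -> W).

Lemma Ck_sub r U U' f : U' `<=` U -> Ck r U f -> Ck r U' f.
Proof.
move=> sU; elim: r f => [|r IH] f /= H; first by move=> y /sU; exact: H.
by move=> v; have [H1 H2] := H v; split; [move=> y /sU; exact: H1|exact: IH].
Qed.

Lemma smooth_sub U U' f : U' `<=` U -> smooth U f -> smooth U' f.
Proof. by move=> sU H r; exact: Ck_sub (H r). Qed.

Lemma Ck_ext r U f g : open U -> (forall y, U y -> f y = g y) ->
  Ck r U f -> Ck r U g.
Proof.
move=> oU; elim: r f g => [|r IH] f g fg /= H.
  move=> y Uy; have fy := H y Uy.
  have -> : {for y, continuous g} = (g @ y --> f y) by rewrite /prop_for /continuous_at fg.
  apply: cvg_trans fy; apply: near_eq_cvg.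
  have nU : nbhs y U by apply: open_nbhs_nbhs.
  by apply: filterS nU => w Uw; exact: fg.
have nfg y : U y -> \forall w \near y, f w = g w.
  move=> Uy; have nU : nbhs y U by apply: open_nbhs_nbhs.
  by apply: filterS nU => w Uw; exact: fg.
move=> v; have [H1 H2] := H v; split.
  move=> y Uy; apply: near_eq_derivable (H1 y Uy); exact: nfg.
apply: IH H2 => y Uy; apply: near_eq_derive; exact: nfg.
Qed.

Lemma smooth_ext U f g : open U -> (forall y, U y -> f y = g y) ->
  smooth U f -> smooth U g.
Proof. by move=> oU fg H r; exact: Ck_ext (H r). Qed.

Lemma smooth_cont U f y : smooth U f -> U y -> {for y, continuous f}.
Proof. by move=> H; exact: (H 0%N). Qed.

Lemma smooth_derivable U f y v : smooth U f -> U y -> derivable f y v.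
Proof. by move=> H; exact: (H 1%N v).1. Qed.

Lemma smooth_derive U f v : smooth U f -> smooth U ('D_v f).
Proof. by move=> H r; exact: (H r.+1 v).2. Qed.

(** Smoothness by coinduction: [Ck] unfolds one directional derivative at a time, so a class of
    continuous functions that contains, up to equality on [U], all directional derivatives of its
    members consists of smooth functions. *)
Lemma smooth_coind (P : (V -> W) -> Prop) U : open U ->
  (forall f, P f -> forall y, U y -> {for y, continuous f}) ->
  (forall f, P f -> forall v, (forall y, U y -> derivable f y v) /\
     exists2 g, P g & forall y, U y -> g y = 'D_v f y) ->
  forall f, P f -> smooth U f.
Proof.
move=> oU Pc Pd f Pf r; elim: r f Pf => [|r IH] f Pf /=; first exact: Pc.
move=> v; have [dP [g Pg gE]] := Pd f Pf v; split => //.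
by apply: (@Ck_ext r U g) => //; exact: IH.
Qed.

Lemma smooth_cst U (c : W) : open U -> smooth U (cst c : V -> W).
Proof.
move=> oU; apply: (@smooth_coind (fun f => exists c : W, f = cst c)) => //.
- by move=> _ [d ->] y _; apply: cvg_cst.
- move=> _ [d ->] v; split=> [y _|]; first exact: derivable_cst.
  by exists (cst 0); [exists 0|move=> y _; rewrite derive_cst].
- by exists c.
Qed.

Lemma smoothD U f g : open U -> smooth U f -> smooth U g ->
  smooth U (fun y => f y + g y).
Proof.
move=> oU sf sg.
apply: (@smooth_coind (fun h => exists f g : V -> W, [/\ smooth U f, smooth U g & h = (f + g)])) => //.
- move=> _ [f1 [g1 [s1 s2 ->]]] y Uy.
  by apply: continuousD; [exact: smooth_cont s1 Uy|exact: smooth_cont s2 Uy].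
- move=> _ [f1 [g1 [s1 s2 ->]]] v; split=> [y Uy|].
    by apply: derivableD; [exact: smooth_derivable s1 Uy|exact: smooth_derivable s2 Uy].
  exists ('D_v f1 + 'D_v g1).
    by exists ('D_v f1), ('D_v g1); split => //; exact: smooth_derive.
  by move=> y Uy; rewrite deriveD //; [exact: smooth_derivable s1 Uy|exact: smooth_derivable s2 Uy].
- by exists f, g.
Qed.

Lemma smoothZ U (c : R) f : open U -> smooth U f -> smooth U (fun y => c *: f y).
Proof.
move=> oU sf.
apply: (@smooth_coind (fun h => exists f : V -> W, smooth U f /\ h = (c \*: f))) => //.
- move=> _ [f1 [s1 ->]] y Uy.
  by apply: continuousZr; exact: smooth_cont s1 Uy.
- move=> _ [f1 [s1 ->]] v; split=> [y Uy|].
    by apply: derivableZ; exact: smooth_derivable s1 Uy.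
  exists (c \*: 'D_v f1).
    by exists ('D_v f1); split => //; exact: smooth_derive.
  by move=> y Uy; rewrite deriveZ //; exact: smooth_derivable s1 Uy.
- by exists f.
Qed.

Lemma smoothN U f : open U -> smooth U f -> smooth U (fun y => - f y).
Proof.
move=> oU sf; have := smoothZ (-1) oU sf.
by apply: smooth_ext => // y _; rewrite scaleN1r.
Qed.

Lemma smoothB U f g : open U -> smooth U f -> smooth U g ->
  smooth U (fun y => f y - g y).
Proof. by move=> oU sf sg; apply: smoothD => //; exact: smoothN. Qed.

Lemma smooth_sum U I (s : seq I) (P : pred I) (F : I -> V -> W) : open U ->
  (forall i, smooth U (F i)) -> smooth U (fun y => \sum_(i <- s | P i) F i y).
Proof.
move=> oU sF; elim: s => [|i s IH].
  by apply: (@smooth_ext U (cst 0)) => // [y _|]; [rewrite big_nil|exact: smooth_cst].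
case Pi : (P i); last first.
  by apply: smooth_ext IH => // y _; rewrite big_cons Pi.
have := smoothD oU (sF i) IH.
by apply: smooth_ext => // y _; rewrite big_cons Pi.
Qed.

End General.

(** The Leibniz rule leads from products to sums of products, so the argument is an induction on the
    order, with stability of [Ck] under sums proved inside. *)
Lemma smoothM (V : normedModType R) (U : set V) (f g : V -> R) : open U ->
  smooth U f -> smooth U g -> smooth U (fun y => f y * g y).
Proof.
move=> oU sf sg r; elim: r f g sf sg => [|r IH] f g sf sg /=.
  by move=> y Uy; apply: continuousM; [exact: smooth_cont sf Uy|exact: smooth_cont sg Uy].
move=> v; split=> [y Uy|].
  by apply: derivableM; [exact: smooth_derivable sf Uy|exact: smooth_derivable sg Uy].
have CkD r' (a b : V -> R) : Ck r' U a -> Ck r' U b -> Ck r' U (a + b).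
  elim: r' a b => [|r' IHr] a b /= Ha Hb.
    by move=> y Uy; apply: continuousD; [exact: Ha|exact: Hb].
  move=> w; have [a1 a2] := Ha w; have [b1 b2] := Hb w; split=> [y Uy|].
    by apply: derivableD; [exact: a1|exact: b1].
  apply: (@Ck_ext _ _ r' U ('D_w a + 'D_w b)) => // [y Uy|]; last exact: IHr.
  by rewrite deriveD //; [exact: a1|exact: b1].
apply: (@Ck_ext _ _ r U ((fun y => f y * 'D_v g y) + (fun y => g y * 'D_v f y))) => //.
  by move=> y Uy; rewrite deriveM //; [exact: smooth_derivable sf Uy|exact: smooth_derivable sg Uy].
by apply: CkD; apply: IH => //; exact: smooth_derive.
Qed.

Lemma smooth_affine (V V' W : normedModType R) (U : set V) (f : V -> W)
    (A : V' -> V) (L : V' -> V) :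
  (forall y v (h : R), A (y + h *: v) = A y + h *: L v) -> continuous A ->
  smooth U f -> smooth (A @^-1` U) (f \o A).
Proof.
move=> AL cA sf r; have {sf} : Ck r U f by exact: sf.
elim: r f => [|r IH] f /= H.
  by move=> y Uy; apply: continuous_comp; [exact: cA|exact: H].
move=> v; have [H1 H2] := H (L v).
have E y : (fun h : R => h^-1 *: (((f \o A) \o shift y) (h *: v) - (f \o A) y))
  = (fun h : R => h^-1 *: ((f \o shift (A y)) (h *: L v) - f (A y))).
  apply/funext => h /=; congr (_ *: (f _ - _)).
  by rewrite addrC AL addrC.
split=> [y Uy|]; first by rewrite /derivable E; exact: H1.
have -> : 'D_v (f \o A) = 'D_(L v) f \o A by apply/funext => y; rewrite /derive E.
exact: IH.
Qed.

Lemma smooth_entry (V : normedModType R) m n (U : set V) (F : V -> 'M[R]_(m, n)) i j :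
  open U -> smooth U F -> smooth U (fun y => F y i j).
Proof.
move=> oU sF.
apply: (@smooth_coind _ _ (fun h => exists F : V -> 'M[R]_(m, n), smooth U F /\ h = (fun y => F y i j))) => //.
- move=> _ [f1 [s1 ->]] y Uy.
  apply: (@continuous_comp _ _ _ f1 (fun M : 'M[R]_(m, n) => M i j)).
    exact: smooth_cont s1 Uy.
  exact: coord_continuous.
- move=> _ [f1 [s1 ->]] v; split=> [y Uy|].
    exact: ((derivable_mxP f1 y v).1 (smooth_derivable s1 Uy) i j).
  exists (fun y => 'D_v f1 y i j).
    by exists ('D_v f1); split => //; exact: smooth_derive.
  by move=> y Uy; rewrite derive_mx ?mxE //; exact: smooth_derivable s1 Uy.
- by exists F.
Qed.

Lemma smooth_id (V : normedModType R) (U : set V) : open U ->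
  smooth U (id : V -> V).
Proof.
move=> oU.
apply: (@smooth_coind _ _ (fun h => (exists c : V, h = cst c) \/ h = id)) => //; last by right.
- move=> _ [[c ->]|->] y Uy; first exact: (@cst_continuous _ _ c y).
  exact: cvg_id.
- move=> _ [[c ->]|->] v; split=> [y Uy|].
  + exact: derivable_cst.
  + by exists (cst 0); [left; exists 0|move=> y _; rewrite derive_cst].
  + exact: derivable_id.
  + by exists (cst v); [left; exists v|move=> y _; rewrite derive_id].
Qed.

Lemma smooth_coord m (U : set 'rV[R]_m) j : open U ->
  smooth U (fun y : 'rV[R]_m => y 0 j).
Proof. by move=> oU; exact: (smooth_entry 0 j oU (smooth_id oU)). Qed.

End Smooth.

(** * Linearity and symmetry of directional derivatives *)

Section Calc.
Context {R : realType}.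

Lemma close2 (x y a b e : R) :
  `|a - x| <= e / 2 -> `|b - y| <= e / 2 -> a = b -> `|x - y| <= e.
Proof. by move=> + + E; rewrite E !ler_norml; lra. Qed.

Lemma close3 (x v w a b c e : R) : a = b + c ->
  `|b - v| <= e / 3 -> `|c - w| <= e / 3 -> `|a - x| <= e / 3 -> `|x - (v + w)| <= e.
Proof. by move=> ->; rewrite !ler_norml; lra. Qed.

Lemma mulhhI (h x y u v : R) : 0 < h -> u = h * h * x -> v = h * h * y -> u = v -> x = y.
Proof. by move=> h0 -> -> /mulfI; apply; rewrite gt_eqF // mulr_gt0. Qed.

Lemma diff2C (x y z w : R) : x - y - (z - w) = x - z - (y - w).
Proof. ring. Qed.

Lemma derive_scale (V W : normedModType R) (f : V -> W) (z v : V) (c : R) :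
  derivable f z v -> 'D_(c *: v) f z = c *: 'D_v f z.
Proof.
have [->|c0] := eqVneq c 0; first by rewrite !scale0r derive0.
move=> fd; have := @is_derive_line R V W f z v 0; rewrite scale0r addr0 => /(_ fd) H1.
have H2 : is_derive (0 : R) 1 (fun u : R => f (z + (c * u) *: v)) (c *: 'D_v f z).
  have dc : is_derive (0 : R) 1 (fun u : R => c * u) c.
    by apply: is_derive_eq; rewrite [LHS]mulr1.
  pose m (u : R) := c * u; pose g (u : R) := f (z + u *: v).
  have d1 : differentiable m 0 by apply/derivable1_diffP; have [] := dc.
  have d2 : differentiable g (m 0).
    by rewrite /m mulr0; apply/derivable1_diffP; have [] := H1.
  have d3 : differentiable (g \o m) 0 by exact: differentiable_comp.
  have Em : 'd m 0 1 = c by rewrite -deriveE //; have [] := dc.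
  have Eg : 'd g (m 0) 1 = 'D_v f z by rewrite -deriveE // /m mulr0; have [] := H1.
  apply: DeriveDef; first exact/derivable1_diffP.
  rewrite -[fun u => _]/(g \o m) deriveE // diff_comp //= Em.
  have -> : 'd g (m 0) c = 'd g (m 0) (c *: (1 : R)) by congr ('d _ _ _); rewrite [RHS]mulr1.
  by rewrite linearZ /= Eg.
have [H3 <-] := H2.
have E : (fun h : R => h^-1 *: (((fun u => f (z + (c * u) *: v)) \o shift 0) (h *: 1) - f (z + (c * 0) *: v)))
  = (fun h : R => h^-1 *: ((f \o shift z) (h *: (c *: v)) - f z)).
  apply/funext => h /=; rewrite mulr0 scale0r !addr0.
  by rewrite [h *: 1]mulr1 scalerA [c * h]mulrC [_ + z]addrC.
by rewrite /derive E.
Qed.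

Section RealValued.
Context {V : normedModType R} (U : set V) (f : V -> R).
Hypotheses (oU : open U) (sf : smooth U f).

Lemma mvt_line (z v : V) (h : R) :
  (forall s, between 0 h s -> U (z + s *: v)) ->
  exists2 s, between 0 h s & f (z + h *: v) - f z = h * 'D_v f (z + s *: v).
Proof.
move=> H.
have D s : between 0 h s -> is_derive s 1 (fun u => f (z + u *: v)) ('D_v f (z + s *: v)).
  by move=> /H Us; apply: is_derive_line; exact: smooth_derivable sf Us.
have [lo [hi [lohi e B]]] := between_ex 0 h.
have D' s : lo <= s <= hi -> is_derive s 1 (fun u => f (z + u *: v)) ('D_v f (z + s *: v)).
  by move=> /B; exact: D.
have [c clh E] := @MVT_segment R (fun u => f (z + u *: v)) _ lo hi lohi
  (fun t tab => D' t (subset_itv_oo_cc tab)) (is_derive_within D').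
exists c; first by apply/B.
case: e => -[e1 e2]; move: E; rewrite e1 e2 scale0r addr0 ?subr0 ?sub0r => E.
  by rewrite E mulrC.
by rewrite -opprB E mulrN opprK mulrC.
Qed.

Lemma nearU z : U z -> exists2 r : R, 0 < r & forall w, `|w - z| <= r -> U w.
Proof. by move=> Uz; apply/nbhs_eps; exact: open_nbhs_nbhs. Qed.

(** Directional derivatives are taken one line at a time, so additivity in the direction has to be
    earned. The increment along [h *: (v + w)] is compared with the two-leg path through
    [z + h *: v] by three mean value steps, and continuity of the three derivatives lets [h] be
    small. *)
Lemma derive_add (z v w : V) : U z -> 'D_(v + w) f z = 'D_v f z + 'D_w f z.
Proof.
move=> Uz; apply/eqP; rewrite -subr_eq0 -normr_eq0; apply/eqP.
apply: le_anti; rewrite normr_ge0 andbT; apply/ler_addgt0Pl => e e0; rewrite addr0.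
have [r r0 rU] := nearU Uz.
have cD u : {for z, continuous ('D_u f)}.
  by apply: (smooth_cont (U := U)) => //; exact: smooth_derive.
have e3 : 0 < e / 3 by rewrite divr_gt0.
have [r1 r10 H1] := (cont_epsP _ _).1 (cD v) _ e3.
have [r2 r20 H2] := (cont_epsP _ _).1 (cD w) _ e3.
have [r3 r30 H3] := (cont_epsP _ _).1 (cD (v + w)) _ e3.
pose r' := Num.min (Num.min r1 r2) (Num.min r3 r).
have r'0 : 0 < r' by rewrite !lt_min r10 r20 r30 r0.
pose h := r' / (`|v| + `|w| + 1).
have K0 : 0 < `|v| + `|w| + 1 by rewrite ltr_wpDl // addr_ge0.
have h0 : 0 < h by rewrite divr_gt0.
have small s t : between 0 h s -> between 0 h t -> `|z + s *: v + t *: w - z| <= r'.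
  move=> /(between_le _ (ltW h0)) /andP[s0 sh] /(between_le _ (ltW h0)) /andP[t0 th].
  rewrite addrC !addrA addNr add0r.
  apply: (le_trans (ler_normD _ _)); rewrite !normrZ !ger0_norm //.
  have -> : r' = h * (`|v| + `|w| + 1) by rewrite /h divfK // gt_eqF.
  have := ler_wpM2r (normr_ge0 v) sh; have := ler_wpM2r (normr_ge0 w) th.
  lra.
have b0 := (between_refl 0 h).1; have bh := (between_refl 0 h).2.
have r'r : r' <= r by rewrite !ge_min lexx !orbT.
have r'r1 : r' <= r1 by rewrite !ge_min lexx.
have r'r2 : r' <= r2 by rewrite !ge_min lexx !orbT.
have r'r3 : r' <= r3 by rewrite !ge_min lexx !orbT.
have [s1 bs1 E1] := @mvt_line z v h (fun s bs => rU _ (le_trans (eq_ind _ (fun x => `|x - z| <= r') (small s 0 bs b0) _ (etrans (congr1 _ (scale0r w)) (addr0 _))) r'r)).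
have [s2 bs2 E2] := @mvt_line (z + h *: v) w h (fun s bs => rU _ (le_trans (small h s bh bs) r'r)).
have [|s3 bs3 E3] := @mvt_line z (v + w) h.
  by move=> s bs; apply: rU; apply: le_trans r'r; rewrite scalerDr addrA; exact: small.
have E : 'D_(v + w) f (z + s3 *: (v + w)) = 'D_v f (z + s1 *: v) + 'D_w f (z + h *: v + s2 *: w).
  apply: (mulfI (lt0r_neq0 h0)); rewrite mulrDr -E1 -E2 -E3.
  by rewrite scalerDr addrA [RHS]addrC addrA subrK.
have A1 : `|'D_v f (z + s1 *: v) - 'D_v f z| <= e / 3.
  by apply: H1; have := small s1 0 bs1 b0; rewrite scale0r addr0 => /le_trans; apply.
have A2 : `|'D_w f (z + h *: v + s2 *: w) - 'D_w f z| <= e / 3.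
  by apply: H2; have := small h s2 bh bs2 => /le_trans; apply.
have A3 : `|'D_(v + w) f (z + s3 *: (v + w)) - 'D_(v + w) f z| <= e / 3.
  by apply: H3; rewrite scalerDr addrA; have := small s3 s3 bs3 bs3 => /le_trans; apply.
exact: close3 E A1 A2 A3.
Qed.

Lemma derive_sumv I (s : seq I) (c : I -> R) (v : I -> V) z : U z ->
  'D_(\sum_(i <- s) c i *: v i) f z = \sum_(i <- s) c i * 'D_(v i) f z.
Proof.
move=> Uz; elim: s => [|i s IH]; first by rewrite !big_nil derive0.
rewrite !big_cons derive_add // IH derive_scale //.
exact: smooth_derivable sf Uz.
Qed.

End RealValued.

(** Schwarz: the second difference over a small parallelogram is symmetric in the two directions
    and, by two mean value steps, equals [h * h] times either mixed derivative at a nearby point. *)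
Lemma derive_deriveC (V : normedModType R) (U : set V) (f : V -> R) (u v z : V) :
  open U -> smooth U f -> U z -> 'D_u ('D_v f) z = 'D_v ('D_u f) z.
Proof.
move=> oU sf Uz; apply/eqP; rewrite -subr_eq0 -normr_eq0; apply/eqP.
apply: le_anti; rewrite normr_ge0 andbT; apply/ler_addgt0Pl => e e0; rewrite addr0.
have [r r0 rU] := nearU oU Uz.
have cD a b : {for z, continuous ('D_a ('D_b f))}.
  by apply: (smooth_cont (U := U)) => //; do 2 apply: smooth_derive.
have e2 : 0 < e / 2 by rewrite divr_gt0.
have [r1 r10 H1] := (cont_epsP _ _).1 (cD u v) _ e2.
have [r2 r20 H2] := (cont_epsP _ _).1 (cD v u) _ e2.
pose r' := Num.min (Num.min r1 r2) r.
have r'0 : 0 < r' by rewrite !lt_min r10 r20 r0.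
have r'r : r' <= r by rewrite !ge_min lexx !orbT.
have r'r1 : r' <= r1 by rewrite !ge_min lexx.
have r'r2 : r' <= r2 by rewrite !ge_min lexx !orbT.
have K0 : 0 < `|v| + `|u| + 1 by rewrite ltr_wpDl // addr_ge0.
pose h := r' / (`|v| + `|u| + 1).
have h0 : 0 < h by rewrite divr_gt0.
have b0 := (between_refl 0 h).1; have bh := (between_refl 0 h).2.
have small s t : between 0 h s -> between 0 h t -> `|z + s *: v + t *: u - z| <= r'.
  move=> /(between_le _ (ltW h0)) /andP[s0 sh] /(between_le _ (ltW h0)) /andP[t0 th].
  rewrite addrC !addrA addNr add0r.
  apply: (le_trans (ler_normD _ _)); rewrite !normrZ !ger0_norm //.
  have -> : r' = h * (`|v| + `|u| + 1) by rewrite /h divfK // gt_eqF.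
  have := ler_wpM2r (normr_ge0 v) sh; have := ler_wpM2r (normr_ge0 u) th.
  lra.
have step a b : (forall s t, between 0 h s -> between 0 h t -> `|z + s *: a + t *: b - z| <= r') ->
  exists s t, [/\ between 0 h s, between 0 h t &
   f (z + h *: a + h *: b) - f (z + h *: a) - (f (z + h *: b) - f z) =
   h * h * 'D_b ('D_a f) (z + s *: a + t *: b)].
  move=> sm.
  have cs : continuous (fun y : V => y + h *: b).
    by move=> y; apply: (@continuousD _ _ _ id (cst (h *: b))); [exact: cvg_id|exact: cst_continuous].
  have sg : smooth ((fun y => y + h *: b) @^-1` U) (f \o (fun y => y + h *: b)).
    apply: (@smooth_affine _ _ _ _ _ _ _ id) => //.
      by move=> y w c; rewrite addrAC.
  pose U2 := U `&` ((fun y => y + h *: b) @^-1` U).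
  have oU2 : open U2.
    apply: openI => //; apply: open_comp => // y _; exact: cs.
  have sg2 : smooth U2 (fun y => f (y + h *: b) - f y).
    by apply: smoothB => //; apply: smooth_sub; [|exact: sg| |exact: sf] => y [].
  have [|s bs E] := @mvt_line V U2 _ sg2 z a h.
    move=> s bs; split.
      by apply: rU; apply: le_trans r'r; have := sm s 0 bs b0; rewrite scale0r addr0.
    by apply: rU; apply: le_trans r'r; exact: sm.
  have sDa := smooth_derive a sf.
  have [|t bt E2] := @mvt_line V U _ sDa (z + s *: a) b h.
    by move=> t bt; apply: rU; apply: le_trans r'r; exact: sm.
  exists s, t; split => //.
  move: E => /=; rewrite addrAC => ->; rewrite -mulrA; congr (_ * _).
  have Us : U (z + s *: a).
    by apply: rU; apply: le_trans r'r; have := sm s 0 bs b0; rewrite scale0r addr0.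
  have Ush : U (z + s *: a + h *: b) by apply: rU; apply: le_trans r'r; exact: sm.
  have D1 : derivable f (z + s *: a) a by exact: smooth_derivable sf Us.
  have EQ : (fun c : R => c^-1 *: (((fun y => f (y + h *: b)) \o shift (z + s *: a)) (c *: a) - f (z + s *: a + h *: b)))
     = (fun c : R => c^-1 *: ((f \o shift (z + s *: a + h *: b)) (c *: a) - f (z + s *: a + h *: b))).
    by apply/funext => c /=; rewrite -!addrA.
  have E3 : 'D_a (fun y => f (y + h *: b)) (z + s *: a) = 'D_a f (z + s *: a + h *: b).
    by rewrite /derive EQ.
  have D2 : derivable (fun y => f (y + h *: b)) (z + s *: a) a.
    by rewrite /derivable EQ; exact: smooth_derivable sf Ush.
  by rewrite (deriveB D2 D1) E3; exact: E2.
have [s1 [t1 [bs1 bt1 E1]]] := step v u small.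
have [|s2 [t2 [bs2 bt2 E2]]] := step u v.
  by move=> s t bs bt; rewrite (addrAC z); exact: small.
have E : 'D_u ('D_v f) (z + s1 *: v + t1 *: u) = 'D_v ('D_u f) (z + s2 *: u + t2 *: v).
  by apply: (mulhhI h0 E1 E2); rewrite (addrAC z) diff2C.
have A1 : `|'D_u ('D_v f) (z + s1 *: v + t1 *: u) - 'D_u ('D_v f) z| <= e / 2.
  by apply: H1; apply: le_trans r'r1; exact: small.
have A2 : `|'D_v ('D_u f) (z + s2 *: u + t2 *: v) - 'D_v ('D_u f) z| <= e / 2.
  by apply: H2; apply: le_trans r'r2; rewrite (addrAC z); exact: small.
exact: close2 A1 A2 E.
Qed.
End Calc.

(** * Quantitative estimates on a ball *)

Section Local.
Context {R : realType}.

Lemma near_min2 (r1 r2 : R) : 0 < r1 -> 0 < r2 ->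
  exists2 r, 0 < r & r <= r1 /\ r <= r2.
Proof.
move=> h1 h2; exists (Num.min r1 r2); first by rewrite lt_min h1.
by rewrite !ge_min !lexx orbT.
Qed.

Lemma norm_sum_le m (F : 'I_m -> R) C : (forall j, `|F j| <= C) ->
  `|\sum_j F j| <= m%:R * C.
Proof.
move=> H; apply: (le_trans (ler_norm_sum _ _ _)).
by rewrite -[m in m%:R]card_ord mulr_natl -sumr_const; exact: ler_sum.
Qed.

Lemma finite_radius (I : finType) (V : normedModType R) (z : V) (P : I -> V -> Prop) :
  (forall i, exists2 r : R, 0 < r & forall w, `|w - z| <= r -> P i w) ->
  exists2 r : R, 0 < r & forall w, `|w - z| <= r -> forall i, P i w.
Proof.
move=> H.
have /nbhs_eps : \forall w \near z, forall i, P i w.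
  by apply: filter_forall => i; apply/nbhs_eps.
exact.
Qed.

Lemma convex_ball (V : normedModType R) (z a b : V) (r s : R) :
  `|a - z| <= r -> `|b - z| <= r -> 0 <= s <= 1 -> `|b + s *: (a - b) - z| <= r.
Proof.
move=> ha hb /andP[s0 s1].
have -> : b + s *: (a - b) - z = (1 - s) *: (b - z) + s *: (a - z).
  have -> : a - b = (a - z) - (b - z) by rewrite opprB addrA subrK.
  rewrite scalerBl scale1r scalerBr addrAC -[RHS]addrA; congr (_ + _).
  by rewrite addrC.
apply: (le_trans (ler_normD _ _)); rewrite !normrZ !ger0_norm ?subr_ge0 //.
nra.
Qed.

Section RV.
Variables (m : nat) (U : set 'rV[R]_m).
Hypothesis oU : open U.

Notation pd f j := ('D_(delta_mx 0 j) f).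

Lemma derive_coords (f : 'rV[R]_m -> R) (v z : 'rV[R]_m) :
  smooth U f -> U z -> 'D_v f z = \sum_j v 0 j * pd f j z.
Proof.
move=> sf Uz; rewrite {1}(row_sum_delta v).
exact: (derive_sumv oU sf (index_enum _) (fun j => v 0 j) (fun j => delta_mx 0 j) Uz).
Qed.

Lemma derive_coords_le (f : 'rV[R]_m -> R) (v z : 'rV[R]_m) (K : R) :
  smooth U f -> U z -> (forall j, `|pd f j z| <= K) -> `|'D_v f z| <= m%:R * K * `|v|.
Proof.
move=> sf Uz H; rewrite derive_coords //.
rewrite -mulrA; apply: norm_sum_le => j; rewrite normrM mulrC.
by apply: ler_pM; rewrite ?normr_ge0 ?mx_entry_le.
Qed.

Lemma smooth_bound (z : 'rV[R]_m) (g : 'rV[R]_m -> R) : U z -> smooth U g ->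
  exists2 r, 0 < r & forall w, `|w - z| <= r -> `|g w| <= `|g z| + 1.
Proof.
move=> Uz sg.
have [r r0 H] := (cont_epsP _ _).1 (smooth_cont sg Uz) 1 ltr01.
exists r => // w /H h; rewrite -(subrK (g z) (g w)) addrC.
by apply: (le_trans (ler_normD _ _)); rewrite lerD2l.
Qed.

(** The last estimate is strict differentiability with an explicit modulus: after subtracting the
    linear map frozen at [c], the derivative along the segment from [b] to [a] is controlled by the
    Lipschitz constant of the partial derivatives. This is the form needed to differentiate the flow
    in [solves_strict]. *)
Lemma loc_est (f : 'rV[R]_m -> R) (z : 'rV[R]_m) : smooth U f -> U z ->
  exists r K : R, [/\ 0 < r, 0 <= K & forall a b c : 'rV[R]_m,
    `|a - z| <= r -> `|b - z| <= r -> `|c - z| <= r ->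
    [/\ U a, `|f a| <= K, `|f a - f b| <= K * `|a - b|, `|'D_(b - a) f c| <= K * `|b - a| &
     `|f a - f b - 'D_(a - b) f c| <= K * (`|a - c| + `|b - c|) * `|a - b| ] ].
Proof.
move=> sf Uz.
have [r0 r00 H0] := smooth_bound Uz sf.
have [r1 r10 H1] := finite_radius (fun j => smooth_bound Uz (smooth_derive (delta_mx 0 j) sf)).
have [r2 r20 H2] := finite_radius (fun ij : 'I_m * 'I_m =>
   smooth_bound Uz (smooth_derive (delta_mx 0 ij.2) (smooth_derive (delta_mx 0 ij.1) sf))).
have [r3 r30 H3] := nearU oU Uz.
pose r := Num.min (Num.min r0 r1) (Num.min r2 r3).
have rr0 : 0 < r by rewrite !lt_min r00 r10 r20 r30.
have le0 : r <= r0 by rewrite !ge_min lexx.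
have le1 : r <= r1 by rewrite !ge_min lexx !orbT.
have le2 : r <= r2 by rewrite !ge_min lexx !orbT.
have le3 : r <= r3 by rewrite !ge_min lexx !orbT.
pose K1 := \sum_j (`|pd f j z| + 1).
pose K2 := \sum_(ij : 'I_m * 'I_m) (`|pd (pd f ij.1) ij.2 z| + 1).
have K10 : 0 <= K1 by apply: sumr_ge0 => j _; rewrite addr_ge0.
have K20 : 0 <= K2 by apply: sumr_ge0 => j _; rewrite addr_ge0.
have B1 w j : `|w - z| <= r -> `|pd f j w| <= K1.
  move=> wr; apply: (le_trans (H1 w (le_trans wr le1) j)).
  rewrite /K1 (bigD1 j) //= lerDl.
  by apply: sumr_ge0 => l _; rewrite addr_ge0.
have B2 w i j : `|w - z| <= r -> `|pd (pd f i) j w| <= K2.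
  move=> wr; apply: (le_trans (H2 w (le_trans wr le2) (i, j))).
  rewrite /K2 (bigD1 (i, j)) //= lerDl.
  by apply: sumr_ge0 => l _; rewrite addr_ge0.
have BU w : `|w - z| <= r -> U w by move=> wr; apply: H3; exact: le_trans wr le3.
have D (g : 'rV[R]_m -> R) (a b : 'rV[R]_m) : smooth U g -> `|a - z| <= r -> `|b - z| <= r ->
    forall t, between 0 1 t -> is_derive t 1 (fun s : R => g (b + s *: (a - b))) ('D_(a - b) g (b + t *: (a - b))).
  move=> sg ha hb t /(between_le _ ler01) t01; apply: is_derive_line.
  by apply: (smooth_derivable (U := U)) => //; apply: BU; exact: convex_ball.
have lip (g : 'rV[R]_m -> R) (Kg : R) (a b : 'rV[R]_m) : smooth U g ->
    (forall w, `|w - z| <= r -> forall j, `|pd g j w| <= Kg) ->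
    `|a - z| <= r -> `|b - z| <= r -> `|g a - g b| <= m%:R * Kg * `|a - b|.
  move=> sg HK ha hb.
  have := @mvt_real _ (fun s : R => g (b + s *: (a - b))) (fun t => 'D_(a - b) g (b + t *: (a - b))) 0 1 (m%:R * Kg * `|a - b|).
  have -> : b + 1 *: (a - b) = a by rewrite scale1r addrC subrK.
  rewrite scale0r addr0 subr0 normr1 mulr1.
  apply=> t tb; split; first exact: D.
  have tz : `|b + t *: (a - b) - z| <= r by apply: convex_ball => //; apply/(between_le _ ler01).
  by apply: derive_coords_le => //; [exact: BU|exact: HK].
pose K := (`|f z| + 1) + m%:R * K1 + m%:R * (m%:R * K2).
have mK1 : 0 <= m%:R * K1 by rewrite mulr_ge0.
have mK2 : 0 <= m%:R * (m%:R * K2) by rewrite !mulr_ge0.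
have f0 : 0 <= `|f z| + 1 by rewrite addr_ge0.
have K0 : 0 <= K by rewrite !addr_ge0.
exists r, K; split => // a b c ha hb hc; split.
- exact: BU.
- apply: (le_trans (H0 _ (le_trans ha le0))); rewrite /K; lra.
- apply: (le_trans (lip f K1 a b sf (fun w h j => B1 w j h) ha hb)).
  by apply: ler_wpM2r => //; rewrite /K; lra.
- apply: (@le_trans _ _ (m%:R * K1 * `|b - a|)).
    by apply: derive_coords_le => // [|j]; [exact: BU|exact: B1].
  by apply: ler_wpM2r => //; rewrite /K; lra.
- have := @mvt_real _ (fun s : R => f (b + s *: (a - b)) - s * 'D_(a - b) f c)
    (fun s => 'D_(a - b) f (b + s *: (a - b)) - 'D_(a - b) f c) 0 1 (m%:R * (m%:R * K2 * (`|a - c| + `|b - c|)) * `|a - b|).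
  have -> : b + 1 *: (a - b) = a by rewrite scale1r addrC subrK.
  rewrite scale0r addr0 mul0r mul1r subr0 subr0 normr1 mulr1 (addrAC (f a)).
  move=> H; apply: (le_trans (H _)); last first.
    have -> : m%:R * (m%:R * K2 * (`|a - c| + `|b - c|)) * `|a - b| =
       m%:R * (m%:R * K2) * ((`|a - c| + `|b - c|) * `|a - b|) by ring.
    rewrite -[leRHS]mulrA; apply: ler_wpM2r; first by rewrite mulr_ge0 // addr_ge0.
    by rewrite /K; lra.
  move=> t tb; split.
    have dl : is_derive t 1 (fun s : R => s * 'D_(a - b) f c) ('D_(a - b) f c).
      by apply: is_derive_eq; rewrite ?scaler0 ?addr0 ?add0r; exact: mulr1.
    exact: (is_deriveB (D f a b sf ha hb t tb) dl).
  have tb' : 0 <= t <= 1 by apply/(between_le _ ler01).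
  have tz : `|b + t *: (a - b) - z| <= r by exact: convex_ball.
  have tc : `|b + t *: (a - b) - c| <= `|a - c| + `|b - c|.
    apply: convex_ball => //; first by rewrite lerDl.
    by rewrite lerDr.
  rewrite (derive_coords (a - b) sf (BU _ tz)) (derive_coords (a - b) sf (BU _ hc)).
  rewrite -sumrB -[leRHS]mulrA; apply: norm_sum_le => j.
  rewrite -mulrBr normrM mulrC.
  apply: ler_pM; rewrite ?normr_ge0 ?mx_entry_le //.
  apply: (@le_trans _ _ (m%:R * K2 * `|b + t *: (a - b) - c|)).
    by apply: (lip (pd f j) K2 _ c (smooth_derive _ sf) _ tz hc) => w wz i; exact: B2.
  by apply: ler_wpM2l => //; rewrite mulr_ge0.
Qed.

End RV.
End Local.

(** * Chain rule, smoothness along curves, Taylor's formula *)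

Section Chain.
Context {R : realType}.

Lemma is_derive_diff_comp (V W : normedModType R) (F : V -> W) (g : R -> V) (t : R) (dg : V) :
  differentiable F (g t) -> is_derive t 1 g dg ->
  is_derive t 1 (F \o g) ('d F (g t) dg).
Proof.
move=> dF Hg.
have d1 : differentiable g t by apply/derivable1_diffP; have [] := Hg.
have d3 : differentiable (F \o g) t by exact: differentiable_comp.
have Eg : 'd g t 1 = dg by rewrite -deriveE //; have [] := Hg.
by apply: DeriveDef; [exact/derivable1_diffP|rewrite deriveE // diff_comp //= Eg].
Qed.

Section RV.
Variables (m : nat) (U : set 'rV[R]_m).
Hypothesis oU : open U.

Notation pd f j := ('D_(delta_mx 0 j) f).

Lemma smooth_diff_est (f : 'rV[R]_m -> R) (z : 'rV[R]_m) : smooth U f -> U z ->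
  forall e : R, 0 < e -> exists2 r : R, 0 < r & forall v : 'rV[R]_m, `|v| <= r ->
     `|f (z + v) - f z - 'D_v f z| <= e * `|v|.
Proof.
move=> sf Uz e e0.
have [r [K [r0 K0 H]]] := loc_est oU sf Uz.
have K10 : 0 < K + 1 by rewrite ltr_wpDl.
have [r' r'0 [r'1 r'2]] := near_min2 r0 (divr_gt0 e0 K10).
exists r' => // v vr.
have zv : z + v - z = v by rewrite addrC addKr.
have [||| _ _ _ _] := H (z + v) z z; rewrite ?subrr ?normr0 ?zv ?(ltW r0) ?(le_trans vr) // addr0.
move=> h; apply: (le_trans h); apply: ler_wpM2r => //.
apply: (@le_trans _ _ ((K + 1) * `|v|)); first by apply: ler_wpM2r => //; rewrite lerDl.
by rewrite mulrC -ler_pdivlMr //; exact: le_trans vr r'2.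
Qed.

Lemma smooth_diff p (F : 'rV[R]_m -> 'rV[R]_p) (z : 'rV[R]_m) :
  (csmooth U F) -> U z ->
  differentiable F z /\ 'J F z = \matrix_(i, j) pd (fun y => F y 0 j) i z.
Proof.
move=> sF Uz; apply: diff_of_est => e e0.
have H j : exists2 r : R, 0 < r & forall w, `|w - z| <= r ->
    `|F w 0 j - F z 0 j - 'D_(w - z) (fun y => F y 0 j) z| <= e * `|w - z|.
  have [r r0 Hr] := smooth_diff_est (sF j) Uz e0; exists r => // w wr.
  have E : z + (w - z) = w by rewrite addrC subrK.
  by have := Hr _ wr; rewrite E.
have [r r0 Hr] := finite_radius H.
exists r => // v vr; apply: mx_norm_leP => [|i j]; first by rewrite mulr_ge0 // ltW.
have zv : z + v - z = v by rewrite addrC addKr.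
have h := Hr (z + v); rewrite zv in h; have {}h := h vr j.
rewrite (derive_coords oU v (sF j) Uz) in h.
rewrite (ord1 i) !mxE (eq_bigr (fun l => v 0 l * pd (fun y => F y 0 j) l z)) // => l _.
by rewrite mxE.
Qed.

Lemma smooth_differentiable (f : 'rV[R]_m -> R) (z : 'rV[R]_m) :
  smooth U f -> U z -> differentiable f z.
Proof.
move=> sf Uz; have [||dF _] := @smooth_diff 1 (fun y => \row_j f y) z => //.
  by move=> j; apply: smooth_ext sf => // y _; rewrite mxE.
have -> : f = (fun M : 'rV[R]_1 => M 0 0) \o (fun y => \row_j f y).
  by apply/funext => y /=; rewrite mxE.
by apply: differentiable_comp => //; exact: differentiable_coord.
Qed.

Lemma is_derive_comp (f : 'rV[R]_m -> R) (g : R -> 'rV[R]_m) (t : R) (dg : 'rV[R]_m) :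
  smooth U f -> U (g t) -> is_derive t 1 g dg ->
  is_derive t 1 (f \o g) ('D_dg f (g t)).
Proof.
move=> sf Ug Hg; have df := smooth_differentiable sf Ug.
by rewrite deriveE //; exact: is_derive_diff_comp.
Qed.

End RV.

Lemma is_derive_dir (f : R -> R) (t v df : R) : is_derive t 1 f df -> is_derive t v f (v * df).
Proof.
move=> [d1 d2]; apply: DeriveDef.
  by apply: diff_derivable; apply/derivable1_diffP.
have {1}-> : v = v *: (1 : R) by rewrite [RHS]mulr1.
by rewrite derive_scale // d2.
Qed.

(** On the line the derivative in direction [1] determines all others; the auxiliary class [P'] adds
    scalar multiples, which makes it stable under derivatives in every direction. *)
Lemma is_derive_smooth1 (I : set R) (P : (R -> R) -> Prop) : open I ->
  (forall f, P f -> exists2 g, P g & forall t, I t -> is_derive t 1 f (g t)) ->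
  forall f, P f -> smooth I f.
Proof.
move=> oI H.
pose P' f := exists (c : R) g, P g /\ f = (fun t => c * g t).
suff S f : P' f -> smooth I f.
  by move=> f Pf; apply: S; exists 1, f; split => //; apply/funext => t; rewrite mul1r.
apply: smooth_coind => //.
  move=> _ [c [g [Pg ->]]] t It; have [g' Pg' dg] := H g Pg.
  apply: (@is_derive_cont _ _ _ _ (c * g' t)).
  by have := dg t It => dgt; apply: is_derive_eq; rewrite ?scaler0 ?addr0 ?add0r.
move=> _ [c [g [Pg ->]]] v; have [g' Pg' dg] := H g Pg.
have D t : I t -> is_derive t v (fun t => c * g t) (c * (v * g' t)).
  move=> It; have dgt := is_derive_dir v (dg t It).
  by apply: is_derive_eq; rewrite ?scaler0 ?addr0 ?add0r.
split=> [t It|]; first by have [] := D t It.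
exists (fun t => (c * v) * g' t); first by exists (c * v), g'.
by move=> t It; have [_ ->] := D t It; rewrite mulrA.
Qed.

Lemma smoothP (I : set R) (f : R -> R) t : smooth I f -> I t ->
  is_derive t 1 f ('D_1 f t).
Proof. by move=> sf It; apply: derivableP; exact: smooth_derivable sf It. Qed.

Lemma derive_sum_seq (T : Type) (s : seq T) (f : T -> R -> R) (df : T -> R) (t : R) :
  (forall i, is_derive t 1 (f i) (df i)) ->
  is_derive t 1 (fun u => \sum_(i <- s) f i u) (\sum_(i <- s) df i).
Proof.
move=> H; elim: s => [|i s IH].
  rewrite big_nil (_ : (fun _ => _) = cst 0); first exact: is_derive_cst.
  by apply/funext => u; rewrite big_nil.
rewrite big_cons (_ : (fun _ => _) = (f i + (fun u => \sum_(i <- s) f i u))).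
  exact: is_deriveD.
by apply/funext => u; rewrite big_cons.
Qed.

Lemma is_deriveM' (f g : R -> R) (t df dg : R) :
  is_derive t 1 f df -> is_derive t 1 g dg ->
  is_derive t 1 (fun u => f u * g u) (df * g t + f t * dg).
Proof.
by move=> hf hg; apply: is_derive_eq; rewrite addrC -![_ *: _]/(_ * _) [g t * _]mulrC.
Qed.

Lemma is_derive_mulmx m n p (A : R -> 'M[R]_(m, n)) (B : R -> 'M[R]_(n, p)) (t : R)
    (dA : 'M[R]_(m, n)) (dB : 'M[R]_(n, p)) :
  is_derive t 1 A dA -> is_derive t 1 B dB ->
  is_derive t 1 (fun u => A u *m B u) (dA *m B t + A t *m dB).
Proof.
move=> /derive_mxP HA /derive_mxP HB; apply/derive_mxP => i j.
rewrite !mxE -big_split /=.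
rewrite (_ : (fun x => _) = (fun x => \sum_k A x i k * B x k j)); last first.
  by apply/funext => u; rewrite mxE.
by apply: derive_sum_seq => k; exact: is_deriveM'.
Qed.

Lemma is_derive_trmx m n (A : R -> 'M[R]_(m, n)) (t : R) (dA : 'M[R]_(m, n)) :
  is_derive t 1 A dA -> is_derive t 1 (fun u => (A u)^T) dA^T.
Proof.
move=> /derive_mxP HA; apply/derive_mxP => i j; rewrite mxE.
rewrite (_ : (fun x => _) = (fun x => A x j i)) //.
by apply/funext => u; rewrite mxE.
Qed.

(** The functions [f \o z] with [f] smooth are closed under differentiation, because along an
    integral curve the derivative is again of this form, with [f] replaced by its derivative along
    [h]. *)
Lemma smooth_integral_curve m (U : set 'rV[R]_m) (h : 'rV[R]_m -> 'rV[R]_m)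
    (I : set R) (z : R -> 'rV[R]_m) : open U -> open I ->
  (csmooth U h) ->
  (forall t, I t -> U (z t) /\ is_derive t 1 z (h (z t))) ->
  forall f : 'rV[R]_m -> R, smooth U f -> smooth I (f \o z).
Proof.
move=> oU oI sh Hz f sf.
apply: (@is_derive_smooth1 I (fun g => exists2 f : 'rV[R]_m -> R, smooth U f & g = f \o z)) => //; last by exists f.
move=> _ [g sg ->].
exists ((fun y => \sum_j h y 0 j * 'D_(delta_mx 0 j) g y) \o z).
  exists (fun y => \sum_j h y 0 j * 'D_(delta_mx 0 j) g y) => //.
  by apply: smooth_sum => // j; apply: smoothM => //; exact: smooth_derive.
move=> t It /=; have [Uz dz] := Hz t It.
by rewrite -(derive_coords oU) //; exact: is_derive_comp sg Uz dz.
Qed.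

(** The class used is that of combinations, with smooth coefficients, of the entries of one row of
    [Y]; the equation keeps derivatives inside it. *)
Lemma smooth_linear_ode p m (I : set R) (S : R -> 'M[R]_m) (Y : R -> 'M[R]_(p, m)) :
  open I -> (forall i j, smooth I (fun t => S t i j)) ->
  (forall t, I t -> is_derive t 1 Y (Y t *m S t)) ->
  forall i j, smooth I (fun t => Y t i j).
Proof.
move=> oI sS HY i j.
apply: (@is_derive_smooth1 I (fun g => exists2 c : 'I_m -> R -> R,
   (forall l, smooth I (c l)) & g = fun t => \sum_l c l t * Y t i l)) => //; last first.
  exists (fun l t => (l == j)%:R); first by move=> l; exact: (smooth_cst _ oI).
  apply/funext => t; rewrite (bigD1 j) //= eqxx mul1r big1 ?addr0 // => l /negPf ->.
  by rewrite mul0r.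
move=> _ [c sc ->].
pose c' l t := 'D_1 (c l) t + \sum_q c q t * S t l q.
exists (fun t => \sum_l c' l t * Y t i l).
  exists c' => // l; apply: smoothD => //; first exact: smooth_derive.
  by apply: smooth_sum => // q; apply: smoothM.
move=> t It.
have := @derive_sum_seq _ (index_enum 'I_m) (fun l u => c l u * Y u i l) _ t
  (fun l => is_deriveM' (smoothP (sc l) It) ((derive_mxP _ _ _).1 (HY t It) i l)).
move=> /is_derive_eq; apply; rewrite /c' big_split /=.
under [RHS]eq_bigr do rewrite mulrDl.
rewrite [RHS]big_split /=; congr (_ + _).
under eq_bigr do rewrite mxE mulr_sumr.
rewrite exchange_big /=; apply: eq_bigr => l _.
by rewrite mulr_suml; apply: eq_bigr => q _; rewrite [Y t i l * _]mulrC mulrA.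
Qed.

Definition dn (j : nat) (f : R -> R) : R -> R := iter j (fun g : R -> R => 'D_1 g) f.

Lemma smooth_dn (I : set R) (f : R -> R) j : smooth I f -> smooth I (dn j f).
Proof. by move=> sf; elim: j => [|j IH] //=; exact: smooth_derive. Qed.

Lemma dnS j f : dn j.+1 f = dn j ('D_1 f).
Proof. by rewrite /dn iterSr. Qed.

(** Induction on the order: the remainder vanishes at [0], and its derivative is the remainder of
    ['D_1 f]. *)
Lemma taylor (I : set R) (f : R -> R) (s : R) (m : nat) : open I -> smooth I f -> I s ->
  exists r K : R, [/\ 0 < r, 0 <= K & forall t, `|t| <= r ->
    `|f (s + t) - \sum_(j < m) dn j f s / j`!%:R * t ^+ j| <= K * `|t| ^+ m].
Proof.
move=> oI + Is; elim: m f => [|m IH] f sf.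
  have [r r0 H] := (cont_epsP _ _).1 (smooth_cont sf Is) 1 ltr01.
  exists r, (`|f s| + 1); split => // t tr.
  rewrite big_ord0 subr0 expr0 mulr1.
  have E : s + t - s = t by rewrite addrC addKr.
  have := H (s + t); rewrite E => /(_ tr).
  by have := ler_normD (f (s + t) - f s) (f s); rewrite subrK; lra.
have [r [K [r0 K0 H]]] := IH _ (smooth_derive (1 : R) sf).
have [r2 r20 HI] := nearU oI Is.
have [r' r'0 [r'1 r'2]] := near_min2 r0 r20.
exists r', K; split => // t tr.
pose P t := f (s + t) - \sum_(j < m.+1) dn j f s / j`!%:R * t ^+ j.
pose dP t := 'D_1 f (s + t) - \sum_(j < m) dn j.+1 f s / j`!%:R * t ^+ j.
have P0 : P 0 = 0.
  rewrite /P addr0 big_ord_recl /= expr0 big1 => [|j _]; last by rewrite expr0n /= mulr0.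
  by rewrite addr0 fact0 divr1 mulr1 subrr.
have := @mvt_real _ P dP 0 t (K * `|t| ^+ m).
rewrite P0 !subr0 -mulrA -exprSr; apply=> u ub.
have ur : `|u| <= `|t| by have := between_dist ub; rewrite !subr0.
split; last first.
  apply: (@le_trans _ _ (K * `|u| ^+ m)).
    have := H u (le_trans ur (le_trans tr r'1)); rewrite /dP.
    by under eq_bigr => j _ do rewrite -dnS.
  by apply: ler_wpM2l => //; apply: lerXn2r; rewrite ?nnegrE.
have Isu : I (s + u).
  by apply: HI; rewrite addrC addKr; exact: le_trans ur (le_trans tr r'2).
have d1 : is_derive u 1 (fun x : R => f (s + x)) ('D_1 f (s + u)).
  have := @is_derive_line _ _ _ f s (1 : R) u; rewrite ![_ *: 1]mulr1.
  move=> /(_ (smooth_derivable sf Isu)).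
  by under [X in is_derive _ _ X _ -> _]eq_fun do rewrite [_ *: 1]mulr1.
have d2 : is_derive u 1 (fun x : R => \sum_(j < m.+1) dn j f s / j`!%:R * x ^+ j)
    (\sum_(j < m) dn j.+1 f s / j`!%:R * u ^+ j).
  have := @derive_sum_seq _ (index_enum 'I_m.+1)
    (fun j x => dn j f s / j`!%:R * x ^+ j)
    (fun j => dn j f s / j`!%:R * (j%:R * u ^+ j.-1)) u.
  rewrite [X in is_derive _ _ _ X]big_ord_recl mul0r mulr0 add0r.
  rewrite (eq_bigr (fun j : 'I_m => dn j.+1 f s / j`!%:R * u ^+ j)); last first.
    move=> j _; rewrite lift0 /= factS natrM invfM -!mulrA; congr (_ * _).
    rewrite mulrCA; congr (_ * _).
    by rewrite mulrA mulVf ?mul1r // pnatr_eq0.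
  apply=> j; have dx : is_derive u 1 (fun x : R => x ^+ j) (j%:R * u ^+ j.-1).
    apply: DeriveDef; first exact: exprn_derivable.
    by rewrite exp_derive [LHS]mulr1.
  have := is_deriveM' (is_derive_cst (dn j f s / j`!%:R) u 1) dx.
  by rewrite mul0r add0r.
exact: is_deriveB d1 d2.
Qed.

End Chain.

(** * Existence of solutions of ordinary differential equations *)

Section Picard.
Context {R : realType}.

Lemma primitive (f : R -> R) (T : R) : 0 < T -> continuous f ->
  exists F : R -> R, F 0 = 0 /\ forall t : R, `|t| < T -> is_derive t (1 : R) F (f t).
Proof.
move=> T0 cf.
pose F t := (\int[lebesgue_measure]_(s in `[- T, t]) f s)%R.
exists (fun t => F t - F 0); split; first by rewrite subrr.
move=> t; rewrite ltr_norml => /andP[t1 t2].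
have [] := @continuous_FTC1_closed R f (- T) t (t + 1) _ _ t1 (cf t).
- by rewrite ltrDl.
- apply: continuous_compact_integrable; first exact: segment_compact.
  exact: continuous_subspaceT.
move=> dF dFE.
have dF' : is_derive t 1 F (f t) by apply: DeriveDef => //; rewrite -derive1E.
by apply: is_derive_eq; rewrite subr0.
Qed.

Lemma primitive_mx m n (f : R -> 'M[R]_(m, n)) (T : R) : 0 < T -> continuous f ->
  exists F : R -> 'M[R]_(m, n), F 0 = 0 /\ forall t : R, `|t| < T -> is_derive t (1 : R) F (f t).
Proof.
move=> T0 cf.
have H (ij : 'I_m * 'I_n) : exists F : R -> R, F 0 = 0 /\ forall t : R, `|t| < T -> is_derive t 1 F (f t ij.1 ij.2).
  apply: primitive => // t.
  apply: (@continuous_comp _ _ _ f (fun M : 'M[R]_(m, n) => M ij.1 ij.2)); first exact: cf.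
  exact: coord_continuous.
have [G HG] := choice H.
exists (fun t => \matrix_(i, j) G (i, j) t); split.
  by apply/matrixP => i j; rewrite !mxE; have [] := HG (i, j).
move=> t tT; apply/derive_mxP => i j.
have -> : (fun x => (\matrix_(i, j) G (i, j) x) i j) = G (i, j) by apply/funext => x; rewrite mxE.
by have [_] := HG (i, j); apply.
Qed.

(** Used for times and, in [retract], for coordinates: it is 1-Lipschitz and the identity on
    [[-T, T]], so local data extend to the whole line. *)
Definition clamp (T t : R) : R := Num.max (- T) (Num.min T t).

Lemma clamp_norm T t : 0 <= T -> `|clamp T t| <= T.
Proof.
move=> T0; rewrite ler_norml /clamp le_max lexx /= ge_max ge_min lexx /= andbT; lra.
Qed.

Lemma clamp_id T t : `|t| <= T -> clamp T t = t.
Proof. by rewrite ler_norml /clamp => /andP[h1 h2]; rewrite min_r // max_r. Qed.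

Lemma clamp_lip T s t : `|clamp T s - clamp T t| <= `|s - t|.
Proof.
rewrite /clamp ler_norml; have := ler_norm (s - t); have := ler_norm (- (s - t)).
rewrite normrN; case: (lerP T s) => h1; case: (lerP T t) => h2;
  case: (lerP (- T) T) => h3; case: (lerP (- T) s) => h4; case: (lerP (- T) t) => h5; lra.
Qed.

End Picard.

Section PicardThm.
Context {R : realType}.

Lemma geo_small (C e : R) : 0 <= C -> 0 < e -> exists N, forall k, (N <= k)%N -> C / 2 ^+ k <= e.
Proof.
move=> C0 e0; have := @cvg_geometric R C (2^-1).
have -> : `|2^-1 : R| < 1 by rewrite ger0_norm // invf_lt1 // ltr1n.
move=> /(_ isT) /cvgrPdist_le /(_ e e0) [N _ HN].
exists N => k Nk; have := HN k Nk; rewrite /= sub0r normrN /geometric /= exprVn.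
by rewrite ger0_norm // mulr_ge0 // invr_ge0 exprn_ge0.
Qed.

Lemma cauchy_seq_mx m n (u : nat -> 'M[R]_(m, n)) (C : R) : 0 <= C ->
  (forall k, `|u k.+1 - u k| <= C / 2 ^+ k) ->
  exists l, forall k, `|u k - l| <= 2 * C / 2 ^+ k.
Proof.
move=> C0 H.
have step k p : `|u (k + p)%N - u k| <= 2 * C / 2 ^+ k - 2 * C / 2 ^+ (k + p).
  elim: p => [|p IH]; first by rewrite addn0 !subrr normr0.
  rewrite addnS -(subrKA (u (k + p)%N)); apply: (le_trans (ler_normD _ _)).
  have := H (k + p)%N => h.
  have e : 2 * C / 2 ^+ (k + p).+1 = C / 2 ^+ (k + p).
    by rewrite exprS invfM mulrACA divff ?pnatr_eq0 // mul1r.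
  rewrite e; have e2 : 2 * C / 2 ^+ (k + p) = C / 2 ^+ (k + p) + C / 2 ^+ (k + p) by ring.
  lra.
have pos k : 0 <= 2 * C / 2 ^+ k by rewrite !mulr_ge0 // invr_ge0 exprn_ge0.
have bnd i j k p : `|u (k + p)%N i j - u k i j| <= 2 * C / 2 ^+ k.
  have := mx_entry_le (u (k + p)%N - u k) i j; rewrite !mxE => h.
  by apply: (le_trans h); apply: (le_trans (step k p)); rewrite gerBl.
have cv i j : exists l : R, (fun k => u k i j) @ \oo --> l.
  apply/cvg_ex; apply/cauchy_cvgP; apply/cauchy_ballP => e e0.
  have e4 : 0 < e / 4 by rewrite divr_gt0.
  have [N HN] := geo_small (mulr_ge0 (ler0n _ 2) C0) e4.
  have HN' := HN N (leqnn N).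
  pose A := [set x : R | exists2 k, (N <= k)%N & x = u k i j].
  exists (A, A); first by split; exists N => // k Nk; exists k.
  move=> [x y] /= [[k kN ->] [q qN ->]]; rewrite /ball /=.
  have := bnd i j N (k - N)%N; have := bnd i j N (q - N)%N; rewrite !subnKC //.
  rewrite !ler_norml ltr_norml; lra.
have /choice [l Hl] : forall ij : 'I_m * 'I_n, exists l : R, (fun k => u k ij.1 ij.2) @ \oo --> l by move=> [i j]; exact: cv.
exists (\matrix_(i, j) l (i, j)) => k; apply: mx_norm_leP => // i j; rewrite !mxE.
have := Hl (i, j) => /= hl.
apply/ler_addgt0Pl => e e0.
have /cvgrPdist_lt /(_ e e0) [N _ HN] := hl.
have := HN (k + N)%N (leq_addl _ _) => /=.
have := bnd i j k N.
rewrite ltr_norml !ler_norml; lra.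
Qed.

(** Picard iteration with clamped time. As [L * T <= 1/2], each step halves the uniform distance of
    two functions, so the iterates converge geometrically and the limit is a fixed point. *)
Lemma picard m (h : R -> 'rV[R]_m -> 'rV[R]_m) (L T : R) (z0 : 'rV[R]_m) :
  0 <= L -> 0 < T -> L * T <= 2^-1 ->
  (forall t z w, `|h t z - h t w| <= L * `|z - w|) ->
  (forall z : R -> 'rV[R]_m, continuous z -> continuous (fun t => h t (z t))) ->
  exists z : R -> 'rV[R]_m, z 0 = z0 /\
    forall t : R, `|t| < T -> is_derive t 1 z (h t (z t)).
Proof.
move=> L0 T0 LT Hlip Hc.
pose cl := clamp T.
have ccl : continuous cl.
  move=> t; apply/cont_epsP => e e0; exists e => // w wt.
  exact: le_trans (clamp_lip _ _ _) wt.
have clT t : `|cl t| <= T by apply: clamp_norm; exact: ltW.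
(* Primitives are taken on an interval twice as long, so that they are differentiable at the
   endpoints of the clamped one. *)
have T20 : 0 < 2 * T by rewrite mulr_gt0.
have TT : T < 2 * T by rewrite ltr_pMl // ltr1n.
have /choice [P HP] : forall z : R -> 'rV[R]_m, exists F : R -> 'rV[R]_m, continuous z ->
    F 0 = 0 /\ forall t : R, `|t| < 2 * T -> is_derive t 1 F (h t (z t)).
  move=> z; have [cz|ncz] := pselect (continuous z); last by exists (cst 0).
  by have [F HF] := primitive_mx T20 (Hc z cz); exists F.
pose step (z : R -> 'rV[R]_m) := fun t => z0 + P z (cl t).
have cstep z : continuous z -> continuous (step z).
  move=> cz t; apply: continuousD; first exact: cst_continuous.
  apply: (@continuous_comp _ _ _ cl (P z)); first exact: ccl.
  by apply: is_derive_cont; apply: (HP z cz).2; exact: le_lt_trans (clT t) TT.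
have bt b t : `|b| <= T -> between 0 b t -> `|t| <= T.
  by move=> bT; apply: between_normle; rewrite // normr0 ltW.
have diff z w D : continuous z -> continuous w -> (forall t, `|t| <= T -> `|z t - w t| <= D) ->
    forall t, `|step z t - step w t| <= D / 2.
  move=> cz cw HD t; rewrite /step opprD addrACA subrr add0r.
  have [z1 z2] := HP z cz; have [w1 w2] := HP w cw.
  have := @mvt_norm _ _ _ (fun t => P z t - P w t) (fun t => h t (z t) - h t (w t)) 0 (cl t) (L * D).
  rewrite z1 w1 subr0 subr0 subr0 => H; apply: (le_trans (H _)).
    move=> s sb; have sT : `|s| <= T by apply: (bt _ _ _ sb).
    split; first by apply: is_deriveB; [apply: z2|apply: w2]; exact: le_lt_trans sT TT.
    by apply: (le_trans (Hlip _ _ _)); apply: ler_wpM2l => //; exact: HD.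
  have nT : `|0 : R| <= T by rewrite normr0 ltW.
  have D0 : 0 <= D := le_trans (normr_ge0 _) (HD 0 nT).
  have := ler_wpM2l (mulr_ge0 L0 D0) (clT t).
  have := ler_wpM2r D0 LT.
  nra.
pose u k := iter k step (cst z0).
have cu k : continuous (u k).
  by elim: k => [|k IH]; [exact: cst_continuous|exact: cstep].
have [C C0 HC] : exists2 C, 0 <= C & forall t, `|u 1%N t - u 0%N t| <= C.
  have cP : {within `[- T, T], continuous (fun t => `|P (cst z0) t|)}.
    move=> t; apply: continuous_comp; last exact: norm_continuous.
    apply: (@is_derive_within _ _ _ (fun t => h t z0)) => s sT.
    apply: (HP (cst z0) _).2; first exact: cst_continuous.
    by apply: le_lt_trans TT; rewrite ler_norml.
  have NT : - T <= T by lra.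
  have [c _ cmax] := EVT_max NT cP.
  exists (`|P (cst z0) c|) => // t.
  rewrite /u /= /step /cst addrAC subrr add0r; apply: cmax.
  by rewrite in_itv /= -ler_norml.
have uk k t : `|u k.+1 t - u k t| <= C / 2 ^+ k.
  elim: k t => [|k IH] t; first by rewrite expr0 divr1.
  rewrite exprSr invfM mulrA.
  by apply: (diff (u k.+1) (u k) _ (cu _) (cu _)) => s _; exact: IH.
have /choice [z Hz] : forall t, exists l, forall k, `|u k t - l| <= 2 * C / 2 ^+ k.
  by move=> t; apply: cauchy_seq_mx.
have small e : 0 < e -> exists k, 2 * C / 2 ^+ k <= e.
  move=> e0; have [N HN] := geo_small (mulr_ge0 (ler0n _ 2) C0) e0.
  by exists N; exact: HN.
have cz : continuous z.
  move=> t; apply/cont_epsP => e e0.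
  have e3 : 0 < e / 3 by rewrite divr_gt0.
  have [k Hk] := small _ e3.
  have [r r0 Hr] := (cont_epsP _ _).1 (cu k t) _ e3.
  exists r => // w /Hr wt.
  have h1 := ler_distD (u k w) (z w) (z t); have h2 := ler_distD (u k t) (u k w) (z t).
  rewrite (distrC (z w) (u k w)) in h1.
  have := le_trans (Hz w k) Hk; have := le_trans (Hz t k) Hk; lra.
have zE t : z t = step z t.
  apply/eqP; rewrite -subr_eq0 -normr_le0; apply/ler_addgt0Pl => e e0; rewrite addr0.
  have e2 : 0 < e / 2 by rewrite divr_gt0.
  have [k Hk] := small _ e2.
  have h1 : `|u k.+1 t - step z t| <= e / 2 / 2.
    by apply: diff => // s _; exact: le_trans (Hz s k) Hk.
  have h2 : `|u k.+1 t - z t| <= e / 2.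
    apply: (le_trans (Hz t k.+1)); apply: le_trans Hk.
    apply: ler_wpM2l; first by rewrite mulr_ge0.
    by rewrite lef_pV2 ?posrE ?exprn_gt0 // ler_eXn2l ?ltr1n.
  have h3 := ler_distD (u k.+1 t) (z t) (step z t).
  rewrite (distrC (z t) (u k.+1 t)) in h3; lra.
exists z; split.
  by rewrite zE /step /cl clamp_id ?normr0 ?ltW // (HP z cz).1 addr0.
move=> t tT.
have d1 : is_derive t 1 (fun s => z0 + P z s) (h t (z t)).
  have d2 := (HP z cz).2 t (lt_trans tT TT).
  have := is_deriveD (is_derive_cst z0 t 1) d2; by rewrite add0r.
apply: near_eq_is_derive d1.
have [r r0 Hr] : exists2 r : R, 0 < r & forall w : R, `|w - t| <= r -> `|w| <= T.
  exists (T - `|t|); first by rewrite subr_gt0.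
  move=> w wt; rewrite -(subrK t w); apply: (le_trans (ler_normD _ _)); lra.
apply/nbhs_eps; exists r => // w /Hr wT.
by rewrite [RHS]zE /step /cl clamp_id.
Qed.

End PicardThm.

Lemma min_pos (R : realType) (I : finType) (F : I -> R) : (forall i, 0 < F i) ->
  exists2 r, 0 < r & forall i, r <= F i.
Proof.
move=> F0.
have [|r r0 Hr] := @finite_radius R I R^o 0 (fun j w => `|w| <= F j).
  by move=> i; exists (F i) => // w; rewrite subr0.
by exists r => // i; have := Hr r; rewrite subr0 gtr0_norm // => /(_ (lexx _) i).
Qed.

Lemma continuous_sum_at (R : realType) (V : normedModType R) (I : Type) (s : seq I)
    (F : I -> V -> R) (t : V) : (forall i, {for t, continuous (F i)}) ->
  {for t, continuous (fun u => \sum_(i <- s) F i u)}.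
Proof.
move=> H; elim: s => [|i s IH].
  rewrite (_ : (fun _ => _) = cst 0); first exact: cst_continuous.
  by apply/funext => u; rewrite big_nil.
rewrite (_ : (fun _ => _) = (F i + (fun u => \sum_(j <- s) F j u))).
  exact: continuousD.
by apply/funext => u; rewrite big_cons.
Qed.

Lemma continuous_mx_at (R : realType) (V : normedModType R) m n
    (F : V -> 'M[R]_(m, n)) (t : V) : (forall i j, {for t, continuous (fun u => F u i j)}) ->
  {for t, continuous F}.
Proof.
move=> H; apply/cont_epsP => e e0.
have [d d0 Hd] := finite_radius (fun ij : 'I_m * 'I_n => (cont_epsP _ _).1 (H ij.1 ij.2) e e0).
exists d => // w /Hd wt; apply: mx_norm_leP; first exact: ltW.
by move=> i j; rewrite !mxE; exact: (wt (i, j)).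
Qed.

(** * Local flow of a smooth vector field and its linearization *)

Section Field.
Context {R : realType} (m : nat) (U : set 'rV[R]_m) (h : 'rV[R]_m -> 'rV[R]_m).
Hypotheses (oU : open U) (sh : csmooth U h).

Definition Dfield (c : 'rV[R]_m) : 'M[R]_m :=
  \matrix_(i, j) 'D_(delta_mx 0 i) (fun y => h y 0 j) c.

Lemma mul_Dfield (v c : 'rV[R]_m) j : U c ->
  (v *m Dfield c) 0 j = 'D_v (fun y => h y 0 j) c.
Proof.
move=> Uc; rewrite (derive_coords oU) // mxE.
by apply: eq_bigr => l _; rewrite mxE.
Qed.

Lemma field_est z : U z -> exists r K : R, [/\ 0 < r, 0 < K & forall a b c : 'rV[R]_m,
    `|a - z| <= r -> `|b - z| <= r -> `|c - z| <= r ->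
    [/\ U a, `|h a| <= K, `|h a - h b| <= K * `|a - b|, `|(b - a) *m Dfield c| <= K * `|b - a| &
     `|h a - h b - (a - b) *m Dfield c| <= K * (`|a - c| + `|b - c|) * `|a - b| ] ].
Proof.
move=> Uz.
have H j : exists rK : R * R, [/\ 0 < rK.1, 0 <= rK.2 & forall a b c : 'rV[R]_m,
    `|a - z| <= rK.1 -> `|b - z| <= rK.1 -> `|c - z| <= rK.1 ->
    [/\ U a, `|h a 0 j| <= rK.2, `|h a 0 j - h b 0 j| <= rK.2 * `|a - b|, `|'D_(b - a) (fun y => h y 0 j) c| <= rK.2 * `|b - a| &
     `|h a 0 j - h b 0 j - 'D_(a - b) (fun y => h y 0 j) c| <= rK.2 * (`|a - c| + `|b - c|) * `|a - b| ] ].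
  by have [r [K HH]] := loc_est oU (sh j) Uz; exists (r, K).
have [f Hf] := choice H.
have [r0 r00 HU] := nearU oU Uz.
have [r1 r10 Hr1] : exists2 r, 0 < r & forall j, r <= (f j).1.
  by apply: min_pos => j; have [] := Hf j.
have [r rr [rr0 rr1]] := near_min2 r00 r10.
pose K := 1 + \sum_j (f j).2.
have f0 j : 0 <= (f j).2 by have [] := Hf j.
have fK j : (f j).2 <= K.
  rewrite /K (bigD1 j) //=; have : 0 <= \sum_(i < m | i != j) (f i).2 by apply: sumr_ge0 => i _; exact: f0.
  lra.
have K0 : 0 < K by rewrite ltr_wpDr // sumr_ge0 // => i _; exact: f0.
exists r, K; split => // a b c ha hb hc.
have rf j := le_trans rr1 (Hr1 j).
have HH j := let: And3 _ _ g := Hf j in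
  g a b c (le_trans ha (rf j)) (le_trans hb (rf j)) (le_trans hc (rf j)).
have Uc : U c by apply: HU; exact: le_trans hc rr0.
split.
- by apply: HU; exact: le_trans ha rr0.
- apply: mx_norm_leP => [|i j]; first exact: ltW.
  by rewrite (ord1 i); have [_ h1 _ _ _] := HH j; exact: le_trans h1 (fK j).
- apply: mx_norm_leP => [|i j]; first by rewrite mulr_ge0 // ltW.
  rewrite (ord1 i) !mxE; have [_ _ h1 _ _] := HH j; apply: (le_trans h1).
  by apply: ler_wpM2r.
- apply: mx_norm_leP => [|i j]; first by rewrite mulr_ge0 // ltW.
  rewrite (ord1 i) mul_Dfield //; have [_ _ _ h1 _] := HH j; apply: (le_trans h1).
  by apply: ler_wpM2r.
- apply: mx_norm_leP => [|i j]; first by apply: mulr_ge0 => //; apply: mulr_ge0; [exact: ltW|exact: addr_ge0].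
  have -> : (h a - h b - (a - b) *m Dfield c) i j = h a 0 j - h b 0 j - ((a - b) *m Dfield c) 0 j.
    by rewrite (ord1 i) [LHS]mxE; congr (_ + _); [rewrite !mxE|rewrite [LHS]mxE].
  rewrite mul_Dfield //; have [_ _ _ _ h1] := HH j; apply: (le_trans h1).
  by do 2 apply: ler_wpM2r => //; rewrite addr_ge0.
Qed.

(** Coordinatewise projection on the closed ball of the sup norm. Being 1-Lipschitz, it turns [h]
    into a globally Lipschitz field, to which [picard] applies. *)
Definition retract (z0 : 'rV[R]_m) (r : R) (z : 'rV[R]_m) : 'rV[R]_m :=
  \row_j (z0 0 j + clamp r (z 0 j - z0 0 j)).

Lemma retract_ball z0 r z : 0 <= r -> `|retract z0 r z - z0| <= r.
Proof.
move=> r0; apply: mx_norm_leP => // i j; rewrite (ord1 i) !mxE addrC addKr.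
exact: clamp_norm.
Qed.

Lemma retract_id z0 r z : `|z - z0| <= r -> retract z0 r z = z.
Proof.
move=> zr; apply/rowP => j; rewrite mxE clamp_id; first by rewrite addrC subrK.
by have := mx_entry_le (z - z0) 0 j; rewrite !mxE => /le_trans; apply.
Qed.

Lemma retract_lip z0 r z w : `|retract z0 r z - retract z0 r w| <= `|z - w|.
Proof.
apply: mx_norm_leP => // i j; rewrite (ord1 i) !mxE opprD addrACA subrr add0r.
apply: (le_trans (clamp_lip _ _ _)); rewrite opprB addrA subrK.
by have := mx_entry_le (z - w) 0 j; rewrite !mxE.
Qed.

Variables (z0 : 'rV[R]_m) (r K : R).
Hypotheses (r0 : 0 < r) (K0 : 0 < K).
Hypothesis est : forall a b c : 'rV[R]_m,
    `|a - z0| <= r -> `|b - z0| <= r -> `|c - z0| <= r ->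
    [/\ U a, `|h a| <= K, `|h a - h b| <= K * `|a - b|, `|(b - a) *m Dfield c| <= K * `|b - a| &
     `|h a - h b - (a - b) *m Dfield c| <= K * (`|a - c| + `|b - c|) * `|a - b| ].

(** [est] bounds [Dfield] only on differences of points of the ball, so [d] is rescaled to length
    [r]. *)
Lemma Dfield_le (d c : 'rV[R]_m) : `|c - z0| <= r -> `|d *m Dfield c| <= K * `|d|.
Proof.
move=> cr; have [->|dn0] := eqVneq d 0; first by rewrite mul0mx !normr0 mulr0.
have nd : 0 < `|d| by rewrite normr_gt0.
have [k k0 kd] : exists2 k, 0 < k & k * `|d| = r.
  by exists (r / `|d|); [exact: divr_gt0|rewrite divfK ?gt_eqF].
have cb : `|z0 + k *: d - z0| <= r.
  by rewrite addrC addKr normrZ gtr0_norm // kd.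
have zb : `|z0 - z0| <= r by rewrite subrr normr0 ltW.
have [_ _ _ h1 _] := est zb cb cr.
move: h1; rewrite addrC addKr -scalemxAl !normrZ gtr0_norm // mulrCA.
by rewrite (ler_pM2l k0).
Qed.

Definition solves (a b : R) (z : R -> 'rV[R]_m) : Prop :=
  forall t, between a b t -> `|z t - z0| <= r /\ is_derive t 1 z (h (z t)).

(** The retracted field is solved. Its speed is at most [K], so [K * T <= r / 2] keeps a solution
    that starts in the half ball inside the ball, where the retraction is the identity. *)
Lemma local_flow T : 0 < T -> K * T <= 2^-1 -> K * T <= r / 2 ->
  exists Phi : 'rV[R]_m -> R -> 'rV[R]_m, flow_bounds R h z0 r K T Phi.
Proof.
move=> T0 KT KTr.
suff H z : exists Z : R -> 'rV[R]_m, `|z - z0| <= r / 2 -> Z 0 = z /\ forall t : R, `|t| < T ->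
      `|Z t - z| <= K * `|t| /\ `|Z t - z0| <= r /\ is_derive t 1 Z (h (Z t)).
  by have [Phi HP] := choice H; exists Phi.
have [|||||Z [Z0 HZ]] := @picard R m (fun _ z => h (retract z0 r z)) K T z => //.
- exact: ltW.
- move=> _ a b; have rb w := retract_ball z0 w (ltW r0).
  have [_ _ h1 _ _] := est (rb a) (rb b) (rb b).
  apply: (le_trans h1); apply: ler_wpM2l; first exact: ltW.
  exact: retract_lip.
- move=> w cw t; apply/cont_epsP => e e0.
  have [d d0 Hd] := (cont_epsP _ _).1 (cw t) _ (divr_gt0 e0 K0).
  exists d => // s /Hd st; have rb w' := retract_ball z0 w' (ltW r0).
  have [_ _ h1 _ _] := est (rb (w s)) (rb (w t)) (rb (w t)).
  apply: (le_trans h1); rewrite -ler_pdivlMl //.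
  by apply: (le_trans (retract_lip _ _ _ _)); apply: (le_trans st); rewrite mulrC.
exists Z => zr; split => // t tT.
have B1 (u : R) : `|u| < T -> `|Z u - z| <= K * `|u|.
  move=> uT; rewrite -[in leLHS]Z0 -[X in K * `|X|]subr0.
  apply: (@mvt_norm _ _ _ Z (fun s => h (retract z0 r (Z s)))) => s sb.
  have sT : `|s| < T by apply: between_norm sb; rewrite ?normr0.
  split; first exact: HZ.
  have rb := retract_ball z0 (Z s) (ltW r0).
  by have [_ ? _ _ _] := est rb rb rb.
have B2 (u : R) : `|u| < T -> `|Z u - z0| <= r.
  move=> uT; apply: (le_trans (ler_distD z _ _)).
  have := B1 u uT; have := ler_wpM2l (ltW K0) (ltW uT); lra.
split; first exact: B1.
split; first exact: B2.
by have := HZ t tT; rewrite retract_id //; exact: B2.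
Qed.

Lemma solves_lip z w s t : K * `|t - s| <= 2^-1 -> solves s t z -> solves s t w ->
  `|z t - w t| <= 2 * `|z s - w s|.
Proof.
move=> Kt Hz Hw.
have := @gronwall _ _ _ (fun u => z u - w u) (fun u => h (z u) - h (w u)) s t K 0 (ltW K0) (lexx _) Kt.
rewrite mulr0 mul0r addr0; apply=> u ub.
have [z1 z2] := Hz u ub; have [w1 w2] := Hw u ub.
split; first exact: is_deriveB.
by rewrite addr0; have [_ _ ? _ _] := est z1 w1 w1.
Qed.

Lemma solves_sub s t u z : between s t u -> solves s t z -> solves s u z.
Proof. by move=> su H v vb; apply: H; exact: between_sub su vb. Qed.

(** Gronwall applied to the difference of two solutions minus its linear prediction along the
    reference [l]. By [solves_lip] the three distances at most double on the interval, which gives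
    the forcing term [e]; the factor [2] in [gronwall] completes the constant [8]. *)
Lemma solves_strict (l z w : R -> 'rV[R]_m) (P : R -> 'M[R]_m) s t :
  K * `|t - s| <= 2^-1 -> solves s t l -> solves s t z -> solves s t w ->
  P s = 1%:M -> (forall u, between s t u -> is_derive u 1 P (P u *m Dfield (l u))) ->
  `|z t - w t - (z s - w s) *m P t| <=
    8 * K * `|t - s| * (`|z s - l s| + `|w s - l s|) * `|z s - w s|.
Proof.
move=> Kt Hl Hz Hw Ps HP.
pose e := K * (2 * `|z s - l s| + 2 * `|w s - l s|) * (2 * `|z s - w s|).
have Kge := ltW K0.
have e0 : 0 <= e by rewrite /e !mulr_ge0 ?addr_ge0 ?mulr_ge0.
have := @gronwall _ _ _ (fun u => z u - w u - (z s - w s) *m P u)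
  (fun u => h (z u) - h (w u) - (z s - w s) *m (P u *m Dfield (l u))) s t K e (ltW K0) e0 Kt.
rewrite Ps mulmx1 subrr normr0 mulr0 add0r => H.
apply: (le_trans (H _)); last by rewrite /e; lra.
move=> u ub; have [z1 z2] := Hz u ub; have [w1 w2] := Hw u ub; have [l1 l2] := Hl u ub.
split.
  have d0 : is_derive u 1 (fun u => (z s - w s) *m P u) (0 *m P u + (z s - w s) *m (P u *m Dfield (l u))).
    exact: is_derive_mulmx (is_derive_cst _ _ _) (HP u ub).
  by move: d0; rewrite mul0mx add0r => d0; exact: (is_deriveB (is_deriveB z2 w2) d0).
have [_ _ _ _ e1] := est z1 w1 l1.
pose d := z u - w u - (z s - w s) *m P u.
have Kd : `|d *m Dfield (l u)| <= K * `|d| by exact: Dfield_le.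
have -> : h (z u) - h (w u) - (z s - w s) *m (P u *m Dfield (l u)) =
   (h (z u) - h (w u) - (z u - w u) *m Dfield (l u)) + d *m Dfield (l u).
  by rewrite /d (mulmxBl (z u - w u)) -mulmxA [RHS]addrA subrK.
apply: (le_trans (ler_normD _ _)); rewrite addrC; apply: lerD => //.
apply: (le_trans e1); rewrite /e.
have Ku := le_trans (ler_wpM2l (ltW K0) (between_dist ub)) Kt.
have lz := solves_lip Ku (solves_sub ub Hz) (solves_sub ub Hl).
have lw := solves_lip Ku (solves_sub ub Hw) (solves_sub ub Hl).
have lzw := solves_lip Ku (solves_sub ub Hz) (solves_sub ub Hw).
apply: ler_pM => //; first by rewrite mulr_ge0 ?addr_ge0.
by apply: ler_wpM2l; [exact: ltW|exact: lerD].
Qed.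

(** The rows of [Y] solve the same linear equation independently, so [picard] is applied row by row,
    with the coefficient read at clamped times. *)
Lemma variational T (l : R -> 'rV[R]_m) : 0 < T -> K * T <= 2^-1 ->
  (forall t : R, `|t| <= T -> `|l t - z0| <= r /\ is_derive t 1 l (h (l t))) ->
  exists Y : R -> 'M[R]_m, Y 0 = 1%:M /\
    forall t : R, `|t| < T -> is_derive t 1 Y (Y t *m Dfield (l t)).
Proof.
move=> T0 KT Hl.
pose cl := clamp T.
have clT t : `|cl t| <= T by apply: clamp_norm; exact: ltW.
have H i : exists y : R -> 'rV[R]_m, y 0 = row i 1%:M /\
    forall t : R, `|t| < T -> is_derive t 1 y (y t *m Dfield (l (cl t))).
  apply: (@picard R m (fun t v => v *m Dfield (l (cl t))) K) => //; first exact: ltW.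
    by move=> t a b; rewrite -mulmxBl; apply: Dfield_le; exact: (Hl _ (clT t)).1.
  move=> z cz t.
  have cD i' j : {for t, continuous (fun s => Dfield (l (cl s)) i' j)}.
    have -> : (fun s => Dfield (l (cl s)) i' j) = (fun c => Dfield c i' j) \o (l \o cl) by [].
    apply: continuous_comp.
      apply: continuous_comp; last exact: is_derive_cont (Hl _ (clT t)).2.
      by apply/cont_epsP => e e0; exists e => // w wt; exact: le_trans (clamp_lip _ _ _) wt.
    have -> : (fun c => Dfield c i' j) = 'D_(delta_mx 0 i') (fun y => h y 0 j).
      by apply/funext => c; rewrite mxE.
    apply: (smooth_cont (U := U)); first exact: smooth_derive.
    have lb := (Hl _ (clT t)).1.
    by have [] := est lb lb lb.
  apply: continuous_mx_at => i' j; rewrite (ord1 i').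
  have -> : (fun s => (z s *m Dfield (l (cl s))) 0 j) = (fun s => \sum_k z s 0 k * Dfield (l (cl s)) k j).
    by apply/funext => s; rewrite mxE.
  apply: continuous_sum_at => k; apply: continuousM; last exact: cD.
  apply: (@continuous_comp _ _ _ z (fun M : 'rV[R]_m => M 0 k)); first exact: cz.
  exact: coord_continuous.
have [y Hy] := choice H.
exists (fun t => \matrix_i y i t); split.
  by apply/row_matrixP => i; rewrite rowK; have [] := Hy i.
move=> t tT; apply/derive_mxP => i j.
have -> : (fun x => (\matrix_i y i x) i j) = (fun x => y i x 0 j).
  by apply/funext => x; rewrite mxE.
have [_ /(_ t tT) /derive_mxP /(_ 0 j)] := Hy i.
rewrite /cl clamp_id ?ltW // => /is_derive_eq; apply.
rewrite [LHS]mxE [RHS]mxE; apply: eq_bigr => k _; congr (_ * _).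
by rewrite [RHS]mxE.
Qed.

End Field.

(** * Orders and leading terms of matrix functions at the right of zero *)

Section BigO.
Context {R : realType}.

(** The bound includes [t = 0], so a positive order forces the value [0] there; [b3] below is the
    variant without the origin. *)
Definition bO (V : normedModType R) (p : nat) (f : R -> V) : Prop :=
  exists K d : R, [/\ 0 <= K, 0 < d & forall t, 0 <= t <= d -> `|f t| <= K * t ^+ p].

Lemma bO_weak (V : normedModType R) p q (f : R -> V) : (p <= q)%N -> bO q f -> bO p f.
Proof.
move=> pq [K [d [K0 d0 H]]]; have [d' d'0 [h1 h2]] := near_min2 d0 (@ltr01 R).
exists K, d'; split => // t /andP[t0 td]; apply: (le_trans (H t _)); first by rewrite t0 (le_trans td).
by apply: ler_wpM2l => //; apply: ler_wiXn2l => //; exact: le_trans td h2.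
Qed.

Lemma bO_ext (V : normedModType R) p (f g : R -> V) : (forall t, f t = g t) -> bO p f -> bO p g.
Proof. by move=> /funext ->. Qed.

Lemma bOD (V : normedModType R) p (f g : R -> V) : bO p f -> bO p g -> bO p (fun t => f t + g t).
Proof.
move=> [K [d [K0 d0 H]]] [K' [d' [K'0 d'0 H']]].
have [e e0 [h1 h2]] := near_min2 d0 d'0.
exists (K + K'), e; split => //; first exact: addr_ge0.
move=> t /andP[t0 te]; apply: (le_trans (ler_normD _ _)); rewrite mulrDl.
by apply: lerD; [apply: H|apply: H']; rewrite t0 (le_trans te).
Qed.

Lemma bON (V : normedModType R) p (f : R -> V) : bO p f -> bO p (fun t => - f t).
Proof.
move=> [K [d [K0 d0 H]]]; exists K, d; split => // t td; rewrite normrN; exact: H.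
Qed.

Lemma bOB (V : normedModType R) p (f g : R -> V) : bO p f -> bO p g -> bO p (fun t => f t - g t).
Proof. by move=> Hf Hg; apply: bOD => //; exact: bON. Qed.

Lemma bOZ (V : normedModType R) p q (a : R -> R) (f : R -> V) :
  bO p a -> bO q f -> bO (p + q) (fun t => a t *: f t).
Proof.
move=> [K [d [K0 d0 H]]] [K' [d' [K'0 d'0 H']]].
have [e e0 [h1 h2]] := near_min2 d0 d'0.
exists (K * K'), e; split => //; first exact: mulr_ge0.
move=> t /andP[t0 te]; rewrite normrZ exprD mulrACA.
by apply: ler_pM => //; [apply: H|apply: H']; rewrite t0 (le_trans te).
Qed.

Lemma bO_mulmx m n q p p' (A : R -> 'M[R]_(m, n)) (B : R -> 'M[R]_(n, q)) :
  bO p A -> bO p' B -> bO (p + p') (fun t => A t *m B t).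
Proof.
move=> [K [d [K0 d0 H]]] [K' [d' [K'0 d'0 H']]].
have [e e0 [h1 h2]] := near_min2 d0 d'0.
exists (n%:R * (K * K')), e; split => //; first by rewrite !mulr_ge0.
move=> t /andP[t0 te]; apply: (le_trans (mulmx_norm _ _)).
rewrite exprD -!mulrA; apply: ler_wpM2l => //.
rewrite [leRHS](_ : _ = (K * t ^+ p) * (K' * t ^+ p')); last by ring.
by apply: ler_pM => //; [apply: H|apply: H']; rewrite t0 (le_trans te).
Qed.

Lemma bO_tr m n p (A : R -> 'M[R]_(m, n)) : bO p A -> bO p (fun t => (A t)^T).
Proof.
move=> [K [d [K0 d0 H]]]; exists K, d; split => // t td; rewrite norm_trmx; exact: H.
Qed.

Lemma bO_entry m n p (A : R -> 'M[R]_(m, n)) i j : bO p A -> bO p (fun t => A t i j).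
Proof.
move=> [K [d [K0 d0 H]]]; exists K, d; split => // t td.
exact: le_trans (mx_entry_le _ _ _) (H t td).
Qed.

Lemma bO_cont (V : normedModType R) (f : R -> V) : {for 0, continuous f} -> bO 0 f.
Proof.
move=> /cont_epsP /(_ 1 ltr01) [d d0 H].
exists (`|f 0| + 1), d; split => // t /andP[t0 td]; rewrite expr0 mulr1.
have := H t; rewrite subr0 ger0_norm // => /(_ td).
have := ler_normD (f t - f 0) (f 0); rewrite subrK; lra.
Qed.

Lemma bO_pow p : bO p (fun t : R => t ^+ p).
Proof.
exists 1, 1; split => // t /andP[t0 _]; rewrite mul1r normrX ger0_norm //.
Qed.

Lemma bO_cst (V : normedModType R) (c : V) : bO 0 (fun=> c).
Proof. by exists `|c|, 1; split => // t _; rewrite expr0 mulr1. Qed.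

Lemma bO_int m n p (f f' : R -> 'M[R]_(m, n)) (d0 : R) : 0 < d0 ->
  (forall t : R, 0 <= t <= d0 -> is_derive t 1 f (f' t)) -> f 0 = 0 -> bO p f' -> bO p.+1 f.
Proof.
move=> d00 Hf f0 [K [d [K0 dd H]]].
have [e e0 [h1 h2]] := near_min2 dd d00.
exists K, e; split => // t /andP[t0 te].
have := @mvt_norm _ _ _ f f' 0 t (K * t ^+ p).
rewrite f0 !subr0 (ger0_norm t0) -mulrA -exprSr; apply=> s /(between_le _ t0) /andP[s0 st].
have se := le_trans st te.
split; first by apply: Hf; rewrite s0 (le_trans se).
apply: (le_trans (H s _)); first by rewrite s0 (le_trans se).
by apply: ler_wpM2l => //; apply: lerXn2r; rewrite ?nnegrE.
Qed.

(** The coefficient [c] may be zero: only a nonzero [c] determines the order of [f]. *)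
Definition lead (V : normedModType R) (p : nat) (c : V) (f : R -> V) : Prop :=
  bO p.+1 (fun t => f t - t ^+ p *: c).

Lemma lead_bO (V : normedModType R) p (c : V) f : lead p c f -> bO p f.
Proof.
move=> /(bO_weak (leqnSn p)) H.
have H2 : bO p (fun t : R => t ^+ p *: c).
  by have := bOZ (bO_pow p) (bO_cst c); rewrite addn0.
by apply: bO_ext (bOD H H2) => t; rewrite subrK.
Qed.

Lemma lead_ext (V : normedModType R) p (c : V) f g : (forall t, f t = g t) -> lead p c f -> lead p c g.
Proof. by move=> /funext ->. Qed.

Lemma leadD (V : normedModType R) p (c c' : V) f g :
  lead p c f -> lead p c' g -> lead p (c + c') (fun t => f t + g t).
Proof.
by move=> h1 h2; apply: bO_ext (bOD h1 h2) => t; rewrite scalerDr opprD addrACA.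
Qed.

Lemma lead_addbO (V : normedModType R) p (c : V) f g :
  lead p c f -> bO p.+1 g -> lead p c (fun t => f t + g t).
Proof. by move=> h1 h2; apply: bO_ext (bOD h1 h2) => t; rewrite addrAC. Qed.

Lemma lead_mulmx m n q p p' (A : R -> 'M[R]_(m, n)) (B : R -> 'M[R]_(n, q)) a b :
  lead p a A -> lead p' b B -> lead (p + p') (a *m b) (fun t => A t *m B t).
Proof.
move=> hA hB.
have h1 := bO_mulmx hA (lead_bO hB).
have h2 := bO_mulmx (bOZ (bO_pow p) (bO_cst a)) hB.
rewrite addn0 addnS in h2.
apply: bO_ext (bOD h1 h2) => t.
rewrite mulmxBl mulmxBr addrA subrK; congr (_ - _).
by rewrite -scalemxAl -scalemxAr scalerA exprD.
Qed.

Lemma lead_entry m n p (A : R -> 'M[R]_(m, n)) a i j : lead p a A -> lead p (a i j) (fun t => A t i j).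
Proof. by move=> /(bO_entry i j); apply: bO_ext => t; rewrite !mxE. Qed.

Lemma lead_tr m n p (A : R -> 'M[R]_(m, n)) a : lead p a A -> lead p a^T (fun t => (A t)^T).
Proof. by move=> /bO_tr; apply: bO_ext => t; rewrite linearB linearZ. Qed.

Lemma leadM p p' (f g : R -> R) (a b : R) :
  lead p a f -> lead p' b g -> lead (p + p') (a * b) (fun t => f t * g t).
Proof.
move=> hA hB.
have h1 := bOZ hA (lead_bO hB).
have h2 := bOZ (bOZ (bO_pow p) (bO_cst a)) hB.
rewrite addn0 addnS in h2.
apply: bO_ext (bOD h1 h2) => t; rewrite exprD /GRing.scale /=; ring.
Qed.

Lemma lead_cst (V : normedModType R) (c : V) : lead 0 c (fun=> c).
Proof.
exists 0, 1; split => // t _; by rewrite expr0 scale1r subrr normr0 mul0r.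
Qed.

Lemma lead_prod (I : Type) (s : seq I) (p : I -> nat) (f : I -> R -> R) (c : I -> R) :
  (forall i, lead (p i) (c i) (f i)) ->
  lead (\sum_(i <- s) p i) (\prod_(i <- s) c i) (fun t => \prod_(i <- s) f i t).
Proof.
move=> H; elim: s => [|i s IH].
  rewrite !big_nil; apply: lead_ext (lead_cst (1 : R)) => t; by rewrite big_nil.
by rewrite !big_cons; apply: lead_ext (leadM (H i) IH) => t; rewrite big_cons.
Qed.

Lemma lead_sum (I : Type) (s : seq I) (p : nat) (f : I -> R -> R) (c : I -> R) :
  (forall i, lead p (c i) (f i)) ->
  lead p (\sum_(i <- s) c i) (fun t => \sum_(i <- s) f i t).
Proof.
move=> H; elim: s => [|i s IH].
  exists 0, 1; split => // t _; by rewrite !big_nil scaler0 subrr normr0 mul0r.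
by rewrite !big_cons; apply: lead_ext (leadD (H i) IH) => t; rewrite big_cons.
Qed.

Lemma lead_int m n p (f f' : R -> 'M[R]_(m, n)) c (d0 : R) : 0 < d0 ->
  (forall t : R, 0 <= t <= d0 -> is_derive t 1 f (f' t)) -> f 0 = 0 -> lead p c f' ->
  lead p.+1 (p.+1%:R^-1 *: c) f.
Proof.
move=> d00 Hf f0 Hl; apply: (@bO_int _ _ _ _ (fun t => f' t - t ^+ p *: c) d0) => //; last first.
  by rewrite expr0n /= scale0r subr0.
move=> t td.
have dx : is_derive t 1 (fun x : R => x ^+ p.+1 *: (p.+1%:R^-1 *: c)) (t ^+ p *: c).
  apply/derive_mxP => i j.
  have -> : (fun x : R => (x ^+ p.+1 *: (p.+1%:R^-1 *: c)) i j) = (fun x : R => x ^+ p.+1 * (p.+1%:R^-1 * c i j)).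
    by apply/funext => x; rewrite !mxE.
  have d1 : is_derive t 1 (fun x : R => x ^+ p.+1) (p.+1%:R * t ^+ p).
    by apply: DeriveDef; [exact: exprn_derivable|rewrite exp_derive [LHS]mulr1].
  have := is_deriveM' d1 (is_derive_cst (p.+1%:R^-1 * c i j) t 1).
  rewrite mulr0 addr0 => /is_derive_eq; apply; rewrite !mxE /cst.
  by rewrite [_ * t ^+ p]mulrC -mulrA mulVKf // pnatr_eq0.
exact: is_deriveB (Hf t td) dx.
Qed.

(** Every permutation contributes at the same order, since the sum over [a] of [w a + w (s a) - 1]
    does not depend on [s]. So the coefficients of the terms assemble into the determinant of the
    leading coefficients. *)
Lemma lead_det n (w : 'I_n -> nat) (G : R -> 'M[R]_n) (g : 'M[R]_n) :
  (forall a, (0 < w a)%N) ->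
  (forall a b, lead (w a + w b).-1 (g a b) (fun t => G t a b)) ->
  lead (\sum_a (2 * w a).-1) (\det g) (fun t => \det (G t)).
Proof.
move=> w0 H; rewrite /determinant.
apply: lead_sum => s.
have -> : (\sum_a (2 * w a).-1 = 0 + \sum_a (w a + w (s a)).-1)%N.
  rewrite add0n.
  have E (f : 'I_n -> nat) : (forall a, (0 < f a)%N) -> (\sum_a (f a).-1 + n = \sum_a f a)%N.
    move=> f0; have En : (\sum_(a < n) 1 = n)%N by rewrite sum1_card card_ord.
    rewrite -[X in (_ + X)%N = _]En -big_split /=.
    by apply: eq_bigr => a _; rewrite addn1 prednK.
  have h1 a : (0 < 2 * w a)%N by rewrite muln_gt0 w0.
  have h2 a : (0 < w a + w (s a))%N by rewrite addn_gt0 w0.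
  apply: (@addIn n); rewrite (E _ h1) (E _ h2).
  under eq_bigr do rewrite mul2n -addnn.
  rewrite !big_split /=; congr (_ + _)%N.
  exact: (reindex_inj (@perm_inj _ s)).
apply: leadM; first exact: lead_cst.
by apply: lead_prod => a; exact: H.
Qed.

End BigO.

(** * Positivity of weighted Gram determinants *)

Section PosDef.
Context {R : realType}.

Lemma poly_zero_on (p : {poly R}) : (forall x, 0 < x < 1 -> p.[x] = 0) -> p = 0.
Proof.
move=> H; apply/eqP/negPn/negP => p0.
pose rs := [seq (i.+2%:R)^-1 : R | i <- iota 0 (size p)].
have Ar : all (root p) rs.
  apply/allP => _ /mapP[i _ ->]; apply/rootP; apply: H.
  by rewrite invr_gt0 ltr0n /= invf_lt1 ?ltr0n // ltr1n.
have Ur : uniq rs.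
  by rewrite map_inj_uniq ?iota_uniq // => i j /invr_inj /eqP; rewrite eqr_nat => /eqP [].
by have := max_poly_roots p0 Ar Ur; rewrite size_map size_iota ltnn.
Qed.

(** Deformation to the identity: [x g + (1 - x) I] is positive on any nonzero vector for [x] in
    [[0, 1]], hence never singular, whereas a nonpositive [det g] would force a root of its
    determinant by the intermediate value theorem. *)
Lemma posdef_det n (g : 'M[R]_n) :
  (forall v : 'rV[R]_n, v != 0 -> 0 < (v *m g *m v^T) 0 0) -> 0 < \det g.
Proof.
move=> H.
pose P : {poly R} := \det ('X *: map_mx polyC g + (1 - 'X) *: 1%:M).
have PE x : P.[x] = \det (x *: g + (1 - x) *: 1%:M).
  rewrite -horner_evalE -det_map_mx; congr (\det _); apply/matrixP => i j.
  by rewrite !mxE /= horner_evalE !hornerE; case: eqP => _; rewrite !hornerE.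
case: (ltrP 0 (\det g)) => // D0.
have [||x /andP[x0 x1] /rootP] := @poly_ivt R (- P) 0 1.
- exact: ler01.
- rewrite !hornerN !PE scale1r subrr !scale0r addr0 subr0 scale1r add0r det1.
  by rewrite lerN10 oppr_ge0.
rewrite hornerN => /eqP; rewrite oppr_eq0 PE => /det0P [v v0 Hv].
have /matrixP /(_ 0 0) : v *m (x *: g + (1 - x) *: 1%:M) *m v^T = 0 by rewrite Hv mul0mx.
rewrite mulmxDr -!scalemxAr mulmx1 mulmxDl -!scalemxAl mxE [X in X + _]mxE [X in _ + X]mxE [RHS]mxE.
have vv : 0 < (v *m v^T) 0 0.
  have [j vj] : exists j, v 0 j != 0.
    apply/existsP; apply: contraNT v0 => /existsPn H0; apply/eqP/rowP => j; rewrite mxE.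
    by apply/eqP; have := H0 j; rewrite negbK.
  rewrite mxE (bigD1 j) //= ltr_pwDl ?sumr_ge0 //= ?mxE.
    by rewrite -expr2 exprn_even_gt0.
  by move=> i _; rewrite mxE -expr2 sqr_ge0.
have := H v v0; nra.
Qed.

(** This is the Gram matrix in $L^2(0,1)$ of the curves $t^{w_a-1}c_a$, because
    $\int_0^1t^{w_a+w_b-2}dt=1/(w_a+w_b-1)$. The integral is replaced by the polynomial primitive
    [Q] of the sum of squares [P]; curves of different weights have different degrees, so
    independence is only asked within one weight. *)
Lemma gram_det n k (c : 'I_n -> 'rV[R]_k) (w : 'I_n -> nat) :
  (forall a, (0 < w a)%N) ->
  (forall (al : 'I_n -> R) i, \sum_(a | w a == i) al a *: c a = 0 -> forall a, w a = i -> al a = 0) ->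
  0 < \det (\matrix_(a, b) ((c a *m (c b)^T) 0 0 / (w a + w b).-1%:R) : 'M[R]_n).
Proof.
move=> w0 ind; apply: posdef_det => v vn0.
pose p l : {poly R} := \sum_a (v 0 a * c a 0 l) *: 'X^((w a).-1).
pose P := \sum_l p l ^+ 2.
pose q a b := v 0 a * v 0 b * (c a *m (c b)^T) 0 0.
pose Q : {poly R} := \sum_a \sum_b (q a b / (w a + w b).-1%:R) *: 'X^((w a + w b).-1).
have wpos a b : (w a + w b).-1 = ((w a).-1 + (w b).-1).+1.
  by rewrite -{1}(prednK (w0 a)) -{1}(prednK (w0 b)) addnS addSn.
have QP : Q^`() = P.
  rewrite /P /Q raddf_sum /=; under [RHS]eq_bigr => l _ do rewrite expr2 /p mulr_suml.
  rewrite [RHS]exchange_big /=; apply: eq_bigr => a _.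
  rewrite raddf_sum /=; under [RHS]eq_bigr => l _ do rewrite mulr_sumr.
  rewrite [RHS]exchange_big /=; apply: eq_bigr => b _.
  rewrite derivZ derivXn.
  have -> : (w a + w b).-1.-1 = ((w a).-1 + (w b).-1)%N.
    by rewrite -{1}(prednK (w0 a)) -{1}(prednK (w0 b)) addnS addSn.
  have N0 : (w a + w b).-1%:R != 0 :> R.
    by rewrite pnatr_eq0 -lt0n -{1}(prednK (w0 a)) -{1}(prednK (w0 b)) addnS addSn.
  rewrite -['X^_ *+ _](@scaler_nat R) scalerA divfK //.
  under [RHS]eq_bigr => l _ do rewrite -scalerAl -scalerAr scalerA -exprD.
  rewrite -scaler_suml; congr (_ *: _).
  rewrite /q mxE mulr_sumr; apply: eq_bigr => l _; rewrite !mxE; ring.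
have P0 x : 0 <= P.[x].
  by rewrite horner_sum sumr_ge0 // => l _; rewrite horner_exp sqr_ge0.
have Q0 : Q.[0] = 0.
  rewrite horner_sum big1 // => a _; rewrite horner_sum big1 // => b _.
  by rewrite hornerZ hornerXn [X in 0 ^+ X]wpos expr0n /= mulr0.
have Q1 : Q.[1] = (v *m (\matrix_(a, b) ((c a *m (c b)^T) 0 0 / (w a + w b).-1%:R)) *m v^T) 0 0.
  rewrite horner_sum [RHS]mxE.
  under [RHS]eq_bigr => b _ do rewrite mxE mulr_suml.
  rewrite [RHS]exchange_big /=; apply: eq_bigr => a _.
  rewrite horner_sum; apply: eq_bigr => b _.
  by rewrite hornerZ hornerXn expr1n mulr1 /q [v^T _ _]mxE [(\matrix_(_, _) _) _ _]mxE; ring.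
rewrite -Q1; case: (ltrP 0 Q.[1]) => // Q1le.
have Qm x y : x <= y -> Q.[x] <= Q.[y].
  move=> xy; rewrite -subr_ge0.
  have [z _ ->] := @MVT_segment R (horner Q) (horner Q^`()) x y xy
     (fun t _ => is_derive_poly Q t) (continuous_subspaceT (@continuous_horner R Q)).
  by rewrite mulr_ge0 ?subr_ge0 // QP.
(* [Q] is nondecreasing with value [0] at [0] and, by assumption, at most [0] at [1], so it vanishes
   on the whole interval. *)
have Qz : Q = 0.
  apply: poly_zero_on => x /andP[x0 x1]; apply: le_anti.
  by rewrite (le_trans (Qm _ _ (ltW x1)) Q1le) -{1}Q0 Qm // ltW.
have pz l : p l = 0.
  apply: poly_zero_on => x _.
  have : P.[x] = 0 by rewrite -QP Qz deriv0 horner0.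
  rewrite horner_sum => /eqP; rewrite psumr_eq0 => [|i _]; last by rewrite horner_exp sqr_ge0.
  by move=> /allP /(_ l (mem_index_enum _)) /=; rewrite horner_exp sqrf_eq0 => /eqP.
case/eqP: vn0; apply/rowP => a; rewrite mxE.
apply: (ind (fun a => v 0 a) (w a)) => //.
apply/rowP => l; rewrite mxE summxE.
have := congr1 (fun r : {poly R} => r`_(w a).-1) (pz l).
rewrite coef0 coef_sum => {2}<-; rewrite [LHS]big_mkcond /=; apply: eq_bigr => b _.
rewrite coefZ coefXn mxE; have -> : ((w a).-1 == (w b).-1) = (w b == w a).
  by rewrite -{2}(prednK (w0 a)) -{2}(prednK (w0 b)) eqSS eq_sym.
by case: eqP; rewrite ?mulr1 ?mulr0.
Qed.

End PosDef.

Lemma is_derive_ext (R : realType) (V : normedModType R) (f g : R -> V) (t : R) (d : V) :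
  is_derive t 1 f d -> f =1 g -> is_derive t 1 g d.
Proof. by move=> H /funext <-. Qed.

(** * Order of vanishing of the upper right block of the linearized flow *)

Section Order.
Context {R : realType} (n k : nat).
Variables (X_ : nat -> R -> 'M[R]_(k, n)) (A C Lq M : R -> 'M[R]_n) (d0 : R).
Hypothesis d00 : 0 < d0.
Hypothesis HX : forall j (t : R), 0 <= t <= d0 ->
  is_derive t 1 (X_ j) (X_ j.+1 t + X_ j t *m A t).
Hypothesis HL : forall t : R, 0 <= t <= d0 ->
  is_derive t 1 Lq (- (Lq t *m (A t)^T) - M t *m C t).
Hypothesis HM : forall t : R, 0 <= t <= d0 ->
  is_derive t 1 M (Lq t *m ((X_ 0%N t)^T *m X_ 0%N t) + M t *m A t).
Hypotheses (L0 : Lq 0 = 1%:M) (M0 : M 0 = 0) (bA : bO 0 A) (bC : bO 0 C).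
Hypothesis CT : forall t, (C t)^T = C t.

Let t0 : (0 : R) <= 0 <= d0. Proof. by rewrite lexx ltW. Qed.

Lemma bO_X j : bO 0 (X_ j).
Proof. by apply: bO_cont; apply: is_derive_cont (HX j t0). Qed.

Lemma bO_L : bO 0 Lq.
Proof. by apply: bO_cont; apply: is_derive_cont (HL t0). Qed.

Lemma bO_M : bO 0 M.
Proof. by apply: bO_cont; apply: is_derive_cont (HM t0). Qed.

Section OneCovector.
Variables (xi : 'rV[R]_n) (w : nat).
Hypothesis w0 : (0 < w)%N.
Hypothesis Hxi : forall j, (j.+1 < w)%N -> xi *m (X_ j 0)^T = 0.

(** For the initial covector variation [xi], [zjet 0] is the variation of the control due to the
    covector and [mjet] the variation of the position. [zjet j] has the frame replaced by its [j]-th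
    derivative along the flow. *)
Definition zjet j t : 'rV[R]_k := xi *m Lq t *m (X_ j t)^T.
Definition mjet t : 'rV[R]_n := xi *m M t.

(** The terms in [A] cancel, since [A] enters the equations of [X_ j] and [Lq] with opposite signs.
    What remains is the next jet and a coupling to [mjet] through [C]. *)
Lemma is_derive_zjet j (t : R) : 0 <= t <= d0 ->
  is_derive t 1 (zjet j) (zjet j.+1 t - mjet t *m C t *m (X_ j t)^T).
Proof.
move=> td.
have d1 := is_derive_mulmx (is_derive_mulmx (is_derive_cst xi t 1) (HL td)) (is_derive_trmx (HX j td)).
apply: is_derive_eq d1 _; rewrite mul0mx add0r /cst /zjet /mjet.
rewrite [(X_ j.+1 t + _)^T]linearD /= trmx_mul mulmxBr mulmxBl mulmxN mulNmx mulmxDr !mulmxA.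
by rewrite [LHS]addrC addrA addrK.
Qed.

Lemma is_derive_mjet (t : R) : 0 <= t <= d0 ->
  is_derive t 1 mjet (zjet 0 t *m X_ 0%N t + mjet t *m A t).
Proof.
move=> td.
have d1 := is_derive_mulmx (is_derive_cst xi t 1) (HM td).
apply: is_derive_eq d1 _; rewrite mul0mx add0r /cst /zjet /mjet.
by rewrite mulmxDr !mulmxA.
Qed.

Lemma zjet0 j : zjet j 0 = xi *m (X_ j 0)^T.
Proof. by rewrite /zjet L0 mulmx1. Qed.

Lemma bO_zjet j : bO 0 (zjet j).
Proof.
have h := bO_mulmx (bO_cst xi) bO_L; exact: (bO_mulmx h (bO_tr (bO_X j))).
Qed.

(** Descent along the jets: the jet of index [w - 1] is bounded, and each lower one vanishes at [0]
    and has as derivative the jet above it, up to the coupling. Every integration gains one order,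
    until the order [p] known for [mjet] becomes the limit. *)
Lemma bO_zjet_step p : bO p mjet -> forall i, (i < w)%N -> bO (minn i p.+1) (zjet (w.-1 - i)).
Proof.
move=> Hm; elim=> [|i IH] iw; first by rewrite min0n; exact: bO_zjet.
have Hi := IH (ltnW iw).
have E : (w.-1 - i = (w.-1 - i.+1).+1)%N by rewrite subnS prednK // subn_gt0 -ltnS prednK.
rewrite E in Hi.
have h2 : bO p (fun t => mjet t *m C t *m (X_ (w.-1 - i.+1)%N t)^T).
  by have := bO_mulmx (bO_mulmx Hm bC) (bO_tr (bO_X (w.-1 - i.+1)%N)); rewrite !addn0.
have h3 : bO (minn i p) (fun t => zjet (w.-1 - i.+1).+1 t - mjet t *m C t *m (X_ (w.-1 - i.+1)%N t)^T).
  apply: bOB; last by apply: bO_weak h2; exact: geq_minr.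
  by apply: bO_weak Hi; rewrite leq_min geq_minl (leq_trans (geq_minr _ _)).
rewrite minnSS; apply: (bO_int d00 (fun t td => is_derive_zjet _ td) _ h3).
rewrite zjet0; apply: Hxi.
by rewrite -E (leq_ltn_trans (leq_subr _ _)) // prednK.
Qed.

(** Bootstrap: order [p] for [mjet] gives order [p] for [zjet 0], and integrating the equation of
    [mjet] gives order [p + 1], up to [w]. *)
Lemma bO_mjet : bO w mjet.
Proof.
suff H p : (p <= w)%N -> bO p mjet by exact: H.
elim: p => [|p IH] pw.
  exact: (bO_mulmx (bO_cst xi) bO_M).
have Hm := IH (ltnW pw).
have Hz : bO p (zjet 0).
  have := @bO_zjet_step p Hm w.-1; rewrite prednK // subnn => /(_ (leqnn _)).
  by apply: bO_weak; rewrite leq_min leqnSn andbT -ltnS prednK.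
apply: (bO_int d00 is_derive_mjet); first by rewrite /mjet M0 mulmx0.
apply: bOD; first by have := bO_mulmx Hz (bO_X 0); rewrite addn0.
by have := bO_mulmx Hm bA; rewrite addn0.
Qed.

(** Integrating the chain of jets [w - 1] times produces the factorial; the coupling to [mjet] has
    order [w], too high to affect the leading term. *)
Lemma lead_zjet : lead w.-1 ((w.-1)`!%:R^-1 *: (xi *m (X_ w.-1 0)^T)) (zjet 0).
Proof.
suff H i : (i < w)%N -> lead i (i`!%:R^-1 *: (xi *m (X_ w.-1 0)^T)) (zjet (w.-1 - i)).
  by have := H w.-1; rewrite subnn prednK //; apply.
have h2 j : bO w (fun t => mjet t *m C t *m (X_ j t)^T).
  by have := bO_mulmx (bO_mulmx bO_mjet bC) (bO_tr (bO_X j)); rewrite !addn0.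
elim: i => [|i IH] iw.
  rewrite subn0 fact0 invr1 scale1r -zjet0.
  apply: (bO_int d00 (f' := fun t => zjet w.-1.+1 t - mjet t *m C t *m (X_ w.-1 t)^T)).
  - move=> t td; have := is_deriveB (is_derive_zjet w.-1 td) (is_derive_cst (zjet w.-1 0) t 1).
    rewrite subr0 => /is_derive_ext; apply => s.
    by rewrite /= expr0 scale1r.
  - by rewrite expr0 scale1r subrr.
  - by apply: bOB; [exact: bO_zjet|apply: bO_weak (h2 _)].
have Hi := IH (ltnW iw).
have E : (w.-1 - i = (w.-1 - i.+1).+1)%N by rewrite subnS prednK // subn_gt0 -ltnS prednK.
rewrite E in Hi.
have h3 : lead i (i`!%:R^-1 *: (xi *m (X_ w.-1 0)^T))
    (fun t => zjet (w.-1 - i.+1).+1 t - mjet t *m C t *m (X_ (w.-1 - i.+1)%N t)^T).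
  by apply: (lead_addbO Hi); apply: bON; apply: bO_weak (h2 _); exact: ltnW.
have := lead_int d00 (fun t td => is_derive_zjet (w.-1 - i.+1) td) _ h3.
rewrite scalerA -invfM -natrM -factS; apply.
rewrite zjet0; apply: Hxi.
by rewrite -E (leq_ltn_trans (leq_subr _ _)) // prednK.
Qed.

End OneCovector.

(** In the product [Xi M Lq^T Xi^T] the terms in [A] cancel: the derivative of its entry [(a, b)] is
    $z_az_b^T-m_aC\,m_b^T$, whose leading term is $t^{w_a+w_b-2}\langle c_a,c_b\rangle$. After
    integration the leading coefficients form the matrix of [gram_det]. As [det Lq] tends to [1],
    the order passes to [det M]. *)
Lemma det_order (w : 'I_n -> nat) (Xi : 'M[R]_n) : (forall a, (0 < w a)%N) -> Xi \in unitmx ->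
  (forall a j, (j.+1 < w a)%N -> row a Xi *m (X_ j 0)^T = 0) ->
  (forall (al : 'I_n -> R) i, \sum_(a | w a == i) al a *: (row a Xi *m (X_ i.-1 0)^T) = 0 ->
     forall a, w a = i -> al a = 0) ->
  exists2 c : R, 0 < c & lead (\sum_a (2 * w a).-1) c (fun t => \det (M t)).
Proof.
move=> w0 uXi Hann Hind.
pose c a : 'rV[R]_k := ((w a).-1)`!%:R^-1 *: (row a Xi *m (X_ (w a).-1 0)^T).
pose g : 'M[R]_n := \matrix_(a, b) ((c a *m (c b)^T) 0 0 / (w a + w b).-1%:R).
have g0 : 0 < \det g.
  apply: gram_det => // al i H a wa.
  have := Hind (fun a => al a * ((w a).-1)`!%:R^-1) i.
  rewrite (eq_bigr (fun a => al a *: c a)) => [/(_ H a wa) /eqP|b /eqP wb]; last first.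
    by rewrite /c scalerA wb.
  by rewrite mulf_eq0 invr_eq0 pnatr_eq0 eqn0Ngt fact_gt0 orbF => /eqP.
pose G t := Xi *m (M t *m (Lq t)^T) *m Xi^T.
have wE a b : ((w a).-1 + (w b).-1).+1 = (w a + w b).-1.
  by rewrite -{2}(prednK (w0 a)) -{2}(prednK (w0 b)) addnS addSn.
have leadG : lead (\sum_a (2 * w a).-1) (\det g) (fun t => \det (G t)).
  apply: lead_det => // a b.
  pose f t : 'M[R]_1 := mjet (row a Xi) t *m (row b Xi *m Lq t)^T.
  have Gf t : G t a b = f t 0 0.
    rewrite /G /f /mjet trmx_mul.
    have -> : row a Xi *m M t *m ((Lq t)^T *m (row b Xi)^T) = row a (Xi *m (M t *m (Lq t)^T)) *m (row b Xi)^T.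
      by rewrite row_mul !mulmxA.
    by rewrite !mxE; apply: eq_bigr => l _; rewrite !mxE.
  apply: (lead_ext (fun t => esym (Gf t))).
  have df (t : R) : 0 <= t <= d0 -> is_derive t 1 f
     (zjet (row a Xi) 0 t *m (zjet (row b Xi) 0 t)^T - mjet (row a Xi) t *m C t *m (mjet (row b Xi) t)^T).
    move=> td.
    have d1 := is_derive_mulmx (is_derive_mjet (row a Xi) td)
      (is_derive_trmx (is_derive_mulmx (is_derive_cst (row b Xi) t 1) (HL td))).
    apply: is_derive_eq d1 _; rewrite mul0mx add0r /cst /zjet /mjet.
    have E : (row b Xi *m (- (Lq t *m (A t)^T) - M t *m C t))^T =
        - (A t *m (Lq t)^T *m (row b Xi)^T) - C t *m (M t)^T *m (row b Xi)^T.
      by rewrite trmx_mul raddfB /= raddfN /= !trmx_mul trmxK CT mulmxBl mulNmx.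
    rewrite E !trmx_mul trmxK mulmxDl mulmxBr mulmxN !mulmxA.
    by rewrite -addrA; congr (_ + _); rewrite addrA subrr sub0r.
  have f0 : f 0 = 0 by rewrite /f /mjet M0 mulmx0 mul0mx.
  have lf : lead ((w a).-1 + (w b).-1) (c a *m (c b)^T)
     (fun t => zjet (row a Xi) 0 t *m (zjet (row b Xi) 0 t)^T - mjet (row a Xi) t *m C t *m (mjet (row b Xi) t)^T).
    apply: lead_addbO.
      by apply: lead_mulmx; [|apply: lead_tr]; apply: lead_zjet => // j; exact: Hann.
    apply: bON.
    have := bO_mulmx (bO_mulmx (bO_mjet (w0 a) (Hann a)) bC) (bO_tr (bO_mjet (w0 b) (Hann b))).
    by apply: bO_weak; rewrite addn0 wE leq_pred.
  have := lead_entry 0 0 (lead_int d00 df f0 lf).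
  by rewrite wE [X in lead _ X _]mxE mulrC [g a b]mxE.
have dXi : \det Xi != 0 by move: uXi; rewrite unitmxE unitfE.
have [e e0 GE] : exists2 e : R, 0 < e & forall t, \det (G t) = e * (\det (M t) * \det (Lq t)).
  exists (\det Xi ^+ 2) => [|t]; first by rewrite exprn_even_gt0.
  by rewrite /G !det_mulmx !det_tr; ring.
exists (\det g / e); first exact: divr_gt0.
pose N := (\sum_a (2 * w a).-1)%N.
have lL : lead 0 (1 : R) (fun t => \det (Lq t)).
  rewrite -(@det1 R n) /determinant; apply: lead_sum => sg.
  rewrite -[X in lead X](addn0 0%N); apply: leadM; first exact: lead_cst.
  have E0 : (\sum_(a < n) 0 = 0)%N by rewrite big1.
  rewrite -[X in lead X]E0; apply: lead_prod => a.
  apply: lead_entry; apply: (bO_int d00 (f' := fun t => - (Lq t *m (A t)^T) - M t *m C t)).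
  - move=> t td; have := is_deriveB (HL td) (is_derive_cst (1%:M : 'M[R]_n) t 1).
    rewrite subr0 => /is_derive_ext; apply => s.
    by rewrite /= expr0 scale1r.
  - by rewrite L0 expr0 scale1r subrr.
  - apply: bOB; first apply: bON.
      exact: (bO_mulmx bO_L (bO_tr bA)).
    exact: (bO_mulmx bO_M bC).
(* Where [det Lq >= 1/2], [det M] is at most twice [det G / e]; this a priori order makes replacing
   [det Lq] by [1] cost one extra power of [t]. *)
have bdet : bO N (fun t => \det (M t)).
  have [K [d [K0 dd HG]]] := lead_bO leadG.
  have [K' [d' [K'0 d'0 HL']]] := lL.
  have d1 : 0 < (K' + 1)^-1 / 2 by rewrite divr_gt0 // invr_gt0 ltr_wpDl.
  have [r r0 [r1 r2]] := near_min2 dd d'0.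
  have [r' r'0 [r'1 r'2]] := near_min2 r0 d1.
  exists (2 * K / e), r'; split => //; first by apply: divr_ge0; [exact: mulr_ge0|exact: ltW].
  move=> t /andP[t0' tr].
  have h1 := HG t (introT andP (conj t0' (le_trans tr (le_trans r'1 r1)))); rewrite GE in h1.
  have h2 := HL' t (introT andP (conj t0' (le_trans tr (le_trans r'1 r2)))); rewrite expr0 scale1r expr1 in h2.
  have h3 : K' * t <= 2^-1.
    apply: (@le_trans _ _ ((K' + 1) * ((K' + 1)^-1 / 2))).
      by apply: ler_pM => //; [rewrite lerDl|exact: le_trans tr r'2].
    by rewrite mulrA divff ?mul1r // gt_eqF // ltr_wpDl.
  have h4 : 2^-1 <= `|\det (Lq t)|.
    apply: le_trans (ler_norm _); move: h2; rewrite ler_norml => /andP[a _]; lra.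
  move: h1; rewrite !normrM (gtr0_norm e0) -/N.
  have m0 := normr_ge0 (\det (M t)); have tN : 0 <= t ^+ N by exact: exprn_ge0.
  move: m0 h4; move: (`|\det (M t)|) (`|\det (Lq t)|) (t ^+ N) => m l' u m0 hl h1.
  have -> : 2 * K / e * u = e^-1 * (2 * (K * u)) by ring.
  rewrite ler_pdivlMl //.
  have : e * (m * 2^-1) <= e * (m * l').
    by rewrite ler_pM2l //; apply: ler_wpM2l.
  lra.
have h1 := bOZ bdet lL.
have bE : bO N.+1 (fun t => \det (M t) * (\det (Lq t) - 1)).
  by move: h1; rewrite addn1; apply: bO_ext => t; rewrite expr0 scale1r.
have bF : bO N.+1 (fun t => e^-1 * (\det (G t) - t ^+ N * \det g)).
  by have := bOZ (bO_cst (e^-1)) leadG; rewrite add0n; apply: bO_ext => t.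
apply: bO_ext (bOB bF bE) => t; rewrite GE /GRing.scale /=.
by field; rewrite gt_eqF.
Qed.

End Order.

(** * Second-order expansions of scalar functions at the right of zero *)

Section OneVar.
Context {R : realType}.

Lemma is_derive_inv (f : R -> R) (t df : R) : is_derive t 1 f df -> f t != 0 ->
  is_derive t 1 (fun u => (f u)^-1) (- (f t) ^- 2 * df).
Proof.
move=> [d1 d2] f0; apply: DeriveDef; first exact: derivableV.
by rewrite deriveV // d2.
Qed.

Lemma smoothV (I : set R) (f : R -> R) : open I -> smooth I f ->
  (forall t, I t -> f t != 0) -> smooth I (fun t => (f t)^-1).
Proof.
move=> oI sf f0.
apply: (@is_derive_smooth1 _ I (fun g => exists2 h : R -> R, smooth I h & exists p : nat, g = fun t => h t * (f t)^-1 ^+ p)) => //; last first.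
  exists (cst 1); first exact: (smooth_cst (1 : R) oI).
  by exists 1%N; apply/funext => t; rewrite mul1r expr1.
move=> _ [h sh [p ->]].
pose h' t := 'D_1 h t * f t - p%:R * 'D_1 f t * h t.
exists (fun t => h' t * (f t)^-1 ^+ p.+1).
  exists h'; last by exists p.+1.
  apply: smoothB => //; first by apply: smoothM => //; exact: smooth_derive.
  apply: smoothM => //; apply: smoothM => //; first exact: (smooth_cst (p%:R : R) oI).
  exact: smooth_derive.
move=> t It; have ft := f0 t It.
have dp : is_derive t 1 (fun u => (f u)^-1 ^+ p) (- (p%:R * 'D_1 f t * (f t)^-1 ^+ p.+1)).
  elim: p {h'} => [|p IH].
    by rewrite !mul0r oppr0; apply: is_derive_ext (is_derive_cst (1 : R) t 1) _ => u; rewrite expr0.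
  have := is_deriveM' (is_derive_inv (smoothP sf It) ft) IH.
  move=> /is_derive_eq H; apply: is_derive_ext (H _ _) _ => [|u]; last by rewrite exprS.
  rewrite !exprS -natr1 exprVn; field; by rewrite ft expf_neq0.
have := is_deriveM' (smoothP sh It) dp => /is_derive_eq; apply.
rewrite /h' exprS; by field.
Qed.

Lemma Rint_FTC (F f : R -> R) (t : R) : 0 <= t ->
  (forall s : R, 0 <= s <= t -> is_derive s 1 F (f s)) ->
  {within `[0, t], continuous f} ->
  \int[lebesgue_measure]_(s in `[0, t]) f s = F t - F 0.
Proof.
rewrite le_eqVlt => /predU1P[<- _ _|t0 HF cf].
  by rewrite set_itv1 Rintegral_set1 subrr.
have c0 : {for 0, continuous F}.
  have h : 0 <= (0 : R) <= t by rewrite lexx ltW.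
  exact: is_derive_cont (HF 0 h).
have ct : {for t, continuous F}.
  have h : 0 <= t <= t by rewrite lexx ltW.
  exact: is_derive_cont (HF t h).
have D : derivable_oo_LRcontinuous F 0 t.
  split; [|exact: cvg_at_right_filter|exact: cvg_at_left_filter].
  move=> s; rewrite in_itv /= => /andP[s0 st].
  have h : 0 <= s <= t by rewrite !ltW.
  by have [] := HF s h.
rewrite /Rintegral (@continuous_FTC2 _ f F 0 t) // => s.
rewrite in_itv /= => /andP[s0 st]; rewrite derive1E.
have h : 0 <= s <= t by rewrite !ltW.
by have [] := HF s h.
Qed.

(** Order [p] on a right neighbourhood with [0] excluded, which admits quotients by powers of
    [t]. *)
Definition b3 (p : nat) (f : R -> R) : Prop :=
  exists K d : R, [/\ 0 <= K, 0 < d & forall t, 0 < t <= d -> `|f t| <= K * t ^+ p].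

Lemma bO_b3 p (f : R -> R) : bO p f -> b3 p f.
Proof. by move=> [K [d [K0 d0 H]]]; exists K, d; split => // t /andP[/ltW t0 td]; apply: H; rewrite t0. Qed.

Lemma b3_ext_near p (f g : R -> R) d0 : 0 < d0 ->
  (forall t, 0 < t <= d0 -> f t = g t) -> b3 p f -> b3 p g.
Proof.
move=> d00 E [K [d [K0 dd H]]]; have [d' d'0 [h1 h2]] := near_min2 dd d00.
exists K, d'; split => // t /andP[t0 td]; rewrite -E ?t0 ?(le_trans td) //.
by apply: H; rewrite t0 (le_trans td).
Qed.

Lemma b3_ext p (f g : R -> R) : (forall t, 0 < t -> f t = g t) -> b3 p f -> b3 p g.
Proof. by move=> E; apply: (@b3_ext_near _ _ _ 1) => // t /andP[t0 _]; exact: E. Qed.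

Lemma b3_weak p q (f : R -> R) : (p <= q)%N -> b3 q f -> b3 p f.
Proof.
move=> pq [K [d [K0 d0 H]]]; have [d' d'0 [h1 h2]] := near_min2 d0 (@ltr01 R).
exists K, d'; split => // t /andP[t0 td]; apply: (le_trans (H t _)); first by rewrite t0 (le_trans td).
by apply: ler_wpM2l => //; apply: ler_wiXn2l => //; [exact: ltW|exact: le_trans td h2].
Qed.

Lemma b3D p (f g : R -> R) : b3 p f -> b3 p g -> b3 p (fun t => f t + g t).
Proof.
move=> [K [d [K0 d0 H]]] [K' [d' [K'0 d'0 H']]].
have [e e0 [h1 h2]] := near_min2 d0 d'0.
exists (K + K'), e; split => //; first exact: addr_ge0.
move=> t /andP[t0 te]; apply: (le_trans (ler_normD _ _)); rewrite mulrDl.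
by apply: lerD; [apply: H|apply: H']; rewrite t0 (le_trans te).
Qed.

Lemma b3M p q (f g : R -> R) : b3 p f -> b3 q g -> b3 (p + q) (fun t => f t * g t).
Proof.
move=> [K [d [K0 d0 H]]] [K' [d' [K'0 d'0 H']]].
have [e e0 [h1 h2]] := near_min2 d0 d'0.
exists (K * K'), e; split => //; first exact: mulr_ge0.
move=> t /andP[t0 te]; rewrite normrM exprD mulrACA.
by apply: ler_pM => //; [apply: H|apply: H']; rewrite t0 (le_trans te).
Qed.

Lemma b3_cst (c : R) : b3 0 (fun=> c).
Proof. by exists `|c|, 1; split => // t _; rewrite expr0 mulr1. Qed.

Lemma b3_pow p : b3 p (fun t : R => t ^+ p).
Proof. by exists 1, 1; split => // t /andP[/ltW t0 _]; rewrite mul1r normrX ger0_norm. Qed.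

(* second-order expansions as [t -> 0+] *)
Definition ex2 (f : R -> R) (c0 c1 c2 : R) : Prop :=
  b3 3 (fun t => f t - (c0 + c1 * t + c2 * t ^+ 2)).

Lemma ex2_b3 f c0 c1 c2 : ex2 f c0 c1 c2 -> b3 0 f.
Proof.
move=> /(b3_weak (leq0n 3)) H.
have h1 : b3 0 (fun t : R => c1 * t).
  by apply: (@b3_weak _ 1) => //; have := b3M (b3_cst c1) (b3_pow 1); apply: b3_ext => t _.
have h2 : b3 0 (fun t : R => c2 * t ^+ 2).
  by apply: (@b3_weak _ 2) => //; have := b3M (b3_cst c2) (b3_pow 2); apply: b3_ext => t _.
by apply: b3_ext (b3D H (b3D (b3D (b3_cst c0) h1) h2)) => t _; rewrite subrK.
Qed.

Lemma ex2D f g a0 a1 a2 b0 b1 b2 : ex2 f a0 a1 a2 -> ex2 g b0 b1 b2 ->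
  ex2 (fun t => f t + g t) (a0 + b0) (a1 + b1) (a2 + b2).
Proof. by move=> Hf Hg; apply: b3_ext (b3D Hf Hg) => t _; ring. Qed.

Lemma ex2M f g a0 a1 a2 c0 c1 c2 : ex2 f a0 a1 a2 -> ex2 g c0 c1 c2 ->
  ex2 (fun t => f t * g t) (a0 * c0) (a0 * c1 + a1 * c0) (a0 * c2 + a1 * c1 + a2 * c0).
Proof.
move=> Hf Hg.
have h1 : b3 3 _ := b3M Hf (ex2_b3 Hg).
have P1 : b3 0 (fun t : R => a0 + a1 * t + a2 * t ^+ 2).
  by apply: (@ex2_b3 _ a0 a1 a2); exists 0, 1; split => // t _; rewrite subrr normr0 mul0r.
have h2 : b3 3 _ := b3M P1 Hg.
have h3 := b3M (b3D (b3_cst (a1 * c2 + a2 * c1)) (b3_weak (leq0n 1) (b3M (b3_cst (a2 * c2)) (b3_pow 1)))) (b3_pow 3).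
by apply: b3_ext (b3D (b3D h1 h2) h3) => t _; ring.
Qed.

Lemma small_eq0 (K d e : R) : 0 <= K -> 0 < d -> (forall t, 0 < t <= d -> `|e| <= K * t) -> e = 0.
Proof.
move=> K0 dd H; apply/eqP; rewrite -normr_le0; apply/ler_addgt0Pl => x x0; rewrite addr0.
have K1 : 0 < K + 1 by rewrite ltr_wpDl.
have [t t0 [td tx]] := near_min2 dd (divr_gt0 x0 K1).
apply: (le_trans (H t _)); first by rewrite t0.
have : (K + 1) * t <= x by rewrite mulrC -ler_pdivlMr.
by nra.
Qed.

Lemma ex2_unique f c0 c1 c2 d0 d1 d2 : ex2 f c0 c1 c2 -> ex2 f d0 d1 d2 ->
  [/\ c0 = d0, c1 = d1 & c2 = d2].
Proof.
move=> H1 H2.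
have [K [d [K0 dd H]]] : b3 3 (fun t => (c0 - d0) + (c1 - d1) * t + (c2 - d2) * t ^+ 2).
  by apply: b3_ext (b3D H2 (b3M (b3_cst (-1)) H1)) => t _; ring.
have [r r0 [rd r1]] := near_min2 dd (@ltr01 R).
have E0 : c0 - d0 = 0.
  apply: (@small_eq0 (K + `|c1 - d1| + `|c2 - d2|) r) => //; first by rewrite !addr_ge0.
  move=> t /andP[t0 tr]; have := H t; rewrite t0 (le_trans tr rd) => /(_ isT) h.
  have t1 : t <= 1 by exact: le_trans tr r1.
  have tp m : (0 < m)%N -> t ^+ m <= t.
    by move=> m0; rewrite -[leRHS]expr1; apply: ler_wiXn2l => //; exact: ltW.
  have -> : c0 - d0 = (c0 - d0 + (c1 - d1) * t + (c2 - d2) * t ^+ 2) - ((c1 - d1) * t + (c2 - d2) * t ^+ 2) by ring.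
  apply: (le_trans (ler_normB _ _)).
  have h1 := ler_wpM2l K0 (tp 3%N isT).
  have h2 := ler_wpM2l (normr_ge0 (c2 - d2)) (tp 2%N isT).
  have h3 := ler_normD ((c1 - d1) * t) ((c2 - d2) * t ^+ 2).
  rewrite !normrM (gtr0_norm t0) in h3.
  apply: (le_trans (lerD h h3)).
  have -> : (K + `|c1 - d1| + `|c2 - d2|) * t = K * t + (`|c1 - d1| * t + `|c2 - d2| * t) by ring.
  by apply: lerD => //; rewrite lerD2l; exact: h2.
have E1 : c1 - d1 = 0.
  apply: (@small_eq0 (K + `|c2 - d2|) r) => //; first by rewrite !addr_ge0.
  move=> t /andP[t0 tr]; have := H t; rewrite t0 (le_trans tr rd) E0 add0r => /(_ isT) h.
  have t1 : t <= 1 by exact: le_trans tr r1.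
  have h' : `|(c1 - d1) + (c2 - d2) * t| <= K * t ^+ 2.
    move: h; have -> : (c1 - d1) * t + (c2 - d2) * t ^+ 2 = ((c1 - d1) + (c2 - d2) * t) * t by ring.
    by rewrite normrM (gtr0_norm t0) exprSr mulrA ler_pM2r.
  have -> : c1 - d1 = (c1 - d1 + (c2 - d2) * t) - (c2 - d2) * t by ring.
  apply: (le_trans (ler_normB _ _)).
  have -> : (K + `|c2 - d2|) * t = K * t + `|c2 - d2| * t by ring.
  rewrite [`|(c2 - d2) * t|]normrM (gtr0_norm t0) lerD2r.
  apply: (le_trans h'); apply: ler_wpM2l => //.
  by rewrite -[leRHS]expr1; apply: ler_wiXn2l => //; exact: ltW.
have E2 : c2 - d2 = 0.
  apply: (@small_eq0 K r) => //.
  move=> t /andP[t0 tr]; have := H t; rewrite t0 (le_trans tr rd) E0 E1 mul0r !add0r => /(_ isT).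
  rewrite normrM normrX (gtr0_norm t0).
  have -> : K * t ^+ 3 = K * t * t ^+ 2 by ring.
  by rewrite ler_pM2r // exprn_gt0.
by split; apply/eqP; rewrite -subr_eq0 ?E0 ?E1 ?E2.
Qed.

Lemma taylor_ex2 (I : set R) (f : R -> R) (s : R) : open I -> smooth I f -> I s ->
  ex2 (fun t => f (s + t)) (f s) ('D_1 f s) ('D_1 ('D_1 f) s / 2).
Proof.
move=> oI sf Is; have [r [K [r0 K0 H]]] := taylor 3 oI sf Is.
exists K, r; split => // t /andP[t0 tr]; have := H t; rewrite gtr0_norm // => /(_ tr).
by rewrite !big_ord_recl big_ord0 /= !expr0 !expr1 !divr1 mulr1 addr0 addrA.
Qed.

(* uniqueness of Taylor coefficients below order [p] *)
Lemma poly_bO_eq0 p (al : nat -> R) : b3 p (fun t => \sum_(j < p) al j * t ^+ j) ->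
  forall j, (j < p)%N -> al j = 0.
Proof.
elim: p al => [//|p IH] al H.
have h1 : b3 0 (fun t => \sum_(j < p) al j.+1 * t ^+ j).
  elim: (p) => [|q IHq]; first by exists 0, 1; split => // t _; rewrite big_ord0 normr0 mul0r.
  have h2 : b3 0 (fun t : R => al q.+1 * t ^+ q).
    by apply: (@b3_weak _ q) => //; exact: (b3M (b3_cst _) (b3_pow q)).
  by apply: b3_ext (b3D IHq h2) => t _; rewrite big_ord_recr.
have a0 : al 0%N = 0.
  have h3 := b3D (b3_weak (isT : (1 <= p.+1)%N) H) (b3M (b3_cst (-1)) (b3M (b3_pow 1) h1)).
  have [K [d [K0 dd h]]] : b3 1 (fun=> al 0%N).
    apply: b3_ext h3 => t _; rewrite big_ord_recl /= expr0 mulr1.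
    under [X in _ + X + _]eq_bigr => j _ do rewrite /bump /= add1n exprS mulrCA.
    by rewrite -mulr_sumr; ring.
  by apply: (small_eq0 K0 dd) => t td; have := h t td; rewrite expr1.
case=> [//|j]; rewrite ltnS => jp; apply: (IH (fun j => al j.+1)) => //.
have [K [d [K0 dd h]]] := H.
exists K, d; split => // t /andP[t0 td]; have := h t; rewrite t0 td => /(_ isT).
rewrite big_ord_recl /= a0 mul0r add0r.
under eq_bigr => i _ do rewrite /bump /= add1n exprS mulrCA.
by rewrite -mulr_sumr normrM (gtr0_norm t0) exprS mulrCA ler_pM2l.
Qed.

End OneVar.

(** * From the two-point determinant to the asymptotic formula *)

Section Asymp.
Context {R : realType}.

Lemma dn_sumM (I : set R) (L : Type) (s : seq L) (phi : L -> R -> R) (c : L -> R) j : open I ->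
  (forall l, smooth I (phi l)) ->
  forall t, I t -> dn j (fun u => \sum_(l <- s) phi l u * c l) t = \sum_(l <- s) dn j (phi l) t * c l.
Proof.
move=> oI; elim: j phi => [//|j IH] phi sphi t It.
rewrite dnS.
have -> : \sum_(l <- s) dn j.+1 (phi l) t * c l = \sum_(l <- s) dn j ('D_1 (phi l)) t * c l.
  by apply: eq_bigr => l _; rewrite dnS.
rewrite -IH //; last by move=> l; exact: smooth_derive.
have E u : I u -> 'D_1 (fun u => \sum_(l <- s) phi l u * c l) u = \sum_(l <- s) 'D_1 (phi l) u * c l.
  move=> Iu.
  have [] // := @derive_sum_seq R L s (fun l u => phi l u * c l) (fun l => 'D_1 (phi l) u * c l) u.
  move=> l; have := is_deriveM' (smoothP (sphi l) Iu) (is_derive_cst (c l) u 1).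
  by rewrite mulr0 addr0.
have dn_ext i (f g : R -> R) : (forall u, I u -> f u = g u) -> forall u, I u -> dn i f u = dn i g u.
  elim: i f g => [|i IHi] f g fg u Iu; first by rewrite /dn /= fg.
  rewrite !dnS; apply: IHi => // v Iv; apply: near_eq_derive.
  have nI : nbhs v I by apply: open_nbhs_nbhs.
  by apply: filterS nI => x Ix; rewrite fg.
exact: dn_ext.
Qed.

Lemma open_absball (d : R) : open [set t : R | `|t| < d].
Proof.
rewrite openE => t /= td.
suff : \forall w \near t, `|w| < d by [].
apply/nbhs_eps; exists ((d - `|t|) / 2); first by rewrite divr_gt0 ?subr_gt0.
move=> w wt /=; have := ler_normD (w - t) t; rewrite subrK; lra.
Qed.

(** A two-sided first-order expansion with quadratic error: just enough to differentiate at [0] a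
    function that is extended there by its limit. *)
Definition e1 (f : R -> R) (c0 c1 : R) : Prop :=
  exists r K : R, [/\ 0 < r, 0 <= K & forall t, `|t| <= r -> `|f t - (c0 + c1 * t)| <= K * `|t| ^+ 2].

Lemma e1M f g a0 a1 c0 c1 : e1 f a0 a1 -> e1 g c0 c1 ->
  e1 (fun t => f t * g t) (a0 * c0) (a0 * c1 + a1 * c0).
Proof.
move=> [r [K [r0 K0 H]]] [r' [K' [r'0 K'0 H']]].
have [d d0 [h1 h2]] := near_min2 r0 r'0.
have [e ee [h3 h4]] := near_min2 d0 (@ltr01 R).
pose C := K * (`|c0| + `|c1| + K') + (`|a0| + `|a1|) * K' + `|a1 * c1|.
exists e, C; split => //; first by rewrite /C !addr_ge0 // mulr_ge0 // !addr_ge0.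
move=> t te.
have F := H t (le_trans te (le_trans h3 h1)); have G := H' t (le_trans te (le_trans h3 h2)).
have t1 : `|t| <= 1 := le_trans te h4.
have t2 : `|t| ^+ 2 <= 1 by rewrite -[leRHS](expr1n _ 2); apply: lerXn2r; rewrite ?nnegrE.
have T0 : 0 <= `|t| ^+ 2 by rewrite exprn_ge0.
have lin (b0 b1 : R) : `|b0 + b1 * t| <= `|b0| + `|b1|.
  apply: (le_trans (ler_normD _ _)); rewrite lerD2l normrM.
  by rewrite -[leRHS]mulr1; apply: ler_wpM2l.
have gb : `|g t| <= `|c0| + `|c1| + K'.
  have -> : g t = (c0 + c1 * t) + (g t - (c0 + c1 * t)) by ring.
  apply: (le_trans (ler_normD _ _)); apply: lerD; first exact: lin.
  apply: (le_trans G); rewrite -[leRHS]mulr1; exact: ler_wpM2l.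
have -> : f t * g t - (a0 * c0 + (a0 * c1 + a1 * c0) * t) =
  (f t - (a0 + a1 * t)) * g t + (a0 + a1 * t) * (g t - (c0 + c1 * t)) + a1 * c1 * t ^+ 2 by ring.
apply: (le_trans (ler_normD _ _)); rewrite /C [leRHS]mulrDl; apply: lerD; last first.
  by rewrite [leLHS]normrM normrX.
apply: (le_trans (ler_normD _ _)); rewrite [leRHS]mulrDl !normrM; apply: lerD.
  by rewrite mulrAC; apply: ler_pM.
by rewrite -mulrA; apply: ler_pM.
Qed.

Lemma e1_cst c : e1 (fun=> c) c 0.
Proof. by exists 1, 0; split => // t _; rewrite mul0r addr0 subrr normr0 mul0r. Qed.

Lemma e1_is_derive (f : R -> R) (c1 : R) : e1 f (f 0) c1 -> is_derive (0 : R) 1 f c1.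
Proof.
move=> [r [K [r0 K0 H]]].
have C : (fun h : R => h^-1 *: ((f \o shift 0) (h *: (1 : R)) - f 0)) @ 0^' --> c1.
  apply/cvgrPdist_le => e e0.
  have K1 : 0 < K + 1 by rewrite ltr_wpDl.
  have [d d0 [h1 h2]] := near_min2 r0 (divr_gt0 e0 K1).
  have D : \forall t \near (0 : R), t != 0 -> `|c1 - t^-1 *: ((f \o shift 0) (t *: (1 : R)) - f 0)| <= e.
    apply/nbhs_eps; exists d => // t; rewrite subr0 => td tn0 /=.
    rewrite [t *: 1]mulr1 addr0.
    have ht := H t (le_trans td h1).
    have nt : 0 < `|t| by rewrite normr_gt0.
    have -> : c1 - t^-1 *: (f t - f 0) = - (t^-1 * (f t - (f 0 + c1 * t))).
      by rewrite /GRing.scale /=; field.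
    rewrite normrN normrM normfV ler_pdivrMl //.
    apply: (le_trans ht); rewrite expr2 mulrA mulrC; apply: ler_wpM2l => //.
    apply: (@le_trans _ _ ((K + 1) * d)).
      by apply: ler_pM => //; rewrite lerDl.
    by rewrite mulrC -ler_pdivlMr.
  by move: D; rewrite near_withinE.
apply: DeriveDef; first by apply/cvg_ex; exists c1.
by apply/cvg_lim.
Qed.

Lemma is_derive_comp1 (f g : R -> R) (t df dg : R) : is_derive (g t) 1 f df ->
  is_derive t 1 g dg -> is_derive t 1 (f \o g) (dg * df).
Proof.
move=> Hf Hg.
have dF : differentiable f (g t) by apply/derivable1_diffP; have [] := Hf.
have := is_derive_diff_comp dF Hg; rewrite -deriveE //.
by have [_ ->] := is_derive_dir dg Hf.
Qed.

Lemma ex2_cst (c : R) : ex2 (fun=> c) c 0 0.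
Proof. by exists 0, 1; split => // t _; rewrite !mul0r !addr0 subrr normr0. Qed.

Section Main.
Variables (I : set R) (L : Type) (ls : seq L) (phi psi : L -> R -> R) (mm : R -> R) (N : nat) (eps : R).
Hypotheses (oI : open I) (eps0 : 0 < eps) (Ieps : forall t : R, `|t| <= eps -> I t).
Hypotheses (sphi : forall l, smooth I (phi l)) (spsi : forall l, smooth I (psi l)).
Hypotheses (smm : smooth I mm) (mm0 : forall t, I t -> mm t != 0).

(** Separated form of the two-point determinant $D(s,t)$: Taylor expansion in [t] and
    differentiation in [s] act on different factors, so one-variable calculus suffices. *)
Definition DD s t := \sum_(l <- ls) phi l t * psi l s.

Hypothesis ord : forall s, 0 <= s < eps -> exists2 c : R, 0 < c & lead N c (fun t => DD s (s + t)).

(** The Taylor coefficient of order [j] of [t |-> DD s (s + t)] at [t = 0], as a smooth function of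
    [s]. *)
Definition alpha j s := (\sum_(l <- ls) dn j (phi l) s * psi l s) / j`!%:R.

Lemma smooth_alpha j : smooth I (alpha j).
Proof.
apply: smoothM => //; last exact: (smooth_cst (_ : R) oI).
by apply: smooth_sum => // l; apply: smoothM => //; exact: smooth_dn.
Qed.

Lemma DD_smooth s : smooth I (DD s).
Proof.
by apply: smooth_sum => // l; apply: smoothM => //; exact: (smooth_cst (_ : R) oI).
Qed.

Lemma Is s : 0 <= s < eps -> I s.
Proof. by move=> /andP[s0 se]; apply: Ieps; rewrite ger0_norm // ltW. Qed.

Lemma DD_taylor s m : I s -> exists r K : R, [/\ 0 < r, 0 <= K & forall t, `|t| <= r ->
    `|DD s (s + t) - \sum_(j < m) alpha j s * t ^+ j| <= K * `|t| ^+ m].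
Proof.
move=> h; have [r [K [r0 K0 H]]] := taylor m oI (DD_smooth s) h.
exists r, K; split => // t tr; have := H t tr.
rewrite (eq_bigr (fun j : 'I_m => alpha j s * t ^+ j)) // => j _.
by rewrite /alpha (dn_sumM ls (fun l => psi l s) j oI sphi h).
Qed.

Lemma alpha_lt s j : 0 <= s < eps -> (j < N)%N -> alpha j s = 0.
Proof.
move=> hs; apply: (@poly_bO_eq0 R N (fun j => alpha j s)).
have [r [K [r0 K0 H]]] := DD_taylor N (Is hs).
have h1 : b3 N (fun t => DD s (s + t) - \sum_(j < N) alpha j s * t ^+ j).
  by exists K, r; split => // t /andP[t0 tr]; have := H t; rewrite gtr0_norm //; apply.
have [c c0 hc] := ord hs.
apply: b3_ext (b3D (bO_b3 (lead_bO hc)) (b3M (b3_cst (-1)) h1)) => t _.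
by rewrite mulN1r opprB addrC subrK.
Qed.

Lemma alpha_N s : 0 <= s < eps -> 0 < alpha N s.
Proof.
move=> hs; have [c c0 hc] := ord hs; suff -> : alpha N s = c by [].
have [r [K [r0 K0 H]]] := DD_taylor N.+1 (Is hs).
have h1 : b3 N.+1 (fun t => DD s (s + t) - \sum_(j < N.+1) alpha j s * t ^+ j).
  by exists K, r; split => // t /andP[t0 tr]; have := H t; rewrite gtr0_norm //; apply.
have [K' [d [K'0 d0 h]]] := b3D (bO_b3 hc) (b3M (b3_cst (-1)) h1).
apply/eqP; rewrite -subr_eq0; apply/eqP.
apply: (small_eq0 K'0 d0) => t /andP[t0 td].
have := h t; rewrite t0 td big_ord_recr /= big1 => [/(_ isT)|i _]; last first.
  by rewrite (alpha_lt hs (ltn_ord i)) mul0r.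
have -> : DD s (s + t) - t ^+ N *: c + - 1 * (DD s (s + t) - (0 + alpha N s * t ^+ N)) =
   (alpha N s - c) * t ^+ N by rewrite /GRing.scale /=; ring.
by rewrite normrM normrX (gtr0_norm t0) exprS mulrA ler_pM2r ?exprn_gt0.
Qed.

Lemma DD_expand s : 0 <= s < eps -> exists r K : R, [/\ 0 < r, 0 <= K & forall t, `|t| <= r ->
  `|DD s (s + t) - t ^+ N * (alpha N s + alpha N.+1 s * t + alpha N.+2 s * t ^+ 2)| <= K * `|t| ^+ N.+3].
Proof.
move=> hs; have [r [K [r0 K0 H]]] := DD_taylor N.+3 (Is hs).
exists r, K; split => // t tr; have := H t tr.
rewrite !big_ord_recr /= big1 => [|i _]; last by rewrite (alpha_lt hs (ltn_ord i)) mul0r.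
rewrite add0r; congr (`| _ - _ | <= _); rewrite !exprS; ring.
Qed.

Definition rhot s := alpha N.+1 s / alpha N s + 'D_1 mm s / mm s.

(** The quotient [t^-N DD s (s + t)], given the value [alpha N s] at [0], is differentiable there
    with derivative [alpha N.+1 s]. The constant factor [mm s] disappears in the logarithmic
    derivative. *)
Lemma rho_formula s (g : R -> R) : 0 <= s < eps ->
  (\forall t \near (0 : R), g t = ln (t ^- N * (mm (s + t) * DD s (s + t) * mm s))) ->
  derive1 (fun t => if t == 0 then lim (g u @[u --> 0^']) else g t) 0 = rhot s.
Proof.
move=> hs Hg.
have a0 := alpha_N hs; have h := Is hs; have m0 := mm0 h.
pose p t := if t == 0 then alpha N s else t ^- N * DD s (s + t).
pose G t := mm (s + t) * p t * mm s.
have G0 : 0 < G 0.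
  by rewrite /G /p eqxx addr0 mulrAC -expr2 mulr_gt0 // exprn_even_gt0.
have dG : is_derive (0 : R) 1 G ((mm s * alpha N.+1 s + 'D_1 mm s * alpha N s) * mm s).
  have [r1 [K1 [r10 K10 H1]]] := DD_expand hs.
  have [r2 [K2 [r20 K20 H2]]] := taylor 2 oI smm h.
  have E1 : e1 (fun t => mm (s + t)) (mm s) ('D_1 mm s).
    exists r2, K2; split => // t /H2; rewrite !big_ord_recl big_ord0 /=.
    by rewrite !expr0 !expr1 !divr1 mulr1 addr0.
  have E2 : e1 p (alpha N s) (alpha N.+1 s).
    have [d d0 [h1 h2]] := near_min2 r10 (@ltr01 R).
    exists d, (K1 + `|alpha N.+2 s|); split => //; first exact: addr_ge0.
    move=> t td; rewrite /p; case: eqP => [->|/eqP tn0].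
      by rewrite mulr0 addr0 subrr normr0 mulr_ge0 ?addr_ge0.
    have ht := H1 t (le_trans td h1).
    have nt : 0 < `|t| ^+ N by rewrite exprn_gt0 // normr_gt0.
    have tN : t ^+ N != 0 by rewrite expf_neq0.
    have -> : t ^- N * DD s (s + t) - (alpha N s + alpha N.+1 s * t) =
      t ^- N * (DD s (s + t) - t ^+ N * (alpha N s + alpha N.+1 s * t + alpha N.+2 s * t ^+ 2)) + alpha N.+2 s * t ^+ 2.
      by field.
    apply: (le_trans (ler_normD _ _)); rewrite mulrDl; apply: lerD; last by rewrite normrM normrX.
    rewrite normrM normfV normrX ler_pdivrMl //; apply: (le_trans ht).
    have -> : `|t| ^+ N * (K1 * `|t| ^+ 2) = K1 * `|t| ^+ N.+2 by rewrite !exprS; ring.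
    apply: ler_wpM2l => //; apply: ler_wiXn2l => //; exact: le_trans td h2.
  have := e1M (e1M E1 E2) (e1_cst (mm s)); rewrite mulr0 add0r => E.
  by apply: e1_is_derive; rewrite {2}/G /p eqxx addr0.
have dlnG : is_derive (0 : R) 1 (@ln R \o G) (rhot s).
  have := is_derive_comp1 (is_derive1_ln G0) dG => /is_derive_eq; apply.
  rewrite /G /p eqxx addr0 /rhot; field; by rewrite m0 gt_eqF.
have near_g : \forall t \near (0 : R), t != 0 -> g t = (@ln R \o G) t.
  apply: filterS Hg => t -> tn0 /=; congr (ln _).
  by rewrite /G /p (negPf tn0); ring.
have lim_g : lim (g u @[u --> 0^']) = ln (G 0).
  apply/cvg_lim => //.
  have cG : (@ln R \o G) u @[u --> 0^'] --> (@ln R \o G) 0.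
    by apply: cvg_within_filter; exact: (is_derive_cont dlnG).
  apply: cvg_trans cG; apply: near_eq_cvg; rewrite near_withinE.
  by apply: filterS near_g => t ht tn0; rewrite ht.
rewrite derive1E; have [_ <-] := dlnG; apply: near_eq_derive.
apply: filterS near_g => t; case: eqP => [-> _|_ /(_ isT)] //.
Qed.

(** The derivative of [rhot] at [0], written out by the quotient rule. *)
Definition rho1 :=
  ('D_1 (alpha N.+1) 0 * alpha N 0 - alpha N.+1 0 * 'D_1 (alpha N) 0) / (alpha N 0) ^+ 2 +
  ('D_1 ('D_1 mm) 0 * mm 0 - ('D_1 mm 0) ^+ 2) / (mm 0) ^+ 2.

(** [P] is a primitive of [rhot], so its expansion uses [rhot 0] and the derivative [rho1]. The
    statement quantifies over [rho] afterwards, since the actual density derivative is known to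
    agree with [rhot] only on [[0, eps)]. *)
Lemma rho_integral : exists (P : R -> R) (d : R), [/\ 0 < d, d < eps,
  forall (rho : R -> R) (t : R), (forall s, 0 <= s < eps -> rho s = rhot s) -> 0 <= t <= d ->
   \int[lebesgue_measure]_(s in `[0, t]) rho s = P t &
  ex2 P 0 (rhot 0) (rho1 / 2)].
Proof.
have h0 : 0 <= (0 : R) < eps by rewrite lexx.
have I0 := Is h0; have a0 := alpha_N h0; have m00 := mm0 I0.
have a2 : 0 < alpha N 0 / 2 by rewrite divr_gt0.
have [d1 d10 H1] := (cont_epsP _ _).1 (smooth_cont (smooth_alpha N) I0) _ a2.
have [d d0 [dd1 de]] := near_min2 d10 eps0.
pose J : set R := [set t | `|t| < d].
have oJ : open J.
  exact: open_absball.
have JI : J `<=` I by move=> t /= td; apply: Ieps; exact: ltW (lt_le_trans td de).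
have aJ t : J t -> alpha N t != 0.
  move=> /= td; have := H1 t; rewrite subr0 => /(_ (le_trans (ltW td) dd1)).
  by rewrite ler_norml => /andP[h _]; rewrite gt_eqF //; lra.
have sr : smooth J rhot.
  apply: smoothD => //; apply: smoothM => //.
  - exact: smooth_sub (smooth_alpha _).
  - by apply: smoothV => //; exact: smooth_sub (smooth_alpha _).
  - by apply: smooth_derive; exact: smooth_sub smm.
  - by apply: smoothV => // [|t /JI /mm0 //]; exact: smooth_sub smm.
have d20 : 0 < d / 2 by rewrite divr_gt0.
have d2d : d / 2 < d by lra.
have cf : continuous (rhot \o clamp (d / 2)).
  move=> t; apply: continuous_comp.
    by apply/cont_epsP => e ee; exists e => // w wt; exact: le_trans (clamp_lip _ _ _) wt.
  apply: (smooth_cont sr); rewrite /J /=.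
  by apply: le_lt_trans d2d; apply: clamp_norm; exact: ltW.
have [P [P0 HP]] := primitive d20 cf.
pose J2 : set R := [set t | `|t| < d / 2].
have oJ2 : open J2.
  exact: open_absball.
have dP t : J2 t -> is_derive t 1 P (rhot t).
  by move=> /= td; have := HP t td; rewrite /= clamp_id // ltW.
have sP : smooth J2 P.
  apply: (@is_derive_smooth1 R J2 (fun g => g = P \/ smooth J2 g)) => //; last by left.
  have J2J : J2 `<=` J by move=> t /= td; exact: lt_trans td d2d.
  move=> g [->|sg]; first by exists rhot => //; right; exact: smooth_sub sr.
  exists ('D_1 g); first by right; exact: smooth_derive.
  by move=> t Jt; exact: smoothP sg Jt.
have J20 : J2 0 by rewrite /J2 /= normr0.
have J0 : J 0 by rewrite /J /= normr0.
exists P, (d / 4); split; first by rewrite divr_gt0.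
- by apply: lt_le_trans de; lra.
- move=> rho t Hr /andP[t0 td].
  have E : {in `[0, t]%classic, rho =1 rhot}.
    move=> s; rewrite inE /= in_itv /= => /andP[s0 st]; apply: Hr.
    by rewrite s0 (le_lt_trans st) // (le_lt_trans td) //; apply: lt_le_trans de; lra.
  transitivity (\int[lebesgue_measure]_(s in `[0, t]) rhot s)%R; first exact: eq_Rintegral.
  have HP1 (s : R) : 0 <= s <= t -> is_derive s 1 P (rhot s).
    move=> /andP[s0 st]; apply: dP; rewrite /J2 /= ger0_norm //.
    by apply: (le_lt_trans st); apply: (le_lt_trans td); lra.
  have HP2 : {within `[0, t], continuous rhot}.
    apply: (@is_derive_within R R^o rhot ('D_1 rhot)) => s /andP[s0 st].
    apply: smoothP sr _; rewrite /J /= ger0_norm //.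
    by apply: (le_lt_trans st); apply: (le_lt_trans td); lra.
  by rewrite (Rint_FTC t0 HP1 HP2) P0 subr0.
have := taylor_ex2 oJ2 sP J20.
have E1 : 'D_1 P 0 = rhot 0 by have [] := dP 0 J20.
have E2 : 'D_1 ('D_1 P) 0 = rho1.
  have -> : 'D_1 ('D_1 P) 0 = 'D_1 rhot 0.
    apply: near_eq_derive; have nJ : nbhs (0 : R) J2 by apply: open_nbhs_nbhs.
    by apply: filterS nJ => t Jt; have [] := dP t Jt.
  have dA j := smoothP (smooth_alpha j) I0.
  have dm := smoothP smm I0.
  have dm' := smoothP (smooth_derive (1 : R) smm) I0.
  have aN0 : alpha N 0 != 0 by rewrite gt_eqF.
  have [_ ->] : is_derive (0 : R) 1 rhot rho1; last by [].
  have := is_deriveD (is_deriveM' (dA N.+1) (is_derive_inv (dA N) aN0)) (is_deriveM' dm' (is_derive_inv dm m00)).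
  move=> /is_derive_eq; apply; rewrite /rho1; field.
  by rewrite aN0 m00.
rewrite P0 E1 E2 => /(b3_ext _); apply => t _.
by rewrite add0r.
Qed.

(** [alpha j] is known to vanish at the right of [0]; differentiability at [0] makes this enough. *)
Lemma dalpha_lt j : (j < N)%N -> 'D_1 (alpha j) 0 = 0.
Proof.
move=> jN; have h0 : 0 <= (0 : R) < eps by rewrite lexx.
have [r [K [r0 K0 H]]] := taylor 2 oI (smooth_alpha j) (Is h0).
have [d d0 [dr de]] := near_min2 r0 eps0.
apply: (@small_eq0 R K (d / 2)) => //; first by rewrite divr_gt0.
move=> t /andP[t0 td].
have td' : t < d by lra.
have ht : 0 <= t < eps by rewrite ltW //= (lt_le_trans td').
have := H t; rewrite (gtr0_norm t0) => /(_ (ltW (lt_le_trans td' dr))).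
rewrite add0r (alpha_lt ht jN) !big_ord_recl big_ord0 /= !expr0 !expr1 !divr1 mulr1 addr0.
rewrite (alpha_lt h0 jN) !add0r.
by rewrite normrN normrM (gtr0_norm t0) expr2 mulrA ler_pM2r.
Qed.

(** The derivative of [DD s t] in [s] at [s = 0]. *)
Definition D1 t := \sum_(l <- ls) phi l t * 'D_1 (psi l) 0.
Definition dD0 t := \sum_(l <- ls) 'D_1 (phi l) t * psi l 0.

Lemma dalphaE j : 'D_1 (alpha j) 0 =
  (\sum_(l <- ls) (dn j.+1 (phi l) 0 * psi l 0 + dn j (phi l) 0 * 'D_1 (psi l) 0)) / j`!%:R.
Proof.
have h0 : 0 <= (0 : R) < eps by rewrite lexx.
have I0 := Is h0.
have d1 : is_derive (0 : R) 1 (fun s => \sum_(l <- ls) dn j (phi l) s * psi l s)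
   (\sum_(l <- ls) (dn j.+1 (phi l) 0 * psi l 0 + dn j (phi l) 0 * 'D_1 (psi l) 0)).
  apply: derive_sum_seq => l; apply: is_deriveM'.
    exact: smoothP (smooth_dn j (sphi l)) I0.
  exact: smoothP (spsi l) I0.
have := is_deriveM' d1 (is_derive_cst (j`!%:R^-1 : R) (0 : R) (1 : R)).
by rewrite mulr0 addr0 => -[_ ->].
Qed.

Lemma sum_low (f : nat -> R) (t : R) m : (forall j, (j < N)%N -> f j = 0) ->
  \sum_(j < N + m) f j * t ^+ j = t ^+ N * \sum_(j < m) f (N + j)%N * t ^+ j.
Proof.
move=> H; rewrite big_split_ord /= big1 => [|i _]; last by rewrite H ?mul0r.
by rewrite add0r mulr_sumr; apply: eq_bigr => i _; rewrite exprD; ring.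
Qed.

Lemma ex2_p : ex2 (fun t => t ^- N * DD 0 t) (alpha N 0) (alpha N.+1 0) (alpha N.+2 0).
Proof.
have h0 : 0 <= (0 : R) < eps by rewrite lexx.
have [r [K [r0 K0 H]]] := DD_expand h0.
exists K, r; split => // t /andP[t0 tr]; have := H t; rewrite (gtr0_norm t0) add0r => /(_ tr).
have tN : 0 < t ^+ N by rewrite exprn_gt0.
have -> : t ^- N * DD 0 t - (alpha N 0 + alpha N.+1 0 * t + alpha N.+2 0 * t ^+ 2) =
  t ^- N * (DD 0 t - t ^+ N * (alpha N 0 + alpha N.+1 0 * t + alpha N.+2 0 * t ^+ 2)).
  by field; rewrite gt_eqF.
rewrite normrM normfV (gtr0_norm tN) ler_pdivrMl // => /le_trans; apply.
by rewrite -addn3 exprD mulrCA.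
Qed.

(** Differentiating $\sum_j\alpha_j(s)(t-s)^j$ in $s$ at $0$ gives the coefficient
    $\alpha_j'(0)-(j+1)\alpha_{j+1}(0)$ of $t^j$. The extra factor [t] raises the lowest order from
    [N - 1] to [N]. *)
Lemma ex2_k : ex2 (fun t => t ^- N * (t * D1 t)) (- N%:R * alpha N 0)
  ('D_1 (alpha N) 0 - N.+1%:R * alpha N.+1 0) ('D_1 (alpha N.+1) 0 - N.+2%:R * alpha N.+2 0).
Proof.
have h0 : 0 <= (0 : R) < eps by rewrite lexx.
have I0 := Is h0.
have sphi' l := smooth_derive (1 : R) (sphi l).
have sD1 : smooth I D1.
  by apply: smooth_sum => // l; apply: smoothM => //; exact: (smooth_cst (_ : R) oI).
have sdD0 : smooth I dD0.
  by apply: smooth_sum => // l; apply: smoothM => //; exact: (smooth_cst (_ : R) oI).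
have [r1 [K1 [r10 K10 H1]]] := taylor (N + 2) oI sD1 I0.
have [r2 [K2 [r20 K20 H2]]] := taylor (N + 2) oI sdD0 I0.
have c1 j : dn j D1 0 / j`!%:R = 'D_1 (alpha j) 0 - j.+1%:R * alpha j.+1 0.
  rewrite (dn_sumM ls (fun l => 'D_1 (psi l) 0) j oI sphi I0) dalphaE /alpha big_split /= factS natrM.
  have Q (x y a b : R) : a != 0 -> b != 0 -> x / a = (y + x) / a - b * (y / (b * a)).
    by move=> an bn; field; rewrite an bn.
  by apply: Q; rewrite pnatr_eq0 // -lt0n fact_gt0.
have [d d0 [dr1 _]] := near_min2 r10 r20.
exists K1, d; split => // t /andP[t0 td].
have tN : 0 < t ^+ N by rewrite exprn_gt0.
have h1 := H1 t; rewrite (gtr0_norm t0) add0r in h1; have {}h1 := h1 (le_trans td dr1).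
(* The shift by one is the factor [t]; the value [0] at index [0] keeps the case [N = 0] within the
   same formula. *)
pose f j := if j is i.+1 then 'D_1 (alpha i) 0 - i.+1%:R * alpha i.+1 0 else 0.
have f_low j : (j < N)%N -> f j = 0.
  case: j => [//|j] jN; rewrite /f dalpha_lt ?alpha_lt ?mulr0 ?subr0 //.
  exact: ltnW.
have E : t * \sum_(j < N + 2) dn j D1 0 / j`!%:R * t ^+ j = t ^+ N * \sum_(j < 3) f (N + j)%N * t ^+ j.
  rewrite -(sum_low t 3 f_low) [in RHS](addnS N 2) [RHS]big_ord_recl /= mul0r add0r mulr_sumr.
  by apply: eq_bigr => j _; rewrite c1 /bump /= add1n exprS mulrCA.
have E3 : \sum_(j < 3) f (N + j)%N * t ^+ j = - N%:R * alpha N 0 +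
  ('D_1 (alpha N) 0 - N.+1%:R * alpha N.+1 0) * t + ('D_1 (alpha N.+1) 0 - N.+2%:R * alpha N.+2 0) * t ^+ 2.
  rewrite !big_ord_recl big_ord0 /= /bump /= !addn0 addn1 addn2 /= !expr0 mulr1 expr1 addr0 addrA.
  congr (_ + _ + _); rewrite /f; case: (N) f_low dalpha_lt => [|n] _ dl; first by rewrite oppr0 mul0r.
  by rewrite dl // sub0r mulNr.
rewrite -E3; have -> : t ^- N * (t * D1 t) - \sum_(j < 3) f (N + j)%N * t ^+ j =
  t ^- N * (t * (D1 t - \sum_(j < N + 2) dn j D1 0 / j`!%:R * t ^+ j)).
  by rewrite mulrBr E; field; rewrite gt_eqF.
rewrite normrM normfV (gtr0_norm tN) ler_pdivrMl // normrM (gtr0_norm t0).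
apply: (@le_trans _ _ (t * (K1 * t ^+ (N + 2)))); first by apply: ler_wpM2l => //; exact: ltW.
by rewrite le_eqVlt; apply/orP; left; apply/eqP; rewrite exprD; ring.
Qed.

Lemma ex2_div (k p : R -> R) k0 k1 k2 p0 p1 p2 q0 q1 q2 : 0 < p0 ->
  ex2 k k0 k1 k2 -> ex2 p p0 p1 p2 ->
  k0 = q0 * p0 -> k1 = q0 * p1 + q1 * p0 -> k2 = q0 * p2 + q1 * p1 + q2 * p0 ->
  ex2 (fun t => k t / p t) q0 q1 q2.
Proof.
move=> p00 Hk Hp e0 e1 e2.
have Q : ex2 (fun t => q0 + q1 * t + q2 * t ^+ 2) q0 q1 q2.
  by exists 0, 1; split => // t _; rewrite subrr normr0 mul0r.
have [d d0 Hd] : exists2 d, 0 < d & forall t, 0 < t <= d -> p0 / 2 <= p t.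
  have : b3 1 (fun t => p t - p0).
    have h1 := b3M (b3_cst p1) (b3_pow 1); have h2 := b3_weak (isT : (1 <= 2)%N) (b3M (b3_cst p2) (b3_pow 2)).
    by apply: b3_ext (b3D (b3D (b3_weak (isT : (1 <= 3)%N) Hp) h1) h2) => t _; ring.
  move=> [K [d [K0 d0 H]]].
  have K1 : 0 < K + 1 by rewrite ltr_wpDl.
  have [e ee [h1 h2]] := near_min2 d0 (divr_gt0 (divr_gt0 p00 (ltr0Sn R 1)) K1).
  exists e => // t /andP[t0 te]; have := H t; rewrite t0 (le_trans te h1) expr1 => /(_ isT).
  have : (K + 1) * t <= p0 / 2 by rewrite mulrC -ler_pdivlMr //; exact: le_trans te h2.
  rewrite ler_norml => h3 /andP[h4 _]; nra.
have B : b3 0 (fun t => (p t)^-1).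
  exists (2 / p0), d; split => //; first by rewrite divr_ge0 // ltW.
  move=> t /Hd h; rewrite expr0 mulr1 normfV ger0_norm; last by apply: le_trans h; rewrite divr_ge0 // ltW.
  by rewrite -[2 / p0]invrK invf_div lef_pV2 ?posrE ?divr_gt0 // (lt_le_trans _ h) // divr_gt0.
have Z := ex2D Hk (ex2M (ex2M Q Hp) (ex2_cst (-1))).
have {}Z : b3 3 (fun t => k t - (q0 + q1 * t + q2 * t ^+ 2) * p t).
  apply: b3_ext Z => t _; rewrite e0 e1 e2; ring.
have := b3M Z B; apply: (@b3_ext_near _ _ _ _ d) => // t /Hd h.
by field; rewrite gt_eqF // (lt_le_trans _ h) // divr_gt0.
Qed.

Lemma b3_half p (f : R -> R) : b3 p f -> b3 p (fun t => f (t / 2)).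
Proof.
move=> [K [d [K0 d0 H]]]; exists K, d; split => // t /andP[t0 td].
have h : 0 < t / 2 <= d by lra.
apply: (le_trans (H _ h)); apply: ler_wpM2l => //; apply: lerXn2r; rewrite ?nnegrE //; lra.
Qed.

Lemma expR_taylor : exists r K : R, [/\ 0 < r, 0 <= K & forall x : R, `|x| <= r ->
  `|expR x - (1 + x + x ^+ 2 / 2)| <= K * `|x| ^+ 3].
Proof.
have oT : open [set: R] by exact: openT.
have sE : smooth [set: R] (@expR R).
  apply: (@is_derive_smooth1 R setT (fun g => g = @expR R)) => // _ ->.
  by exists (@expR R) => // t _; exact: is_derive_expR.
have DE x : 'D_1 (@expR R) x = expR x by have [] := is_derive_expR x.
have [r [K [r0 K0 H]]] := taylor 3 oT sE (Logic.I : [set: R] 0).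
exists r, K; split => // x xr; have := H x xr.
have E2 : 'D_1 ('D_1 (@expR R)) 0 = 1.
  by rewrite (_ : 'D_1 (@expR R) = @expR R) ?DE ?expR0 //; apply/funext => y; exact: DE.
rewrite add0r !big_ord_recl big_ord0 /= /dn /= /bump /= DE E2 expR0 expr0 expr1 !divr1 mul1r addr0 addrA mul1r.
have -> : 1 / (1 + (1 + 0))`!%:R * x ^+ (1 + (1 + 0)) = x ^+ 2 / 2 :> R.
  by rewrite mulrC mul1r.
by [].
Qed.

Lemma ex2_expR (P : R -> R) p1 p2 : ex2 P 0 p1 p2 ->
  ex2 (fun t => expR (- P t)) 1 (- p1) (p1 ^+ 2 / 2 - p2).
Proof.
move=> HP; have [r [K [r0 K0 HE]]] := expR_taylor.
have h1 := b3M (b3_cst p1) (b3_pow 1); have h2 := b3_weak (isT : (1 <= 2)%N) (b3M (b3_cst p2) (b3_pow 2)).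
have [K1 [d [K10 d0 H]]] : b3 1 P.
  by apply: b3_ext (b3D (b3D (b3_weak (isT : (1 <= 3)%N) HP) h1) h2) => t _; ring.
have K11 : 0 < K1 + 1 by rewrite ltr_wpDl.
have [e ee [e1' e2']] := near_min2 d0 (divr_gt0 r0 K11).
have X3 : b3 3 (fun t => expR (- P t) - (1 - P t + P t ^+ 2 / 2)).
  exists (K * K1 ^+ 3), e; split => //; first by rewrite mulr_ge0 // exprn_ge0.
  move=> t /andP[t0 te]; have := H t; rewrite t0 (le_trans te e1') expr1 => /(_ isT) hP.
  have hr : `|- P t| <= r.
    rewrite normrN; apply: (le_trans hP).
    have : (K1 + 1) * t <= r by rewrite mulrC -ler_pdivlMr //; exact: le_trans te e2'.
    by nra.
  have := HE _ hr; rewrite sqrrN normrN => /le_trans; apply.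
  by rewrite -mulrA -exprMn; apply: ler_wpM2l => //; apply: lerXn2r; rewrite ?nnegrE ?mulr_ge0 // ltW.
have HP2 := ex2M HP HP.
have T := ex2D (ex2D (ex2_cst 1) (ex2M (ex2_cst (-1)) HP)) (ex2M (ex2_cst (1 / 2)) HP2).
by apply: b3_ext (b3D X3 T) => t _; field.
Qed.

Variables (trQ : R -> R) (tI e KQ dQ : R).
Hypotheses (KQ0 : 0 <= KQ) (dQ0 : 0 < dQ).
Hypothesis HQ : forall t : R, 0 < t <= dQ ->
  is_derive t 1 (fun u => D1 u / DD 0 u) (trQ t) /\ `|trQ t - (tI / t ^+ 2 + e)| <= KQ * t.

Let a0 := alpha N 0.
Let b0 := alpha N.+1 0.
Let c0 := alpha N.+2 0.
(** With [u1], the coefficients of the quotient [t D1 / DD 0], found by solving the triangular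
    system of [ex2_div] with constant term [- N]. *)
Let u0 := ('D_1 (alpha N) 0 - b0) / a0.
Let u1 := ('D_1 (alpha N.+1) 0 - 2 * c0 - u0 * b0) / a0.

Lemma a0_gt0 : 0 < a0.
Proof. by apply: alpha_N; rewrite lexx. Qed.

Lemma ex2_q : ex2 (fun t => t * (D1 t / DD 0 t)) (- N%:R) u0 u1.
Proof.
have := @ex2_div _ _ _ _ _ _ _ _ (- N%:R) u0 u1 a0_gt0 ex2_k ex2_p.
have h : a0 != 0 by rewrite gt_eqF // a0_gt0.
rewrite /u1 /u0 -/a0 -/b0 -/c0 -natr1 -[N.+2]addn2 natrD => H.
apply: b3_ext (H _ _ _) => [t t0| | |]; try by field.
have tN : t ^+ N != 0 by rewrite gt_eqF // exprn_gt0.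
by rewrite -mulf_div divff ?invr_eq0 // mul1r mulrA.
Qed.

(** [HQ] concerns the derivative of [D1 / DD 0], which leaves an unknown constant of integration.
    The combination [q t - 2 q (t / 2)] eliminates it, and its expansion computed from [ex2_q] is
    compared with the one computed from [HQ]. *)
Lemma trace_eq : e = u1.
Proof.
pose q t := t * (D1 t / DD 0 t).
have B : b3 3 (fun t => q t - 2 * q (t / 2) - tI - e / 2 * t ^+ 2).
  exists (KQ / 2), dQ; split => //; first exact: divr_ge0.
  move=> t /andP[t0 td].
  (* [D1 / DD 0] minus a primitive of the model [tI / u^2 + e], so the derivative of [W] is of size
     [KQ * u]. *)
  pose W u := D1 u / DD 0 u + tI / u - e * u.
  have t2 : 0 < t / 2 by rewrite divr_gt0.
  have t2t : t / 2 <= t by lra.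
  have := @mvt_real R W (fun u => trQ u - tI / u ^+ 2 - e) (t / 2) t (KQ * t).
  have -> : `|t - t / 2| = t / 2 by rewrite ger0_norm; lra.
  move=> H.
  have {}H : `|W t - W (t / 2)| <= KQ * t * (t / 2).
    apply: H => u /(between_le _ t2t) /andP[ut tu].
    have u0' : 0 < u by lra.
    have [h1 h2] := HQ (introT andP (conj u0' (le_trans tu td))).
    split.
      have d1 : is_derive u 1 (fun v : R => tI / v) (- tI / u ^+ 2).
        have := is_deriveM' (is_derive_cst tI u (1 : R)) (is_derive_inv (is_derive_id u (1 : R)) (lt0r_neq0 u0')).
        by rewrite mul0r add0r mulr1 mulrN mulNr.
      have d2 : is_derive u 1 (fun v : R => e * v) e.
        by have := is_deriveM' (is_derive_cst e u (1 : R)) (is_derive_id u (1 : R)); rewrite mul0r add0r mulr1.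
      have := is_deriveB (is_deriveD h1 d1) d2; by rewrite mulNr.
    have -> : trQ u - tI / u ^+ 2 - e = trQ u - (tI / u ^+ 2 + e) by rewrite opprD addrA.
    by apply: (le_trans h2); apply: ler_wpM2l.
  have -> : q t - 2 * q (t / 2) - tI - e / 2 * t ^+ 2 = t * (W t - W (t / 2)).
    rewrite /q /W; move: (D1 t / DD 0 t) (D1 (t / 2) / DD 0 (t / 2)) => A B.
    by field; rewrite gt_eqF.
  rewrite normrM (gtr0_norm t0); apply: (le_trans (ler_wpM2l (ltW t0) H)).
  by rewrite le_eqVlt; apply/orP; left; apply/eqP; field.
have Hq := ex2_q.
have Hh : ex2 (fun t => q (t / 2)) (- N%:R) (u0 / 2) (u1 / 4).
  by apply: b3_ext (b3_half Hq) => t _; rewrite -/(q (t / 2)); move: (q (t / 2)) => A; field.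
have T := ex2D Hq (ex2M (ex2_cst (- 2)) Hh).
have [] := @ex2_unique R (fun t => q t + - 2 * q (t / 2)) _ _ _ tI 0 (e / 2) T.
  by apply: b3_ext B => t _; ring.
move=> _ _; lra.
Qed.

(** The remainder [r] is defined by solving the formula for it. Once [e] is expressed through the
    [alpha] by [trace_eq], the calculus of expansions shows that its coefficients of orders 0, 1 and
    2 cancel identically. *)
Lemma asymptotics : exists C : R, 0 < C /\ exists r : R -> R, r t / t ^+ 2 @[t --> 0^'+] --> 0 /\
  forall rho : R -> R, (forall s, 0 <= s < eps -> rho s = rhot s) ->
  \forall t \near 0^'+, mm 0 * mm t * DD 0 t = C * t ^+ N *
     expR (\int[lebesgue_measure]_(s in `[0, t]) rho s) * (1 - t ^+ 2 * (e / 2) + r t).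
Proof.
have h0 : 0 <= (0 : R) < eps by rewrite lexx.
have I0 := Is h0; have m00 := mm0 I0.
have [P [d [d0 de HP exP]]] := rho_integral.
have exm : ex2 mm (mm 0) ('D_1 mm 0) ('D_1 ('D_1 mm) 0 / 2).
  by apply: b3_ext (taylor_ex2 oI smm I0) => t _; rewrite add0r.
pose C := mm 0 ^+ 2 * a0.
have C0 : 0 < C by rewrite mulr_gt0 ?a0_gt0 // exprn_even_gt0.
have Cn0 : C != 0 by rewrite gt_eqF.
(* The left-hand side divided by [t^N] and by the exponential of the integral of [rho]. *)
pose F t := mm 0 * mm t * (t ^- N * DD 0 t) * expR (- P t).
pose r t := F t / C - 1 + t ^+ 2 * (e / 2).
have br : b3 3 r.
  have T := ex2M (ex2M (ex2M (ex2_cst (mm 0)) exm) ex2_p) (ex2_expR exP).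
  have := b3M (b3_cst (C^-1)) T; apply: b3_ext => t _.
  have an0 : a0 != 0 by rewrite gt_eqF // a0_gt0.
  rewrite /r /F /C trace_eq /u1 /u0 /rho1 /rhot -/a0 -/b0 -/c0.
  move: (t ^- N * DD 0 t) (expR (- P t)) => X Y; field.
  by rewrite an0 m00.
exists C; split => //; exists r; split.
  have [K [d' [K0 d'0 H]]] := br.
  apply/cvgrPdist_le => x x0.
  have K1 : 0 < K + 1 by rewrite ltr_wpDl.
  have [d2 d20 [h1 h2]] := near_min2 d'0 (divr_gt0 x0 K1).
  near=> t.
  have t0 : 0 < t by near: t; exact: nbhs_right_gt.
  have td : t <= d2 by near: t; exact: nbhs_right_le.
  have := H t; rewrite t0 (le_trans td h1) => /(_ isT) ht.
  rewrite sub0r normrN normrM normfV normrX (gtr0_norm t0) ler_pdivrMr ?exprn_gt0 //.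
  apply: (le_trans ht); rewrite exprS mulrA; apply: ler_wpM2r; first by rewrite exprn_ge0 // ltW.
  have : (K + 1) * t <= x by rewrite mulrC -ler_pdivlMr //; exact: le_trans td h2.
  by nra.
move=> rho Hrho; near=> t.
have t0 : 0 < t by near: t; exact: nbhs_right_gt.
have td : t <= d by near: t; exact: nbhs_right_le.
rewrite (HP rho t Hrho) ?(ltW t0) //.
have -> : 1 - t ^+ 2 * (e / 2) + r t = F t / C by rewrite /r; ring.
have EE : expR (P t) * expR (- P t) = 1 by rewrite expRN mulfV // gt_eqF // expR_gt0.
have tN : t ^+ N != 0 by rewrite gt_eqF // exprn_gt0.
have -> : C * t ^+ N * expR (P t) * (F t / C) =
  (expR (P t) * expR (- P t)) * (mm 0 * mm t * DD 0 t) by rewrite /F; field; rewrite tN Cn0.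
by rewrite EE mul1r.
Unshelve. all: by end_near. Qed.

End Main.
End Asymp.

(** * Bases adapted to a flag of subspaces *)

Section FlagBasis.
Context {R : realType} (n : nat) (W : nat -> {vspace 'rV[R]_n}).
Hypotheses (W0 : W 0 = 0%VS) (Wm : forall i, (W i <= W i.+1)%VS).

(** Vectors are stored with their level: each step appends a basis of a complement of [W m] in
    [W m.+1], so that level [i] occurs [dim (W i) - dim (W i.-1)] times. *)
Lemma flag_seq m : exists s : seq ('rV[R]_n * nat),
  [/\ free (map fst s), <<map fst s>>%VS = W m,
      (forall a, a \in s -> (0 < a.2 <= m)%N /\ a.1 \in W a.2),
      (forall i, (i <= m)%N -> (W i <= <<map fst [seq a <- s | (a.2 <= i)%N]>>)%VS) &
      (\sum_(a <- s) (2 * a.2).-1 =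
       \sum_(1 <= i < m.+1) (2 * i - 1) * (\dim (W i) - \dim (W i.-1)))%N].
Proof.
elim: m => [|m [s [fs sp sw sf ss]]].
  exists [::]; split => //=.
  - by rewrite nil_free.
  - by rewrite span_nil W0.
  - by move=> [|i] //; rewrite W0 sub0v.
  - by rewrite big_nil big_geq.
set D := (W m.+1 :\: W m)%VS.
have capD : (W m :&: D)%VS = 0%VS by rewrite capvC capv_diff.
have addD : (W m + D)%VS = W m.+1 by rewrite addvC addv_diff; exact/addv_idPl.
have dimD : (\dim D = \dim (W m.+1) - \dim (W m))%N.
  by rewrite -addD dimv_disjoint_sum // addKn.
set s' := [seq (v, m.+1) | v <- vbasis D].
have s'1 : map fst s' = vbasis D by rewrite -map_comp map_id_in.
have spD : <<vbasis D>>%VS = D by exact: (span_basis (vbasisP D)).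
exists (s ++ s'); split.
- rewrite map_cat s'1 cat_free fs (basis_free (vbasisP D)) /=.
  by apply/directv_addP; rewrite sp spD.
- by rewrite map_cat s'1 span_cat sp spD.
- move=> a; rewrite mem_cat => /orP[/sw [/andP[-> h1] h2]|/mapP[v vD ->]].
    by rewrite leqW.
  by rewrite ltnSn; split=> //=; apply: (subvP (diffvSl _ _)); exact: (vbasis_mem vD).
- move=> i; rewrite leq_eqVlt => /orP[/eqP ->|].
    rewrite (_ : [seq a <- _ | _] = s ++ s'); last first.
      apply/all_filterP/allP => a; rewrite mem_cat => /orP[/sw [/andP[_ h1] _]|/mapP[v vD ->]] //.
      exact: leqW.
    by rewrite map_cat s'1 span_cat sp spD addD.
  rewrite ltnS => im; rewrite filter_cat map_cat span_cat.
  by apply: subv_trans (sf _ im) _; exact: addvSl.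
- rewrite big_cat /= ss [RHS]big_nat_recr //=; congr (_ + _)%N.
  rewrite big_map /= big_const_seq count_predT size_tuple dimD iter_addn_0.
  by congr (_ * _)%N; lia.
Qed.

Lemma mem_span_filter (p : pred ('rV[R]_n * nat)) x0 s v :
  v \in <<map fst [seq a <- s | p a]>>%VS -> exists x : nat -> R,
    v = \sum_(0 <= i < size s | p (nth x0 s i)) x i *: (nth x0 s i).1.
Proof.
elim: s v => [|a s IH] v /=.
  by rewrite span_nil memv0 => /eqP ->; exists (fun=> 0); rewrite big_nil.
have E (x : nat -> R) (c : R) : \sum_(0 <= i < (size s).+1 | p (nth x0 (a :: s) i))
    (if i is j.+1 then x j else c) *: (nth x0 (a :: s) i).1 =
    (if p a then c *: a.1 else 0) + \sum_(0 <= i < size s | p (nth x0 s i)) x i *: (nth x0 s i).1.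
  by rewrite big_mkcond big_nat_recl //= -big_mkcond.
case: ifP => pa /=; last first.
  move=> /IH[x ->]; exists (fun i => if i is j.+1 then x j else 0).
  by rewrite E pa add0r.
rewrite span_cons => /memv_addP[_ /vlineP[c ->] [v' /IH[x ->] ->]].
by exists (fun i => if i is j.+1 then x j else c); rewrite E pa.
Qed.

(** [Xi] is the dual basis of an adapted basis: the covector dual to a vector of level [w]
    annihilates [W (w - 1)], and those of level [i] are independent on [W i], as the vectors of that
    level show. *)
Lemma flag_basis m : W m = fullv -> exists (w : 'I_n -> nat) (Xi : 'M[R]_n),
  [/\ Xi \in unitmx, (forall a, (0 < w a)%N),
      (forall a v, v \in W (w a).-1 -> row a Xi *m v^T = 0),
      (forall (al : 'I_n -> R) i,
         (forall v, v \in W i -> \sum_(a | w a == i) al a *: (row a Xi *m v^T) = 0) ->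
         forall a, w a = i -> al a = 0) &
      (\sum_a (2 * w a).-1 =
       \sum_(1 <= i < m.+1) (2 * i - 1) * (\dim (W i) - \dim (W i.-1)))%N].
Proof.
move=> Wfull; have [s [fs sp sw sf ss]] := flag_seq m.
have sn : size s = n.
  have := eqP (fs : \dim _ == size _); rewrite sp Wfull size_map dimvf => <-.
  by rewrite /dim /= mul1n.
pose x0 : 'rV[R]_n * nat := (0, 1%N).
pose f (a : 'I_n) := nth x0 s a.
have fin (a : 'I_n) : f a \in s by apply: mem_nth; rewrite sn.
pose P : 'M[R]_n := \matrix_a (f a).1.
have rP a : row a P = (f a).1 by rewrite rowK.
have Pu : P \in unitmx.
  rewrite -row_free_unit -kermx_eq0; apply/rowV0P => u /sub_kermxP uP.
  have szt : size (map fst s) == n by rewrite size_map sn.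
  have := elimT (freeP (X := Tuple szt)) fs (fun a => u 0 a).
  move=> /(_ _) h; apply/rowP => a; rewrite mxE; apply: h => //.
  rewrite -[RHS]uP mulmx_sum_row; apply: eq_bigr => b _.
  by rewrite rP /= (nth_map x0) ?sn.
have dual a c : row a (invmx P)^T *m ((f c).1)^T = (a == c)%:R%:M.
  have : P *m invmx P = 1%:M by rewrite mulmxV.
  move=> /matrixP/(_ c a); rewrite !mxE => E.
  apply/matrixP => i j; rewrite !ord1 !mxE /= mulr1n eq_sym -E.
  by apply: eq_bigr => b _; rewrite !mxE mulrC.
have Wsum i v : v \in W i -> exists x : nat -> R,
    v = \sum_(c < n | ((f c).2 <= i)%N) x c *: (f c).1.
  move=> vi; have [im|mi] := leqP i m.
    have /mem_span_filter-/(_ x0)[x ->] := subvP (sf _ im) _ vi.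
    by exists x; rewrite sn big_mkord.
  have /mem_span_filter-/(_ x0)[x ->] : v \in <<map fst [seq a <- s | (a.2 <= i)%N]>>%VS.
    rewrite (_ : [seq a <- _ | _] = s) ?sp ?Wfull ?memvf //.
    by apply/all_filterP/allP => a /sw[/andP[_ h] _]; apply: leq_trans h (ltnW mi).
  by exists x; rewrite sn big_mkord.
exists (fun a => (f a).2), (invmx P)^T; split.
- by rewrite unitmx_tr unitmx_inv.
- by move=> a; have [/andP[]] := sw _ (fin a).
- move=> a v /Wsum[x ->]; have [/andP[a0 _] _] := sw _ (fin a).
  rewrite raddf_sum mulmx_sumr big1 // => c hc; rewrite /= (_ : (x c *: (f c).1)^T = x c *: ((f c).1)^T); last by apply/matrixP => i j; rewrite !mxE.
  rewrite -scalemxAr dual.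
  case: eqP hc => [<-|]; last by rewrite raddf0 scaler0.
  by rewrite -ltnS prednK // ltnn.
- move=> al i h a wa; have [_ ha] := sw _ (fin a); rewrite wa in ha.
  have := h _ ha; rewrite (bigD1 a) /= ?wa //= dual eqxx big1 ?addr0 => [|c /andP[_ ca]].
    by move=> /matrixP/(_ 0 0); rewrite !mxE mulr1.
  by rewrite dual (negPf ca) raddf0 scaler0.
- by rewrite -ss (big_nth x0) sn big_mkord.
Qed.
End FlagBasis.

Section Pairing.
Context {R : realType} (n : nat).
Implicit Types p q v w : 'rV[R]_n.

Lemma pairingE p v : pairing p v = \sum_j p 0 j * v 0 j.
Proof. by rewrite /pairing !mxE; apply: eq_bigr => j _; rewrite !mxE. Qed.

Lemma pairingDl p q v : pairing (p + q) v = pairing p v + pairing q v.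
Proof. by rewrite /pairing mulmxDl mxE. Qed.

Lemma pairingDr p v w : pairing p (v + w) = pairing p v + pairing p w.
Proof. by rewrite /pairing linearD mulmxDr mxE. Qed.

Lemma pairingZl (c : R) p v : pairing (c *: p) v = c * pairing p v.
Proof. by rewrite /pairing -scalemxAl mxE. Qed.

Lemma pairingZr (c : R) p v : pairing p (c *: v) = c * pairing p v.
Proof. by rewrite !pairingE mulr_sumr; apply: eq_bigr => j _; rewrite mxE mulrCA. Qed.

Lemma pairingC p v : pairing p v = pairing v p.
Proof. by rewrite !pairingE; apply: eq_bigr => j _; rewrite mulrC. Qed.

Lemma pairingBl p q v : pairing (p - q) v = pairing p v - pairing q v.
Proof. by rewrite pairingDl -scaleN1r pairingZl mulN1r. Qed.

Lemma pairingBr p v w : pairing p (v - w) = pairing p v - pairing p w.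
Proof. by rewrite pairingDr -scaleN1r pairingZr mulN1r. Qed.

Lemma pairing_mulmx m (p : 'rV[R]_m) (v : 'rV[R]_n) (A : 'M[R]_(m, n)) :
  pairing (p *m A) v = pairing p (v *m A^T).
Proof. by rewrite /pairing trmx_mul trmxK mulmxA. Qed.

Lemma pairing_delta p j : pairing p (delta_mx 0 j) = p 0 j.
Proof.
rewrite pairingE (bigD1 j) //= mxE !eqxx mulr1 big1 ?addr0 // => i ij.
by rewrite mxE (negPf ij) andbF mulr0.
Qed.

Lemma pairing_norm p v : `|pairing p v| <= n%:R * `|p| * `|v|.
Proof.
rewrite pairingE; apply: (le_trans (norm_sum_le (C := `|p| * `|v|) _)).
  by move=> j; rewrite normrM ler_pM // mx_entry_le.
by rewrite mulrA.
Qed.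

End Pairing.

Lemma smooth_prod (R : realType) (V : normedModType R) (U : set V) (I : Type) (s : seq I)
    (f : I -> V -> R) : open U -> (forall i, smooth U (f i)) ->
  smooth U (fun y => \prod_(i <- s) f i y).
Proof.
move=> oU sf; elim: s => [|i s IH].
  rewrite (_ : (fun _ => _) = cst 1); first exact: smooth_cst.
  by apply/funext => y; rewrite big_nil.
rewrite (_ : (fun _ => _) = fun y => f i y * \prod_(i <- s) f i y); first exact: smoothM.
by apply/funext => y; rewrite big_cons.
Qed.

Lemma derive_of_line (R : realType) (V W : normedModType R) (f : V -> W) (z v : V) (d : W) :
  derivable f z v -> is_derive (0 : R) 1 (fun u : R => f (z + u *: v)) d -> 'D_v f z = d.
Proof.
move=> h D; have D' : is_derive (0 : R) 1 (fun u : R => f (z + u *: v)) ('D_v f (z + 0 *: v)).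
  by apply: is_derive_line; rewrite scale0r addr0.
by rewrite -(@derive_val _ _ _ _ _ _ _ D) (@derive_val _ _ _ _ _ _ _ D') scale0r addr0.
Qed.

Lemma derive_line_ext (R : realType) (V V' W : normedModType R) (f : V -> W) (g : V' -> W)
    (a v : V) (b w : V') : (forall h : R, f (h *: v + a) = g (h *: w + b)) ->
  'D_v f a = 'D_w g b.
Proof.
move=> h; rewrite /derive.
have -> // : (fun u : R => u^-1 *: ((f \o shift a) (u *: v) - f a)) =
  (fun u : R => u^-1 *: ((g \o shift b) (u *: w) - g b)).
by apply/funext => u /=; rewrite h; have := h 0; rewrite !scale0r !add0r => ->.
Qed.

(** * The Hamiltonian in canonical coordinates and its linearization *)

Section Model.
Context {R : realType} (n k : nat).
Variables (U : set 'rV[R]_n) (F0 : 'rV[R]_n -> 'rV[R]_n) (F : 'I_k -> 'rV[R]_n -> 'rV[R]_n)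
  (Qp : 'rV[R]_n -> R).
Hypotheses (oU : open U) (sF0 : csmooth U F0)
  (sF : forall i, csmooth U (F i)) (sQ : smooth U Qp).

Local Notation state := 'rV[R]_(n + n).

Definition hamE (q y : 'rV[R]_n) : R :=
  2^-1 * (\sum_(i < k) pairing q (F i y) ^+ 2) + pairing q (F0 y) + 2^-1 * Qp y.
Definition Hz (z : state) : R := hamE (lsubmx z) (rsubmx z).
Definition UU : set state := [set z | U (rsubmx z)].
Definition XX (y : 'rV[R]_n) : 'M[R]_(k, n) := \matrix_(i < k) F i y.
(** For rows with the covector first: a gradient row times [symp_mx] is the Hamiltonian field
    $(-\partial_yH,\partial_qH)$. *)
Definition symp_mx : 'M[R]_(n + n) := block_mx 0 1%:M (- 1%:M) 0.
Definition hH (z : state) : state := grad Hz z *m symp_mx.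

Lemma rsubmx_continuous : continuous (@rsubmx R 1 n n).
Proof.
move=> z; apply: continuous_mx_at => i j.
rewrite (_ : (fun u : state => rsubmx u i j) = fun u : state => u i (rshift n j)).
  exact: coord_continuous.
by apply/funext => u; rewrite mxE.
Qed.

Lemma oUU : open UU.
Proof. by apply: (open_comp _ oU) => z _; exact: rsubmx_continuous. Qed.

Lemma smooth_rsub (f : 'rV[R]_n -> R) : smooth U f -> smooth UU (fun z => f (rsubmx z)).
Proof.
move=> sf; apply: (smooth_affine (A := @rsubmx R 1 n n) (L := @rsubmx R 1 n n)) => //.
  by move=> y v h; rewrite linearD linearZ.
exact: rsubmx_continuous.
Qed.

Lemma smooth_lsub j : smooth UU (fun z => lsubmx z 0 j).
Proof.
apply: (smooth_ext oUU _ (smooth_coord (lshift n j) oUU)) => z _.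
by rewrite mxE.
Qed.

Lemma smooth_pairing (G : state -> 'rV[R]_n) : (csmooth UU G) ->
  smooth UU (fun z => pairing (lsubmx z) (G z)).
Proof.
move=> sG; apply: (smooth_ext oUU (f := fun z => \sum_j lsubmx z 0 j * G z 0 j)).
  by move=> z _; rewrite pairingE.
by apply: smooth_sum _ _ oUU _ => j; apply: smoothM oUU _ _ => //; exact: smooth_lsub.
Qed.

Lemma sHz : smooth UU Hz.
Proof.
have sp (G : 'rV[R]_n -> 'rV[R]_n) : (csmooth U G) ->
    smooth UU (fun z => pairing (lsubmx z) (G (rsubmx z))).
  by move=> sG; apply: smooth_pairing => j; exact: smooth_rsub (sG j).
apply: smoothD oUU _ _; last first.
  by apply: (smoothZ _ oUU); exact: smooth_rsub.
apply: smoothD oUU _ (sp _ sF0); apply: (smoothZ _ oUU).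
by apply: smooth_sum _ _ oUU _ => i; apply: smoothM oUU _ _; exact: sp.
Qed.

(** The velocity of the base point, that is $\partial_qH$. *)
Definition rH (z : state) : 'rV[R]_n :=
  lsubmx z *m ((XX (rsubmx z))^T *m XX (rsubmx z)) + F0 (rsubmx z).

Lemma XXtE q y v : pairing (q *m ((XX y)^T *m XX y)) v =
  \sum_i pairing q (F i y) * pairing v (F i y).
Proof.
rewrite mulmxA pairing_mulmx pairingE; apply: eq_bigr => i _.
by rewrite !pairingE !mxE; congr (_ * _); apply: eq_bigr => j _; rewrite !mxE.
Qed.

(** Exact, because the Hamiltonian is quadratic in the covector. It gives $\partial_qH$ here and the
    quadratic form of the cost in [cost_dot_quadratic]. *)
Lemma hamE_line (q dq y : 'rV[R]_n) (u : R) : hamE (q + u *: dq) y = hamE q y +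
  u * pairing dq (q *m ((XX y)^T *m XX y) + F0 y) +
  u ^+ 2 * (2^-1 * \sum_i pairing dq (F i y) ^+ 2).
Proof.
rewrite /hamE pairingDr pairingDl pairingZl [pairing dq (q *m _)]pairingC XXtE.
have -> : \sum_i pairing (q + u *: dq) (F i y) ^+ 2 = \sum_i pairing q (F i y) ^+ 2 +
   2 * u * (\sum_i pairing q (F i y) * pairing dq (F i y)) + u ^+ 2 * (\sum_i pairing dq (F i y) ^+ 2).
  rewrite !mulr_sumr -!big_split /=; apply: eq_bigr => i _.
  by rewrite pairingDl pairingZl; ring.
by field.
Qed.

Lemma derive_Hq (z : state) dq : UU z -> 'D_(row_mx dq 0) Hz z = pairing dq (rH z).
Proof.
move=> Uz; apply: derive_of_line; first exact: (smooth_derivable sHz Uz).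
set c2 := 2^-1 * \sum_i pairing dq (F i (rsubmx z)) ^+ 2.
apply: (is_derive_ext (f := fun u : R => Hz z + u * pairing dq (rH z) + u ^+ 2 * c2)); last first.
  move=> u; rewrite /Hz !linearD !linearZ /= row_mxKl row_mxKr scaler0 addr0.
  by rewrite hamE_line.
have h1 : is_derive (0 : R) 1 (fun u : R => u ^+ 2 * c2) 0.
  have := is_deriveM' (is_deriveM' (is_derive_id (0 : R) 1) (is_derive_id (0 : R) 1))
    (is_derive_cst c2 (0 : R) 1).
  by rewrite /= !mulr0 !addr0 mul0r addr0 mul0r.
have h2 : is_derive (0 : R) 1 (fun u : R => Hz z + u * pairing dq (rH z)) (pairing dq (rH z)).
  have h := is_deriveM' (is_derive_id (0 : R) 1) (is_derive_cst (pairing dq (rH z)) (0 : R) 1).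
  have := is_deriveD (is_derive_cst (Hz z) (0 : R) 1) h.
  by rewrite /= mulr0 addr0 add0r mul1r; apply.
by have := is_deriveD h2 h1; rewrite addr0; apply.
Qed.

Lemma rsub_hH z : UU z -> rsubmx (hH z) = rH z.
Proof.
move=> Uz; rewrite /hH -[grad Hz z]hsubmxK mul_row_block row_mxKr mulmx1 mulmx0 addr0.
apply/rowP => j; rewrite [LHS]mxE [LHS]mxE.
have -> : delta_mx 0 (lshift n j) = row_mx (delta_mx 0 j) 0 :> state by rewrite delta_mx_lshift.
by rewrite derive_Hq // pairingC pairing_delta.
Qed.

Lemma lsub_hH z : lsubmx (hH z) = - rsubmx (grad Hz z).
Proof.
by rewrite /hH -[grad Hz z]hsubmxK mul_row_block row_mxKl !row_mxKr mulmx0 add0r mulmxN mulmx1.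
Qed.

Lemma grad_hamE_q q y : grad (fun q' => hamE q' y) q = lsubmx (grad Hz (row_mx q y)).
Proof.
apply/rowP => j; rewrite !mxE.
have -> : delta_mx 0 (lshift n j) = row_mx (delta_mx 0 j) 0 :> state by rewrite delta_mx_lshift.
apply: derive_line_ext => u; rewrite /Hz.
by rewrite !linearD !linearZ /= !row_mxKl !row_mxKr scaler0 add0r.
Qed.

Lemma grad_hamE_y q y : grad (fun y' => hamE q y') y = rsubmx (grad Hz (row_mx q y)).
Proof.
apply/rowP => j; rewrite !mxE.
have -> : delta_mx 0 (rshift n j) = row_mx 0 (delta_mx 0 j) :> state by rewrite delta_mx_rshift.
apply: derive_line_ext => u; rewrite /Hz.
by rewrite !linearD !linearZ /= !row_mxKl !row_mxKr scaler0 add0r.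
Qed.

Lemma hHE q y : U y -> hH (row_mx q y) =
  row_mx (- grad (fun y' => hamE q y') y) (grad (fun q' => hamE q' y) q).
Proof.
move=> Uy; rewrite grad_hamE_q grad_hamE_y -[LHS]hsubmxK lsub_hH; congr row_mx.
by rewrite /hH -[grad Hz _]hsubmxK mul_row_block !row_mxKr row_mxKl mulmx1 mulmx0 addr0.
Qed.

Lemma sgrad i : smooth UU (fun z => grad Hz z 0 i).
Proof.
apply: (smooth_ext oUU _ (smooth_derive (delta_mx 0 i) sHz)) => z _.
by rewrite mxE.
Qed.

Lemma shH j : smooth UU (fun z => hH z 0 j).
Proof.
apply: (smooth_ext oUU (f := fun z => \sum_i symp_mx i j *: grad Hz z 0 i)).
  by move=> z _; rewrite mxE; apply: eq_bigr => i _; rewrite mulrC.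
by apply: smooth_sum _ _ oUU _ => i; apply: (smoothZ _ oUU); exact: sgrad.
Qed.

Definition Hess (z : state) : 'M[R]_(n + n) :=
  \matrix_(i, j) 'D_(delta_mx 0 i) ('D_(delta_mx 0 j) Hz) z.
Local Notation DH := (Dfield hH).

Lemma Hess_sym z : UU z -> (Hess z)^T = Hess z.
Proof. by move=> Uz; apply/matrixP => i j; rewrite !mxE (derive_deriveC _ _ oUU sHz). Qed.

Lemma is_derive_dir_line (V : normedModType R) (D : set V) (f : V -> R) (z v : V) :
  smooth D f -> D z -> is_derive z v f ('D_v f z).
Proof. by move=> sf Dz; apply: DeriveDef => //; exact: smooth_derivable sf Dz. Qed.

Lemma is_derive_lin (V : normedModType R) (I : Type) (s : seq I) (c : I -> R) (f : I -> V -> R) (z v : V) df :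
  (forall i, is_derive z v (f i) (df i)) ->
  is_derive z v (fun y => \sum_(i <- s) f i y * c i) (\sum_(i <- s) df i * c i).
Proof.
move=> h; elim: s => [|i s IH].
  rewrite big_nil (_ : (fun _ => _) = cst 0); first exact: is_derive_cst.
  by apply/funext => y; rewrite big_nil.
rewrite big_cons (_ : (fun _ => _) = (c i \*: f i) + (fun y => \sum_(i <- s) f i y * c i)).
  by apply: is_deriveD IH; rewrite mulrC; exact: is_deriveZ.
by apply/funext => y; rewrite big_cons mulrC.
Qed.

Lemma DHE z : UU z -> DH z = Hess z *m symp_mx.
Proof.
move=> Uz; apply/matrixP => i j; rewrite !mxE.
apply: derive_val; rewrite (_ : (fun y => hH y 0 j) =
  fun y => \sum_l 'D_(delta_mx 0 l) Hz y * symp_mx l j); last first.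
  by apply/funext => y; rewrite mxE; apply: eq_bigr => l _; rewrite mxE.
have D : is_derive z (delta_mx 0 i) (fun y => \sum_l 'D_(delta_mx 0 l) Hz y * symp_mx l j)
    (\sum_l 'D_(delta_mx 0 i) ('D_(delta_mx 0 l) Hz) z * symp_mx l j).
  apply: is_derive_lin => l.
  exact: (is_derive_dir_line _ (smooth_derive (delta_mx 0 l) sHz) Uz).
by apply: is_derive_eq; apply: eq_bigr => l _; rewrite !mxE.
Qed.

(** The Jacobian of the Hamiltonian field is the Hessian times [symp_mx], so symmetry of the Hessian
    relates its diagonal blocks, and makes each off-diagonal block symmetric as in [DH_dl]. *)
Lemma DH_ul z : UU z -> ulsubmx (DH z) = - (drsubmx (DH z))^T.
Proof.
move=> Uz; rewrite DHE // -[Hess z]submxK /symp_mx mulmx_block block_mxKul block_mxKdr.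
rewrite !mulmx0 !mulmx1 !mulmxN !mulmx1 !add0r !addr0.
by congr (- _); rewrite -{1}(Hess_sym Uz) trmx_dlsub.
Qed.

Lemma DH_dl z : UU z -> (dlsubmx (DH z))^T = dlsubmx (DH z).
Proof.
move=> Uz; rewrite DHE // -[Hess z]submxK /symp_mx mulmx_block block_mxKdl.
rewrite !mulmx0 !mulmxN !mulmx1 !add0r linearN /=; congr (- _).
by rewrite -{2}(Hess_sym Uz) trmx_drsub.
Qed.

Lemma smooth_DH i j : smooth UU (fun z => DH z i j).
Proof.
apply: (smooth_ext oUU _ (smooth_derive (delta_mx 0 i) (shH j))) => z _.
by rewrite mxE.
Qed.

Lemma derive_rH (v : state) z j : UU z -> (v *m DH z) 0 (rshift n j) = 'D_v (fun z => rH z 0 j) z.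
Proof.
move=> Uz; rewrite (mul_Dfield oUU shH) //.
apply: near_eq_derive; have : nbhs z UU by apply: open_nbhs_nbhs; split=> //; exact: oUU.
by apply: filterS => w Uw; rewrite -rsub_hH // [RHS]mxE.
Qed.

Lemma smooth_rH j : smooth UU (fun z => rH z 0 j).
Proof.
apply: (smooth_ext oUU _ (shH (rshift n j))) => z Uz.
by rewrite -rsub_hH // [RHS]mxE.
Qed.

Lemma DH_ur z : UU z -> ursubmx (DH z) = (XX (rsubmx z))^T *m XX (rsubmx z).
Proof.
move=> Uz; apply/matrixP => i j; set B := _ *m _.
have eB : ((delta_mx 0 i : 'rV[R]_n) *m B) 0 j = B i j by rewrite -rowE mxE.
have -> : ursubmx (DH z) i j = ((delta_mx 0 (lshift n i) : state) *m DH z) 0 (rshift n j).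
  by rewrite -rowE [RHS]mxE [LHS]mxE [LHS]mxE.
rewrite (derive_rH _ _ Uz).
have -> : delta_mx 0 (lshift n i) = row_mx (delta_mx 0 i) 0 :> state by rewrite delta_mx_lshift.
apply: derive_of_line; first exact: (smooth_derivable (smooth_rH j) Uz).
apply: (is_derive_ext (f := fun u : R => rH z 0 j + u * B i j)); last first.
  move=> u; rewrite /rH !linearD !linearZ /= row_mxKl row_mxKr scaler0 addr0 mulmxDl.
  rewrite -eB -scalemxAl -/B; move: (lsubmx z *m B) (F0 _) (_ *m B) => x1 x2 x3.
  by rewrite !mxE; ring.
have h := is_deriveM' (is_derive_id (0 : R) 1) (is_derive_cst (B i j) (0 : R) 1).
have := is_deriveD (is_derive_cst (rH z 0 j) (0 : R) 1) h.
by rewrite /= mulr0 addr0 add0r mul1r; apply.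
Qed.

(** Derivatives of the frame corrected by the linearized flow: along an extremal $X_{j+1}=\dot
    X_j-X_jA$, with $A$ the lower right block of [DH]. The derivative in time is written as a
    derivative along [hH], so that every [Xs j] is a function of the state. *)
Fixpoint Xs (j : nat) (z : state) : 'M[R]_(k, n) :=
  if j is j'.+1 then
    (\matrix_(a, b) \sum_l hH z 0 l * 'D_(delta_mx 0 l) (fun w => Xs j' w a b) z)
      - Xs j' z *m drsubmx (DH z)
  else XX (rsubmx z).

Lemma smooth_Xs j a b : smooth UU (fun z => Xs j z a b).
Proof.
elim: j a b => [|j IH] a b /=.
  by apply: (smooth_ext oUU _ (smooth_rsub (sF a b))) => z _; rewrite mxE.
apply: (smooth_ext oUU (f := fun z => \sum_l hH z 0 l * 'D_(delta_mx 0 l) (fun w => Xs j w a b) z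
   - \sum_l Xs j z a l * DH z (rshift n l) (rshift n b))).
  by move=> z _; rewrite !mxE; congr (_ - _); apply: eq_bigr => l _; rewrite !mxE.
apply: smoothB oUU _ _; apply: smooth_sum _ _ oUU _ => l; apply: smoothM oUU _ _.
- exact: shH.
- exact: smooth_derive (IH a b).
- exact: IH.
- exact: smooth_DH.
Qed.

Lemma is_derive_Xs (z : R -> state) (t : R) j : UU (z t) -> is_derive t 1 z (hH (z t)) ->
  is_derive t 1 (fun t => Xs j (z t)) (Xs j.+1 (z t) + Xs j (z t) *m drsubmx (DH (z t))).
Proof.
move=> Uz dz; rewrite /= subrK; apply/derive_mxP => a b; rewrite mxE.
have := is_derive_comp oUU (smooth_Xs j a b) Uz dz.
by rewrite (derive_coords oUU _ (smooth_Xs j a b) Uz).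
Qed.

End Model.

(** * Derivatives of determinants and inverse matrices *)

Section DetDerive.
Context {R : realType}.

Lemma is_derive_prod_seq (T : eqType) (s : seq T) (f : T -> R -> R) (df : T -> R) (t : R) :
  uniq s -> (forall i, is_derive t 1 (f i) (df i)) ->
  is_derive t 1 (fun u => \prod_(i <- s) f i u)
    (\sum_(i <- s) df i * \prod_(j <- s | j != i) f j t).
Proof.
move=> + h; elim: s => [|a s IH] /=.
  move=> _; rewrite big_nil (_ : (fun _ => _) = cst 1); first exact: is_derive_cst.
  by apply/funext => y; rewrite big_nil.
move=> /andP[as_ us].
rewrite (_ : (fun _ => _) = fun u => f a u * \prod_(i <- s) f i u); last first.
  by apply/funext => y; rewrite big_cons.
have D := is_deriveM' (h a) (IH us).
apply: is_derive_eq.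
rewrite big_cons big_cons eqxx /=; congr (_ * _ + _).
  rewrite [LHS]big_seq [RHS]big_seq_cond; apply: eq_bigl => i.
  by case: (boolP (i \in s)) => //= is_; case: eqP => // E; move: as_; rewrite -E is_.
rewrite mulr_sumr [LHS]big_seq [RHS]big_seq; apply: eq_bigr => i is_; rewrite big_cons.
case: eqP => [E|_]; first by move: as_; rewrite E is_.
by rewrite mulrCA.
Qed.

Lemma is_derive_prod (I : finType) (f : I -> R -> R) (df : I -> R) (t : R) :
  (forall i, is_derive t 1 (f i) (df i)) ->
  is_derive t 1 (fun u => \prod_i f i u) (\sum_i df i * \prod_(j | j != i) f j t).
Proof. by move=> h; apply: is_derive_prod_seq => //; exact: index_enum_uniq. Qed.

(** Jacobi's formula: in the Leibniz expansion, the terms that differentiate row [i] sum to the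
    determinant with that row taken from [dA], which is then expanded along it. *)
Lemma is_derive_det n (A : R -> 'M[R]_n) (t : R) (dA : 'M[R]_n) :
  is_derive t 1 A dA -> is_derive t 1 (fun u => \det (A u)) (\tr (\adj (A t) *m dA)).
Proof.
move=> /derive_mxP hA.
have h : is_derive t 1 (fun u => \det (A u)) (\sum_(s : 'S_n)
   (-1) ^+ s * \sum_i dA i (s i) * \prod_(j | j != i) A t j (s j)).
  rewrite /determinant; apply: (derive_sum_seq (index_enum 'S_n)
    (f := fun (s : 'S_n) u => (-1) ^+ s * \prod_i A u i (s i))) => s.
  have D := is_derive_prod (fun i => hA i (s i)).
  have := is_deriveM' (is_derive_cst ((-1) ^+ s : R) t 1) D.
  by rewrite mul0r add0r; apply.
apply: is_derive_eq; under eq_bigr do rewrite mulr_sumr.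
rewrite exchange_big mxtrace_mulC /=; apply: eq_bigr => i _; rewrite mxE.
pose B : 'M[R]_n := \matrix_(a, b) (if a == i then dA a b else A t a b).
transitivity (\det B).
  rewrite /determinant; apply: eq_bigr => s _; congr (_ * _).
  rewrite [RHS](bigD1 i) //= mxE eqxx; congr (_ * _); apply: eq_bigr => j ji.
  by rewrite mxE (negPf ji).
rewrite (expand_det_row B i); apply: eq_bigr => j _; rewrite !mxE eqxx; congr (_ * _).
rewrite /cofactor; congr (_ * \det _); apply/matrixP => a b; rewrite !mxE.
by rewrite eq_sym (negPf (neq_lift _ _)).
Qed.

Lemma is_derive_shift (V : normedModType R) (f : R -> V) (s t : R) df :
  is_derive (s + t) 1 f df -> is_derive t 1 (fun u => f (s + u)) df.
Proof.
move=> D; have [d e] := D.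
have := is_derive_line (f := f) (z := s) (v := 1) (s := t).
rewrite /GRing.scale /= mulr1 e => /(_ d) D3; apply: (is_derive_ext D3) => u.
by rewrite /GRing.scale /= mulr1.
Qed.

Lemma is_derive_unique (V : normedModType R) (f : R -> V) (t : R) (a b : V) :
  is_derive t 1 f a -> is_derive t 1 f b -> a = b.
Proof. by move=> h1 h2; rewrite -(@derive_val _ _ _ _ _ _ _ h1) (@derive_val _ _ _ _ _ _ _ h2). Qed.

(** Differentiability comes from Cramer's formula; the value then follows by differentiating the
    product of [A] with its inverse. *)
Lemma is_derive_invmx n (A : R -> 'M[R]_n) (t : R) (dA : 'M[R]_n) :
  is_derive t 1 A dA -> A t \in unitmx ->
  is_derive t 1 (fun u => invmx (A u)) (- (invmx (A t) *m dA *m invmx (A t))).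
Proof.
move=> hA Au; have hd := is_derive_det hA.
have dn0 : \det (A t) != 0 by rewrite -unitfE -unitmxE.
have near_u : \forall u \near t, A u \in unitmx.
  have := is_derive_cont hd => /(_ [set x | x != 0]) h.
  have : nbhs t [set u | \det (A u) != 0].
    by apply: h; apply: (open_nbhs_nbhs (conj _ _)) => //; exact: open_neq.
  by apply: filterS => u; rewrite unitmxE unitfE.
have hadj : exists E, is_derive t 1 (fun u => (\det (A u))^-1 *: \adj (A u)) E.
  suff H : forall i j, exists e, is_derive t 1 (fun u => ((\det (A u))^-1 *: \adj (A u)) i j) e.
    exists (\matrix_(i, j) projT1 (cid (H i j))); apply/derive_mxP => i j.
    by rewrite mxE; case: (cid _).
  move=> i j; have hm : is_derive t 1 (fun u => row' j (col' i (A u))) (row' j (col' i dA)).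
    apply/derive_mxP => a b; move/derive_mxP: hA => /(_ (lift j a) (lift i b)) D.
    by rewrite !mxE; apply: (is_derive_ext D) => u; rewrite !mxE.
  have h1 := is_deriveM' (is_derive_cst ((-1) ^+ (j + i) : R) t 1) (is_derive_det hm).
  have h2 := is_deriveM' (is_derive_inv hd dn0) h1.
  eexists; apply: (is_derive_ext h2) => u; rewrite !mxE /cofactor.
  by [].
have [E hE] := hadj.
have hI : is_derive t 1 (fun u => invmx (A u)) E.
  apply: near_eq_is_derive hE; apply: filterS near_u => u uu.
  by rewrite /invmx uu.
have h1 : is_derive t 1 (fun u => A u *m invmx (A u)) 0.
  apply: (near_eq_is_derive (f := cst 1%:M)) (is_derive_cst _ _ _).
  by apply: filterS near_u => u uu; rewrite mulmxV.
have e := is_derive_unique (is_derive_mulmx hA hI) h1.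
suff -> : - (invmx (A t) *m dA *m invmx (A t)) = E by [].
have := congr1 (mulmx (invmx (A t))) e; rewrite mulmxDr mulKmx // mulmx0 mulmxA => /eqP.
by rewrite addr_eq0 => /eqP ->; rewrite opprK.
Qed.

End DetDerive.

Lemma ulE (R : realType) n (A : 'M[R]_(n + n)) i j : ulsubmx A i j = A (lshift n i) (lshift n j).
Proof. by rewrite !mxE. Qed.

Lemma urE (R : realType) n (A : 'M[R]_(n + n)) i j : ursubmx A i j = A (lshift n i) (rshift n j).
Proof. by rewrite !mxE. Qed.

(** * The symplectic linearized flow and its two-point determinant *)

Section Jacobi.
Context {R : realType} (n k : nat).
Variables (U : set 'rV[R]_n) (F0 : 'rV[R]_n -> 'rV[R]_n) (F : 'I_k -> 'rV[R]_n -> 'rV[R]_n)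
  (Qp : 'rV[R]_n -> R).
Hypotheses (oU : open U) (sF0 : csmooth U F0)
  (sF : forall i, csmooth U (F i)) (sQ : smooth U Qp).
Local Notation hF := (hH F0 F Qp).
Local Notation DH := (Dfield hF).
Local Notation UF := (@UU R n U).
Variables (T : R) (zc : R -> 'rV[R]_(n + n)) (Ps : R -> 'M[R]_(n + n)).
Hypotheses (T0 : 0 < T) (zcU : forall t : R, `|t| < T -> UF (zc t))
  (dzc : forall t : R, `|t| < T -> is_derive t 1 zc (hF (zc t)))
  (Ps0 : Ps 0 = 1%:M) (dPs : forall t : R, `|t| < T -> is_derive t 1 Ps (Ps t *m DH (zc t))).

Local Notation A_ t := (drsubmx (DH (zc t))).
Local Notation X_ t := (XX F (rsubmx (zc t))).

Local Notation Om := (@symp_mx R n).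

Lemma OmT : Om^T = - Om.
Proof. by rewrite /symp_mx tr_block_mx opp_block_mx !trmx0 linearN /= trmx1 !oppr0 opprK. Qed.

Lemma OmOm : Om *m Om = - 1%:M.
Proof.
rewrite /symp_mx mulmx_block !mulmx0 !mul0mx !mulmx1 !mul1mx !addr0 !add0r.
by rewrite (scalar_mx_block n n (1 : R)) opp_block_mx !oppr0.
Qed.

Lemma DH_symp z : UF z -> DH z *m Om + Om *m (DH z)^T = 0.
Proof.
move=> Uz; rewrite (DHE oU sF0 sF sQ) // -mulmxA OmOm trmx_mul OmT (Hess_sym oU sF0 sF sQ) //.
by rewrite mulNmx !mulmxN mulmxA OmOm mulNmx mul1mx opprK mulmx1 addNr.
Qed.

Lemma symplectic t : `|t| < T -> Ps t *m Om *m (Ps t)^T = Om.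
Proof.
move=> tT; pose f (u : R) := Ps u *m Om *m (Ps u)^T.
have df (u : R) : `|u| < T -> is_derive u (1 : R) f 0.
  move=> uT; have h := is_derive_mulmx (is_derive_mulmx (dPs uT) (is_derive_cst Om u (1 : R)))
    (is_derive_trmx (dPs uT)).
  apply: is_derive_eq; rewrite mulmx0 addr0 trmx_mul.
  rewrite -!mulmxA -mulmxDr !mulmxA -mulmxDl.
  by rewrite DH_symp ?mul0mx ?mulmx0 //; exact: zcU.
have h : `|f t - f 0| <= 0 * `|t - 0|.
  apply: (mvt_norm (dF := fun=> 0)) => u hu; split; last by rewrite normr0.
  by apply: df; apply: between_norm hu => //; rewrite normr0.
move: h; rewrite mul0r normr_le0 subr_eq0 => /eqP; rewrite /f => ->.
by rewrite Ps0 trmx1 mul1mx mulmx1.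
Qed.

(** The inverse of [Ps s], by symplecticity, in a form linear in the entries of [Ps s], hence
    visibly smooth in [s]. *)
Definition symp_inv (s : R) : 'M[R]_(n + n) := Om *m (Ps s)^T *m Om^T.

Lemma PsGs t : `|t| < T -> Ps t *m symp_inv t = 1%:M.
Proof. by move=> tT; rewrite /symp_inv !mulmxA symplectic // OmT mulmxN OmOm opprK. Qed.

Lemma GsPs t : `|t| < T -> symp_inv t *m Ps t = 1%:M.
Proof. by move=> tT; apply: mulmx1C; exact: PsGs. Qed.

(** In the row convention, the derivative of the position at time [t] with respect to the covector
    at time [s]. *)
Definition Mst (s t : R) : 'M[R]_n := ursubmx (symp_inv s *m Ps t).
(** Index of the expansion of [det (Mst s t)] that separates [s] from [t]: a permutation and, for
    each row, the inner index of the product of [symp_inv s] with [Ps t]. *)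
Definition idx := ('S_n * {ffun 'I_n -> 'I_(n + n)})%type.
Definition phiJ (l : idx) (t : R) : R := (-1) ^+ l.1 * \prod_i Ps t (l.2 i) (rshift n (l.1 i)).
Definition psiJ (l : idx) (s : R) : R := \prod_i symp_inv s (lshift n i) (l.2 i).

Lemma DD_det s t : DD (index_enum idx) phiJ psiJ s t = \det (Mst s t).
Proof.
rewrite /DD /determinant -(pair_bigA _ (fun a b => phiJ (a, b) t * psiJ (a, b) s)) /=.
apply: eq_bigr => g _; rewrite /phiJ /psiJ /=.
transitivity ((-1) ^+ g * \prod_i \sum_l symp_inv s (lshift n i) l * Ps t l (rshift n (g i))).
  rewrite bigA_distr_bigA mulr_sumr /=; apply: eq_bigr => f _.
  by rewrite big_split /= -mulrA; congr (_ * _); rewrite mulrC.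
by congr (_ * _); apply: eq_bigr => i _; rewrite /Mst !mxE.
Qed.

Definition IT : set R := [set t : R | `|t| < T].

Lemma oIT : open IT. Proof. exact: open_absball. Qed.

Lemma smooth_zc (f : 'rV[R]_(n + n) -> R) : smooth UF f -> smooth IT (f \o zc).
Proof.
apply: (smooth_integral_curve (U := UF) (h := hF) (I := IT) (z := zc)).
- exact: oUU.
- exact: open_absball.
- exact: shH.
- by move=> t tT; split; [exact: zcU | exact: dzc].
Qed.

Lemma smooth_Ps i j : smooth IT (fun t => Ps t i j).
Proof.
apply: (smooth_linear_ode (I := IT) (S := fun t => DH (zc t)) (Y := Ps)) => //.
  exact: open_absball.
by move=> a b; exact: (smooth_zc (smooth_DH oU sF0 sF sQ a b)).
Qed.

Lemma smooth_Gs i j : smooth IT (fun t => symp_inv t i j).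
Proof.
rewrite (_ : (fun _ => _) = fun t => \sum_l Om^T l j *: \sum_a Om i a *: Ps t l a).
  apply: smooth_sum _ _ oIT _ => l; apply: (smoothZ _ oIT).
  apply: smooth_sum _ _ oIT _ => a; apply: (smoothZ _ oIT).
  exact: smooth_Ps.
apply/funext => t; rewrite /symp_inv mxE; apply: eq_bigr => l _; rewrite mulrC; congr (_ * _).
by rewrite mxE; apply: eq_bigr => a _; rewrite [(Ps t)^T _ _]mxE.
Qed.

Lemma smooth_phiJ l : smooth IT (phiJ l).
Proof.
by apply: (smoothZ _ oIT); apply: smooth_prod oIT _ => i; exact: smooth_Ps.
Qed.

Lemma smooth_psiJ l : smooth IT (psiJ l).
Proof. by apply: smooth_prod oIT _ => i; exact: smooth_Gs. Qed.

(** [symp_inv s *m Ps (s + t)] is the identity at [t = 0] and solves the linearized equation from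
    time [s] on; its two upper blocks are the [Lq] and [M] of [det_order]. *)
Lemma order_at (s : R) (w : 'I_n -> nat) (Xi : 'M[R]_n) : 0 <= s < T ->
  (forall a, (0 < w a)%N) -> Xi \in unitmx ->
  (forall a j, (j.+1 < w a)%N -> row a Xi *m (Xs F0 F Qp j (zc s))^T = 0) ->
  (forall (al : 'I_n -> R) i,
     \sum_(a | w a == i) al a *: (row a Xi *m (Xs F0 F Qp i.-1 (zc s))^T) = 0 ->
     forall a, w a = i -> al a = 0) ->
  exists2 c : R, 0 < c & lead (\sum_a (2 * w a).-1) c
     (fun t => DD (index_enum idx) phiJ psiJ s (s + t)).
Proof.
move=> /andP[s0 sT] w0 Xiu h1 h2; set d0 := (T - s) / 2.
have d00 : 0 < d0 by rewrite divr_gt0 ?subr_gt0.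
have inT (t : R) : 0 <= t <= d0 -> `|s + t| < T.
  by move=> /andP[t0 td]; rewrite ger0_norm ?addr_ge0 //; move: td sT; rewrite /d0; lra.
pose P (t : R) := symp_inv s *m Ps (s + t).
have dP (t : R) : 0 <= t <= d0 -> is_derive t (1 : R) P (P t *m DH (zc (s + t))).
  move=> td; have := is_derive_mulmx (is_derive_cst (symp_inv s) t 1) (is_derive_shift (dPs (inT _ td))).
  by rewrite mul0mx add0r mulmxA; apply.
(* On the interval this is minus the lower left block of [DH]. It is symmetrized because [det_order]
   asks for symmetry at every [t], including times where the extremal is not controlled. *)
pose Ct (t : R) : 'M[R]_n := - (2^-1 *: (dlsubmx (DH (zc (s + t))) + (dlsubmx (DH (zc (s + t))))^T)).
have CtE (t : R) : 0 <= t <= d0 -> Ct t = - dlsubmx (DH (zc (s + t))).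
  move=> td; rewrite /Ct (DH_dl oU sF0 sF sQ); last exact/zcU/inT.
  congr (- _); move: (dlsubmx _) => Y; rewrite scalerDr -scalerDl.
  by rewrite (_ : 2^-1 + 2^-1 = 1) ?scale1r //; field.
have blk (t : R) : 0 <= t <= d0 -> P t *m DH (zc (s + t)) = block_mx
   (- (ulsubmx (P t) *m (A_ (s + t))^T) - ursubmx (P t) *m Ct t)
   (ulsubmx (P t) *m ((X_ (s + t))^T *m X_ (s + t)) + ursubmx (P t) *m A_ (s + t))
   (dlsubmx (P t *m DH (zc (s + t)))) (drsubmx (P t *m DH (zc (s + t)))).
  move=> td; have Uz := zcU (inT _ td).
  rewrite -{1}[_ *m DH _]submxK; congr block_mx.
    rewrite -{1}[P t]submxK -{1}[DH _]submxK mulmx_block block_mxKul (DH_ul oU sF0 sF sQ) //.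
    by rewrite CtE // !mulmxN opprK.
  rewrite -{1}[P t]submxK -{1}[DH _]submxK mulmx_block block_mxKur.
  by rewrite (DH_ur oU sF0 sF sQ).
have dblk (t : R) : 0 <= t <= d0 -> is_derive t (1 : R) (fun t => ulsubmx (P t)) (ulsubmx (P t *m DH (zc (s + t)))) /\
    is_derive t (1 : R) (fun t => ursubmx (P t)) (ursubmx (P t *m DH (zc (s + t)))).
  move=> /dP /derive_mxP D; split; apply/derive_mxP => i j.
    by rewrite ulE; apply: (is_derive_ext (D (lshift n i) (lshift n j))) => u; rewrite ulE.
  by rewrite urE; apply: (is_derive_ext (D (lshift n i) (rshift n j))) => u; rewrite urE.
have cDH i j : {for 0, continuous (fun t : R => DH (zc (s + t)) i j)}.
  have D := smoothP (smooth_zc (smooth_DH oU sF0 sF sQ i j)) (t := s + 0).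
  have i0 : IT (s + 0) by rewrite /IT /= addr0 ger0_norm.
  exact: (is_derive_cont (is_derive_shift (D i0))).
have [c c0 hc] : exists2 c : R, 0 < c & lead (\sum_a (2 * w a).-1) c (fun t => \det (ursubmx (P t))).
  apply: (det_order (X_ := fun j t => Xs F0 F Qp j (zc (s + t))) (A := fun t => A_ (s + t))
    (C := Ct) (Lq := fun t => ulsubmx (P t)) d00 _ _ _ _ _ _ _ _ w0 Xiu).
  - move=> j t td; apply: (is_derive_shift (f := fun t => Xs F0 F Qp j (zc t))).
    by apply: (is_derive_Xs oU sF0 sF sQ); [apply/zcU/inT|apply/dzc/inT].
  - by move=> t td; have [D _] := dblk t td; rewrite blk // block_mxKul in D.
  - by move=> t td; have [_ D] := dblk t td; rewrite blk // block_mxKur in D.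
  - by rewrite /P addr0 GsPs ?ger0_norm // (scalar_mx_block n n (1 : R)) block_mxKul.
  - by rewrite /P addr0 GsPs ?ger0_norm // (scalar_mx_block n n (1 : R)) block_mxKur.
  - apply: bO_cont; apply: continuous_mx_at => i j.
    rewrite (_ : (fun _ => _) = fun t : R => DH (zc (s + t)) (rshift n i) (rshift n j)); first exact: cDH.
    by apply/funext => t; rewrite !mxE.
  - rewrite /Ct; apply: bON; apply: (bOZ (p := 0) (bO_cst _)); apply: bOD; [|apply: bO_tr];
    (apply: bO_cont; apply: continuous_mx_at => i j;
     rewrite (_ : (fun _ => _) = fun t : R => DH (zc (s + t)) (rshift n i) (lshift n j)); first exact: cDH);
    by apply/funext => t; rewrite !mxE.
  - by move=> t; rewrite /Ct linearN linearZ linearD /= trmxK addrC.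
  - by move=> a j ja; rewrite addr0; exact: h1.
  - by move=> al i; rewrite addr0; exact: h2.
by exists c => //; apply: (lead_ext _ hc) => t; rewrite DD_det.
Qed.

End Jacobi.

Lemma drE (R : realType) n (A : 'M[R]_(n + n)) i j : drsubmx A i j = A (rshift n i) (rshift n j).
Proof. by rewrite !mxE. Qed.

Lemma mx_block_ext (R : realType) n (A : 'M[R]_(n + n)) :
  A = block_mx (ulsubmx A) (ursubmx A) (dlsubmx A) (drsubmx A).
Proof. by rewrite submxK. Qed.

(** * The mixed logarithmic derivative of the two-point determinant *)

Section Trace.
Context {R : realType} (n k : nat).
Variables (U : set 'rV[R]_n) (F0 : 'rV[R]_n -> 'rV[R]_n) (F : 'I_k -> 'rV[R]_n -> 'rV[R]_n)
  (Qp : 'rV[R]_n -> R).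
Hypotheses (oU : open U) (sF0 : csmooth U F0)
  (sF : forall i, csmooth U (F i)) (sQ : smooth U Qp).
Local Notation hF := (hH F0 F Qp).
Local Notation DH := (Dfield hF).
Local Notation UF := (@UU R n U).
Variables (T : R) (zc : R -> 'rV[R]_(n + n)) (Ps : R -> 'M[R]_(n + n)).
Hypotheses (T0 : 0 < T) (zcU : forall t : R, `|t| < T -> UF (zc t))
  (dzc : forall t : R, `|t| < T -> is_derive t 1 zc (hF (zc t)))
  (Ps0 : Ps 0 = 1%:M) (dPs : forall t : R, `|t| < T -> is_derive t 1 Ps (Ps t *m DH (zc t))).
Local Notation Om := (@symp_mx R n).
Local Notation A_ t := (drsubmx (DH (zc t))).
Local Notation X_ t := (XX F (rsubmx (zc t))).
Local Notation psi := (psiJ Ps).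
Local Notation phi := (phiJ Ps).
Local Notation Gs := (symp_inv Ps).
Local Notation a t := (ulsubmx (Ps t)).
Local Notation b t := (ursubmx (Ps t)).
Local Notation c t := (dlsubmx (Ps t)).
Local Notation d t := (drsubmx (Ps t)).
Local Notation ls := (index_enum (idx n)).

Let n0T : `|0 : R| < T. Proof. by rewrite normr0. Qed.

Lemma OmOmT : Om *m Om^T = 1%:M.
Proof. by rewrite OmT mulmxN OmOm opprK. Qed.

Lemma Gs0 : Gs 0 = 1%:M.
Proof. by rewrite /symp_inv Ps0 trmx1 mulmx1 OmOmT. Qed.

Lemma DD0E t : DD ls phi psi 0 t = \det (b t).
Proof. by rewrite DD_det /Mst Gs0 mul1mx. Qed.

Lemma is_derive_Gs0 : is_derive (0 : R) 1 Gs (- DH (zc 0)).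
Proof.
have h := is_derive_mulmx (is_derive_mulmx (is_derive_cst Om (0 : R) 1)
  (is_derive_trmx (dPs n0T))) (is_derive_cst Om^T (0 : R) 1).
apply: is_derive_eq; rewrite mulmx0 addr0 mul0mx add0r Ps0 mul1mx.
have /eqP := DH_symp oU sF0 sF sQ (zcU n0T); rewrite addrC addr_eq0 => /eqP ->.
by rewrite mulNmx -mulmxA OmOmT mulmx1.
Qed.

Lemma D1_det t : D1 ls phi psi t = \tr (\adj (b t) *m ursubmx (- DH (zc 0) *m Ps t)).
Proof.
have h1 : is_derive (0 : R) 1 (fun s => DD ls phi psi s t) (D1 ls phi psi t).
  apply: (derive_sum_seq ls (f := fun l s => phi l t * psi l s)) => l.
  have D := smoothP (smooth_psiJ oU sF0 sF sQ zcU dzc dPs l) (n0T : IT T 0).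
  have := is_deriveM' (is_derive_cst (phi l t) (0 : R) 1) D.
  by rewrite mul0r add0r; apply.
have h2 : is_derive (0 : R) 1 (fun s => Mst Ps s t) (ursubmx (- DH (zc 0) *m Ps t)).
  have /derive_mxP D := is_derive_mulmx is_derive_Gs0 (is_derive_cst (Ps t) (0 : R) 1).
  rewrite mulmx0 addr0 in D.
  apply/derive_mxP => i j; rewrite urE.
  by apply: (is_derive_ext (D (lshift n i) (rshift n j))) => u; rewrite /Mst urE.
have h3 := is_derive_ext (is_derive_det h2) (fun s => esym (DD_det Ps s t)).
rewrite (is_derive_unique h1 h3); congr (\tr (\adj _ *m _)).
by rewrite /Mst Gs0 mul1mx.
Qed.

(** At [s = 0] the factor [symp_inv] is the identity with derivative [- DH (zc 0)]. By Jacobi's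
    formula and the block form of [DH], the dependence on [t] is confined to [d b^-1]. *)
Lemma D1_DD0 t : b t \in unitmx -> D1 ls phi psi t / DD ls phi psi 0 t =
  \tr (A_ 0) - \tr ((X_ 0)^T *m X_ 0 *m (d t *m invmx (b t))).
Proof.
move=> bu; have dn0 : \det (b t) != 0 by rewrite -unitfE -unitmxE.
have adjE : \adj (b t) = \det (b t) *: invmx (b t).
  by rewrite /invmx bu scalerA mulfV // scale1r.
rewrite D1_det DD0E.
have -> : ursubmx (- DH (zc 0) *m Ps t) = (A_ 0)^T *m b t - (X_ 0)^T *m X_ 0 *m d t.
  rewrite {1}[Ps t]mx_block_ext {1}[DH _]mx_block_ext opp_block_mx mulmx_block block_mxKur.
  rewrite (DH_ul oU sF0 sF sQ) ?(DH_ur oU sF0 sF sQ) ?opprK ?mulNmx //; exact: zcU.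
rewrite adjE -scalemxAl mxtraceZ mulrAC mulfV // mul1r mulmxBr linearB /=; congr (_ - _).
  by rewrite mxtrace_mulC -mulmxA mulmxV // mulmx1 mxtrace_tr.
by rewrite mxtrace_mulC mulmxA.
Qed.

(** Read off the blocks of the symplectic relation: [b^-1 a] is symmetric and [c b^T - d a^T] is
    minus the identity. *)
Lemma blocks_symp t : `|t| < T -> b t \in unitmx ->
  c t - d t *m invmx (b t) *m a t = - (invmx (b t))^T.
Proof.
move=> tT bu; have := symplectic oU sF0 sF sQ T0 zcU Ps0 dPs tT.
rewrite {1 2}[Ps t]mx_block_ext /symp_mx tr_block_mx !mulmx_block.
rewrite !mulmx0 !mulmx1 !mulmxN !mulmx1 !addr0 !add0r !mulNmx => /eq_block_mx[e1 e2 _ _].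
have but : (b t)^T \in unitmx by rewrite unitmx_tr.
have e1' : invmx (b t) *m a t = (a t)^T *m invmx (b t)^T.
  apply: (canRL (mulmxK but)); rewrite -mulmxA.
  move/eqP: e1; rewrite addrC subr_eq0 => /eqP ->.
  by rewrite mulKmx.
have e2' : c t *m (b t)^T - d t *m (a t)^T = - 1%:M.
  move: e2 => /(congr1 trmx); rewrite linearD linearN /= !trmx_mul !trmxK trmx1 => <-.
  by rewrite opprD opprK.
rewrite trmx_inv -mulmxA e1' mulmxA -[c t in LHS](mulmxK but) -mulmxBl e2'.
by rewrite mulNmx mul1mx.
Qed.

(** The derivative of [d b^-1] is [(c - d b^-1 a) X^T X b^-1]; the first factor is [- b^-T] by
    [blocks_symp], and cyclicity of the trace exhibits a sum of squares. *)
Lemma trace_identity t : `|t| < T -> b t \in unitmx ->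
  let Y := X_ 0 *m (invmx (b t))^T *m (X_ t)^T in
  is_derive t 1 (fun u => D1 ls phi psi u / DD ls phi psi 0 u) (\tr (Y *m Y^T)).
Proof.
move=> tT bu Y; have /derive_mxP D := dPs tT.
have db : is_derive t 1 (fun u => b u) (a t *m ((X_ t)^T *m X_ t) + b t *m A_ t).
  rewrite -(DH_ur oU sF0 sF sQ); last exact: zcU.
  apply/derive_mxP => i j; have -> : (a t *m ursubmx (DH (zc t)) + b t *m A_ t) =
    ursubmx (Ps t *m DH (zc t)).
    by rewrite [in RHS](mx_block_ext (Ps t)) [in RHS](mx_block_ext (DH (zc t))) mulmx_block block_mxKur.
  by rewrite urE; apply: (is_derive_ext (D (lshift n i) (rshift n j))) => u; rewrite urE.
have dd : is_derive t 1 (fun u => d u) (c t *m ((X_ t)^T *m X_ t) + d t *m A_ t).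
  rewrite -(DH_ur oU sF0 sF sQ); last exact: zcU.
  apply/derive_mxP => i j; have -> : (c t *m ursubmx (DH (zc t)) + d t *m A_ t) =
    drsubmx (Ps t *m DH (zc t)).
    by rewrite [in RHS](mx_block_ext (Ps t)) [in RHS](mx_block_ext (DH (zc t))) mulmx_block block_mxKdr.
  by rewrite drE; apply: (is_derive_ext (D (rshift n i) (rshift n j))) => u; rewrite drE.
have dE := is_derive_mulmx (is_derive_cst ((X_ 0)^T *m X_ 0) t 1)
  (is_derive_mulmx dd (is_derive_invmx db bu)).
have near_u : \forall u \near t, b u \in unitmx.
  have := is_derive_cont (is_derive_det db) => /(_ [set x | x != 0]) h0.
  have h : nbhs t [set u | \det (b u) != 0].
    by apply: h0; apply: open_nbhs_nbhs; split; [exact: open_neq|rewrite /= -unitfE -unitmxE].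
  by apply: filterS h => u; rewrite unitmxE unitfE.
apply: (near_eq_is_derive (f := fun u => \tr (A_ 0) - \tr ((X_ 0)^T *m X_ 0 *m (d u *m invmx (b u))))).
  by apply: filterS near_u => u uu; rewrite D1_DD0.
have dtr m (Z : R -> 'M[R]_m) (dZ : 'M[R]_m) : is_derive t 1 Z dZ ->
    is_derive t 1 (fun u => \tr (Z u)) (\tr dZ).
  move=> /derive_mxP hZ.
  exact: (derive_sum_seq (index_enum 'I_m) (f := fun i u => Z u i i) (fun i => hZ i i)).
have := is_deriveB (is_derive_cst (\tr (A_ 0)) t 1) (dtr _ _ _ dE).
rewrite mul0mx !add0r => D3; apply: is_derive_eq.
set B := (X_ t)^T *m X_ t; set B0 := (X_ 0)^T *m X_ 0.
have -> : (c t *m B + d t *m A_ t) *m invmx (b t) +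
    d t *m (- (invmx (b t) *m (a t *m B + b t *m A_ t) *m invmx (b t))) =
    (c t - d t *m invmx (b t) *m a t) *m B *m invmx (b t).
  rewrite mulmxN !mulmxA -mulmxBl; congr (_ *m _).
  rewrite mulmxDr !mulmxA mulmxKV // opprD addrACA subrr addr0.
  by rewrite -2!mulmxBl.
rewrite blocks_symp // !mulNmx mulmxN linearN opprK /=.
rewrite /Y /B /B0 !trmx_mul !trmxK !mulmxA [RHS]mxtrace_mulC !mulmxA.
by [].
Qed.

End Trace.

(** * Integration of essentially bounded measurable functions *)

Section Lebesgue.
Context {R : realType}.
Local Notation leb := (@lebesgue_measure R).
Local Notation int a b f := (\int[leb]_(s in `[a, b]) f s).
Implicit Types f g : R -> R.

Lemma aeS (P Q : R -> Prop) : {ae leb, forall x, P x} -> (forall x, P x -> Q x) ->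
  {ae leb, forall x, Q x}.
Proof. by move=> hP h; apply: filterS hP => //; exact: (ae_filter_ringOfSetsType leb). Qed.

Lemma aeS2 (P P' Q : R -> Prop) : {ae leb, forall x, P x} -> {ae leb, forall x, P' x} ->
  (forall x, P x -> P' x -> Q x) -> {ae leb, forall x, Q x}.
Proof. by move=> hP hP' h; apply: filterS2 hP hP' => //; exact: (ae_filter_ringOfSetsType leb). Qed.

(** The regularity of admissible controls. It is stable under sums and products and implies
    integrability. *)
Definition bint (a b : R) (f : R -> R) : Prop :=
  measurable_fun `[a, b] f /\
  exists B : R, {ae leb, forall t, a <= t <= b -> `|f t| <= B}.

Lemma bint_sub a b c d f : a <= c -> d <= b -> bint a b f -> bint c d f.
Proof.
move=> ac db [mf [B hB]]; split.
  apply: measurable_funS mf => //= t /=; rewrite !in_itv /= => /andP[h1 h2].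
  by rewrite (le_trans ac h1) (le_trans h2 db).
exists B; apply: (aeS hB) => t h /andP[h1 h2]; apply: h.
by rewrite (le_trans ac h1) (le_trans h2 db).
Qed.

Lemma bint_ext a b f g : (forall t, a <= t <= b -> f t = g t) -> bint a b f -> bint a b g.
Proof.
move=> h [mf [B hB]]; split.
  by apply: eq_measurable_fun mf => t; rewrite inE /= in_itv /= => /h.
by exists B; apply: (aeS hB) => t hf ht; rewrite -h //; exact: hf.
Qed.

Lemma bintD a b f g : bint a b f -> bint a b g -> bint a b (fun t => f t + g t).
Proof.
move=> [mf [B hB]] [mg [C hC]]; split; first exact: measurable_funD.
exists (B + C); apply: (aeS2 hB hC) => t hf hg ht.
by rewrite (le_trans (ler_normD _ _)) // lerD ?hf ?hg.
Qed.

Lemma bintM a b f g : bint a b f -> bint a b g -> bint a b (fun t => f t * g t).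
Proof.
move=> [mf [B hB]] [mg [C hC]]; split; first exact: measurable_funM.
exists (B * C); apply: (aeS2 hB hC) => t hf hg ht.
by rewrite normrM ler_pM ?hf ?hg.
Qed.

Lemma bint_cst a b (c : R) : bint a b (fun=> c).
Proof. by split; [exact: measurable_cst|exists `|c|; apply: aeW]. Qed.

Lemma bintZ a b (c : R) f : bint a b f -> bint a b (fun t => c * f t).
Proof. by apply: bintM; exact: bint_cst. Qed.

Lemma bintB a b f g : bint a b f -> bint a b g -> bint a b (fun t => f t - g t).
Proof.
move=> bf bg; apply: (bint_ext (f := fun t => f t + (-1) * g t)).
  by move=> t _; rewrite mulN1r.
by apply: bintD bf _; exact: bintZ.
Qed.

Lemma bint_norm a b f : bint a b f -> bint a b (fun t => `|f t|).
Proof.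
move=> [mf [B hB]]; split; first exact: measurableT_comp mf.
by exists B; apply: (aeS hB) => t h ht; rewrite normr_id; exact: h.
Qed.

Lemma bint_sum a b (I : Type) (s : seq I) (f : I -> R -> R) :
  (forall i, bint a b (f i)) -> bint a b (fun t => \sum_(i <- s) f i t).
Proof.
move=> h; elim: s => [|i s IH].
  by apply: (bint_ext (f := fun=> 0)) (bint_cst _ _ _) => t _; rewrite big_nil.
apply: (bint_ext (f := fun t => f i t + \sum_(i <- s) f i t)); last exact: bintD.
by move=> t _; rewrite big_cons.
Qed.

Lemma bint_cont a b f : (forall t, a <= t <= b -> {for t, continuous f}) -> bint a b f.
Proof.
move=> cf; have wf : {within `[a, b], continuous f}.
  by apply: continuous_in_subspaceT => t; rewrite inE /= in_itv /=; exact: cf.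
split; first exact: subspace_continuous_measurable_fun.
have [ab|ba] := leP a b; last first.
  by exists 0; apply: aeW => t /andP[h1 h2]; move: (le_lt_trans h2 ba); rewrite ltNge h1.
have wn : {within `[a, b], continuous (fun t => `|f t|)}.
  apply: continuous_in_subspaceT => t; rewrite inE /= in_itv /= => /cf ct.
  by apply: (continuous_comp ct); exact: norm_continuous.
have [c _ hc] := EVT_max ab wn.
by exists `|f c|; apply: aeW => t ht; apply: hc; rewrite in_itv.
Qed.

Lemma bint_le a b f : bint a b f -> exists B : R, 0 <= B /\
  forall s t, a <= s -> s <= t -> t <= b ->
   (\int[leb]_(x in `[s, t]) (`|f x|%:E) <= (B * (t - s))%:E)%E.
Proof.
move=> [mf [B hB]]; exists `|B|; split=> // s t as_ st tb.
have mfs : measurable_fun `[s, t] f.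
  apply: measurable_funS mf => //= x /=; rewrite !in_itv /= => /andP[h1 h2].
  by rewrite (le_trans as_ h1) (le_trans h2 tb).
apply: (@le_trans _ _ (\int[leb]_(x in `[s, t]) (`|B|%:E))%E).
  apply: ae_ge0_le_integral => //.
  - by apply/measurable_EFinP; exact: measurableT_comp mfs.
  - apply: (aeS hB) => x h /=; rewrite in_itv /= => /andP[h1 h2]; rewrite lee_fin.
    by rewrite (le_trans (h _)) ?ler_norm // (le_trans as_ h1) (le_trans h2 tb).
rewrite integral_cst //= lebesgue_measure_itv /= lte_fin.
case: ltP => h; first by rewrite -EFinB -EFinM.
by rewrite mule0 lee_fin mulr_ge0 // subr_ge0.
Qed.

Lemma bint_int a b f : bint a b f -> leb.-integrable `[a, b] (EFin \o f).
Proof.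
move=> bf; have [ab|ba] := leP a b; last first.
  by rewrite set_itv_ge ?bnd_simp -?ltNge //; exact: integrable_set0.
have [B [_ /(_ a b (lexx _) ab (lexx _)) hB]] := bint_le bf.
apply/integrableP; split; first by apply/measurable_EFinP; case: bf.
by apply: le_lt_trans hB _; rewrite ltry.
Qed.

Lemma Rint_bnd a b f : bint a b f -> exists B : R, 0 <= B /\
  forall s t, a <= s -> s <= t -> t <= b -> int s t (fun x => `|f x|) <= B * (t - s).
Proof.
move=> bf; have [B [B0 h]] := bint_le bf; exists B; split=> // s t as_ st tb.
have bst := bint_sub as_ tb bf.
rewrite -lee_fin; apply: le_trans (h s t as_ st tb).
rewrite /Rintegral fineK //; apply: integrable_fin_num => //.
exact: (bint_int (bint_norm bst)).
Qed.

Lemma RintD a b f g : bint a b f -> bint a b g ->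
  int a b (fun t => f t + g t) = int a b f + int a b g.
Proof. by move=> bf bg; apply: RintegralD => //; exact: bint_int. Qed.

Lemma RintZ a b (c : R) f : bint a b f -> int a b (fun t => c * f t) = c * int a b f.
Proof. by move=> bf; apply: RintegralZl => //; exact: bint_int. Qed.

Lemma RintB a b f g : bint a b f -> bint a b g ->
  int a b (fun t => f t - g t) = int a b f - int a b g.
Proof. by move=> bf bg; apply: RintegralB => //; exact: bint_int. Qed.

Lemma Rint_le a b f g : bint a b f -> bint a b g ->
  (forall t, a <= t <= b -> f t <= g t) -> int a b f <= int a b g.
Proof.
by move=> bf bg h; apply: le_Rintegral => //; exact: bint_int.
Qed.

Lemma Rint_ext a b f g : (forall t, a <= t <= b -> f t = g t) -> int a b f = int a b g.
Proof. by move=> h; apply: eq_Rintegral => t; rewrite inE /= in_itv /=; exact: h. Qed.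

Lemma Rint_norm a b f : bint a b f -> `|int a b f| <= int a b (fun t => `|f t|).
Proof. by move=> bf; apply: le_normr_Rintegral => //; exact: bint_int. Qed.

Lemma Rint_cst a b (c : R) : a <= b -> int a b (fun=> c) = c * (b - a).
Proof.
move=> ab; rewrite Rintegral_cst //= lebesgue_measure_itv /= lte_fin.
case: ltP => h /=; first by [rewrite -?EFinB].
by have -> : b = a by [apply/eqP; rewrite eq_le h ab]; rewrite subrr.
Qed.

Lemma Rint_ge0 a b f : (forall t, a <= t <= b -> 0 <= f t) -> 0 <= int a b f.
Proof. by move=> h; apply: Rintegral_ge0 => t /=; rewrite in_itv /=; exact: h. Qed.

Lemma Rint_aa a f : int a a f = 0.
Proof. by rewrite set_itv1 Rintegral_set1. Qed.

Lemma Rint_split a c b f : a <= c -> c <= b -> bint a b f ->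
  int a b f = int a c f + int c b f.
Proof.
move=> ac cb bf; have := @Rintegral_itvB R f (BLeft a) (BRight b) c (bint_int bf).
rewrite !bnd_simp => /(_ ac cb) E.
have <- := @Rintegral_itv_obnd_cbnd R c (BRight b) f.
  by rewrite -E addrC subrK.
apply: (integrableS _ _ _ (bint_int (bint_sub ac (lexx b) bf))) => //.
by move=> t /=; rewrite !in_itv /= => /andP[/ltW -> ->].
Qed.

Lemma bint_glue a c b f : a <= c -> c <= b -> bint a c f -> bint c b f -> bint a b f.
Proof.
move=> ac cb [m1 [B1 h1]] [m2 [B2 h2]]; split.
  have -> : `[a, b]%classic = `[a, c]%classic `|` `[c, b]%classic.
    apply/seteqP; split => t /=; rewrite !in_itv /=.
      by move=> /andP[h3 h4]; case: (leP t c) => h5; [left|right]; rewrite ?h3 ?h4 ?(ltW h5).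
    by case=> /andP[h3 h4]; rewrite ?h3 ?h4 ?(le_trans h4 cb) ?(le_trans ac h3).
  by apply/measurable_funU.
exists (Num.max B1 B2); apply: (aeS2 h1 h2) => t e1 e2 /andP[h3 h4].
by rewrite le_max; case: (leP t c) => h5; [rewrite e1 ?h3|rewrite e2 ?(ltW h5) ?h4 ?orbT].
Qed.

Lemma Rint_shrink a c b f : a <= c -> c <= b -> bint a b f ->
  (forall t, a <= t <= b -> 0 <= f t) -> int a c f <= int a b f.
Proof.
move=> ac cb bf h; rewrite (Rint_split ac cb bf) lerDl; apply: Rint_ge0 => t /andP[h1 h2].
by apply: h; rewrite h2 (le_trans ac h1).
Qed.

(** Cutting [[0, s]] into [N] equal pieces bounds the total increment by [C s^2 / N], for every
    [N]. *)
Lemma quadratic_increments (f : R -> R) (s C : R) : 0 <= s -> 0 <= C ->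
  (forall u v, 0 <= u -> u <= v -> v <= s -> `|f v - f u| <= C * (v - u) ^+ 2) -> f s = f 0.
Proof.
move=> s0 C0 h; apply/eqP; rewrite -subr_eq0 -normr_le0 leNgt; apply/negP => e0.
set e := `|_| in e0.
have E0 : 0 <= C * s ^+ 2 / e.
  by apply: divr_ge0; [apply: mulr_ge0; rewrite ?sqr_ge0|exact: ltW].
have [N hN] : exists N : nat, C * s ^+ 2 / e < N%:R.
  by exists (Num.bound (C * s ^+ 2 / e)); exact: archi_boundP.
have N0 : (0 : R) < N%:R by exact: le_lt_trans hN.
have [d d0 dN] : exists2 d, 0 <= d & N%:R * d = s.
  exists (s / N%:R); first by rewrite divr_ge0 // ltW.
  by rewrite mulrCA mulfV ?mulr1 // gt_eqF.
have H j : (j <= N)%N -> `|f (j%:R * d) - f 0| <= j%:R * (C * d ^+ 2).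
  elim: j => [|j IH] jN; first by rewrite !mul0r subrr normr0.
  have hj : j.+1%:R * d <= s by rewrite -dN ler_wpM2r // ler_nat.
  have e1 : j.+1%:R * d = j%:R * d + d by rewrite -natr1 mulrDl mul1r.
  have := h (j%:R * d) (j.+1%:R * d); rewrite e1 [_ + d - _]addrC addKr => /(_ _ _ _).
  move=> h2; have {}h2 : `|f (j%:R * d + d) - f (j%:R * d)| <= C * d ^+ 2.
    by apply: h2; rewrite ?mulr_ge0 ?ler0n ?lerDl // -e1.
  have {}IH := IH (ltnW jN).
  have -> : f (j%:R * d + d) - f 0 = (f (j%:R * d + d) - f (j%:R * d)) + (f (j%:R * d) - f 0) by ring.
  rewrite -natr1 mulrDl mul1r [leRHS]addrC; apply: le_trans (ler_normD _ _) _.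
  exact: lerD.
have := H N (leqnn _); rewrite dN -/e => h1.
have : e * N%:R <= C * s ^+ 2.
  apply: le_trans (ler_wpM2r (ltW N0) h1) _.
  by rewrite -dN exprMn (_ : N%:R * (C * d ^+ 2) * N%:R = C * (N%:R ^+ 2 * d ^+ 2)) //; ring.
rewrite mulrC -ler_pdivlMr // => h3.
by move: (lt_le_trans hN h3); rewrite ltxx.
Qed.

(** [X] is only the integral of a bounded measurable function and may fail to be differentiable.
    Both sides are therefore compared through their increments over [[u, v]], which differ by
    [O((v - u)^2)], and [quadratic_increments] concludes. *)
Lemma Rint_parts (P dP X w : R -> R) (s : R) : 0 <= s ->
  (forall t : R, 0 <= t <= s -> is_derive t (1 : R) P (dP t)) ->
  (forall t, 0 <= t <= s -> {for t, continuous dP}) ->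
  bint 0 s w -> (forall t, 0 <= t <= s -> X t = X 0 + int 0 t w) ->
  bint 0 s X ->
  P s * X s - P 0 * X 0 = int 0 s (fun t => P t * w t + dP t * X t).
Proof.
move=> s0 hP cdP bw hX bX.
have bP : bint 0 s P by apply: bint_cont => t /hP; exact: is_derive_cont.
have bdP := bint_cont cdP.
have bint1 : bint 0 s (fun t => P t * w t + dP t * X t) by apply: bintD; exact: bintM.
have [L L0 hL] : exists2 L, 0 <= L & forall t, 0 <= t <= s -> `|dP t| <= L.
  have wn : {within `[0, s], continuous (fun t => `|dP t|)}.
    apply: continuous_in_subspaceT => t; rewrite inE /= in_itv /= => /cdP ct.
    by apply: (continuous_comp ct); exact: norm_continuous.
  by have [c _ hc] := EVT_max s0 wn; exists `|dP c|.
have [B [B0 hB]] := Rint_bnd bw.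
pose Phi (t : R) := P t * X t - int 0 t (fun t => P t * w t + dP t * X t).
suff : Phi s = Phi 0.
  by rewrite /Phi Rint_aa subr0 => /eqP; rewrite subr_eq => /eqP ->; rewrite addrC addKr.
apply: (@quadratic_increments _ s (L * B + L * B)) => //; first by rewrite addr_ge0 ?mulr_ge0.
move=> u v u0 uv vs; have us := le_trans uv vs; have v0 := le_trans u0 uv.
have bsub (f : R -> R) : bint 0 s f -> bint u v f by exact: bint_sub.
have b0v (f : R -> R) : bint 0 s f -> bint 0 v f by exact: bint_sub.
have hu : 0 <= u <= s by rewrite u0 us.
have hv : 0 <= v <= s by rewrite v0 vs.
have dX (a b : R) : u <= a -> a <= b -> b <= v -> X b - X a = int a b w.
  move=> ua ab bv; have h1 := le_trans u0 ua; have h2 := le_trans bv vs.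
  rewrite (hX b) ?(hX a) ?h1 ?h2 ?(le_trans h1 ab) ?(le_trans ab h2) //.
  rewrite (Rint_split h1 ab); last exact: bint_sub bw.
  by rewrite opprD addrACA subrr add0r addrC addKr.
have lX (a b : R) : u <= a -> a <= b -> b <= v -> `|X b - X a| <= B * (b - a).
  move=> ua ab bv; rewrite dX //; have h1 := le_trans u0 ua; have h2 := le_trans bv vs.
  by apply: le_trans (Rint_norm _) (hB _ _ h1 ab h2); exact: bint_sub bw.
have FTC (t : R) : 0 <= t <= s -> int 0 t dP = P t - P 0.
  move=> /andP[t0 ts]; apply: Rint_FTC => //.
    by move=> x /andP[x0 xt]; apply: hP; rewrite x0 (le_trans xt).
  apply: continuous_in_subspaceT => x; rewrite inE /= in_itv /= => /andP[x0 xt].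
  by apply: cdP; rewrite x0 (le_trans xt).
have dPuv : P v - P u = int u v dP.
  have := FTC _ hv; rewrite (Rint_split u0 uv (b0v _ bdP)) FTC // => e.
  by move: e; move: (int u v dP) => x e; lra.
have -> : Phi v - Phi u = int u v (fun t => (P u - P t) * w t + dP t * (X v - X t)).
  have -> : int u v (fun t => (P u - P t) * w t + dP t * (X v - X t)) =
      int u v (fun t => (P u * w t + X v * dP t) - (P t * w t + dP t * X t)).
    by apply: Rint_ext => t _; ring.
  have e0 : int u v (fun t => P u * w t + X v * dP t) = P u * (X v - X u) + X v * (P v - P u).
    rewrite RintD; try by apply: bintZ; exact: bsub.
    by rewrite RintZ ?RintZ -?dPuv ?dX //; exact: bsub.
  rewrite RintB; last exact: bsub.
    rewrite e0 /Phi (Rint_split u0 uv (b0v _ bint1)).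
    by ring.
  by apply: bintD; apply: bintZ; exact: bsub.
have lP (t : R) : u <= t <= v -> `|P u - P t| <= L * (v - u).
  move=> /andP[ut tv]; rewrite distrC.
  apply: (le_trans (mvt_real (df := dP) (K := L) _)); last first.
    by rewrite ler_wpM2l // ger0_norm ?subr_ge0 // lerD2r.
  move=> x /(between_le _ ut)/andP[ux xt].
  have hx : 0 <= x <= s by rewrite (le_trans u0 ux) (le_trans xt (le_trans tv vs)).
  by split; [exact: hP|exact: hL].
have bE : bint u v (fun t => (P u - P t) * w t + dP t * (X v - X t)).
  apply: bintD; apply: bintM; try exact: bsub; apply: bintB; try exact: bsub; exact: bint_cst.
apply: le_trans (Rint_norm bE) _.
apply: (@le_trans _ _ (int u v (fun t => L * (v - u) * `|w t| + L * (B * (v - u))))).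
  apply: Rint_le; first exact: bint_norm.
    by apply: bintD; [apply: bintZ; apply: bint_norm; exact: bsub|exact: bint_cst].
  move=> t ht; have /andP[ut tv] := ht.
  rewrite (le_trans (ler_normD _ _)) // !normrM lerD ?ler_pM ?ler_wpM2r ?lP //.
    by apply: hL; rewrite (le_trans u0 ut) (le_trans tv vs).
  apply: le_trans (lX _ _ ut tv (lexx _)) _; rewrite ler_wpM2l //.
  by rewrite lerD2l lerN2.
have bw' : bint u v (fun t => `|w t|) by apply: bint_norm; exact: bsub.
rewrite RintD; last exact: bint_cst.
  rewrite (Rint_cst _ uv) RintZ //.
  have := hB u v u0 uv vs; have : 0 <= L * (v - u) by rewrite mulr_ge0 // subr_ge0.
  move=> h1 h2.
  apply: le_trans (lerD (ler_wpM2l h1 h2) (lexx _)) _.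
  by rewrite (_ : L * (v - u) * (B * (v - u)) + L * (B * (v - u)) * (v - u) = (L * B + L * B) * (v - u) ^+ 2) //; ring.
exact: bintZ.
Qed.

End Lebesgue.

Notation field_bounds U h z0 r K := (forall a b c : matrix _ 1 _,
    `|a - z0| <= r -> `|b - z0| <= r -> `|c - z0| <= r ->
    [/\ U a, `|h a| <= K, `|h a - h b| <= K * `|a - b|, `|(b - a) *m Dfield h c| <= K * `|b - a| &
     `|h a - h b - (a - b) *m Dfield h c| <= K * (`|a - c| + `|b - c|) * `|a - b| ]) (only parsing).

(** Banach's theorem in a ball: the first step has length at most [rho / 2] and later ones halve, so
    the iterates never leave the ball where [G] contracts. *)
Lemma contraction_fix (R : realType) n (G : 'rV[R]_n -> 'rV[R]_n) (q0 : 'rV[R]_n) (rho : R) :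
  2 * `|G q0 - q0| <= rho ->
  (forall q q', `|q - q0| <= rho -> `|q' - q0| <= rho -> `|G q - G q'| <= 2^-1 * `|q - q'|) ->
  exists q, `|q - q0| <= 2 * `|G q0 - q0| /\ G q = q.
Proof.
move=> hr hG; set C := `|G q0 - q0| in hr *; have C0 : 0 <= C by rewrite normr_ge0.
pose u k := iter k G q0.
have p2 k : (0 : R) < 2 ^+ k by rewrite exprn_gt0.
have H k : `|u k - q0| <= 2 * C - 2 * C / 2 ^+ k /\ `|u k.+1 - u k| <= C / 2 ^+ k.
  elim: k => [|k [IH1 IH2]].
    by rewrite subrr normr0 expr0 divr1 subrr divr1.
  have e2 : 2 * C / 2 ^+ k.+1 = C / 2 ^+ k.
    by rewrite exprS invfM; field; rewrite expf_neq0.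
  have b k' : `|u k' - q0| <= 2 * C - 2 * C / 2 ^+ k' -> `|u k' - q0| <= rho.
    move=> h; apply: le_trans h (le_trans _ hr); rewrite gerBl.
    by apply: divr_ge0; [apply: mulr_ge0|exact: ltW].
  have h1 : `|u k.+1 - q0| <= 2 * C - 2 * C / 2 ^+ k.+1.
    rewrite -(subrKA (u k)); apply: le_trans (ler_normD _ _) _.
    apply: le_trans (lerD IH2 IH1) _; rewrite e2 -mulrA.
    by move: (C / _) => x; lra.
  split=> //; have := hG _ _ (b _ h1) (b _ IH1) => h2.
  have {}h2 : `|u k.+2 - u k.+1| <= 2^-1 * `|u k.+1 - u k| by exact: h2.
  apply: le_trans h2 _; apply: le_trans (ler_wpM2l _ IH2) _ => //.
  by rewrite exprS invfM mulrCA.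
have [l hl] := cauchy_seq_mx C0 (fun k => (H k).2).
have lq : `|l - q0| <= 2 * C.
  have := hl 0%N; rewrite expr0 divr1 /= distrC; exact.
exists l; split=> //; apply/eqP; rewrite -subr_eq0 -normr_le0.
rewrite leNgt; apply/negP => e0.
have [N hN] := geo_small (mulr_ge0 (ler0n _ 4) C0) e0.
have := hN N (leqnn _) => {}hN.
have uq : `|u N - q0| <= rho.
  have [h _] := H N; apply: le_trans h (le_trans _ hr); rewrite gerBl.
  by apply: divr_ge0; [apply: mulr_ge0|exact: ltW].
have h1 := hG l (u N) (le_trans lq hr) uq.
have h2 := hl N; have h3 := hl N.+1.
have h4 : `|G l - l| <= `|G l - G (u N)| + `|u N.+1 - l|.
  by rewrite -(subrKA (G (u N))) ler_normD.
rewrite distrC in h2.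
have e2 : 2 * C / 2 ^+ N.+1 = 2^-1 * (2 * C / 2 ^+ N) by rewrite exprS invfM; move: (2 ^+ N)^-1 => x; ring.
have e4 : 4 * C / 2 ^+ N = 2 * (2 * C / 2 ^+ N) by rewrite -!mulrA; move: (C / _) => x; ring.
rewrite e2 in h3; rewrite e4 in hN.
have : 0 < `|G l - l| by [].
move: h1 h2 h3 h4 hN; move: (2 * C / 2 ^+ N) `|G l - G _| `|l - _| `|_ - l| `|G l - l| => *; lra.
Qed.

Section Halves.
Context {R : realType} (n : nat).

Lemma norm_rsubmx (v : 'rV[R]_(n + n)) : `|rsubmx v| <= `|v|.
Proof. by apply: mx_norm_leP => // i j; rewrite mxE mx_entry_le. Qed.

Lemma norm_lsubmx (v : 'rV[R]_(n + n)) : `|lsubmx v| <= `|v|.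
Proof. by apply: mx_norm_leP => // i j; rewrite mxE mx_entry_le. Qed.

Lemma norm_row_mx (u v : 'rV[R]_n) : `|row_mx u v| <= `|u| + `|v|.
Proof.
apply: mx_norm_leP => [|i j]; first by rewrite addr_ge0.
rewrite mxE; case: splitP => j' _; apply: le_trans (mx_entry_le _ _ _) _.
  by rewrite lerDl.
by rewrite lerDr.
Qed.

Lemma row_mxB (a b c d : 'rV[R]_n) : row_mx a b - row_mx c d = row_mx (a - c) (b - d).
Proof. by rewrite opp_row_mx add_row_mx. Qed.

Lemma rsub_mul (a c : 'rV[R]_n) (P : 'M[R]_(n + n)) :
  rsubmx (row_mx a c *m P) = a *m ursubmx P + c *m drsubmx P.
Proof. by rewrite -{1}[P]submxK mul_row_block row_mxKr. Qed.

Lemma lsub_mul (a c : 'rV[R]_n) (P : 'M[R]_(n + n)) :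
  lsubmx (row_mx a c *m P) = a *m ulsubmx P + c *m dlsubmx P.
Proof. by rewrite -{1}[P]submxK mul_row_block row_mxKl. Qed.

Lemma rsubB (u v : 'rV[R]_(n + n)) : rsubmx (u - v) = rsubmx u - rsubmx v.
Proof. by rewrite linearB. Qed.

Lemma lsubB (u v : 'rV[R]_(n + n)) : lsubmx (u - v) = lsubmx u - lsubmx v.
Proof. by rewrite linearB. Qed.

End Halves.

Lemma half_absorb (R : realFieldType) (x a b : R) : x <= a + b -> a <= 2^-1 * x -> x <= 2 * b.
Proof. lra. Qed.

(** * Extremals that end at a prescribed position *)

Section Extremals.
Context {R : realType} (n : nat) (U : set 'rV[R]_(n + n)) (h : 'rV[R]_(n + n) -> 'rV[R]_(n + n)).
Hypotheses (oU : open U) (sh : csmooth U h).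
Variables (q0 y0 : 'rV[R]_n) (r K T : R) (Phi : 'rV[R]_(n + n) -> R -> 'rV[R]_(n + n)) (Ps : R -> 'M[R]_(n + n)).
Local Notation z0 := (row_mx q0 y0).
Hypotheses (r0 : 0 < r) (K0 : 0 < K) (T0 : 0 < T) (KT : K * T <= 2^-1).
Hypothesis est : field_bounds U h z0 r K.
Hypothesis HPhi : flow_bounds R h z0 r K T Phi.
Hypotheses (Ps0 : Ps 0 = 1%:M)
  (dPs : forall t : R, `|t| < T -> is_derive t 1 Ps (Ps t *m Dfield h (Phi z0 t))).

Let z00 : `|z0 - z0| <= r / 2. Proof. by rewrite subrr normr0 divr_ge0 // ltW. Qed.

Lemma Phi_solves z t : `|z - z0| <= r / 2 -> `|t| < T -> solves h z0 r 0 t (Phi z).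
Proof.
move=> hz tT u hu; have uT : `|u| < T by apply: between_norm hu => //; rewrite normr0.
by have [_ /(_ u uT)[_ []]] := HPhi hz.
Qed.

Lemma Phi_lip z w t : `|z - z0| <= r / 2 -> `|w - z0| <= r / 2 -> `|t| < T ->
  `|Phi z t - Phi w t| <= 2 * `|z - w|.
Proof.
move=> hz hw tT.
have := solves_lip K0 est (z := Phi z) (w := Phi w) (s := 0) (t := t).
rewrite subr0 (HPhi hz).1 (HPhi hw).1; apply; try exact: Phi_solves.
by apply: le_trans KT; rewrite ler_wpM2l // ltW.
Qed.

Lemma Phi_time z s t : `|z - z0| <= r / 2 -> `|s| < T -> `|t| < T ->
  `|Phi z s - Phi z t| <= K * `|s - t|.
Proof.
move=> hz sT tT; apply: (mvt_norm (dF := fun u => h (Phi z u))) => u hu.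
have uT : `|u| < T by exact: between_norm hu.
have [_ /(_ u uT)[_ [h1 h2]]] := HPhi hz; split=> //.
by have [] := est h1 h1 h1.
Qed.

Variable t : R.
Hypothesis tT : `|t| < T.

(** [solves_strict] is made small by taking both states near [z0]; continuity of [Ps] then lets the
    single matrix [Ps t] serve for all times near [t]. Each effect uses half of [kappa]. *)
Lemma strict_near (kappa : R) : 0 < kappa -> exists2 rho, 0 < rho &
  forall z w s, `|z - z0| <= rho -> `|w - z0| <= rho -> `|s - t| <= rho ->
   [/\ `|s| < T, `|z - z0| <= r / 2, `|w - z0| <= r / 2 &
   `|Phi z s - Phi w s - (z - w) *m Ps t| <= kappa * `|z - w| ].
Proof.
move=> k0; set m := ((n + n)%:R : R).
have m0 : 0 < m + 1 by rewrite ltr_wpDl // ler0n.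
have cPs := is_derive_cont (dPs tT).
have km0 : 0 < kappa / 2 / (m + 1) by rewrite !divr_gt0.
have [d1 d10 hd1] := (cont_epsP _ _).1 cPs _ km0.
set d2 := kappa / 2 / (16 * K * T).
have d20 : 0 < d2 by rewrite !divr_gt0 ?mulr_gt0.
set d3 := (T - `|t|) / 2; have d30 : 0 < d3 by rewrite divr_gt0 // subr_gt0.
have r20 : 0 < r / 2 by rewrite divr_gt0.
have [e1 e10 [e11 e12]] := near_min2 d10 d20.
have [e2 e20 [e21 e22]] := near_min2 d30 r20.
have [e e0 [ee1 ee2]] := near_min2 e10 e20.
exists e => // z w s hz hw hs.
have sT : `|s| < T.
  rewrite -[s](subrK t); apply: le_lt_trans (ler_normD _ _) _.
  have := le_trans hs (le_trans ee2 e21); rewrite /d3; move: `|s - t| `|t| tT => a b; lra.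
have hz2 := le_trans hz (le_trans ee2 e22); have hw2 := le_trans hw (le_trans ee2 e22).
split=> //.
have S := solves_strict r0 K0 est (l := Phi z0) (z := Phi z) (w := Phi w) (P := Ps) (s := 0) (t := s).
rewrite subr0 (HPhi hz2).1 (HPhi hw2).1 (HPhi z00).1 in S.
have {}S : `|Phi z s - Phi w s - (z - w) *m Ps s| <= 8 * K * `|s| * (`|z - z0| + `|w - z0|) * `|z - w|.
  apply: S => //; try exact: Phi_solves.
    by apply: le_trans KT; rewrite ler_wpM2l // ltW.
  by move=> u hu; apply: dPs; apply: between_norm hu => //; rewrite normr0.
have E : Phi z s - Phi w s - (z - w) *m Ps t =
    (Phi z s - Phi w s - (z - w) *m Ps s) + (z - w) *m (Ps s - Ps t).
  by rewrite mulmxBr addrA subrK.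
have P := mulmx_norm (z - w) (Ps s - Ps t).
have hP := hd1 s (le_trans hs (le_trans ee1 e11)).
rewrite E; apply: le_trans (ler_normD _ _) _; apply: le_trans (lerD S P) _.
have zw0 := normr_ge0 (z - w).
have b1 : 8 * K * `|s| * (`|z - z0| + `|w - z0|) <= kappa / 2.
  have h1 : `|z - z0| + `|w - z0| <= 2 * d2.
    have := le_trans hz (le_trans ee1 e12); have := le_trans hw (le_trans ee1 e12).
    by move: `|z - z0| `|w - z0| => *; lra.
  apply: (@le_trans _ _ (8 * K * T * (2 * d2))).
    apply: ler_pM => //; rewrite ?addr_ge0 ?mulr_ge0 // ?ltW //.
    by rewrite ltr_pM2l // mulr_gt0.
  rewrite /d2 (_ : 8 * K * T * (2 * (kappa / 2 / (16 * K * T))) = kappa / 2) //.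
  by move: K0 T0 => k1 t1; field; rewrite !gt_eqF.
have b2 : m * `|Ps s - Ps t| <= kappa / 2.
  apply: (@le_trans _ _ ((m + 1) * (kappa / 2 / (m + 1)))).
    by apply: ler_pM => //; rewrite ?ler0n ?lerDl.
  by rewrite mulrC divfK // gt_eqF.
apply: (@le_trans _ _ ((8 * K * `|s| * (`|z - z0| + `|w - z0|) + m * `|Ps s - Ps t|) * `|z - w|)).
  by rewrite le_eqVlt; apply/orP; left; apply/eqP; rewrite /m; ring.
by rewrite ler_wpM2r //; lra.
Qed.

Local Notation b := (ursubmx (Ps t)).
Hypothesis bu : b \in unitmx.

Hypothesis symp : dlsubmx (Ps t) - drsubmx (Ps t) *m invmx b *m ulsubmx (Ps t) = - (invmx b)^T.
Local Notation bi := (invmx b).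

(** Shooting: [qf y s] is the fixed point of the Newton map with the inverse Jacobian frozen at
    [b^-1], chosen so that the extremal issued from [y] meets the reference geodesic at time [s]. In
    the last clause the final position is fixed, so $\delta q=-\delta y\,d\,b^{-1}$ and the final
    covector varies by $\delta y\,(c-d\,b^{-1}a)=-\delta y\,b^{-T}$. *)
Lemma extremal_family : exists (d C : R) (qf : 'rV[R]_n -> R -> 'rV[R]_n), [/\ 0 < d, 0 <= C,
  forall y s, `|y - y0| <= d -> `|s - t| <= d ->
    [/\ `|s| < T, `|row_mx (qf y s) y - z0| <= r / 2,
        `|row_mx (qf y s) y - z0| <= C * `|y - y0|,
        rsubmx (Phi (row_mx (qf y s) y) s) = rsubmx (Phi z0 s) &
        `|qf y s - qf y t| <= C * `|s - t| ] &
  forall e : R, 0 < e -> exists2 rho, 0 < rho & forall y, `|y - y0| <= rho ->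
    `|lsubmx (Phi (row_mx (qf y t) y) t) - lsubmx (Phi z0 t) + (y - y0) *m (invmx b)^T| <= e * `|y - y0| ].
Proof.
have [q1 q11 q1E] : exists2 q1 : R, 1 <= q1 & n%:R * `|bi| <= q1.
  by exists (n%:R * `|bi| + 1); rewrite ?lerDl // lerDr mulr_ge0.
have q10 : 0 < q1 by apply: lt_le_trans q11.
have q1w := ltW q10.
have nbi (v : 'rV[R]_n) : `|v *m bi| <= q1 * `|v|.
  by apply: le_trans (mulmx_norm _ _) _; rewrite mulrAC ler_wpM2r.
pose ga s := rsubmx (Phi z0 s).
pose E q y s := rsubmx (Phi (row_mx q y) s).
pose G y s q := q - (E q y s - ga s) *m bi.
have k10 : 0 < 2^-1 / q1 by rewrite divr_gt0.
have [p1 p10 hp1] := strict_near k10.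
(* Then [4 * q1 * d], the radius in which the covectors [qf y s] are found, is [p1 / 2], and
   [d <= p1 / 2] as [q1 >= 1]; the states stay within [p1] of [z0]. *)
set d := p1 / (8 * q1).
have d0 : 0 < d by rewrite divr_gt0 // mulr_gt0.
have dq1 : 4 * q1 * d = p1 / 2 by rewrite /d; field; rewrite gt_eqF.
have dp1 : d <= p1 / 2.
  rewrite -dq1 -[leLHS]mul1r ler_wpM2r ?(ltW c30) //; move: q11; lra.
have ball q y : `|q - q0| <= p1 / 2 -> `|y - y0| <= d -> `|row_mx q y - z0| <= p1.
  move=> h1 h2; rewrite row_mxB; apply: le_trans (norm_row_mx _ _) _.
  by have := le_trans h2 dp1; lra.
have Gc y s q q' : `|y - y0| <= d -> `|s - t| <= d -> `|q - q0| <= p1 / 2 -> `|q' - q0| <= p1 / 2 ->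
    `|G y s q - G y s q'| <= 2^-1 * `|q - q'|.
  move=> hy hs hq hq'; have hs' : `|s - t| <= p1 by apply: le_trans hs (le_trans dp1 _); move: p10; lra.
  have [_ _ _ S] := hp1 _ _ _ (ball q y hq hy) (ball q' y hq' hy) hs'.
  have e : G y s q - G y s q' =
      - (rsubmx (Phi (row_mx q y) s - Phi (row_mx q' y) s - (row_mx q y - row_mx q' y) *m Ps t) *m bi).
    rewrite row_mxB subrr !rsubB rsub_mul mul0mx addr0 !mulmxBl !mulmxK // /G /E.
    by rewrite !mulmxBl; apply/rowP => j; rewrite !mxE; ring.
  rewrite e normrN; apply: le_trans (nbi _) _; apply: le_trans (ler_wpM2l (ltW q10) (norm_rsubmx _)) _.
  apply: le_trans (ler_wpM2l (ltW q10) S) _; rewrite row_mxB subrr.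
  have hh : `|row_mx (q - q') (0 : 'rV[R]_n)| <= `|q - q'|.
    by apply: le_trans (norm_row_mx _ _) _; rewrite normr0 addr0.
  rewrite mulrA mulrCA mulfV ?gt_eqF // mulr1.
  by rewrite ler_wpM2l.
have G0 y s : `|y - y0| <= d -> `|s - t| <= d -> `|G y s q0 - q0| <= 2 * q1 * `|y - y0|.
  move=> hy hs; have hs' : `|s - t| <= p1 by apply: le_trans hs (le_trans dp1 _); move: p10; lra.
  have hq : `|q0 - q0| <= p1 / 2 by rewrite subrr normr0 divr_ge0 // ltW.
  have [sT h1 h2 _] := hp1 _ _ _ (ball q0 y hq hy) (ball q0 y hq hy) hs'.
  rewrite /G addrC addKr normrN; apply: le_trans (nbi _) _.
  rewrite -mulrA mulrCA ler_wpM2l // /E /ga -rsubB.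
  apply: le_trans (norm_rsubmx _) _; apply: le_trans (Phi_lip h1 z00 sT) _.
  rewrite ler_wpM2l // row_mxB subrr; apply: le_trans (norm_row_mx _ _) _.
  by rewrite normr0 add0r.
pose qs y s := [set q | `|q - q0| <= 4 * q1 * `|y - y0| /\ G y s q = q].
pose qf y s := xget q0 (qs y s).
have Hq y s : `|y - y0| <= d -> `|s - t| <= d ->
    `|qf y s - q0| <= 4 * q1 * `|y - y0| /\ G y s (qf y s) = qf y s.
  move=> hy hs; have h0 := G0 y s hy hs.
  have h1 : 2 * `|G y s q0 - q0| <= p1 / 2.
    rewrite -dq1; apply: le_trans (ler_wpM2l _ h0) _ => //.
    have := ler_wpM2l (ltW q10) hy; lra.
  have [q [hq1 hq2]] := contraction_fix h1 (fun q q' => Gc y s q q' hy hs).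
  have : qs y s q.
    split=> //; apply: le_trans hq1 _; apply: le_trans (ler_wpM2l _ h0) _ => //.
    by rewrite !mulrA -natrM.
  by move=> hs'; have := xgetPex q0 (ex_intro _ q hs').
have Hb y s : `|y - y0| <= d -> `|s - t| <= d -> `|qf y s - q0| <= p1 / 2.
  move=> hy hs; have [hh _] := Hq y s hy hs; apply: le_trans hh _; rewrite -dq1.
  by apply: ler_wpM2l hy; rewrite mulr_ge0.
have HE y s : `|y - y0| <= d -> `|s - t| <= d -> E (qf y s) y s = ga s.
  move=> hy hs; have [_ /eqP] := Hq y s hy hs; rewrite /G subr_eq addrC -subr_eq subrr eq_sym => /eqP hh.
  by apply/eqP; rewrite -subr_eq0 -[X in X == 0](mulmxKV bu) hh mul0mx.
have Hz y s : `|y - y0| <= d -> `|s - t| <= d -> `|row_mx (qf y s) y - z0| <= (4 * q1 + 1) * `|y - y0|.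
  move=> hy hs; rewrite row_mxB; apply: le_trans (norm_row_mx _ _) _; rewrite mulrDl mul1r lerD2r.
  by have [] := Hq y s hy hs.
have tt : `|t - t| <= d by rewrite subrr normr0 ltW.
set C := 4 * q1 + 1 + 4 * K * q1.
have C0 : 0 <= C by rewrite !addr_ge0 ?mulr_ge0 // ltW.
have C1 : 4 * q1 + 1 <= C by rewrite lerDl !mulr_ge0 // ltW.
exists d, C, qf; split=> //.
  move=> y s hy hs; have hs' : `|s - t| <= p1 by apply: le_trans hs (le_trans dp1 _); move: p10; lra.
  have tt' : `|t - t| <= p1 by rewrite subrr normr0 ltW.
  have bs := ball _ _ (Hb y s hy hs) hy; have bt := ball _ _ (Hb y t hy tt) hy.
  have [sT h1 h2 _] := hp1 _ _ _ bs bt hs'.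
  have w1 := Hz y s hy hs; have w2 := HE y s hy hs.
  split; [exact: sT|exact: h1| |exact: w2|].
  - by apply: le_trans w1 _; rewrite ler_wpM2r.
  - have [_ hs1] := Hq y s hy hs; have [_ ht1] := Hq y t hy tt.
    have g1 := Gc y s _ _ hy hs (Hb y s hy hs) (Hb y t hy tt).
    have g2 : `|G y s (qf y t) - qf y t| <= q1 * (2 * K * `|s - t|).
      rewrite /G addrC addKr normrN; apply: le_trans (nbi _) _; rewrite ler_wpM2l //.
      have -> : E (qf y t) y s - ga s = (E (qf y t) y s - E (qf y t) y t) + (ga t - ga s).
        by rewrite HE // addrA subrK.
      apply: le_trans (ler_normD _ _) _; rewrite /E /ga -!rsubB -mulrA mulrDl mul1r.
      apply: lerD; apply: le_trans (norm_rsubmx _) _; first exact: Phi_time.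
      by rewrite [in leRHS]distrC; exact: Phi_time.
    have g3 : `|qf y s - qf y t| <= `|G y s (qf y s) - G y s (qf y t)| + `|G y s (qf y t) - qf y t|.
      by rewrite -{1}hs1 -{1}(subrK (G y s (qf y t)) (G y s (qf y s))) -addrA ler_normD.
    apply: (@le_trans _ _ (4 * K * q1 * `|s - t|)); last first.
      by rewrite ler_wpM2r // /C lerDr addr_ge0 ?mulr_ge0 // ltW.
    apply: le_trans (half_absorb g3 g1) _; apply: le_trans (ler_wpM2l (ler0n R 2) g2) _.
    by rewrite (_ : 2 * (q1 * (2 * K * `|s - t|)) = 4 * K * q1 * `|s - t|) //; ring.
move=> e e0; set a := ulsubmx (Ps t).
set c2 : R := (1 + n%:R * q1 * `|a|) * (4 * q1 + 1).
have c20 : 0 < c2.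
  by apply: mulr_gt0; [rewrite ltr_wpDr ?ltr01 ?mulr_ge0|apply: addr_gt0 => //; exact: mulr_gt0].
have k20 : 0 < e / c2 by rewrite divr_gt0.
have [p2 p20 hp2] := strict_near k20.
have c30 : 0 < 4 * q1 + 1 by rewrite addr_gt0 ?mulr_gt0.
have [p3 p30 [h31 h32]] := near_min2 d0 (divr_gt0 p20 c30).
exists p3 => // y hy; have hyd := le_trans hy h31.
have hz := Hz y t hyd tt.
have hz2 : `|row_mx (qf y t) y - z0| <= p2.
  apply: le_trans hz _; rewrite -[leRHS](divfK (lt0r_neq0 c30)) mulrC ler_wpM2r ?(ltW c30) //.
  exact: le_trans hy h32.
have hz0 : `|z0 - z0| <= p2 by rewrite subrr normr0 ltW.
have tt2 : `|t - t| <= p2 by rewrite subrr normr0 ltW.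
have [_ _ _] := hp2 _ _ t hz2 hz0 tt2.
set D := _ - _ *m Ps t => S.
have eR : rsubmx D = - ((qf y t - q0) *m b + (y - y0) *m drsubmx (Ps t)).
  by rewrite /D rsubB rsubB row_mxB rsub_mul (HE y t hyd tt : rsubmx _ = rsubmx _) subrr sub0r.
have edq : qf y t - q0 = - ((rsubmx D + (y - y0) *m drsubmx (Ps t)) *m bi).
  by rewrite eR opprD subrK mulNmx opprK mulmxK.
have eL : lsubmx (Phi (row_mx (qf y t) y) t) - lsubmx (Phi z0 t) + (y - y0) *m bi^T =
    lsubmx D - rsubmx D *m bi *m a.
  rewrite {1}/D lsubB lsubB row_mxB lsub_mul edq.
  have -> : bi^T = - (dlsubmx (Ps t) - drsubmx (Ps t) *m bi *m a) by rewrite symp opprK.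
  rewrite mulmxN mulmxBr !mulNmx !mulmxDl !mulmxA.
  by move: (rsubmx D *m _ *m _) (lsubmx _) (lsubmx _) (_ *m dlsubmx _) (_ *m _ *m _ *m a) => *;
    apply/rowP => j; rewrite !mxE; ring.
rewrite eL; apply: le_trans (ler_normB _ _) _.
have n1 := norm_lsubmx D; have n2 := norm_rsubmx D.
have n3 : `|rsubmx D *m bi *m a| <= n%:R * q1 * `|a| * `|D|.
  apply: le_trans (mulmx_norm _ _) _.
  have := le_trans (nbi (rsubmx D)) (ler_wpM2l q1w n2) => h4.
  have := ler_wpM2r (normr_ge0 a) (ler_wpM2l (ler0n R n) h4) => h5; apply: le_trans h5 _.
  by rewrite le_eqVlt; apply/orP; left; apply/eqP; ring.
apply: le_trans (lerD n1 n3) _.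
have {}S : `|D| <= e / c2 * ((4 * q1 + 1) * `|y - y0|).
  by apply: le_trans S _; rewrite ler_wpM2l // ltW.
have c4 : 0 <= 1 + n%:R * q1 * `|a| by rewrite addr_ge0 ?mulr_ge0.
have h5 := ler_wpM2l c4 S.
have e5 : (1 + n%:R * q1 * `|a|) * (e / c2 * ((4 * q1 + 1) * `|y - y0|)) = e * `|y - y0|.
  have c2n : c2 != 0 by rewrite gt_eqF.
  transitivity (e / c2 * c2 * `|y - y0|); first by rewrite /c2; ring.
  by rewrite divfK.
by rewrite e5 in h5; move: h5; rewrite mulrDl mul1r.
Qed.
End Extremals.

(** * Comparison of the action of a trajectory with that of an extremal *)

Section Action.
Context {R : realType} (n k : nat).
Variables (U : set 'rV[R]_n) (F0 : 'rV[R]_n -> 'rV[R]_n) (F : 'I_k -> 'rV[R]_n -> 'rV[R]_n)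
  (Qp : 'rV[R]_n -> R).
Hypotheses (oU : open U) (sF0 : csmooth U F0)
  (sF : forall i, csmooth U (F i)) (sQ : smooth U Qp).
Local Notation hF := (hH F0 F Qp).
Local Notation state := 'rV[R]_(n + n).
Local Notation int a b f := (\int[@lebesgue_measure R]_(s in `[a, b]) f s).

Definition fld (x : 'rV[R]_n) (u : 'rV[R]_k) : 'rV[R]_n := F0 x + u *m XX F x.
Definition lagr (x : 'rV[R]_n) (u : 'rV[R]_k) : R := (\sum_(i < k) u 0 i ^+ 2) - Qp x.
Definition etraj (s : R) (u : R -> 'rV[R]_k) (x : R -> 'rV[R]_n) : Prop :=
  [/\ (forall t, 0 <= t <= s -> {for t, continuous x}),
      (forall i, bint 0 s (fun t => u t 0 i)) &
      forall t j, 0 <= t <= s -> x t 0 j = x 0 0 j + int 0 t (fun a => fld (x a) (u a) 0 j)].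
Definition eact (s : R) (u : R -> 'rV[R]_k) (x : R -> 'rV[R]_n) : R :=
  2^-1 * int 0 s (fun t => lagr (x t) (u t)).
(** The maximizing control of Pontryagin's principle for the covector [p] at [x]. *)
Definition ctrl (p x : 'rV[R]_n) : 'rV[R]_k := p *m (XX F x)^T.

Lemma ctrlE p x i : ctrl p x 0 i = pairing p (F i x).
Proof. by rewrite /ctrl pairingE mxE; apply: eq_bigr => j _; rewrite !mxE. Qed.

Lemma pairing_fld p x u : pairing p (fld x u) = pairing p (F0 x) + \sum_i u 0 i * ctrl p x 0 i.
Proof.
rewrite /fld pairingDr; congr (_ + _).
by rewrite pairingC pairing_mulmx pairingE.
Qed.

(** The Fenchel-Young inequality with its exact defect, half the squared distance of [u] to the
    maximizing control. *)
Lemma lagr_id p x u : 2^-1 * lagr x u =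
  pairing p (fld x u) - hamE F0 F Qp p x + 2^-1 * \sum_i (u 0 i - ctrl p x 0 i) ^+ 2.
Proof.
rewrite /lagr /hamE pairing_fld.
have -> : \sum_i (u 0 i - ctrl p x 0 i) ^+ 2 = \sum_i u 0 i ^+ 2
   - 2 * (\sum_i u 0 i * ctrl p x 0 i) + \sum_i pairing p (F i x) ^+ 2.
  rewrite mulr_sumr -sumrB -big_split /=; apply: eq_bigr => i _.
  by rewrite -ctrlE; ring.
by field.
Qed.

Lemma fld_ctrl (z : state) : fld (rsubmx z) (ctrl (lsubmx z) (rsubmx z)) = rH F0 F z.
Proof. by rewrite /fld /ctrl /rH addrC mulmxA. Qed.

Lemma Rint_sum a b (I : Type) (s : seq I) (f : I -> R -> R) : (forall i, bint a b (f i)) ->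
  int a b (fun t => \sum_(i <- s) f i t) = \sum_(i <- s) int a b (f i).
Proof.
move=> h; elim: s => [|i s IH].
  by rewrite big_nil (_ : (fun _ => _) = fun=> 0) ?Rintegral_cst ?mul0r //; apply/funext => t; rewrite big_nil.
rewrite big_cons -IH -RintD //; last exact: bint_sum.
by apply: Rint_ext => t _; rewrite big_cons.
Qed.

Lemma bint_pairing a b (p v : R -> 'rV[R]_n) : (forall j, bint a b (fun t => p t 0 j)) ->
  (forall j, bint a b (fun t => v t 0 j)) -> bint a b (fun t => pairing (p t) (v t)).
Proof.
move=> hp hv; apply: (bint_ext (f := fun t => \sum_j p t 0 j * v t 0 j)).
  by move=> t _; rewrite pairingE.
by apply: bint_sum => j; exact: bintM.
Qed.

Lemma bint_sqr a b (f : R -> R) : bint a b f -> bint a b (fun t => f t ^+ 2).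
Proof. by move=> h; apply: (bint_ext (f := fun t => f t * f t)) (bintM h h). Qed.

Lemma bint_entry a b m (f : R -> 'rV[R]_m) j : (forall t, a <= t <= b -> {for t, continuous f}) ->
  bint a b (fun t => f t 0 j).
Proof.
move=> cf; apply: bint_cont => t ht.
exact: (continuous_comp (cf t ht) (@coord_continuous _ _ _ 0 j _)).
Qed.

Lemma bint_smooth a b (f : 'rV[R]_n -> R) (x : R -> 'rV[R]_n) : smooth U f ->
  (forall t, a <= t <= b -> {for t, continuous x} /\ U (x t)) -> bint a b (fun t => f (x t)).
Proof.
move=> sf hx; apply: bint_cont => t ht; have [cx Ux] := hx t ht.
exact: (continuous_comp cx (smooth_cont sf Ux)).
Qed.

Lemma bint_fld a b (x : R -> 'rV[R]_n) (u : R -> 'rV[R]_k) j : (forall t, a <= t <= b -> {for t, continuous x} /\ U (x t)) ->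
  (forall i, bint a b (fun t => u t 0 i)) -> bint a b (fun t => fld (x t) (u t) 0 j).
Proof.
move=> hx hu; apply: (bint_ext (f := fun t => F0 (x t) 0 j + \sum_i u t 0 i * F i (x t) 0 j)).
  by move=> t _; rewrite !mxE; congr (_ + _); apply: eq_bigr => i _; rewrite !mxE.
apply: bintD; first exact: (bint_smooth (sF0 j)).
by apply: bint_sum => i; apply: bintM => //; exact: (bint_smooth (sF i j)).
Qed.

Lemma bint_lagr a b (x : R -> 'rV[R]_n) (u : R -> 'rV[R]_k) : (forall t, a <= t <= b -> {for t, continuous x} /\ U (x t)) ->
  (forall i, bint a b (fun t => u t 0 i)) -> bint a b (fun t => lagr (x t) (u t)).
Proof.
move=> hx hu; apply: bintB; last exact: bint_smooth.
by apply: bint_sum => i; exact: bint_sqr.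
Qed.

Lemma bint_ctrl a b (p x : R -> 'rV[R]_n) i : (forall t, a <= t <= b -> {for t, continuous x} /\ U (x t)) ->
  (forall j, bint a b (fun t => p t 0 j)) -> bint a b (fun t => ctrl (p t) (x t) 0 i).
Proof.
move=> hx hp; apply: (bint_ext (f := fun t => pairing (p t) (F i (x t)))).
  by move=> t _; rewrite ctrlE.
by apply: bint_pairing => // j; exact: (bint_smooth (sF i j)).
Qed.

Lemma bint_hamE a b (p x : R -> 'rV[R]_n) : (forall t, a <= t <= b -> {for t, continuous x} /\ U (x t)) ->
  (forall j, bint a b (fun t => p t 0 j)) -> bint a b (fun t => hamE F0 F Qp (p t) (x t)).
Proof.
move=> hx hp; apply: bintD; first apply: bintD.
- apply: bintZ; apply: bint_sum => i; apply: bint_sqr; apply: bint_pairing => // j.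
  exact: (bint_smooth (sF i j)).
- by apply: bint_pairing => // j; exact: (bint_smooth (sF0 j)).
- by apply: bintZ; exact: bint_smooth.
Qed.

(* Young's inequality, optimized over its parameter. *)
Lemma int_abs_sq s (v : R -> 'rV[R]_k) : 0 <= s -> (forall i, bint 0 s (fun t => v t 0 i)) ->
  forall c : R, 2 * c * int 0 s (fun t => \sum_i `|v t 0 i|) <=
    k%:R * c ^+ 2 * s + int 0 s (fun t => \sum_i v t 0 i ^+ 2).
Proof.
move=> s0 bv c.
have b1 : bint 0 s (fun t => \sum_i `|v t 0 i|) by apply: bint_sum => i; exact: bint_norm.
have b2 : bint 0 s (fun t => \sum_i v t 0 i ^+ 2) by apply: bint_sum => i; exact: bint_sqr.
rewrite -RintZ //.
have -> : k%:R * c ^+ 2 * s + int 0 s (fun t => \sum_i v t 0 i ^+ 2) =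
    int 0 s (fun t => k%:R * c ^+ 2 + \sum_i v t 0 i ^+ 2).
  by rewrite RintD ?(Rint_cst _ s0) ?subr0 //; exact: bint_cst.
apply: Rint_le; [exact: bintZ|by apply: bintD b2; exact: bint_cst|] => t _.
have -> : k%:R * c ^+ 2 = \sum_(i < k) c ^+ 2 by rewrite sumr_const card_ord mulr_natl.
rewrite mulr_sumr -big_split /=; apply: ler_sum => i _.
rewrite -[v t 0 i ^+ 2]real_normK ?num_real //; move: `|_| => x.
have := sqr_ge0 (c - x); rewrite sqrrB mulr2n; lra.
Qed.

Section Comparison.
Variables (z0 : state) (r K K' KX : R).
Hypotheses (r0 : 0 < r) (K0 : 0 < K) (K'0 : 0 <= K') (KX0 : 0 <= KX).
Hypothesis lipH : forall a b : state, `|a - z0| <= r -> `|b - z0| <= r ->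
  UU U a /\ `|hF a - hF b| <= K * `|a - b|.
Hypothesis hHz : forall a b : state, `|a - z0| <= r -> `|b - z0| <= r ->
  `|Hz F0 F Qp a - Hz F0 F Qp b - 'D_(a - b) (Hz F0 F Qp) b| <= K' * `|a - b| ^+ 2.
Hypothesis hX : forall y i j, `|y - rsubmx z0| <= r -> `|F i y 0 j| <= KX.

Variables (s : R) (zb : R -> state) (u : R -> 'rV[R]_k) (x : R -> 'rV[R]_n).
Hypotheses (s0 : 0 <= s)
  (Hzb : forall t, 0 <= t <= s -> is_derive t 1 zb (hF (zb t)))
  (zbr : forall t, 0 <= t <= s -> `|row_mx (lsubmx (zb t)) (x t) - z0| <= r /\ `|zb t - z0| <= r)
  (tx : etraj s u x) (x0 : x 0 = rsubmx (zb 0)).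

Local Notation p t := (lsubmx (zb t)).
Local Notation xb t := (rsubmx (zb t)).
Local Notation xi t := (x t - xb t).
Local Notation w t := (row_mx (p t) (x t)).
(** The defect of the competing control, measured at the position of the competitor but with the
    covector of the reference extremal. *)
Definition vv (t : R) : 'rV[R]_k := u t - ctrl (p t) (x t).
(** The second-order Taylor remainder of the Hamiltonian in the position at fixed covector: by
    Hamilton's equations [lsubmx (hF (zb t))] is $-\partial_yH$. *)
Definition rem (t : R) : R :=
  Hz F0 F Qp (w t) - Hz F0 F Qp (zb t) + pairing (lsubmx (hF (zb t))) (xi t).

Let Hx t : 0 <= t <= s -> {for t, continuous x} /\ U (x t).
Proof.
move=> ht; have [cx _ _] := tx; split; first exact: cx.
by have [h1 _] := zbr ht; have [] := lipH h1 h1; rewrite /UU /= row_mxKr.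
Qed.

Let czb t : 0 <= t <= s -> {for t, continuous zb}.
Proof. by move=> /Hzb; exact: is_derive_cont. Qed.

Let bp j : bint 0 s (fun t => p t 0 j).
Proof.
apply: (bint_ext (f := fun t => zb t 0 (lshift n j))) (bint_entry _ czb).
by move=> t _; rewrite mxE.
Qed.

Let bxb j : bint 0 s (fun t => xb t 0 j).
Proof.
apply: (bint_ext (f := fun t => zb t 0 (rshift n j))) (bint_entry _ czb).
by move=> t _; rewrite mxE.
Qed.

Let Hxb t : 0 <= t <= s -> {for t, continuous (fun t => xb t)} /\ U (xb t).
Proof.
move=> ht; have [_ h1] := zbr ht; have [h2 _] := lipH h1 h1; split; last exact: h2.
exact: (continuous_comp (czb ht) (@rsubmx_continuous R n _)).
Qed.

Let chF j t : 0 <= t <= s -> {for t, continuous (fun t => hF (zb t) 0 j)}.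
Proof.
move=> ht; have [_ h1] := zbr ht; have [h2 _] := lipH h1 h1.
exact: (continuous_comp (czb ht) (smooth_cont (shH oU sF0 sF sQ j) h2)).
Qed.

Let bu i : bint 0 s (fun t => u t 0 i). Proof. by case: tx. Qed.

Lemma bint_vv i : bint 0 s (fun t => vv t 0 i).
Proof.
apply: (bint_ext (f := fun t => u t 0 i - ctrl (p t) (x t) 0 i)); first by move=> t _; rewrite !mxE.
by apply: bintB => //; exact: bint_ctrl.
Qed.

Let bxi j : bint 0 s (fun t => xi t 0 j).
Proof.
apply: (bint_ext (f := fun t => x t 0 j - xb t 0 j)); first by move=> t _; rewrite !mxE.
by apply: bintB => //; apply: bint_entry => t /Hx[].
Qed.

Let bl j : bint 0 s (fun t => lsubmx (hF (zb t)) 0 j).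
Proof.
have h : bint 0 s (fun t => hF (zb t) 0 (lshift n j)) by apply: bint_cont; exact: chF.
by apply: (bint_ext _ h) => t _; rewrite [RHS]mxE.
Qed.

Lemma bint_rem : bint 0 s rem.
Proof.
apply: bintD; last exact: bint_pairing.
apply: bintB; last first.
  by apply: (bint_hamE (p := fun t => p t) (x := fun t => xb t)) => // t /Hxb.
apply: (bint_ext (f := fun t => hamE F0 F Qp (p t) (x t))).
  by move=> t _; rewrite /Hz row_mxKl row_mxKr.
exact: bint_hamE.
Qed.

Definition ww (t : R) : 'rV[R]_n := fld (x t) (u t) - rH F0 F (zb t).

Let wwE t j : 0 <= t <= s -> fld (x t) (u t) 0 j - hF (zb t) 0 (rshift n j) = ww t 0 j.
Proof.
move=> ht; have [_ h1] := zbr ht; have [h2 _] := lipH h1 h1.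
have e : rH F0 F (zb t) 0 j = hF (zb t) 0 (rshift n j) by rewrite -(rsub_hH oU sF0 sF sQ h2) mxE.
by rewrite -e /ww; move: (fld _ _) (rH _ _ _) => f g; rewrite !mxE.
Qed.

Let bww j : bint 0 s (fun t => ww t 0 j).
Proof.
apply: (bint_ext (fun t ht => wwE j ht)).
by apply: bintB; [exact: bint_fld|apply: bint_cont; exact: chF].
Qed.

Lemma xi_int t j : 0 <= t <= s -> xi t 0 j = int 0 t (fun a => ww a 0 j).
Proof.
move=> ht; have /andP[t0 ts] := ht.
have bfl : bint 0 t (fun a => fld (x a) (u a) 0 j) by apply: (bint_sub (lexx 0) ts); exact: bint_fld.
have bhf : bint 0 t (fun a => hF (zb a) 0 (rshift n j)).
  by apply: (bint_sub (lexx 0) ts); apply: bint_cont; exact: chF.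
have E : int 0 t (fun a => ww a 0 j) = int 0 t (fun a => fld (x a) (u a) 0 j - hF (zb a) 0 (rshift n j)).
  by apply: Rint_ext => a /andP[a0 at_]; rewrite wwE // a0 (le_trans at_).
rewrite E RintB //; have [_ _ hx] := tx.
have -> : xi t 0 j = x t 0 j - zb t 0 (rshift n j) by rewrite !mxE.
rewrite (hx t j ht) x0.
have -> : int 0 t (fun a => hF (zb a) 0 (rshift n j)) = zb t 0 (rshift n j) - zb 0 0 (rshift n j).
  apply: (Rint_FTC (F := fun a => zb a 0 (rshift n j)) t0).
    move=> a /andP[a0 at_]; have ha : 0 <= a <= s by rewrite a0 (le_trans at_).
    by have /derive_mxP := Hzb ha; apply.
  apply: continuous_in_subspaceT => a; rewrite inE /= in_itv /= => /andP[a0 at_].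
  by apply: chF; rewrite a0 (le_trans at_).
have -> : rsubmx (zb 0) 0 j = zb 0 0 (rshift n j) by rewrite mxE.
by ring.
Qed.

Lemma pairing_xi : pairing (p s) (xi s) =
  int 0 s (fun t => pairing (p t) (ww t) + pairing (lsubmx (hF (zb t))) (xi t)).
Proof.
have -> : int 0 s (fun t => pairing (p t) (ww t) + pairing (lsubmx (hF (zb t))) (xi t)) =
   int 0 s (fun t => \sum_j (p t 0 j * ww t 0 j + lsubmx (hF (zb t)) 0 j * xi t 0 j)).
  by apply: Rint_ext => t _; rewrite !pairingE -big_split.
rewrite Rint_sum; last by move=> j; apply: bintD; exact: bintM.
rewrite pairingE; apply: eq_bigr => j _.
have ss : 0 <= (0 : R) <= s by rewrite lexx.
have xi0 : xi 0 0 j = 0 by rewrite x0 !mxE subrr.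
have h1 t : 0 <= t <= s -> is_derive t 1 (fun t => p t 0 j) (lsubmx (hF (zb t)) 0 j).
  move=> ht; have /derive_mxP/(_ 0 (lshift n j)) D := Hzb ht.
  have e2 : lsubmx (hF (zb t)) 0 j = hF (zb t) 0 (lshift n j) by rewrite [LHS]mxE.
  by rewrite e2; apply: (is_derive_ext D) => a; rewrite mxE.
have h2 t : 0 <= t <= s -> {for t, continuous (fun t => lsubmx (hF (zb t)) 0 j)}.
  move=> ht; rewrite (_ : (fun t => _) = fun t => hF (zb t) 0 (lshift n j)); first exact: chF.
  by apply/funext => a; rewrite [LHS]mxE.
have h3 t : 0 <= t <= s -> xi t 0 j = xi 0 0 j + int 0 t (fun a => ww a 0 j).
  by move=> ht; rewrite xi0 add0r; exact: xi_int.
have E := Rint_parts s0 h1 h2 (bww j) h3 (bxi j).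
by rewrite -E xi0 mulr0 subr0.
Qed.

(** The reference covector acts as a calibration. With [lagr_id] on both sides and [pairing_xi] for
    the boundary term, what is left is the remainder of the Hamiltonian and the squared defect. *)
Lemma act_diff : eact s u x - eact s (fun t => ctrl (p t) (xb t)) (fun t => xb t) =
  pairing (p s) (xi s) - int 0 s rem + 2^-1 * int 0 s (fun t => \sum_i vv t 0 i ^+ 2).
Proof.
have bL : bint 0 s (fun t => lagr (x t) (u t)) by exact: bint_lagr.
have bLb : bint 0 s (fun t => lagr (xb t) (ctrl (p t) (xb t))).
  by apply: bint_lagr => // i; exact: (bint_ctrl (p := fun t => p t) (x := fun t => xb t)).
have bV : bint 0 s (fun t => \sum_i vv t 0 i ^+ 2).
  by apply: bint_sum => i; apply: bint_sqr; exact: bint_vv.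
have bP : bint 0 s (fun t => pairing (p t) (ww t) + pairing (lsubmx (hF (zb t))) (xi t)).
  by apply: bintD; exact: bint_pairing.
rewrite /eact pairing_xi -mulrBr -RintB // -RintZ; last exact: bintB.
rewrite -RintB //; last exact: bint_rem.
rewrite -RintZ // -RintD; [|apply: bintB => //; exact: bint_rem|exact: bintZ].
apply: Rint_ext => t ht; rewrite mulrBr (lagr_id (p t)) (lagr_id (p t) (xb t)).
have -> : \sum_i (ctrl (p t) (xb t) 0 i - ctrl (p t) (xb t) 0 i) ^+ 2 = 0.
  by rewrite big1 // => i _; rewrite subrr expr0n.
have -> : \sum_i (u t 0 i - ctrl (p t) (x t) 0 i) ^+ 2 = \sum_i vv t 0 i ^+ 2.
  by apply: eq_bigr => i _; rewrite !mxE.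
rewrite fld_ctrl /rem /ww pairingBr /Hz row_mxKl row_mxKr.
by move: (pairing _ (fld _ _)) (pairing _ (rH _ _ _)) (pairing _ (xi t)) (hamE _ _ _ _ _)
  (hamE _ _ _ _ _) (\sum_i _) => *; ring.
Qed.

Lemma rem_le t : 0 <= t <= s -> `|rem t| <= K' * `|xi t| ^+ 2.
Proof.
move=> ht; have [h1 h2] := zbr ht; have [Ub _] := lipH h2 h2.
have := hHz h1 h2; set Z := zb t.
have E : w t - Z = row_mx 0 (xi t) by rewrite -[Z in LHS]hsubmxK row_mxB subrr.
have -> : 'D_(w t - Z) (Hz F0 F Qp) Z = - pairing (lsubmx (hF Z)) (xi t).
  rewrite E (derive_coords (oUU oU) _ (sHz oU sF0 sF sQ) Ub) big_split_ord /= big1 ?add0r.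
    rewrite lsub_hH -[LHS]opprK; congr (- _).
    rewrite pairingE -sumrN; apply: eq_bigr => j _; rewrite row_mxEr !mxE; ring.
  by move=> j _; rewrite row_mxEl mxE mul0r.
rewrite opprK E /rem => h; apply: le_trans h _; rewrite ler_wpM2l //.
have h : `|row_mx (0 : 'rV[R]_n) (xi t)| <= `|xi t|.
  by apply: le_trans (norm_row_mx _ _) _; rewrite normr0 add0r.
by rewrite !expr2 ler_pM.
Qed.

(* xi is driven by vv, with a Lipschitz feedback. *)
Lemma xi_le : K * s <= 2^-1 -> forall t, 0 <= t <= s ->
  `|xi t| <= 2 * KX * int 0 s (fun t => \sum_i `|vv t 0 i|).
Proof.
move=> Ks; set I := int 0 s _.
have bN : bint 0 s (fun t => \sum_i `|vv t 0 i|).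
  by apply: bint_sum => i; apply: bint_norm; exact: bint_vv.
have I0 : 0 <= I by apply: Rint_ge0 => t _; exact: sumr_ge0.
have wn : {within `[0, s], continuous (fun t => `|xi t|)}.
  apply: continuous_in_subspaceT => t; rewrite inE /= in_itv /= => ht.
  have [cx _] := Hx ht; have [cb _] := Hxb ht.
  exact: (continuous_comp (continuousB cx cb) (@norm_continuous _ _ _)).
have [c cI hc] := EVT_max s0 wn; set m := `|xi c| in hc.
suff hm : m <= 2 * KX * I by move=> t ht; apply: le_trans (hc t _) hm; rewrite in_itv.
have m0 : 0 <= m by rewrite normr_ge0.
have hww a j : 0 <= a <= s -> `|ww a 0 j| <= K * m + KX * \sum_i `|vv a 0 i|.
  move=> ha; have [h1 h2] := zbr ha; have [U1 L] := lipH h1 h2; have [U2 _] := lipH h2 h2.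
  have -> : ww a 0 j = (rH F0 F (w a) - rH F0 F (zb a)) 0 j + (vv a *m XX F (x a)) 0 j.
    rewrite /ww -(fld_ctrl (w a)) row_mxKl row_mxKr /vv mulmxBl /fld.
    move: (F0 _) (u a *m _) (ctrl _ _ *m _) (rH _ _ _) => f1 f2 f3 f4.
    by rewrite !mxE; ring.
  apply: le_trans (ler_normD _ _) _; apply: lerD.
    rewrite -(rsub_hH oU sF0 sF sQ U1) -(rsub_hH oU sF0 sF sQ U2) -rsubB.
    apply: le_trans (mx_entry_le _ _ _) _; apply: le_trans (norm_rsubmx _) _.
    apply: le_trans L _; rewrite ler_wpM2l ?(ltW K0) //.
    rewrite -[X in `|_ - X|]hsubmxK row_mxB subrr.
    apply: le_trans (norm_row_mx _ _) _; rewrite normr0 add0r.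
    by apply: hc; rewrite in_itv.
  rewrite mxE mulr_sumr; apply: le_trans (ler_norm_sum _ _ _) _.
  apply: ler_sum => i _; rewrite normrM mulrC ler_wpM2r // mxE; apply: hX.
  have := norm_rsubmx (w a - z0); rewrite rsubB row_mxKr => h; exact: le_trans h h1.
have hx t j : 0 <= t <= s -> `|xi t 0 j| <= K * m * s + KX * I.
  move=> ht; rewrite xi_int //; have /andP[t0 ts] := ht.
  have bw := bint_sub (lexx 0) ts (bww j); apply: le_trans (Rint_norm bw) _.
  have b2 : bint 0 s (fun a => K * m + KX * \sum_i `|vv a 0 i|).
    by apply: bintD; [exact: bint_cst|exact: bintZ].
  apply: (@le_trans _ _ (int 0 t (fun a => K * m + KX * \sum_i `|vv a 0 i|))).
    apply: Rint_le; [exact: bint_norm|exact: bint_sub b2|] => a /andP[a0 at_].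
    by apply: hww; rewrite a0 (le_trans at_).
  have pos a : 0 <= a <= s -> 0 <= K * m + KX * \sum_i `|vv a 0 i|.
    by move=> _; rewrite addr_ge0 ?mulr_ge0 ?sumr_ge0 // ltW.
  apply: le_trans (Rint_shrink t0 ts b2 pos) _.
  rewrite RintD; [|exact: bint_cst|exact: bintZ].
  by rewrite (Rint_cst _ s0) subr0 RintZ.
have hm : m <= K * m * s + KX * I.
  apply: mx_norm_leP; first by rewrite addr_ge0 ?mulr_ge0 // ltW.
  by move=> i j; rewrite ord1; apply: hx; move: cI; rewrite in_itv.
have h := ler_wpM2r m0 Ks; have e : K * m * s = K * s * m by ring.
by rewrite e in hm; rewrite -mulrA; move: (KX * I) (K * s * m) hm h => y1 y2; lra.
Qed.

(** With equal endpoints the boundary term vanishes. By [xi_le] and Cauchy-Schwarz the remainder is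
    at most a constant times [s^2] times the integrated squared defect, so for short times the
    defect dominates. The comparison is direct, without a field of extremals. *)
Lemma local_min : K * s <= 2^-1 -> 8 * K' * KX ^+ 2 * (k%:R + 1) * s ^+ 2 <= 1 -> x s = xb s ->
  eact s (fun t => ctrl (p t) (xb t)) (fun t => xb t) <= eact s u x.
Proof.
move=> Ks hs xs; rewrite -subr_ge0 act_diff xs subrr.
have -> : pairing (p s) 0 = 0 by rewrite -(scale0r (0 : 'rV[R]_n)) pairingZr mul0r.
rewrite add0r addrC subr_ge0.
set V := int 0 s (fun t => \sum_i vv t 0 i ^+ 2); set I := int 0 s (fun t => \sum_i `|vv t 0 i|).
have V0 : 0 <= V by apply: Rint_ge0 => t _; apply: sumr_ge0 => i _; exact: sqr_ge0.
have I2 : I ^+ 2 <= (k%:R + 1) * s * V.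
  have [s1|s1] := leP s 0.
    have s00 : s = 0 by apply/eqP; rewrite eq_le s1.
    by rewrite /I s00 Rint_aa mulr0 mul0r expr0n.
  have k1 : 0 < (k%:R + 1) * s by rewrite mulr_gt0 // ltr_wpDl.
  (* The optimal parameter would have [k] in place of [k + 1]; the shift keeps the denominator
     positive when [k = 0]. *)
  have := int_abs_sq s0 bint_vv (I / ((k%:R + 1) * s)); rewrite -/I -/V.
  set c := I / _ => h; have cI : c * ((k%:R + 1) * s) = I by rewrite divfK // gt_eqF.
  have k0 : 0 <= k%:R :> R by rewrite ler0n.
  have c2 : 0 <= c ^+ 2 * s by rewrite mulr_ge0 ?sqr_ge0.
  have h2 : c * I <= V.
    have e : c * I = c ^+ 2 * ((k%:R + 1) * s) by rewrite -{1}cI; ring.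
    rewrite e in h *; move: h; rewrite -mulrA e; lra.
  have := ler_wpM2l (ltW k1) h2; rewrite mulrA [_ * c]mulrC cI expr2.
  by [].
have xl := xi_le Ks; rewrite -/I in xl.
have hrem : int 0 s rem <= int 0 s (fun=> K' * (2 * KX * I) ^+ 2).
  apply: Rint_le; [exact: bint_rem|exact: bint_cst|] => t ht.
  apply: le_trans (ler_norm _) _; apply: le_trans (rem_le ht) _.
  by rewrite ler_wpM2l // !expr2 ler_pM // xl.
apply: le_trans hrem _; rewrite (Rint_cst _ s0) subr0.
have h1 : 4 * K' * KX ^+ 2 * s * I ^+ 2 <= 4 * K' * KX ^+ 2 * s * ((k%:R + 1) * s * V).
  by rewrite ler_wpM2l // !mulr_ge0 ?sqr_ge0.
have h2 := ler_wpM2r V0 hs.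
have e1 : K' * (2 * KX * I) ^+ 2 * s = 4 * K' * KX ^+ 2 * s * I ^+ 2 by ring.
have e2 : 4 * K' * KX ^+ 2 * s * ((k%:R + 1) * s * V) =
  2^-1 * (8 * K' * KX ^+ 2 * (k%:R + 1) * s ^+ 2 * V) by field.
rewrite e1; apply: le_trans h1 _; rewrite e2 ler_wpM2l //.
by rewrite mul1r in h2.
Qed.

(** A first variation formula with quadratic error: the endpoints are free here, so the boundary
    pairing stays. *)
Lemma act_close (e : R) : 0 <= e -> s <= 1 -> (forall t, 0 <= t <= s -> `|xi t| <= e) ->
  (forall t i, 0 <= t <= s -> `|vv t 0 i| <= e) ->
  `|eact s u x - eact s (fun t => ctrl (p t) (xb t)) (fun t => xb t) - pairing (p s) (xi s)| <=
    (K' + k%:R) * e ^+ 2.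
Proof.
move=> e0 s1 hxi hv.
have bV : bint 0 s (fun t => \sum_i vv t 0 i ^+ 2).
  by apply: bint_sum => i; apply: bint_sqr; exact: bint_vv.
rewrite act_diff; set Cc := pairing _ _; set V := int 0 s (fun t => \sum_i _); set I := int 0 s rem.
have -> : Cc - I + 2^-1 * V - Cc = 2^-1 * V - I by ring.
have V1 : 0 <= V <= k%:R * e ^+ 2.
  apply/andP; split; first by apply: Rint_ge0 => t _; apply: sumr_ge0 => i _; exact: sqr_ge0.
  apply: (@le_trans _ _ (int 0 s (fun=> k%:R * e ^+ 2))).
    apply: Rint_le => //; first exact: bint_cst.
    move=> t ht; have -> : k%:R * e ^+ 2 = \sum_(i < k) e ^+ 2 by rewrite sumr_const card_ord mulr_natl.
    apply: ler_sum => i _; rewrite -[vv t 0 i ^+ 2]real_normK ?num_real //.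
    by rewrite !expr2 ler_pM // hv.
  by rewrite (Rint_cst _ s0) subr0 ler_piMr // mulr_ge0 ?sqr_ge0.
have hr : `|int 0 s rem| <= K' * e ^+ 2.
  apply: le_trans (Rint_norm bint_rem) _.
  apply: (@le_trans _ _ (int 0 s (fun=> K' * e ^+ 2))).
    apply: Rint_le; [exact/bint_norm/bint_rem|exact: bint_cst|] => t ht.
    by apply: le_trans (rem_le ht) _; rewrite ler_wpM2l // !expr2 ler_pM // hxi.
  by rewrite (Rint_cst _ s0) subr0 ler_piMr // mulr_ge0 ?sqr_ge0.
apply: le_trans (ler_normB _ _) _; rewrite mulrDl [leRHS]addrC; apply: lerD => //.
have /andP[V2 V3] := V1; rewrite ger0_norm ?mulr_ge0 //.
by apply: le_trans V3; rewrite ler_piMl //; lra.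
Qed.

End Comparison.

(* Leaving a ball in a short time is expensive. *)
Lemma crossing (y0 : 'rV[R]_n) (r KF : R) (Lam rho : R) : 0 <= KF -> 0 < rho ->
  (forall y, `|y - y0| <= r -> [/\ U y, (forall j, `|F0 y 0 j| <= KF),
     (forall i j, `|F i y 0 j| <= KF) & `|Qp y| <= KF]) ->
  exists2 sb : R, 0 < sb & forall s u x, 0 <= s <= sb -> etraj s u x ->
    (forall t, 0 <= t <= s -> `|x t - y0| <= r) -> rho <= `|x s - x 0| -> Lam <= eact s u x.
Proof.
move=> KF0 rho0 hb; set L := `|Lam| + 1.
have L0 : 0 < L by rewrite ltr_wpDl.
(* The Young parameter for which a displacement of [rho] forces [c * I >= L], half of [rho] being
   left to the drift. *)
have [c c0 cE] : exists2 c : R, 0 <= c & c * rho = 2 * L * (KF + 1).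
  exists (2 * L * (KF + 1) / rho); last by rewrite divfK // gt_eqF.
  by rewrite divr_ge0 ?mulr_ge0 ?addr_ge0 // ltW.
have D0 : 0 < KF + 1 by rewrite ltr_wpDl.
have k0 : 0 <= k%:R :> R by rewrite ler0n.
set sb := Num.min (rho / 2 / (KF + 1)) (1 / (k%:R * c ^+ 2 + KF + 1)).
have E0 : 0 < k%:R * c ^+ 2 + KF + 1 by rewrite ltr_wpDl // addr_ge0 // mulr_ge0 ?sqr_ge0.
exists sb; first by rewrite lt_min !divr_gt0.
move=> s u x /andP[s0 ssb] tx hx hr.
have {}[cx bu hint] := tx.
have Hx t : 0 <= t <= s -> {for t, continuous x} /\ U (x t).
  by move=> ht; split; [exact: cx|have [] := hb _ (hx t ht)].
have [s1 s2] : s * (KF + 1) <= rho / 2 /\ s * (k%:R * c ^+ 2 + KF + 1) <= 1.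
  by move: ssb; rewrite le_min !ler_pdivlMr // => /andP[].
set I := int 0 s (fun t => \sum_i `|u t 0 i|).
have bN : bint 0 s (fun t => \sum_i `|u t 0 i|) by apply: bint_sum => i; exact: bint_norm.
have I0 : 0 <= I by apply: Rint_ge0 => t _; exact: sumr_ge0.
have hI : rho <= KF * s + KF * I.
  apply: le_trans hr _; apply: mx_norm_leP; first by rewrite addr_ge0 ?mulr_ge0.
  move=> i j; rewrite ord1 !mxE hint ?s0 ?lexx // addrC addKr.
  have bf : bint 0 s (fun t => fld (x t) (u t) 0 j) by exact: bint_fld.
  apply: le_trans (Rint_norm bf) _.
  apply: (@le_trans _ _ (int 0 s (fun t => KF + KF * \sum_i `|u t 0 i|))).
    apply: Rint_le; [exact: bint_norm|by apply: bintD; [exact: bint_cst|exact: bintZ]|] => t ht.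
    have [_ h1 h2 _] := hb _ (hx t ht); rewrite !mxE; apply: le_trans (ler_normD _ _) _.
    apply: lerD; first exact: h1.
    rewrite mulr_sumr; apply: le_trans (ler_norm_sum _ _ _) _; apply: ler_sum => l _.
    by rewrite normrM mulrC ler_wpM2r // mxE.
  by rewrite RintD ?RintZ ?(Rint_cst _ s0) ?subr0 //; [exact: bint_cst|exact: bintZ].
have h1 := int_abs_sq s0 bu c; rewrite -/I in h1.
set V := int 0 s (fun t => \sum_i u t 0 i ^+ 2) in h1.
have bV : bint 0 s (fun t => \sum_i u t 0 i ^+ 2) by apply: bint_sum => i; exact: bint_sqr.
have bQ : bint 0 s (fun t => Qp (x t)) by exact: bint_smooth.
have eA : eact s u x = 2^-1 * (V - int 0 s (fun t => Qp (x t))) by rewrite /eact RintB.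
have hQ : int 0 s (fun t => Qp (x t)) <= KF * s.
  rewrite -[s in leRHS]subr0 -(Rint_cst _ s0); apply: Rint_le => //; first exact: bint_cst.
  by move=> t ht; have [_ _ _ h] := hb _ (hx t ht); apply: le_trans (ler_norm _) h.
have hcI : 2 * L <= 2 * (c * I).
  have a1 : rho / 2 <= (KF + 1) * I by nra.
  have a2 : c * (rho / 2) <= c * ((KF + 1) * I) by rewrite ler_wpM2l.
  have a3 : L * (KF + 1) <= (c * I) * (KF + 1).
    by move: a2; rewrite mulrA cE; move=> a2; rewrite (_ : c * I * (KF + 1) = c * ((KF + 1) * I)); [lra|ring].
  by rewrite ler_pM2r // in a3; rewrite ler_pM2l.
have hL : Lam <= `|Lam| by exact: ler_norm.
rewrite eA; move: h1 hQ hcI s2; rewrite /L.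
set q := int 0 s (fun t => Qp (x t)) => h1 hQ hcI s2.
have s3 : s * (k%:R * c ^+ 2) + s * KF + s <= 1 by move: s2; rewrite !mulrDr mulr1.
have e1 : k%:R * c ^+ 2 * s = s * (k%:R * c ^+ 2) by rewrite mulrC.
have e2 : KF * s = s * KF by rewrite mulrC.
have e3 : 2 * (c * I) = 2 * c * I by rewrite mulrA.
rewrite e1 in h1; rewrite e2 in hQ; rewrite e3 in hcI.
by clear -s3 h1 hQ hcI hL s0; lra.
Qed.

End Action.

(** Induction on an interval, by a supremum argument. It propagates both the agreement of curves
    ([ham_unique]) and confinement to a ball ([excursion]). *)
Lemma real_ind (R : realType) (P : R -> Prop) (t : R) : 0 <= t -> P 0 ->
  (forall a, 0 < a <= t -> (forall s, 0 <= s < a -> P s) -> P a) ->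
  (forall a, 0 <= a < t -> P a -> exists2 d, 0 < d & forall s, a <= s <= a + d -> P s) ->
  P t.
Proof.
move=> t0 P0 hc ho; pose A := [set a | 0 <= a <= t /\ forall s, 0 <= s <= a -> P s].
have A0 : A 0.
  split; first by rewrite lexx t0.
  by move=> s /andP[h1 h2]; have -> : s = 0 by apply/eqP; rewrite eq_le h1 h2.
have hs : has_sup A by split; [exists 0|exists t => a [/andP[]]].
set b := sup A.
have b0 : 0 <= b by apply: sup_upper_bound.
have bt : b <= t by apply: ge_sup; [exists 0|move=> a [/andP[]]].
have lb s : 0 <= s < b -> P s.
  move=> /andP[s0 sb]; have e0 : 0 < b - s by rewrite subr_gt0.
  have [a [_ ha]] := sup_adherent e0 hs; rewrite -/b opprB addrC subrK => sa.
  by apply: ha; rewrite s0 ltW.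
have Pb : P b.
  move: b0; rewrite le_eqVlt => /predU1P[<- //|b0]; apply: hc; first by rewrite b0.
  exact: lb.
have [bt'|tb] := ltP b t; last by have <- : b = t by apply/eqP; rewrite eq_le bt.
have [d d0 hd] := ho b (introT andP (conj b0 bt')) Pb.
have : A (Num.min t (b + d)).
  split; first by rewrite le_min t0 ge_min lexx addr_ge0 // ltW.
  move=> s /andP[s0]; rewrite le_min => /andP[st sbd].
  have [sb|bs] := ltP s b; first by apply: lb; rewrite s0.
  by apply: hd; rewrite bs.
move=> /(sup_upper_bound hs); rewrite -/b leNgt => /negP []; rewrite lt_min bt'.
by rewrite ltrDl.
Qed.

Lemma near_between (R : realType) (a t b : R) : a < t < b -> \forall s \near t, a < s < b.
Proof.
move=> /andP[h1 h2]; have d1 : 0 < (t - a) / 2 by rewrite divr_gt0 // subr_gt0.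
have d2 : 0 < (b - t) / 2 by rewrite divr_gt0 // subr_gt0.
have [d d0 [d3 d4]] := near_min2 d1 d2; apply/nbhs_eps; exists d => // s.
by rewrite ler_norml => /andP[h3 h4]; apply/andP; split; lra.
Qed.

Lemma is_derive_rsub (R : realType) n (z : R -> 'rV[R]_(n + n)) (t : R) dz :
  is_derive t 1 z dz -> is_derive t 1 (fun s => rsubmx (z s)) (rsubmx dz).
Proof.
move=> /derive_mxP D; apply/derive_mxP => i j; rewrite ord1 [rsubmx _ 0 j]mxE.
by apply: (is_derive_ext (D 0 (rshift n j))) => s; rewrite mxE.
Qed.

Lemma is_derive_lsub (R : realType) n (z : R -> 'rV[R]_(n + n)) (t : R) dz :
  is_derive t 1 z dz -> is_derive t 1 (fun s => lsubmx (z s)) (lsubmx dz).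
Proof.
move=> /derive_mxP D; apply/derive_mxP => i j; rewrite ord1 [lsubmx _ 0 j]mxE.
by apply: (is_derive_ext (D 0 (lshift n j))) => s; rewrite mxE.
Qed.

Lemma is_derive_row_mx (R : realType) n (f g : R -> 'rV[R]_n) (t : R) df dg :
  is_derive t 1 f df -> is_derive t 1 g dg ->
  is_derive t 1 (fun u => row_mx (f u) (g u)) (row_mx df dg).
Proof.
move=> /derive_mxP D1 /derive_mxP D2; apply/derive_mxP => a b.
case: (split_ordP b) => l ->.
  by rewrite row_mxEl; apply: (is_derive_ext (D1 a l)) => u; rewrite row_mxEl.
by rewrite row_mxEr; apply: (is_derive_ext (D2 a l)) => u; rewrite row_mxEr.
Qed.

Lemma line_derive (R : realType) n (y v : 'rV[R]_n) (u : R) :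
  is_derive u (1 : R) (fun u : R => y + u *: v) v.
Proof.
apply/derive_mxP => i j.
have := is_deriveD (is_derive_cst (y i j) u (1 : R)) (is_deriveM' (is_derive_id u (1 : R)) (is_derive_cst (v i j) u (1 : R))).
rewrite mulr0 addr0 add0r mul1r => D; apply: (is_derive_ext D) => a; by rewrite !mxE.
Qed.

Lemma near_curve (R : realType) (V : normedModType R) (g : R -> V) (t : R) dg (P : V -> Prop) :
  is_derive t 1 g dg -> (\forall w \near g t, P w) -> \forall u \near t, P (g u).
Proof. by move=> D h; exact: (is_derive_cont D h). Qed.

(* Hamilton's equations are invariant under the cotangent lift of a change of
   coordinates; this uses the symmetry of its second derivatives. *)
Section ChartChange.
Context {R : realType} (n k : nat).
Variables (O : set 'rV[R]_n) (Tr : 'rV[R]_n -> 'rV[R]_n).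
Hypotheses (oO : open O) (sTr : csmooth O Tr)
  (uTr : forall w, O w -> 'J Tr w \in unitmx).
Variables (U : set 'rV[R]_n) (F0 : 'rV[R]_n -> 'rV[R]_n) (F : 'I_k -> 'rV[R]_n -> 'rV[R]_n)
  (Qp : 'rV[R]_n -> R).
Hypotheses (oU : open U) (sF0 : csmooth U F0)
  (sF : forall i, csmooth U (F i)) (sQ : smooth U Qp).
Variables (U' : set 'rV[R]_n) (F0' : 'rV[R]_n -> 'rV[R]_n) (F' : 'I_k -> 'rV[R]_n -> 'rV[R]_n)
  (Qp' : 'rV[R]_n -> R).
Hypotheses (oU' : open U') (sF0' : csmooth U' F0')
  (sF' : forall i, csmooth U' (F' i)) (sQ' : smooth U' Qp').
Hypotheses (OU : forall w, O w -> U w) (OU' : forall w, O w -> U' (Tr w)).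
Hypothesis hh : forall q1 w, O w -> hamE F0' F' Qp' q1 (Tr w) = hamE F0 F Qp (q1 *m ('J Tr w)^T) w.
Variables (z : R -> 'rV[R]_(n + n)) (t : R) (cv : R -> 'rV[R]_n).
Hypotheses (Oy : O (rsubmx (z t))) (Uz : UU U (z t)) (dz : is_derive t 1 z (hH F0 F Qp (z t))).
Hypothesis hcv : forall s, O (rsubmx (z s)) -> cv s = lsubmx (z s) *m (invmx ('J Tr (rsubmx (z s))))^T.
Local Notation H := (Hz F0 F Qp).
Local Notation H' := (Hz F0' F' Qp').
Local Notation y := (rsubmx (z t)).
Local Notation J := ('J Tr y).

Lemma J_partial w : O w -> differentiable Tr w /\
  'J Tr w = \matrix_(i, j) 'D_(delta_mx 0 i) (fun y => Tr y 0 j) w.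
Proof. by move=> ow; exact: (smooth_diff oO sTr ow). Qed.

Lemma smooth_jac i j : smooth O (fun w => 'J Tr w i j).
Proof.
apply: (smooth_ext oO _ (smooth_derive (delta_mx 0 i) (sTr j))) => w ow.
by rewrite (J_partial ow).2 mxE.
Qed.

Lemma near_O w : O w -> \forall u \near w, O u.
Proof. by move=> ow; apply: open_nbhs_nbhs; split. Qed.

Lemma jac_curve (g : R -> 'rV[R]_n) (u : R) dg w : g u = w -> O w -> is_derive u 1 g dg ->
  is_derive u 1 (Tr \o g) (dg *m 'J Tr w) /\
  exists dG, is_derive u 1 (fun s => 'J Tr (g s)) dG /\
    forall i j, dG i j = 'D_dg (fun w => 'J Tr w i j) w.
Proof.
move=> <- og D; split.
  have [df _] := J_partial og.
  have -> : dg *m 'J Tr (g u) = 'd Tr (g u) dg by rewrite /jacobian mul_rV_lin1.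
  exact: is_derive_diff_comp.
exists (\matrix_(i, j) 'D_dg (fun w => 'J Tr w i j) (g u)); split; last by move=> i j; rewrite mxE.
apply/derive_mxP => i j; rewrite mxE.
exact: (is_derive_comp oO (smooth_jac i j) og D).
Qed.

Local Opaque jacobian.

Lemma derive_Hy (U1 : set 'rV[R]_n) (G0 : 'rV[R]_n -> 'rV[R]_n) (G : 'I_k -> 'rV[R]_n -> 'rV[R]_n)
    (Gq : 'rV[R]_n -> R) (w : 'rV[R]_n) (z1 : 'rV[R]_(n + n)) :
  open U1 -> (csmooth U1 G0) ->
  (forall i, csmooth U1 (G i)) -> smooth U1 Gq ->
  UU U1 z1 -> 'D_(row_mx 0 w) (Hz G0 G Gq) z1 = pairing (rsubmx (grad (Hz G0 G Gq) z1)) w.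
Proof.
move=> o1 s1 s2 s3 U3; rewrite (derive_coords (oUU o1) _ (sHz o1 s1 s2 s3) U3).
rewrite big_split_ord /= big1 ?add0r; last by move=> j _; rewrite row_mxEl mxE mul0r.
by rewrite pairingE; apply: eq_bigr => j _; rewrite row_mxEr !mxE mulrC.
Qed.

Lemma jac_sym y0 i l j : O y0 ->
  'D_(delta_mx 0 i) (fun w => 'J Tr w l j) y0 = 'D_(delta_mx 0 l) (fun w => 'J Tr w i j) y0.
Proof.
move=> Oy0; have Jn a1 : \forall w \near y0, 'J Tr w a1 j = 'D_(delta_mx 0 a1) (fun w => Tr w 0 j) w.
  by apply: filterS (near_O Oy0) => w ow; rewrite (J_partial ow).2 mxE.
rewrite (near_eq_derive _ (Jn i)) (near_eq_derive _ (Jn l)).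
exact: (derive_deriveC _ _ oO (sTr j) Oy0).
Qed.

(** The position part is the chain rule. For the covector part, [cv J^T] is the old covector along
    the curve; this relation is differentiated, and the gradient of the new Hamiltonian is computed
    along lines in the old coordinates. Both computations contain second derivatives of [Tr], which
    match by [jac_sym]. *)
Lemma chart_change :
  is_derive t 1 (fun s => Tr (rsubmx (z s))) (grad (fun q => hamE F0' F' Qp' q (Tr y)) (cv t)) /\
  is_derive t 1 cv (- grad (fun y' => hamE F0' F' Qp' (cv t) y') (Tr y)).
Proof.
have dq := is_derive_lsub dz; have dy := is_derive_rsub dz.
have Ju := uTr Oy; have JTu : J^T \in unitmx by rewrite unitmx_tr.
have cvt : cv t *m J^T = lsubmx (z t).
  by rewrite (hcv Oy) trmx_inv mulmxKV.
have zE : row_mx (cv t *m J^T) y = z t by rewrite cvt hsubmxK.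
have rE := rsub_hH oU sF0 sF sQ Uz.
have [D1 [dG [hG dGE]]] := jac_curve (erefl y) Oy dy.
have U1 : UU U' (row_mx (cv t) (Tr y)) by rewrite /UU /= row_mxKr; exact: OU'.
split.
  suff -> : grad (fun q => hamE F0' F' Qp' q (Tr y)) (cv t) = rsubmx (hH F0 F Qp (z t)) *m J by exact: D1.
  apply/rowP => j; rewrite [LHS]mxE.
  transitivity ('D_(row_mx (delta_mx 0 j *m J^T) 0) H (z t)); last first.
    by rewrite (derive_Hq oU sF0 sF sQ) // -rE pairing_mulmx trmxK pairingC pairing_delta.
  apply: derive_line_ext => u; rewrite -zE /Hz !linearD !linearZ /=.
  by rewrite !row_mxKl !row_mxKr scaler0 add0r (hh _ Oy) mulmxDl -scalemxAl.
have nov : \forall s \near t, O (rsubmx (z s)) by apply: (near_curve dy); exact: near_O.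
have [d dd] : exists d, is_derive t 1 cv d.
  have D := is_derive_mulmx dq (is_derive_trmx (is_derive_invmx hG Ju)).
  by eexists; exact: (near_eq_is_derive (filterS (fun s os => esym (hcv os)) nov) D).
have nE : \forall s \near t, cv s *m ('J Tr (rsubmx (z s)))^T = lsubmx (z s).
  apply: filterS nov => s os; rewrite (hcv os) trmx_inv.
  have us : ('J Tr (rsubmx (z s)))^T \in unitmx by rewrite unitmx_tr; exact: uTr os.
  by rewrite (mulmxKV us).
have ed : lsubmx (hH F0 F Qp (z t)) = d *m J^T + cv t *m dG^T.
  exact: (is_derive_unique dq (near_eq_is_derive nE (is_derive_mulmx dd (is_derive_trmx hG)))).
set gr := grad _ _.
suff egr : gr *m J^T = - lsubmx (hH F0 F Qp (z t)) + cv t *m dG^T.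
  have -> : - gr = d; last exact: dd.
  apply: (can_inj (mulmxK JTu)); rewrite mulNmx egr opprD opprK ed.
  by rewrite addrK.
apply/rowP => i; set v : 'rV[R]_n := delta_mx 0 i.
have g0 : y + 0 *: v = y by rewrite scale0r addr0.
have Dl := line_derive y v 0.
have [DF [dGi [DJ dGiE]]] := jac_curve g0 Oy Dl.
have U1' : UU U' (row_mx (cv t) ((Tr \o (fun u : R => y + u *: v)) 0)) by rewrite /= g0.
have E1 := is_derive_comp (oUU oU') (sHz oU' sF0' sF' sQ') U1'
  (is_derive_row_mx (is_derive_cst (cv t) (0 : R) 1) DF).
have U2 : UU U (row_mx (cv t *m ('J Tr (y + 0 *: v))^T) (y + 0 *: v)).
  by rewrite /UU /= row_mxKr g0; exact: OU.
have D2 := is_derive_mulmx (is_derive_cst (cv t) (0 : R) 1) (is_derive_trmx DJ).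
have E2 := is_derive_comp (oUU oU) (sHz oU sF0 sF sQ) U2 (is_derive_row_mx D2 Dl).
have nu : \forall u \near (0 : R),
  (H \o (fun u : R => row_mx (cv t *m ('J Tr (y + u *: v))^T) (y + u *: v))) u =
  (H' \o (fun u : R => row_mx (cv t) ((Tr \o (fun u : R => y + u *: v)) u))) u.
  have ho : \forall u \near (0 : R), O (y + u *: v).
    by apply: (near_curve Dl); rewrite g0; exact: near_O.
  apply: filterS ho => u ou.
  by rewrite /Hz /= !row_mxKl !row_mxKr (hh _ ou).
have := is_derive_unique E1 (near_eq_is_derive nu E2).
rewrite /= mul0mx add0r g0 (derive_Hy _ oU' sF0' sF' sQ' U1) zE.
have -> : row_mx (cv t *m dGi^T) v = row_mx (cv t *m dGi^T) 0 + row_mx 0 v by rewrite add_row_mx addr0 add0r.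
rewrite (derive_add (oUU oU) (sHz oU sF0 sF sQ)) //.
rewrite (derive_Hy _ oU sF0 sF sQ Uz) (derive_Hq oU sF0 sF sQ) // -grad_hamE_y => E3.
have -> : (gr *m J^T) 0 i = pairing gr (v *m J).
  by rewrite -[J]trmxK -pairing_mulmx trmxK pairing_delta.
rewrite E3 [RHS]mxE lsub_hH opprK [RHS]addrC pairing_delta; congr (_ + _).
rewrite pairingE [RHS]mxE.
under eq_bigr do rewrite [(cv t *m _) _ _]mxE mulr_suml.
rewrite exchange_big; apply: eq_bigr => j _ /=.
rewrite [dG^T j i]mxE dGE (derive_coords oO _ (smooth_jac i j) Oy).
rewrite mulr_sumr; apply: eq_bigr => l _; rewrite -rE.
rewrite [dGi^T j l]mxE dGiE (jac_sym _ _ _ Oy).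
by rewrite -mulrA; congr (_ * _); rewrite mulrC.
Qed.
End ChartChange.

(** * Transition maps and the Hamiltonian flow on the manifold *)

Section Charts.
Context {R : realType} {n : nat} {M : manifold R n}.
Local Notation ct := (chart R n M).
Implicit Types (c : ct) (x : M).

Definition tr c c' : 'rV[R]_n -> 'rV[R]_n := cmap c' \o cinv c.
Definition ov c c' : set 'rV[R]_n := cmap c @` (cdom c `&` cdom c').

Section TwoCharts.
Variables c c' : ct.
Hypotheses (ac : atlas M c) (ac' : atlas M c').
Let hc := atlas_chart ac.
Let hc' := atlas_chart ac'.

Lemma ovP y : ov c c' y <-> ccod c y /\ cdom c' (cinv c y).
Proof using ac ac'.
split=> [[x [dx dx'] <-]|[[x dx <-]]]; rewrite (cmapK hc) //.
  by split=> //; exists x.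
by move=> dx'; exists x.
Qed.

Lemma ov_cmap x : cdom c x -> cdom c' x -> ov c c' (cmap c x).
Proof. by move=> h1 h2; exists x. Qed.

Lemma open_ov : open (ov c c').
Proof.
rewrite openE => y /ovP[cy dy]; rewrite /interior.
have h1 : nbhs y (ccod c) by apply: open_nbhs_nbhs; split; [exact: ccod_open hc|].
have h2 : nbhs y (cinv c @^-1` cdom c').
  apply: (cinv_continuous hc cy); apply: open_nbhs_nbhs; split; [exact: cdom_open hc'|exact: dy].
by apply: filterS2 h1 h2 => w w1 w2; apply/ovP.
Qed.

Lemma smooth_tr j : smooth (ov c c') (fun y => tr c c' y 0 j).
Proof. exact: (smooth_entry 0 j open_ov (atlas_compatible ac ac')). Qed.

Lemma tr_diff y : ov c c' y -> differentiable (tr c c') y /\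
  'J (tr c c') y = \matrix_(i, j) 'D_(delta_mx 0 i) (fun y => tr c c' y 0 j) y.
Proof. by move=> oy; exact: (smooth_diff open_ov smooth_tr oy). Qed.

Lemma is_derive_tr (g : R -> 'rV[R]_n) (t : R) dg y : g t = y -> ov c c' y -> is_derive t 1 g dg ->
  is_derive t 1 (tr c c' \o g) (dg *m 'J (tr c c') y).
Proof.
move=> <- og D; have [df _] := tr_diff og.
have -> : dg *m 'J (tr c c') (g t) = 'd (tr c c') (g t) dg by rewrite /jacobian mul_rV_lin1.
exact: is_derive_diff_comp.
Qed.

Lemma cinvK y : ccod c y -> cmap c (cinv c y) = y.
Proof. by move=> [x dx <-]; rewrite (cmapK hc). Qed.

Lemma cinv_dom y : ccod c y -> cdom c (cinv c y).
Proof. by move=> [x dx <-]; rewrite (cmapK hc). Qed.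

Lemma trJE y : ccod c y -> transition_jac c c' (cinv c y) = 'J (tr c c') y.
Proof using ac ac'. by move=> cy; rewrite /transition_jac cinvK. Qed.
End TwoCharts.

Lemma near_ov c c' y : atlas M c -> atlas M c' -> ov c c' y -> \forall w \near y, ov c c' w.
Proof. by move=> ac ac' oy; apply: open_nbhs_nbhs; split=> //; exact: open_ov. Qed.

Lemma transition_chain c c1 c2 x : atlas M c -> atlas M c1 -> atlas M c2 ->
  cdom c x -> cdom c1 x -> cdom c2 x ->
  transition_jac c c2 x = transition_jac c c1 x *m transition_jac c1 c2 x.
Proof.
move=> ac a1 a2 dc d1 d2; apply/row_matrixP => i; rewrite !rowE.
set v := delta_mx 0 i; set y := cmap c x.
have o1 : ov c c1 y by exact: ov_cmap.
have o2 : ov c c2 y by exact: ov_cmap.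
have cx : cinv c y = x by rewrite /y (cmapK (atlas_chart ac)).
have o3 : ov c1 c2 (cmap c1 x) by exact: ov_cmap.
have g0 : y + 0 *: v = y by rewrite scale0r addr0.
have D1 := is_derive_tr ac a1 g0 o1 (line_derive y v 0).
have D2 := is_derive_tr ac a2 g0 o2 (line_derive y v 0).
have g1 : (tr c c1 \o (fun u : R => y + u *: v)) 0 = cmap c1 x by rewrite /= g0 /tr /= cx.
have D3 := is_derive_tr a1 a2 g1 o3 D1.
have E : \forall u \near (0 : R), (tr c1 c2 \o (tr c c1 \o (fun u : R => y + u *: v))) u =
    (tr c c2 \o (fun u : R => y + u *: v)) u.
  have h : \forall u \near (0 : R), ov c c1 (y + u *: v).
    by apply: (near_curve (line_derive y v 0)); rewrite g0; exact: near_ov.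
  near=> u; have /(ovP ac a1)[_ hu] : ov c c1 (y + u *: v) by near: u.
  by rewrite /tr /= (cmapK (atlas_chart a1)).
have e := is_derive_unique (near_eq_is_derive E D3) D2.
by rewrite mulmxA; exact: esym e.
Unshelve. all: by end_near.
Qed.

Lemma transition_id c x : atlas M c -> cdom c x -> transition_jac c c x = 1%:M.
Proof.
move=> ac dc; apply/row_matrixP => i; rewrite !rowE.
set v := delta_mx 0 i; set y := cmap c x.
have o1 : ov c c y by exact: ov_cmap.
have g0 : y + 0 *: v = y by rewrite scale0r addr0.
have D1 := is_derive_tr ac ac g0 o1 (line_derive y v 0).
have E : \forall u \near (0 : R), y + u *: v = (tr c c \o (fun u : R => y + u *: v)) u.
  have h : \forall u \near (0 : R), ov c c (y + u *: v).
    by apply: (near_curve (line_derive y v 0)); rewrite g0; exact: near_ov.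
  near=> u; have /(ovP ac ac)[hu _] : ov c c (y + u *: v) by near: u.
  by rewrite /tr /= (cinvK ac hu).
have e := is_derive_unique (near_eq_is_derive E (line_derive y v 0)) D1.
by rewrite mulmx1; exact: esym e.
Unshelve. all: by end_near.
Qed.

Local Opaque jacobian transition_jac.

Lemma transition_inv c c' x : atlas M c -> atlas M c' -> cdom c x -> cdom c' x ->
  transition_jac c c' x *m transition_jac c' c x = 1%:M.
Proof. by move=> ac ac' d d'; rewrite -transition_chain // transition_id. Qed.

Let at_ x := chart_at_atlas x.
Let dom_ x := chart_at_dom x.

Lemma covec_cotangent c c' q y : atlas M c -> atlas M c' -> ov c c' y ->
  covec_in c' (cotangent_of c q y) = q *m (transition_jac c' c (cinv c y))^T.
Proof.
move=> ac ac' /(ovP ac ac')[cy dy]; rewrite /covec_in /cotangent_of /= -mulmxA -trmx_mul.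
by rewrite -transition_chain //; exact: cinv_dom.
Qed.

Lemma covec_cotangent_id c q y : atlas M c -> ccod c y -> covec_in c (cotangent_of c q y) = q.
Proof.
move=> ac cy; rewrite covec_cotangent //; last by apply/(ovP ac ac); split=> //; exact: cinv_dom.
by rewrite transition_id ?trmx1 ?mulmx1 //; exact: cinv_dom.
Qed.

Lemma cotangent_covec c l : atlas M c -> cdom c l.1 ->
  cotangent_of c (covec_in c l) (cmap c l.1) = l.
Proof.
case: l => x p ac /= dx; rewrite /cotangent_of /covec_in /= (cmapK (atlas_chart ac)) //.
by rewrite -mulmxA -trmx_mul -transition_chain // transition_id // trmx1 mulmx1.
Qed.

Section System.
Variables (k : nat) (S : affine_system M k).
Hypothesis hS : smooth_system S.

Definition cF0 c : 'rV[R]_n -> 'rV[R]_n := field_in c (drift S).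
Definition cF c (i : 'I_k) : 'rV[R]_n -> 'rV[R]_n := field_in c (frame S i).
Definition cQ c : 'rV[R]_n -> R := potential S \o cinv c.

Section OneChart.
Variable c : ct.
Hypothesis ac : atlas M c.

Lemma oc : open (ccod c). Proof. exact: ccod_open (atlas_chart ac). Qed.
Lemma scF0 j : smooth (ccod c) (fun y => cF0 c y 0 j).
Proof. by case: hS => h _ _; exact: (smooth_entry 0 j oc (h c ac)). Qed.
Lemma scF i j : smooth (ccod c) (fun y => cF c i y 0 j).
Proof. by case: hS => _ h _; exact: (smooth_entry 0 j oc (h i c ac)). Qed.
Lemma scQ : smooth (ccod c) (cQ c).
Proof. by case: hS => _ _ h; have := h c ac; rewrite setIT. Qed.

Lemma hamiltonian_chart q y : hamiltonian S (cotangent_of c q y) = hamE (cF0 c) (cF c) (cQ c) q y.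
Proof.
rewrite /hamiltonian /hamE /cotangent_of /= pairing_mulmx trmxK; congr (_ * _ + _ + _).
by apply: eq_bigr => i _; rewrite pairing_mulmx trmxK.
Qed.

Lemma grad_ham_q q y : grad (fun q' => hamiltonian S (cotangent_of c q' y)) q =
  grad (fun q' => hamE (cF0 c) (cF c) (cQ c) q' y) q.
Proof.
have -> // : (fun q' => hamiltonian S (cotangent_of c q' y)) =
  (fun q' => hamE (cF0 c) (cF c) (cQ c) q' y).
by apply/funext => q'; rewrite hamiltonian_chart.
Qed.

Lemma grad_ham_y q y : grad (fun y' => hamiltonian S (cotangent_of c q y')) y =
  grad (fun y' => hamE (cF0 c) (cF c) (cQ c) q y') y.
Proof.
have -> // : (fun y' => hamiltonian S (cotangent_of c q y')) =
  (fun y' => hamE (cF0 c) (cF c) (cQ c) q y').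
by apply/funext => y'; rewrite hamiltonian_chart.
Qed.
End OneChart.

Local Notation hF c := (hH (cF0 c) (cF c) (cQ c)).

(** [hamiltonian_curve] asks for Hamilton's equations in every chart of the atlas; they are solved
    in [c] and transferred by [chart_change]. *)
Lemma ham_curve_of c (a b : R) (z : R -> 'rV[R]_(n + n)) : atlas M c ->
  (forall t, a < t < b -> UU (ccod c) (z t) /\ is_derive t 1 z (hF c (z t))) ->
  hamiltonian_curve S a b (fun t => cotangent_of c (lsubmx (z t)) (rsubmx (z t))).
Proof.
move=> ac hz t tab; have [Uz dz] := hz t tab.
have dy : is_derive t 1 (fun s => rsubmx (z s)) (rsubmx (hF c (z t))) by exact: is_derive_rsub.
split.
  exact: (continuous_comp (is_derive_cont dy) (cinv_continuous (atlas_chart ac) Uz)).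
move=> c' ac' dx'.
have oy : ov c c' (rsubmx (z t)) by apply/(ovP ac ac').
have hh q1 w : ov c c' w -> hamE (cF0 c') (cF c') (cQ c') q1 (tr c c' w) =
    hamE (cF0 c) (cF c) (cQ c) (q1 *m ('J (tr c c') w)^T) w.
  move=> ow; have [cw dw] := (ovP ac ac' w).1 ow.
  have e1 : cinv c' (tr c c' w) = cinv c w by exact: (cmapK (atlas_chart ac') dw).
  have e2 : transition_jac (chart_at (cinv c w)) c' (cinv c w) =
      transition_jac (chart_at (cinv c w)) c (cinv c w) *m 'J (tr c c') w.
    have h := transition_chain (at_ (cinv c w)) ac ac' (dom_ (cinv c w)) (cinv_dom ac cw) dw.
    by rewrite (trJE ac ac' cw) in h; exact: h.
  have e3 : q1 *m (transition_jac (chart_at (cinv c w)) c' (cinv c w))^T = q1 *m ('J (tr c c') w)^T *m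
      (transition_jac (chart_at (cinv c w)) c (cinv c w))^T.
    by rewrite e2 trmx_mul mulmxA.
  have e4 : cotangent_of c' q1 (tr c c' w) = cotangent_of c (q1 *m ('J (tr c c') w)^T) w.
    have e5 : q1 *m (transition_jac (chart_at (cinv c' (tr c c' w))) c' (cinv c' (tr c c' w)))^T =
      q1 *m ('J (tr c c') w)^T *m (transition_jac (chart_at (cinv c w)) c (cinv c w))^T.
      by rewrite e1; exact: e3.
    exact: (f_equal2 pair e1 e5).
  transitivity (hamiltonian S (cotangent_of c' q1 (tr c c' w))).
    exact: esym (hamiltonian_chart c' q1 (tr c c' w)).
  rewrite e4; exact: hamiltonian_chart.
have Ju w : ov c c' w -> 'J (tr c c') w \in unitmx /\
    invmx ('J (tr c c') w) = transition_jac c' c (cinv c w).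
  move=> ow; have [cw dw] := (ovP ac ac' w).1 ow.
  have i1 : transition_jac c' c (cinv c w) *m 'J (tr c c') w = 1%:M.
    have h := transition_inv ac' ac dw (cinv_dom ac cw).
    by rewrite (trJE ac ac' cw) in h; exact: h.
  have [_ u1] := mulmx1_unit i1; split; first exact: u1.
  by have := congr1 (mulmx^~ (invmx ('J (tr c c') w))) i1; rewrite mulmxK // mul1mx.
pose cv s := covec_in c' (cotangent_of c (lsubmx (z s)) (rsubmx (z s))).
have hcv s : ov c c' (rsubmx (z s)) -> cv s = lsubmx (z s) *m (invmx ('J (tr c c') (rsubmx (z s))))^T.
  move=> os; rewrite (Ju _ os).2; exact: (covec_cotangent _ ac ac' os).
have img w : ov c c' w -> ccod c' (tr c c' w).
  by move=> ow; have [cw dw] := (ovP ac ac' w).1 ow; exists (cinv c w).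
have [R1 R2] := chart_change (open_ov ac ac') (smooth_tr ac ac') (fun w ow => (Ju w ow).1)
  (oc ac) (scF0 ac) (scF ac) (scQ ac) (oc ac') (scF0 ac') (scF ac') (scQ ac')
  (fun w ow => ((ovP ac ac' w).1 ow).1) img hh oy Uz dz hcv.
have g1 := grad_ham_q c' (cv t) (tr c c' (rsubmx (z t))).
have g2 := grad_ham_y c' (cv t) (tr c c' (rsubmx (z t))).
rewrite -g1 in R1; rewrite -g2 in R2.
exact: (conj R1 R2).
Qed.

Lemma ode_unique_near m (U : set 'rV[R]_m) (h : 'rV[R]_m -> 'rV[R]_m) (z w : R -> 'rV[R]_m) (t : R) :
  open U -> (csmooth U h) -> U (z t) -> z t = w t ->
  (\forall s \near t, is_derive (s : R) (1 : R) z (h (z s)) /\ is_derive (s : R) (1 : R) w (h (w s))) ->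
  \forall s \near t, z s = w s.
Proof.
move=> oU sh Uz zw hd; have [r [K [r0 K0 est]]] := field_est oU sh Uz.
have [dz dw] := nbhs_singleton hd.
have nz := (cont_epsP _ _).1 (is_derive_cont dz) r r0.
have nw := (cont_epsP _ _).1 (is_derive_cont dw) r r0.
have [d1 d10 h1] := nz; have [d2 d20 h2] := nw.
have [d3 d30 h3] := (nbhs_eps _ _).1 hd.
have k0 : 0 < 2^-1 / K by rewrite divr_gt0.
have [e1 e10 [e11 e12]] := near_min2 d10 d20; have [e2 e20 [e21 e22]] := near_min2 d30 k0.
have [e e0 [ee1 ee2]] := near_min2 e10 e20.
apply/nbhs_eps; exists e => // s hs.
have bt u : between t s u -> `|u - t| <= e by move=> /between_dist hu; exact: le_trans hu hs.
have := solves_lip K0 est (z := z) (w := w) (s := t) (t := s).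
rewrite zw subrr normr0 mulr0 normr_le0 subr_eq0 => H; apply/eqP; apply: H.
- apply: le_trans (ler_wpM2l (ltW K0) (le_trans hs (le_trans ee2 e22))) _.
  by rewrite mulrC divfK // gt_eqF.
- move=> u /bt hu; split; first by rewrite -zw; exact: h1 (le_trans hu (le_trans ee1 e11)).
  by have [] := h3 _ (le_trans hu (le_trans ee2 e21)).
- move=> u /bt hu; split; last by have [] := h3 _ (le_trans hu (le_trans ee2 e21)).
  exact: h2 (le_trans hu (le_trans ee1 e12)).
Qed.

(** A priori [g] may leave the chart. Agreement is propagated by [real_ind] in the factor [th] of
    [th * t], which treats both signs of [t]. At a limit the base points agree because the manifold
    is Hausdorff, which brings [g] back into the chart; the full states agree by continuity, and
    local uniqueness continues the identity. *)
Lemma ham_unique c (a b T : R) g (z : R -> 'rV[R]_(n + n)) : atlas M c -> a < 0 < b ->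
  hamiltonian_curve S a b g ->
  (forall t : R, `|t| < T -> UU (ccod c) (z t) /\ is_derive t 1 z (hF c (z t))) ->
  g 0 = cotangent_of c (lsubmx (z 0)) (rsubmx (z 0)) ->
  forall t, a < t < b -> `|t| < T -> g t = cotangent_of c (lsubmx (z t)) (rsubmx (z t)).
Proof.
move=> ac /andP[a0 b0] hg hz g0 t tab tT.
have in_ab th : 0 <= th <= 1 -> a < th * t < b /\ `|th * t| < T.
  move=> /andP[h0 h1]; have /andP[ta tb] := tab; split.
    have [t0|t0] := leP 0 t.
      have h2 : th * t <= t by rewrite ler_piMl.
      by have h3 := mulr_ge0 h0 t0; apply/andP; split; lra.
    have h2 : (1 - th) * t <= 0 by rewrite mulr_ge0_le0 ?subr_ge0 // ltW.
    have h3 : th * t <= 0 by rewrite mulr_ge0_le0 // ltW.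
    by rewrite mulrBl mul1r in h2; apply/andP; split; lra.
  by rewrite normrM ger0_norm //; apply: le_lt_trans tT; rewrite ler_piMl.
pose zh s := cotangent_of c (lsubmx (z s)) (rsubmx (z s)).
pose w s := row_mx (covec_in c (g s)) (cmap c (g s).1).
have wz s : `|s| < T -> g s = zh s -> w s = z s.
  move=> sT e; have [Uz _] := hz s sT.
  by rewrite /w e /zh (covec_cotangent_id _ ac Uz) /= (cinvK ac Uz) hsubmxK.
have zw s : cdom c (g s).1 -> w s = z s -> g s = zh s.
  move=> ds e; rewrite /zh -e /w row_mxKl row_mxKr.
  by rewrite cotangent_covec.
have wd s : a < s < b -> cdom c (g s).1 -> is_derive s 1 w (hF c (w s)).
  move=> sab ds; have [_ /(_ c ac ds)[D1 D2]] := hg s sab.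
  have cs : ccod c (cmap c (g s).1) by exists (g s).1.
  have e1 := grad_ham_q c (covec_in c (g s)) (cmap c (g s).1).
  have e2 := grad_ham_y c (covec_in c (g s)) (cmap c (g s).1).
  rewrite e1 in D1; rewrite e2 in D2.
  have e3 := @hHE _ _ _ (ccod c) (cF0 c) (cF c) (cQ c) (covec_in c (g s)) (cmap c (g s).1) cs.
  have D := is_derive_row_mx D2 D1; rewrite -e3 in D; exact: D.
have zc s : `|s| < T -> {for s, continuous (fun s => (zh s).1)}.
  move=> sT; have [Uz dz] := hz s sT.
  have c1 : {for s, continuous (fun s => rsubmx (z s))}.
    exact: (continuous_comp (is_derive_cont dz) (@rsubmx_continuous R n _)).
  exact: (continuous_comp c1 (cinv_continuous (atlas_chart ac) Uz)).
have sc th : {for th, continuous (fun th : R => th * t)}.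
  by apply: is_derive_cont; exact: (is_deriveM' (is_derive_id th (1 : R)) (is_derive_cst t th (1 : R))).
suff : g (1 * t) = zh (1 * t) by rewrite mul1r.
apply: (real_ind (P := fun th => g (th * t) = zh (th * t)) ler01).
- by rewrite mul0r.
- move=> th /andP[th0 th1] hs; have hth : 0 <= th <= 1 by rewrite ltW.
  have [sab sT] := in_ab th hth; have [Uz dz] := hz _ sT.
  have nl : \forall s \near th^'-, g (s * t) = zh (s * t).
    by near=> s; apply: hs; apply/andP; split; [apply: ltW; near: s; exact: nbhs_left_gt|near: s; exact: nbhs_left_lt].
  have [cg _] := hg _ sab.
  have e1 : (g (th * t)).1 = (zh (th * t)).1.
    have c1 : (fun s => (g (s * t)).1) @ th^'- --> (g (th * t)).1.
      by apply: cvg_at_left_filter; exact: (continuous_comp (sc th) cg).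
    have c2 : (fun s => (zh (s * t)).1) @ th^'- --> (zh (th * t)).1.
      by apply: cvg_at_left_filter; exact: (continuous_comp (sc th) (zc _ sT)).
    apply: (cvg_unique (manifold_hausdorff (m := M)) c1).
    by apply: cvg_trans c2; apply: near_eq_cvg; apply: filterS nl => s ->.
  have dth : cdom c (g (th * t)).1 by rewrite e1; exact: cinv_dom.
  apply: (zw _ dth).
  have c1 : (fun s => w (s * t)) @ th^'- --> w (th * t).
    by apply: cvg_at_left_filter; exact: (continuous_comp (sc th) (is_derive_cont (wd _ sab dth))).
  have c2 : (fun s => z (s * t)) @ th^'- --> z (th * t).
    by apply: cvg_at_left_filter; exact: (continuous_comp (sc th) (is_derive_cont dz)).
  apply: (cvg_unique (@norm_hausdorff R _) c1).
  apply: cvg_trans c2; apply: near_eq_cvg; near=> s; apply/esym/wz; last by near: s.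
  apply: (in_ab s _).2; apply/andP; split.
    by apply: ltW; near: s; exact: nbhs_left_gt.
  by apply: le_trans th1; apply: ltW; near: s; exact: nbhs_left_lt.
- move=> th /andP[th0 th1] e; have hth : 0 <= th <= 1 by rewrite th0 ltW.
  have [sab sT] := in_ab th hth; have [Uz dz] := hz _ sT.
  have [cg _] := hg _ sab.
  have dth : cdom c (g (th * t)).1 by rewrite e; exact: cinv_dom.
  have n1 : \forall s \near th * t, cdom c (g s).1.
    by apply: cg; apply: open_nbhs_nbhs; split; [exact: cdom_open (atlas_chart ac)|].
  have n2 : \forall s \near th * t, a < s < b.
    exact: near_between.
  have n3 : \forall s \near th * t, `|s| < T.
    by apply: open_nbhs_nbhs; split; [exact: open_absball|].
  have n4 : \forall s \near th * t, z s = w s.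
    apply: (ode_unique_near (oUU (oc ac)) (shH (oc ac) (scF0 ac) (scF ac) (scQ ac)) Uz); first by rewrite wz.
    near=> s; split; last by apply: wd; near: s.
    by have [|_ ?] := hz s; first by near: s.
  have n5 : \forall s \near th * t, g s = zh s.
    by near=> s; apply: zw; [near: s|apply/esym; near: s].
  have [d d0 hd] := (nbhs_eps _ _).1 n5.
  have t10 : 0 < `|t| + 1 by rewrite ltr_wpDl.
  exists (d / (`|t| + 1)); first by rewrite divr_gt0.
  move=> s /andP[s1 s2]; apply: hd; rewrite -mulrBl normrM ger0_norm ?subr_ge0 //.
  have h1 : s - th <= d / (`|t| + 1) by rewrite lerBlDl.
  apply: (@le_trans _ _ (d / (`|t| + 1) * (`|t| + 1))); last by rewrite divfK // gt_eqF.
  by apply: ler_pM => //; rewrite ?subr_ge0 // lerDl.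
Unshelve. all: by end_near.
Qed.

(** [flow] is a choice among the endpoints of Hamiltonian curves, so it is identified by
    uniqueness. *)
Lemma flow_local c (T : R) (z : R -> 'rV[R]_(n + n)) (t : R) : atlas M c ->
  (forall t : R, `|t| < T -> UU (ccod c) (z t) /\ is_derive t 1 z (hF c (z t))) -> `|t| < T ->
  flow S t (cotangent_of c (lsubmx (z 0)) (rsubmx (z 0))) = cotangent_of c (lsubmx (z t)) (rsubmx (z t)).
Proof.
move=> ac hz tT; set l := cotangent_of c _ _.
have T0 : 0 < T by apply: le_lt_trans tT.
have ex : flow_rel S t l (cotangent_of c (lsubmx (z t)) (rsubmx (z t))).
  exists (- T), T, (fun s => cotangent_of c (lsubmx (z s)) (rsubmx (z s))); split=> //.
  - by rewrite oppr_lt0 T0.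
  - by rewrite -ltr_norml.
  - by apply: ham_curve_of => // s; rewrite -ltr_norml; exact: hz.
have [a [b [g [ab tab hg g0 gt]]]] : flow_rel S t l (flow S t l) by apply: xgetPex; eexists; exact: ex.
by rewrite -gt; exact: (ham_unique ac ab hg hz g0 tab tT).
Qed.

End System.
End Charts.

Notation cH S c := (hH (cF0 S c) (cF S c) (cQ S c)).
Notation cHz S c := (Hz (cF0 S c) (cF S c) (cQ S c)).

(** [vspan] is defined by choice, so a smallest subspace has to be exhibited: the span of a finite
    part of [A] of maximal dimension. *)
Lemma vspanP (R : realType) n (A : set 'rV[R]_n) :
  (forall v, A v -> v \in vspan A) /\
  (forall U : {vspace 'rV[R]_n}, (forall v, A v -> v \in U) -> (vspan A <= U)%VS).
Proof.
pose Q (d : nat) := `[< exists s : seq 'rV[R]_n, (forall v, v \in s -> A v) /\ \dim << s >>%VS = d >].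
have Q0 : exists d, Q d.
  by exists 0%N; apply/asboolP; exists [::]; rewrite span_nil dimv0.
have Qn d : Q d -> (d <= \dim (fullv : {vspace 'rV[R]_n}))%N.
  by move=> /asboolP[s [_ <-]]; apply: dimvS; exact: subvf.
have [d /asboolP[s [sA sd]] dmax] := ex_maxnP Q0 Qn.
have P : (forall v, A v -> v \in << s >>%VS) /\
    (forall U : {vspace 'rV[R]_n}, (forall v, A v -> v \in U) -> (<< s >> <= U)%VS).
  split=> [v Av|U hU]; last by apply/span_subvP => v /sA; exact: hU.
  have h : (<< s >> <= << v :: s >>)%VS by rewrite span_cons addvSr.
  have : (\dim << v :: s >>%VS <= d)%N.
    apply: dmax; apply/asboolP; exists (v :: s); split=> // w.
    by rewrite inE => /orP[/eqP -> //|/sA].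
  rewrite -sd => h2; have /eqP -> : << s >>%VS == << v :: s >>%VS by rewrite eqEdim h.
  by rewrite memv_span // mem_head.
rewrite /vspan; have := xgetPex 0%VS (ex_intro _ << s >>%VS P : exists U, [set U : {vspace 'rV[R]_n} |
  (forall v, A v -> v \in U) /\
    (forall U' : {vspace 'rV[R]_n}, (forall v, A v -> v \in U') -> (U <= U')%VS)] U).
by [].
Qed.

Lemma smooth_det (R : realType) (V : normedModType R) (U : set V) n (A : V -> 'M[R]_n) : open U ->
  (forall i j, smooth U (fun y => A y i j)) -> smooth U (fun y => \det (A y)).
Proof.
move=> oU sA; apply: (smooth_sum _ _ oU) => s.
by apply: (smoothZ _ oU); apply: (smooth_prod _ oU) => i; exact: sA.
Qed.

Lemma smooth_mulmx (R : realType) (V : normedModType R) (U : set V) m n p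
    (A : V -> 'M[R]_(m, n)) (B : V -> 'M[R]_(n, p)) : open U ->
  (forall i j, smooth U (fun y => A y i j)) -> (forall i j, smooth U (fun y => B y i j)) ->
  forall i j, smooth U (fun y => (A y *m B y) i j).
Proof.
move=> oU sA sB i j; apply: (smooth_ext oU (f := fun y => \sum_l A y i l * B y l j)).
  by move=> y _; rewrite mxE.
by apply: (smooth_sum _ _ oU) => l; exact: smoothM.
Qed.

Lemma smooth_invmx (R : realType) (I : set R) n (A : R -> 'M[R]_n) : open I ->
  (forall i j, smooth I (fun t => A t i j)) -> (forall t, I t -> A t \in unitmx) ->
  forall i j, smooth I (fun t => invmx (A t) i j).
Proof.
move=> oI sA uA i j.
apply: (smooth_ext oI (f := fun t => (\det (A t))^-1 * ((-1) ^+ (j + i) * \det (row' j (col' i (A t)))))).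
  by move=> t It; rewrite /invmx (uA t It) [RHS]mxE [X in _ = _ * X]mxE.
apply: (smoothM oI).
  apply: smoothV => //; first exact: smooth_det.
  by move=> t It; rewrite -unitfE -unitmxE; exact: uA.
apply: (smoothZ _ oI); apply: smooth_det => // a b.
by apply: (smooth_ext oI _ (sA (lift j a) (lift i b))) => t _; rewrite !mxE.
Qed.

(** * Naturality of the Lie bracket under a change of coordinates *)

Section BracketChange.
Context {R : realType} (n : nat).
Variables (O : set 'rV[R]_n) (Tr : 'rV[R]_n -> 'rV[R]_n).
Hypotheses (oO : open O) (sTr : csmooth O Tr).
Variables (U : set 'rV[R]_n) (Xa Ya Xc Yc : 'rV[R]_n -> 'rV[R]_n).
Hypothesis oU : open U.
Hypotheses (sXa : csmooth O Xa) (sYa : csmooth O Ya)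
  (sXc : csmooth U Xc) (sYc : csmooth U Yc).
Hypotheses (OU : forall w, O w -> U (Tr w)).
Hypotheses (hX : forall w, O w -> Xc (Tr w) = Xa w *m 'J Tr w)
  (hY : forall w, O w -> Yc (Tr w) = Ya w *m 'J Tr w).

Let one (Xa' Xc' : 'rV[R]_n -> 'rV[R]_n) v y j : (csmooth O Xa') ->
  (csmooth U Xc') ->
  (forall w, O w -> Xc' (Tr w) = Xa' w *m 'J Tr w) -> O y ->
  'D_(v *m 'J Tr y) (fun w => Xc' w 0 j) (Tr y) =
   \sum_l 'D_v (fun w => Xa' w 0 l) y * 'J Tr y l j +
   \sum_l Xa' y 0 l * \sum_m v 0 m * 'D_(delta_mx 0 m) (fun w => 'J Tr w l j) y.
Proof.
move=> sA sC hh Oy.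
have g0 : y + 0 *: v = y by rewrite scale0r addr0.
have Dl := line_derive y v 0.
have [DF [dG [DJ dGE]]] := jac_curve oO sTr g0 Oy Dl.
have U1 : U ((Tr \o (fun u : R => y + u *: v)) 0) by rewrite /= g0; exact: OU.
have E1 := is_derive_comp oU (sC j) U1 DF.
have E2 : is_derive (0 : R) 1 (fun u : R => \sum_l Xa' (y + u *: v) 0 l * 'J Tr (y + u *: v) l j)
    (\sum_l ('D_v (fun w => Xa' w 0 l) y * 'J Tr y l j + Xa' y 0 l * dG l j)).
  apply: (derive_sum_seq (index_enum 'I_n)
    (f := fun l (u : R) => Xa' (y + u *: v) 0 l * 'J Tr (y + u *: v) l j)) => l.
  have Oy0 : O (y + 0 *: v) by rewrite g0.
  have D1 := is_derive_comp oO (sA l) Oy0 Dl.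
  have /derive_mxP/(_ l j) D2 := DJ.
  by have := is_deriveM' D1 D2; rewrite /= g0; apply.
have nu : \forall u \near (0 : R), (fun u : R => \sum_l Xa' (y + u *: v) 0 l * 'J Tr (y + u *: v) l j) u =
   ((fun w => Xc' w 0 j) \o (Tr \o (fun u : R => y + u *: v))) u.
  have ho : \forall u \near (0 : R), O (y + u *: v).
    by apply: (near_curve Dl); rewrite g0; exact: near_O.
  by apply: filterS ho => u ou; rewrite /= (hh _ ou) mxE.
have := is_derive_unique E1 (near_eq_is_derive nu E2); rewrite /= g0 => ->.
rewrite big_split /=; congr (_ + _); apply: eq_bigr => l _; congr (_ * _).
by rewrite dGE (derive_coords oO _ (smooth_jac oO sTr l j) Oy).
Qed.

(** Each derivative of a transported field carries a term with second derivatives of [Tr]; the two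
    such terms are exchanged by symmetry and cancel in the bracket. *)
Lemma bracket_change y j : O y ->
  \sum_l ('D_(Ya y) (fun w => Xa w 0 l) y - 'D_(Xa y) (fun w => Ya w 0 l) y) * 'J Tr y l j =
  'D_(Yc (Tr y)) (fun w => Xc w 0 j) (Tr y) - 'D_(Xc (Tr y)) (fun w => Yc w 0 j) (Tr y).
Proof.
move=> Oy; rewrite (hX Oy) (hY Oy) (one _ j sXa sXc hX Oy) (one _ j sYa sYc hY Oy).
have -> : \sum_l Xa y 0 l * \sum_m Ya y 0 m * 'D_(delta_mx 0 m) (fun w => 'J Tr w l j) y =
    \sum_l Ya y 0 l * \sum_m Xa y 0 m * 'D_(delta_mx 0 m) (fun w => 'J Tr w l j) y.
  under eq_bigr do rewrite mulr_sumr.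
  rewrite exchange_big; apply: eq_bigr => m _ /=; rewrite mulr_sumr; apply: eq_bigr => l _.
  by rewrite mulrCA; congr (_ * (_ * _)); exact: (jac_sym oO sTr _ _ _ Oy).
rewrite opprD addrACA subrr addr0 -sumrB; apply: eq_bigr => l _.
by rewrite mulrBl.
Qed.
End BracketChange.

(** One-sided, because an admissible extension reproduces the velocity of the geodesic at
    nonnegative times only. *)
Lemma is_derive_right_unique (R : realType) (f g : R -> R) (t d a b : R) : 0 < d ->
  is_derive t 1 f a -> is_derive t 1 g b -> (forall s, t <= s < t + d -> f s = g s) -> a = b.
Proof.
move=> d0 Df Dg h; have D := is_deriveB Df Dg.
apply/eqP; rewrite -subr_eq0; apply/eqP.
have e := @derive_val _ _ _ _ _ _ _ D; have [hc _] := D.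
have h1 : (fun u : R => u^-1 *: (((f - g) \o shift t) (u *: 1) - (f - g) t)) @ 0^'+ --> a - b.
  by rewrite -e; apply: cvg_dnbhs_at_right; exact: hc.
have h2 : (fun u : R => u^-1 *: (((f - g) \o shift t) (u *: 1) - (f - g) t)) @ 0^'+ --> (0 : R).
  apply: (@cvg_trans _ ((fun=> (0 : R)) @ 0^'+)); last exact: cvg_cst.
  apply: near_eq_cvg; near=> u; rewrite /= /shift /=.
  have u0 : 0 < u by near: u; exact: nbhs_right_gt.
  have ud : u < d by near: u; exact: nbhs_right_lt.
  have e1 : f (u *: 1 + t) = g (u *: 1 + t).
    by apply: h; rewrite /GRing.scale /= mulr1; apply/andP; split; lra.
  have e2 : f t = g t by apply: h; apply/andP; split; lra.
  by rewrite -[(f - g) (u *: 1 + t)]/(f (u *: 1 + t) - g (u *: 1 + t)) -[(f - g) t]/(f t - g t)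
    e1 e2 !subrr scaler0.
exact: (cvg_unique (@norm_hausdorff R _) h1 h2).
Unshelve. all: by end_near.
Qed.

(** * Iterated brackets along the extremal *)

Section FlagRec.
Context {R : realType} (n k : nat).
Variables (U : set 'rV[R]_n) (F0 : 'rV[R]_n -> 'rV[R]_n) (F : 'I_k -> 'rV[R]_n -> 'rV[R]_n)
  (Qp : 'rV[R]_n -> R).
Hypotheses (oU : open U) (sF0 : csmooth U F0)
  (sF : forall i, csmooth U (F i)) (sQ : smooth U Qp).
Local Notation hF := (hH F0 F Qp).
Local Notation DH := (Dfield hF).
Variables (T eps : R) (zc : R -> 'rV[R]_(n + n)) (E : 'M[R]_(n, k)) (Vc : 'rV[R]_n -> 'rV[R]_n).
Local Notation yc t := (rsubmx (zc t)).
Hypotheses (T0 : 0 < T) (epsT : eps <= T) (zcU : forall t : R, `|t| < T -> UU U (zc t))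
  (dzc : forall t : R, `|t| < T -> is_derive t 1 zc (hF (zc t)))
  (uE : forall t : R, `|t| < T -> XX F (yc t) *m E \in unitmx)
  (sV : csmooth U Vc)
  (secV : forall y, U y -> exists a : 'rV[R]_k, Vc y = F0 y + a *m XX F y)
  (velV : forall t, 0 <= t < eps -> rsubmx (hF (zc t)) = Vc (yc t)).
Local Notation IT := (@IT R T).
Local Notation A_ t := (drsubmx (DH (zc t))).
Local Notation B_ t := (Dfield Vc (yc t)).

Let inT t : 0 <= t < eps -> `|t| < T.
Proof. by move=> /andP[t0 te]; rewrite ger0_norm // (lt_le_trans te). Qed.

Definition Cm (t : R) : 'M[R]_(n, k) := (A_ t - B_ t) *m E *m invmx (XX F (yc t) *m E).

(** With the covector frozen, the difference of [rH] and [Vc] takes values in the distribution and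
    vanishes on the extremal at time [t], so its derivative there lies in the distribution as well.
    [Cm] gives its coordinates in the frame: any row [Z] in the span of the frame satisfies
    $Z=ZE(XE)^{-1}X$. *)
Lemma connection_diff t : 0 <= t < eps -> A_ t - B_ t = Cm t *m XX F (yc t).
Proof.
move=> ht; have tT := inT ht; have Uz := zcU tT; set y := yc t; set q := lsubmx (zc t).
apply/row_matrixP => i; rewrite row_mul /Cm !row_mul; set v : 'rV[R]_n := delta_mx 0 i.
set f' := row i (A_ t - B_ t).
have g0 : y + 0 *: v = y by rewrite scale0r addr0.
have Dl := line_derive y v 0.
pose X u := XX F (y + u *: v).
pose f (u : R) := q *m ((X u)^T *m X u) + F0 (y + u *: v) - Vc (y + u *: v).
have U0 : U (y + 0 *: v) by rewrite g0.
have [dX DX] : exists dX, is_derive (0 : R) 1 X dX.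
  exists (\matrix_(a, b) 'D_v (fun w => F a w 0 b) (y + 0 *: v)); apply/derive_mxP => a b; rewrite mxE.
  apply: (is_derive_ext (is_derive_comp oU (sF a b) U0 Dl)) => u.
  by rewrite /= mxE.
have Df : is_derive (0 : R) 1 f f'.
  have Ur : UU U (row_mx q (y + 0 *: v)) by rewrite /UU /= row_mxKr g0.
  apply/derive_mxP => a j; rewrite ord1.
  have D1 := is_derive_comp (oUU oU) (smooth_rH oU sF0 sF sQ j) Ur (is_derive_row_mx (is_derive_cst q (0 : R) 1) Dl).
  have D2 := is_derive_comp oU (sV j) U0 Dl.
  have D := is_deriveB D1 D2.
  have e : f' 0 j = 'D_(row_mx 0 v) (fun z => rH F0 F z 0 j) (row_mx q (y + 0 *: v)) -
      'D_v (fun w => Vc w 0 j) (y + 0 *: v).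
    rewrite g0 hsubmxK -(derive_rH oU sF0 sF sQ) // -(mul_Dfield oU sV) //.
    rewrite /f' [LHS]mxE [LHS]mxE [X in _ + X]mxE; congr (_ - _).
      rewrite drE -[zc t in RHS]/(zc t).
      have -> : row_mx 0 v = delta_mx 0 (rshift n i) :> 'rV[R]_(n + n) by rewrite delta_mx_rshift.
      by rewrite -rowE [RHS]mxE.
    by rewrite -rowE [RHS]mxE.
  rewrite e; apply: (is_derive_ext D) => u.
  rewrite -[LHS]/(rH F0 F (row_mx q (y + u *: v)) 0 j - Vc (y + u *: v) 0 j) /rH row_mxKl row_mxKr.
  by rewrite /f /X; move: (Vc _) (F0 _) (_ *m _) => x1 x2 x3; rewrite !mxE.
have f0 : f 0 = 0.
  have e1 : rH F0 F (zc t) = Vc y by rewrite -(rsub_hH oU sF0 sF sQ Uz); exact: velV.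
  by rewrite /f /X g0 -e1 /rH subrr.
have X0u : X 0 *m E \in unitmx by rewrite /X g0; exact: uE.
have DXE : is_derive (0 : R) 1 (fun u => X u *m E) (dX *m E).
  by have := is_derive_mulmx DX (is_derive_cst E (0 : R) 1); rewrite mulmx0 addr0; apply.
have DG := is_derive_invmx DXE X0u.
have DfE : is_derive (0 : R) 1 (fun u => f u *m E) (f' *m E).
  by have := is_derive_mulmx Df (is_derive_cst E (0 : R) 1); rewrite mulmx0 addr0; apply.
have Dall := is_derive_mulmx (is_derive_mulmx DfE DG) DX.
have nu : \forall u \near (0 : R), f u *m E *m invmx (X u *m E) *m X u = f u.
  have h1 : \forall u \near (0 : R), U (y + u *: v).
    by apply: (near_curve Dl); rewrite g0; apply: open_nbhs_nbhs; split.
  have h2 : \forall u \near (0 : R), X u *m E \in unitmx.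
    have Dd := is_derive_det DXE.
    have h : \forall x \near \det (X 0 *m E), x != 0.
      by apply: open_nbhs_nbhs; split; [exact: open_neq|rewrite /= -unitfE -unitmxE].
    have := near_curve Dd h; apply: filterS => u; by rewrite unitmxE unitfE.
  apply: filterS2 h1 h2 => u u1 u2.
  have [a ha] := secV u1.
  have -> : f u = (q *m (X u)^T - a) *m X u.
    have lin (x1 x2 x3 : 'rV[R]_n) : x1 + x2 - (x2 + x3) = x1 - x3 by rewrite opprD addrA addrK.
    by rewrite /f ha mulmxBl mulmxA; exact: lin.
  by rewrite -[(_ - _) *m X u *m E]mulmxA mulmxK.
have e := is_derive_unique (near_eq_is_derive nu Dall) Df.
have e' : f' *m E *m invmx (X 0 *m E) *m X 0 = f'.
  by move: e; rewrite /= f0 !mul0mx !addr0.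
by move: e'; rewrite /X g0 => ->.
Qed.

Let oI : open IT. Proof. exact: oIT. Qed.
Let sz (f : 'rV[R]_n -> R) : smooth U f -> smooth IT (fun t => f (yc t)).
Proof. by move=> sf; exact: (smooth_zc oU sF0 sF sQ zcU dzc (smooth_rsub sf)). Qed.

Lemma smooth_Cm i l : smooth IT (fun t => Cm t i l).
Proof.
have sE a b : smooth IT (fun=> E a b) by exact: smooth_cst.
have sX a b : smooth IT (fun t => (XX F (yc t)) a b).
  by apply: (smooth_ext oI _ (sz (sF a b))) => t _; rewrite mxE.
apply: (smooth_mulmx (A := fun t => (A_ t - B_ t) *m E) (B := fun t => invmx (XX F (yc t) *m E)) oI) => a b.
  apply: (smooth_mulmx (A := fun t => A_ t - B_ t) (B := fun=> E) oI) => // a' b'.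
  apply: (smooth_ext oI (f := fun t => DH (zc t) (rshift n a') (rshift n b') - 'D_(delta_mx 0 a') (fun w => Vc w 0 b') (yc t))).
    by move=> t _; rewrite [RHS]mxE [X in _ = _ + X]mxE drE; congr (_ - _); rewrite mxE.
  apply: (smoothB oI); first exact: (smooth_zc oU sF0 sF sQ zcU dzc (smooth_DH oU sF0 sF sQ _ _)).
  exact: (sz (smooth_derive (delta_mx 0 a') (sV b'))).
apply: (smooth_invmx (A := fun t => XX F (yc t) *m E) oI) => // a' b'.
exact: (smooth_mulmx (A := fun t => XX F (yc t)) (B := fun=> E) oI).
Qed.

#[local] Arguments Xs : simpl never.

(** Induction on [j]: differentiating $\sum_ic_iX_i$ along the extremal produces the $X_{i+1}$ and a
    term in $A$, while the bracket subtracts a term in $B$. The difference $A-B$ is a multiple of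
    $X_0$ by [connection_diff]. The top coefficient is always [g], so the relation is triangular. *)
Lemma flag_rec (G : nat -> 'rV[R]_n -> 'rV[R]_n) (g : R -> 'rV[R]_k) :
  (forall j b, smooth U (fun y => G j y 0 b)) ->
  (forall j y b, U y -> G j.+1 y 0 b =
     'D_(Vc y) (fun w => G j w 0 b) y - 'D_(G j y) (fun w => Vc w 0 b) y) ->
  (forall l, smooth IT (fun t => g t 0 l)) ->
  (forall t, 0 <= t < eps -> G 0%N (yc t) = g t *m XX F (yc t)) ->
  forall j, exists c : nat -> R -> 'rV[R]_k,
    [/\ (forall i l, smooth IT (fun t => c i t 0 l)), c j = g &
        forall t, 0 <= t < eps -> G j (yc t) = \sum_(i < j.+1) c i t *m Xs F0 F Qp i (zc t)].
Proof.
move=> sG GS sg G0; elim=> [|j [c [sc cj cE]]].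
  by exists (fun=> g); split=> // t ht; rewrite big_ord1 G0.
pose dc i t : 'rV[R]_k := \row_l 'D_1 (fun t => c i t 0 l) t.
pose c' i t : 'rV[R]_k := (if (i <= j)%N then dc i t else 0) +
  (if i is i'.+1 then c i' t else G j (yc t) *m Cm t).
have sdc i l : smooth IT (fun t => dc i t 0 l).
  by apply: (smooth_ext oI _ (smooth_derive (1 : R) (sc i l))) => t _; rewrite mxE.
exists c'; split.
- move=> i l; apply: (smooth_ext oI (f := fun t => (if (i <= j)%N then dc i t 0 l else 0) +
    (if i is i'.+1 then c i' t 0 l else (G j (yc t) *m Cm t) 0 l))).
    by move=> t _; rewrite [RHS]mxE; case: ifP => _; case: i => [|i] //; rewrite [X in _ = X + _]mxE.
  apply: (smoothD oI); first by case: (i <= j)%N; [exact: sdc|exact: smooth_cst].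
  case: i => [|i]; last exact: sc.
  apply: (smooth_mulmx (A := fun t => G j (yc t)) (B := Cm) oI); last exact: smooth_Cm.
  by move=> a b; rewrite ord1; exact: (sz (sG j b)).
- by apply/funext => t; rewrite /c' ltnn add0r cj.
move=> t ht; have tT := inT ht; have Uz := zcU tT; have Dz := dzc tT.
have /andP[t0 te] := ht; have d0 : 0 < eps - t by rewrite subr_gt0.
have DS : is_derive t 1 (fun t => \sum_(i < j.+1) c i t *m Xs F0 F Qp i (zc t))
   (\sum_(i < j.+1) (dc i t *m Xs F0 F Qp i (zc t) +
      c i t *m (Xs F0 F Qp i.+1 (zc t) + Xs F0 F Qp i (zc t) *m A_ t))).
  apply/derive_mxP => a b; rewrite ord1 summxE.
  have Di (i : 'I_j.+1) : is_derive t 1 (fun t => (c i t *m Xs F0 F Qp i (zc t)) 0 b)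
    ((dc i t *m Xs F0 F Qp i (zc t) + c i t *m (Xs F0 F Qp i.+1 (zc t) + Xs F0 F Qp i (zc t) *m A_ t)) 0 b).
    have D1 : is_derive t 1 (c i) (dc i t).
      apply/derive_mxP => a' l; rewrite ord1 mxE.
      exact: (smoothP (sc i l) tT).
    have D2 := is_derive_Xs oU sF0 sF sQ i Uz Dz.
    by have /derive_mxP := is_derive_mulmx D1 D2; apply.
  by apply: (is_derive_ext (derive_sum_seq (index_enum 'I_j.+1) Di)) => u; rewrite summxE.
apply/rowP => b; rewrite GS //.
have dy : is_derive t 1 (fun t => yc t) (Vc (yc t)) by rewrite -velV //; exact: is_derive_rsub.
have DG := is_derive_comp oU (sG j b) Uz dy.
have /derive_mxP/(_ 0 b) DSb := DS.
have -> := is_derive_right_unique d0 DG DSb _; last first.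
  by move=> s /andP[s1 s2]; rewrite /= cE // (le_trans t0 s1) /=; move: s2; rewrite addrC subrK.
rewrite -(mul_Dfield oU sV) //.
set S1 := \sum_(i < _) _; set S2 := \sum_(i < _) _.
suff -> : S2 = S1 - G j (yc t) *m B_ t by rewrite [RHS]mxE [X in _ = _ + X]mxE.
have e1 : S1 = \sum_(i < j.+1) (dc i t *m Xs F0 F Qp i (zc t) + c i t *m Xs F0 F Qp i.+1 (zc t)) +
    G j (yc t) *m A_ t.
  rewrite cE // mulmx_suml -big_split; apply: eq_bigr => i _ /=.
  by rewrite mulmxDr mulmxA addrA.
rewrite e1 -addrA -mulmxBr connection_diff // /S2 /c'.
under eq_bigr do rewrite mulmxDl.
rewrite big_split /=.
have s1 : \sum_(i < j.+2) (if (i <= j)%N then dc i t else 0) *m Xs F0 F Qp i (zc t) =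
    \sum_(i < j.+1) dc i t *m Xs F0 F Qp i (zc t).
  rewrite big_ord_recr /= ltnn mul0mx addr0; apply: eq_bigr => i _.
  by rewrite -ltnS ltn_ord.
have s2 : \sum_(i < j.+2) (if nat_of_ord i is i'.+1 then c i' t else G j (yc t) *m Cm t) *m Xs F0 F Qp i (zc t) =
    G j (yc t) *m Cm t *m XX F (yc t) + \sum_(i < j.+1) c i t *m Xs F0 F Qp i.+1 (zc t).
  by rewrite big_ord_recl; congr (_ + _); apply: eq_bigr.
rewrite s1 s2 big_split /= -!addrA; congr (_ + _).
by rewrite -mulmxA; exact: addrC.
Qed.
End FlagRec.

(** * The flag of the geodesic and the order of the two-point determinant *)

Section Fields.
Context {R : realType} {n k : nat} {M : manifold R n} (S : affine_system M k).
Local Notation ct := (chart R n M).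
Local Opaque jacobian transition_jac.

Definition esmooth (X : vfield M) := forall c, atlas M c -> forall j, smooth (ccod c) (fun y => field_in c X y 0 j).

Lemma smooth_field_entry (X : vfield M) : smooth_field X -> esmooth X.
Proof. by move=> sX c ac j; exact: (smooth_entry 0 j (oc ac) (sX c ac)). Qed.

Lemma field_inE (c : ct) (X : vfield M) y : field_in c X y =
  X (cinv c y) *m transition_jac (chart_at (cinv c y)) c (cinv c y).
Proof. by []. Qed.

Lemma field_tr (c c' : ct) (X : vfield M) y : atlas M c -> atlas M c' -> ov c c' y ->
  field_in c' X (tr c c' y) = field_in c X y *m 'J (tr c c') y.
Proof.
move=> ac ac' oy; have [cy dy] := (ovP ac ac' y).1 oy.
have e : cinv c' (tr c c' y) = cinv c y by exact: (cmapK (atlas_chart ac') dy).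
rewrite !field_inE e -mulmxA -(trJE ac ac' cy).
by rewrite -(transition_chain (chart_at_atlas _) ac ac' (chart_at_dom _) (cinv_dom ac cy) dy).
Qed.

Lemma derive_entry (f : 'rV[R]_n -> 'rV[R]_n) (U : set 'rV[R]_n) y v j : U y ->
  (csmooth U f) -> ('D_v f y) 0 j = 'D_v (fun w => f w 0 j) y.
Proof.
move=> Uy sf; have df : derivable f y v.
  by apply/derivable_mxP => a b; rewrite ord1; exact: (smooth_derivable (sf b) Uy).
by rewrite derive_mx // mxE.
Qed.

Lemma field_in_at (X : vfield M) x : field_in (chart_at x) X (cmap (chart_at x) x) = X x.
Proof.
have e : cinv (chart_at x) (cmap (chart_at x) x) = x by exact: (cmapK (atlas_chart (chart_at_atlas x)) (chart_at_dom x)).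
by rewrite field_inE e (transition_id (chart_at_atlas x) (chart_at_dom x)) mulmx1.
Qed.

Lemma ccod_tr (c c' : ct) w : atlas M c -> atlas M c' -> ov c c' w -> ccod c' (tr c c' w).
Proof. by move=> ac ac' /(ovP ac ac')[cw dw]; exists (cinv c w). Qed.

(** [bracket] is computed at each point in that point's own chart; naturality allows a single fixed
    chart. *)
Lemma bracket_in (c : ct) (X Y : vfield M) y j : atlas M c -> esmooth X -> esmooth Y -> ccod c y ->
  field_in c (bracket Y X) y 0 j =
  'D_(field_in c Y y) (fun w => field_in c X w 0 j) y - 'D_(field_in c X y) (fun w => field_in c Y w 0 j) y.
Proof.
move=> ac sX sY cy; set x := cinv c y; set a := chart_at x.
have aa : atlas M a by exact: chart_at_atlas.
have dx : cdom a x by exact: chart_at_dom.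
have dc : cdom c x by exact: cinv_dom.
have ya : cmap c x = y by exact: cinvK.
have oa : ov a c (cmap a x) by exact: ov_cmap.
have ea : tr a c (cmap a x) = y by rewrite /tr /= (cmapK (atlas_chart aa) dx) ya.
have ca : ccod a (cmap a x) by exists x.
have sub (f : 'rV[R]_n -> R) : smooth (ccod a) f -> smooth (ov a c) f.
  by move=> sf; apply: (smooth_sub _ sf) => w /(ovP aa ac)[].
have h := bracket_change (open_ov aa ac) (smooth_tr aa ac) (oc ac)
  (fun j => sub _ (sX a aa j)) (fun j => sub _ (sY a aa j)) (sX c ac) (sY c ac)
  (fun w ow => ccod_tr aa ac ow) (fun w ow => field_tr X aa ac ow) (fun w ow => field_tr Y aa ac ow) j oa.
rewrite ea in h; rewrite -h field_inE -/x -/a [LHS]mxE; apply: eq_bigr => l _.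
have e1 : transition_jac a c x = 'J (tr a c) (cmap a x).
  by rewrite -(trJE aa ac ca) (cmapK (atlas_chart aa) dx).
rewrite e1; congr (_ * _).
rewrite /bracket -/a [LHS]mxE [X in _ + X]mxE.
rewrite (derive_entry _ _ ca (sX a aa)) (derive_entry _ _ ca (sY a aa)).
by rewrite !field_in_at.
Qed.

Lemma esmooth_bracket (X Y : vfield M) : esmooth X -> esmooth Y -> esmooth (bracket Y X).
Proof.
move=> sX sY c ac j; have o := oc ac.
have sD (f : 'rV[R]_n -> R) (Z : vfield M) : esmooth Z -> smooth (ccod c) f ->
    smooth (ccod c) (fun y => \sum_i field_in c Z y 0 i * 'D_(delta_mx 0 i) f y).
  move=> sZ sf; apply: (smooth_sum _ _ o) => i; apply: (smoothM o); first exact: sZ.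
  exact: smooth_derive.
apply: (smooth_ext o _ (smoothB o (sD _ _ sY (sX c ac j)) (sD _ _ sX (sY c ac j)))) => y cy.
have e1 := derive_coords o (field_in c Y y) (sX c ac j) cy.
have e2 := derive_coords o (field_in c X y) (sY c ac j) cy.
exact: etrans (f_equal2 (fun a b : R => a - b) (esym e1) (esym e2)) (esym (bracket_in j ac sX sY cy)).
Qed.

Lemma esmooth_iter (X Y : vfield M) j : esmooth X -> esmooth Y -> esmooth (iter j (bracket Y) X).
Proof. by move=> sX sY; elim: j => [|j IH] //=; exact: esmooth_bracket. Qed.

Lemma frame_in (c : ct) y (a : 'rV[R]_k) (X : vfield M) : X (cinv c y) = a *m frame_mx S (cinv c y) ->
  field_in c X y = a *m XX (cF S c) y.
Proof.
move=> e; rewrite field_inE e -mulmxA; congr (_ *m _); apply/row_matrixP => i.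
by rewrite row_mul !rowK.
Qed.

Hypotheses (hS : smooth_system S) (hfree : forall x : M, row_free (frame_mx S x)).
Variables (V Xd : vfield M).
Hypotheses (sXd : section_D S Xd) (VE : V = (fun x => drift S x + Xd x)).
Variables (c : ct) (T eps : R) (zc : R -> 'rV[R]_(n + n)) (Ps : R -> 'M[R]_(n + n)) (E : 'M[R]_(n, k)).
Hypothesis ac : atlas M c.
Local Notation hF := (cH S c).
Local Notation yc t := (rsubmx (zc t)).
Local Notation Fc := (cF S c).
Local Notation X_ j t := (Xs (cF0 S c) (cF S c) (cQ S c) j (zc t)).
Local Notation gam t := (cinv c (yc t)).
Hypotheses (T0 : 0 < T) (epsT : eps <= T) (zcU : forall t : R, `|t| < T -> UU (ccod c) (zc t))
  (dzc : forall t : R, `|t| < T -> is_derive t 1 zc (hF (zc t)))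
  (Ps0 : Ps 0 = 1%:M) (dPs : forall t : R, `|t| < T -> is_derive t 1 Ps (Ps t *m Dfield hF (zc t)))
  (uE : forall t : R, `|t| < T -> XX Fc (yc t) *m E \in unitmx)
  (velV : forall t, 0 <= t < eps -> rsubmx (hF (zc t)) = field_in c V (yc t)).

Let sV : esmooth V.
Proof.
move=> c' ac' j; case: hS => sd _ _; case: sXd => sx _.
apply: (smooth_ext (oc ac') _ (smoothD (oc ac') (smooth_field_entry sd ac' j) (smooth_field_entry sx ac' j))).
by move=> y _; rewrite VE !field_inE mulmxDl [RHS]mxE.
Qed.

Let secV y : ccod c y -> exists a : 'rV[R]_k, field_in c V y = cF0 S c y + a *m XX Fc y.
Proof.
move=> cy; case: sXd => _ /(_ (cinv c y))[a ha]; exists a.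
by rewrite -(frame_in ha) VE !field_inE mulmxDl.
Qed.

(** The second clause identifies the top coefficient of a section with constant coefficients;
    applied to the frame fields it makes the triangular relation invertible. *)
Lemma section_rec (X : vfield M) : section_D S X -> forall j, exists cc : nat -> R -> 'rV[R]_k,
  forall t, 0 <= t < eps ->
   field_in c (iter j (bracket V) X) (yc t) = \sum_(i < j.+1) cc i t *m X_ i t /\
   forall a : 'rV[R]_k, (forall y, ccod c y -> field_in c X y = a *m XX Fc y) -> cc j t = a.
Proof.
move=> [sX hX] j; have eX := smooth_field_entry sX.
pose g t : 'rV[R]_k := field_in c X (yc t) *m E *m invmx (XX Fc (yc t) *m E).
have oI := @oIT R T.
have sz (f : 'rV[R]_n -> R) : smooth (ccod c) f -> smooth (IT T) (fun t => f (yc t)).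
  by move=> sf; exact: (smooth_zc (oc ac) (scF0 hS ac) (scF hS ac) (scQ hS ac) zcU dzc (smooth_rsub sf)).
have sE a b : smooth (IT T) (fun=> E a b) by exact: smooth_cst.
have sXX a b : smooth (IT T) (fun t => (XX Fc (yc t)) a b).
  by apply: (smooth_ext oI _ (sz _ (scF hS ac a b))) => t _; rewrite [RHS]mxE.
have sg l : smooth (IT T) (fun t => g t 0 l).
  apply: (smooth_mulmx (A := fun t => field_in c X (yc t) *m E) (B := fun t => invmx (XX Fc (yc t) *m E)) oI) => a b.
    apply: (smooth_mulmx (A := fun t => field_in c X (yc t)) (B := fun=> E) oI) => // a' b'.
    by rewrite ord1; exact: (sz _ (eX c ac b')).
  apply: (smooth_invmx (A := fun t => XX Fc (yc t) *m E) oI) => // a' b'.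
  exact: (smooth_mulmx (A := fun t => XX Fc (yc t)) (B := fun=> E) oI).
have inT t : 0 <= t < eps -> `|t| < T.
  by move=> /andP[t0 te]; rewrite ger0_norm // (lt_le_trans te).
have gE t (a : 'rV[R]_k) : 0 <= t < eps -> field_in c X (yc t) = a *m XX Fc (yc t) -> g t = a.
  by move=> /inT tT e; rewrite /g e -(mulmxA a) mulmxK // uE.
have G0 t : 0 <= t < eps -> field_in c X (yc t) = g t *m XX Fc (yc t).
  by move=> ht; have [a ha] := hX (gam t); have e := frame_in ha; rewrite (gE _ _ ht e).
have [cc [_ ccj ccE]] := flag_rec (oc ac) (scF0 hS ac) (scF hS ac) (scQ hS ac) epsT zcU dzc uE
  (sV ac) secV velV (G := fun j y => field_in c (iter j (bracket V) X) y)
  (fun j b => esmooth_iter j eX sV ac b) (fun j y b cy => bracket_in b ac (esmooth_iter j eX sV) sV cy)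
  sg G0 j.
exists cc => t ht; split; first exact: ccE.
by move=> a ha; rewrite ccj; apply: gE => //; apply: ha; exact: (zcU (inT _ ht)).
Qed.

Lemma frame_section l : section_D S (frame S l).
Proof.
split; first by case: hS.
by move=> x; exists (delta_mx 0 l); rewrite -rowE rowK.
Qed.

Lemma flag_gen i x (X : vfield M) j : section_D S X -> (j < i)%N -> iter j (bracket V) X x \in flag S V i x.
Proof. by move=> sX ji; apply: (vspanP _).1; exists X, j. Qed.

Lemma flag0 x : flag S V 0 x = 0%VS.
Proof. by apply/eqP; rewrite -subv0; apply: (vspanP _).2 => v [X [j []]]. Qed.

Lemma flagS i x : (flag S V i x <= flag S V i.+1 x)%VS.
Proof. by apply: (vspanP _).2 => v [X [j [sX ji ->]]]; apply: flag_gen => //; exact: leqW. Qed.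

Section AtTime.
Variable s : R.
Hypothesis hs : 0 <= s < eps.
Let sT : `|s| < T.
Proof. by case/andP: hs => s0 se; rewrite ger0_norm // (lt_le_trans se). Qed.
Local Notation x := (gam s).
Local Notation a := (chart_at x).
Local Notation Jca := (transition_jac c a x).
Let cy : ccod c (yc s). Proof. exact: zcU. Qed.
Let J1 : transition_jac a c x *m Jca = 1%:M.
Proof. by apply: transition_inv; [exact: chart_at_atlas|exact: ac|exact: chart_at_dom|exact: cinv_dom]. Qed.

Lemma field_back (X : vfield M) : field_in c X (yc s) *m Jca = X x.
Proof. by rewrite field_inE -mulmxA J1 mulmx1. Qed.

(** Inverts the triangular relation by strong induction: a row of [X_ j] is an iterated bracket of a
    frame field minus combinations of rows of lower index. *)
Lemma rows_in_flag j l i : (j < i)%N -> row l (X_ j s) *m Jca \in flag S V i x.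
Proof.
elim/ltn_ind: j l => j IH l ji.
have [cc ccE] := section_rec (frame_section l) j.
have [e1 e2] := ccE s hs.
have e3 : cc j s = delta_mx 0 l.
  apply: e2 => y _; apply: (frame_in (X := frame S l)).
  by rewrite -rowE rowK.
have -> : row l (X_ j s) = field_in c (iter j (bracket V) (frame S l)) (yc s) - \sum_(i < j) cc i s *m X_ i s.
  by rewrite e1 big_ord_recr /= e3 -rowE addrC addrK.
rewrite mulmxBl rpredB //.
  by rewrite field_back; apply: flag_gen ji; exact: frame_section.
rewrite mulmx_suml; apply: rpred_sum => i' _.
rewrite (mulmx_sum_row (cc i' s) (X_ i' s)) mulmx_suml; apply: rpred_sum => l' _.
by rewrite -scalemxAl; apply: rpredZ; apply: IH => //; exact: ltn_trans ji.
Qed.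

(** Level [i] of the flag is spanned by the rows of the [X_ j] with [j < i], one inclusion being
    [rows_in_flag] and the other [section_rec]. A dual basis adapted to the flag therefore satisfies
    the hypotheses of [order_at]. *)
Lemma order_manifold : (exists m, flag S V m x = fullv) ->
  exists2 c0 : R, 0 < c0 & lead (geodesic_dim S V x) c0
     (fun t => DD (index_enum (idx n)) (phiJ Ps) (psiJ Ps) s (s + t)).
Proof.
move=> hm; have fs : flag S V (flag_step S V x) x = fullv.
  have [m hm' mm] : exists2 m, flag S V m x = fullv & forall m', flag S V m' x = fullv -> (m <= m')%N.
    have hm2 : exists m, flag S V m x == fullv by have [m em] := hm; exists m; rewrite em.
    have [m /eqP h1 h2] := ex_minnP hm2; exists m => // m' /eqP; exact: h2.
  have ex : exists m, [set m | flag S V m x = fullv /\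
                    forall m', flag S V m' x = fullv -> (m <= m')%N] m by exists m.
  by have [] := xgetPex 0%N ex.
have [w [Xi [Xu w0 an ind sumw]]] := flag_basis (flag0 x) (fun i => flagS i x) fs.
have Ju : Jca \in unitmx by have [] := mulmx1_unit J1.
pose Xi' := Xi *m Jca^T.
have Xu' : Xi' \in unitmx by rewrite unitmx_mul Xu unitmx_tr.
have an' b j : (j.+1 < w b)%N -> row b Xi' *m (X_ j s)^T = 0.
  move=> jw; apply/trmx_inj; rewrite trmx0 trmx_mul trmxK; apply/row_matrixP => l.
  have jw2 : (j < (w b).-1)%N by rewrite -ltnS prednK.
  have := an b _ (rows_in_flag l jw2); rewrite /Xi' row0 row_mul => /(congr1 trmx).
  by rewrite trmx_mul trmxK trmx0 row_mul trmx_mul trmxK mulmxA.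
have ind' (al : 'I_n -> R) i : \sum_(b | w b == i) al b *: (row b Xi' *m (X_ i.-1 s)^T) = 0 ->
    forall b, w b = i -> al b = 0.
  move=> h; apply: (ind al i) => v vi.
  pose xv : 'rV[R]_n := \sum_(b | w b == i) al b *: row b Xi.
  have xvE (u : 'rV[R]_n) : \sum_(b | w b == i) al b *: (row b Xi *m u^T) = xv *m u^T.
    by rewrite mulmx_suml; apply: eq_bigr => b _; rewrite scalemxAl.
  rewrite xvE.
  (* For [j < i - 1] by the annihilation property of covectors of weight [i]; for [j = i - 1] by the
     assumed relation. So [xv] vanishes on the whole level [i]. *)
  have z0 j : (j < i)%N -> X_ j s *m Jca *m xv^T = 0.
    move=> ji; apply/trmx_inj; rewrite trmx0 !trmx_mul trmxK mulmxA.
    have -> : xv *m Jca^T *m (X_ j s)^T = \sum_(b | w b == i) al b *: (row b Xi' *m (X_ j s)^T).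
      rewrite /xv !mulmx_suml; apply: eq_bigr => b _; rewrite -!scalemxAl.
      by rewrite /Xi' row_mul.
    have [ji1|] := ltnP j.+1 i.
      by rewrite big1 // => b /eqP wb; rewrite an' ?scaler0 // wb.
    by move=> h1; have -> : j = i.-1 by apply/eqP; rewrite eqn_leq -ltnS prednK ?ji ?(leq_ltn_trans _ ji) //= -ltnS prednK ?(leq_ltn_trans _ ji).
  have sub : (flag S V i x <= lker (linfun (mulmxr xv^T : 'rV[R]_n -> 'rV[R]_1)))%VS.
    apply: (vspanP _).2 => u [X [j [sX ji ->]]]; rewrite memv_ker lfunE /=.
    have [cc ccE] := section_rec sX j; have [e1 _] := ccE s hs.
    rewrite -field_back e1 mulmx_suml mulmx_suml big1 // => i' _.
    by rewrite -!mulmxA (mulmxA (X_ i' s)) z0 ?mulmx0 // (leq_ltn_trans _ ji) // -ltnS.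
  have := subvP sub _ vi; rewrite memv_ker lfunE /= => /eqP e.
  by apply/trmx_inj; rewrite trmx_mul trmxK e trmx0.
have hs' : 0 <= s < T by case/andP: hs => h1 h2; rewrite h1 (lt_le_trans h2).
have [c0 c00 hc] := order_at (oc ac) (scF0 hS ac) (scF hS ac) (scQ hS ac) T0 zcU dzc Ps0 dPs hs' w0 Xu' an' ind'.
by exists c0 => //; rewrite /geodesic_dim -sumw.
Qed.
End AtTime.
End Fields.

Lemma Rint_FTC2 (R : realType) (F f : R -> R) (a b : R) : a <= b ->
  (forall s : R, a <= s <= b -> is_derive s 1 F (f s)) ->
  (forall s : R, a <= s <= b -> {for s, continuous f}) ->
  \int[lebesgue_measure]_(s in `[a, b]) f s = F b - F a.
Proof.
rewrite le_eqVlt => /predU1P[<- _ _|ab HF cf]; first by rewrite set_itv1 Rintegral_set1 subrr.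
have ha : a <= a <= b by rewrite lexx ltW.
have hb : a <= b <= b by rewrite lexx ltW.
have c0 := is_derive_cont (HF a ha).
have ct := is_derive_cont (HF b hb).
have wf : {within `[a, b], continuous f}.
  by apply: continuous_in_subspaceT => t; rewrite inE /= in_itv /=; exact: cf.
have D : derivable_oo_LRcontinuous F a b.
  split; [|exact: cvg_at_right_filter|exact: cvg_at_left_filter].
  move=> s; rewrite in_itv /= => /andP[s0 st].
  have h : a <= s <= b by rewrite !ltW.
  by have [] := HF s h.
rewrite /Rintegral (@continuous_FTC2 _ f F a b) // => s.
rewrite in_itv /= => /andP[s0 st]; rewrite derive1E.
have h : a <= s <= b by rewrite !ltW.
by have [] := HF s h.
Qed.

(** * Clamping and concatenation of curves *)

Section Glue.
Context {R : realType}.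
Local Notation int a b f := (\int[@lebesgue_measure R]_(s in `[a, b]) f s).

Definition clampI (T t : R) : R := Num.max 0 (Num.min T t).

Lemma clampI_in T t : 0 <= T -> 0 <= clampI T t <= T.
Proof. by move=> T0; rewrite /clampI le_max lexx /= ge_max T0 ge_min lexx. Qed.

Lemma clampI_id T t : 0 <= t <= T -> clampI T t = t.
Proof. by move=> /andP[t0 tT]; rewrite /clampI (min_idPr tT) (max_idPr t0). Qed.

Lemma clampI_continuous T : continuous (clampI T).
Proof.
move=> t; apply: continuous_max; first exact: cst_continuous.
by apply: continuous_min; first exact: cst_continuous.
Qed.

Lemma clampI_comp (X : topologicalType) T (x : R -> X) : 0 <= T -> {within `[0, T], continuous x} ->
  continuous (x \o clampI T).
Proof.
move=> T0 /subspace_continuousP cx t A hA.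
have h : `[0, T]%classic (clampI T t) by rewrite /= in_itv /=; exact: clampI_in.
have := cx _ h A hA; rewrite /nbhs /= /within /= => h2.
have h3 : \forall s \near t, `[0, T]%classic (clampI T s) -> A (x (clampI T s)).
  exact: (@clampI_continuous T t _ h2).
have h4 : \forall s \near t, A (x (clampI T s)).
  apply: filterS h3 => s; apply; rewrite /= in_itv /=; exact: clampI_in.
exact: h4.
Qed.

Definition glue (X : Type) (s1 : R) (x1 x2 : R -> X) (t : R) : X := if t <= s1 then x1 t else x2 t.

Lemma glue_continuous (X : topologicalType) s1 (x1 x2 : R -> X) : continuous x1 -> continuous x2 ->
  x1 s1 = x2 s1 -> continuous (glue s1 x1 x2).
Proof.
move=> c1 c2 e t A; rewrite /glue /= => hA.
suff : \forall s \near t, A (if s <= s1 then x1 s else x2 s) by [].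
move: hA; have [ts|st|ts] := ltgtP t s1 => hA.
- have n1 : \forall s \near t, A (x1 s) by exact: (c1 t A hA).
  have n2 : \forall s \near t, s < s1 by exact: lt_nbhsl.
  by apply: filterS2 n1 n2 => s h1 h2; rewrite /= ltW.
- have n1 : \forall s \near t, A (x2 s) by exact: (c2 t A hA).
  have n2 : \forall s \near t, s1 < s by exact: lt_nbhsr.
  by apply: filterS2 n1 n2 => s h1 h2; rewrite /= leNgt h2.
- have hA2 : nbhs (x2 t) A by rewrite ts -e -ts.
  have n1 : \forall s \near t, A (x1 s) by exact: (c1 t A hA).
  have n2 : \forall s \near t, A (x2 s) by exact: (c2 t A hA2).
  by apply: filterS2 n1 n2 => s h1 h2 /=; case: ifP.
Qed.

Lemma bint_ext_oc a b (f g : R -> R) : (forall t, a < t <= b -> f t = g t) -> bint a b f -> bint a b g.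
Proof.
move=> h [mf [B hB]]; split.
  apply/(measurable_fun_itv_obnd_cbndP a (BRight b) g).
  apply: (eq_measurable_fun f); first by move=> t; rewrite inE /= in_itv /= => /h.
  by apply/(measurable_fun_itv_obnd_cbndP a (BRight b) f).
exists (Num.max B `|g a|); apply: (aeS hB) => t hf /andP[at_ tb]; rewrite le_max.
move: at_; rewrite le_eqVlt => /predU1P[->|at_]; first by rewrite lexx orbT.
have hl := hf (introT andP (conj (ltW at_) tb)).
by rewrite -h ?at_ ?tb // hl.
Qed.

Lemma Rint_ext_oc a b (f g : R -> R) : bint a b f -> (forall t, a < t <= b -> f t = g t) ->
  int a b f = int a b g.
Proof.
move=> bf h; have bg := bint_ext_oc h bf.
have sub : [set` `]a, b]] `<=` [set` `[a, b]].
  by move=> t /=; rewrite !in_itv /= => /andP[/ltW -> ->].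
rewrite -(@Rintegral_itv_obnd_cbnd R a (BRight b) f); last first.
  by apply: (integrableS _ _ _ (bint_int bf)).
rewrite -(@Rintegral_itv_obnd_cbnd R a (BRight b) g); last first.
  by apply: (integrableS _ _ _ (bint_int bg)).
by apply: eq_Rintegral => t; rewrite inE /= in_itv /= => /h.
Qed.
End Glue.

Lemma row_XX (R : realType) (n k : nat) (F : 'I_k -> 'rV[R]_n -> 'rV[R]_n) y i : row i (XX F y) = F i y.
Proof. exact: rowK. Qed.

(** * Trajectories of the control system on the manifold *)

Section Traj.
Context {R : realType} {n k : nat} {M : manifold R n} (S : affine_system M k).
Local Notation ct := (chart R n M).
Local Notation int a b f := (\int[@lebesgue_measure R]_(s in `[a, b]) f s).
Hypothesis hS : smooth_system S.
Local Opaque jacobian transition_jac.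

Definition mvel (c : ct) (x' : M) (v : 'rV[R]_k) : 'rV[R]_n :=
  vec_in c x' (drift S x' + v *m frame_mx S x').

Lemma mvelE (c : ct) x' v : atlas M c -> cdom c x' ->
  mvel c x' v = fld (cF0 S c) (cF S c) (cmap c x') v.
Proof.
move=> ac dx; have e : cinv c (cmap c x') = x' by exact: (cmapK (atlas_chart ac) dx).
rewrite /mvel /vec_in mulmxDl /fld /cF0 field_inE e; congr (_ + _).
rewrite -mulmxA; congr (_ *m _); apply/row_matrixP => i.
by rewrite row_mul !rowK /cF field_inE e.
Qed.

Lemma fld_tr (c c' : ct) y v : atlas M c -> atlas M c' -> ov c c' y ->
  fld (cF0 S c') (cF S c') (tr c c' y) v = fld (cF0 S c) (cF S c) y v *m 'J (tr c c') y.
Proof.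
move=> ac ac' oy; rewrite /fld mulmxDl /cF0 (field_tr _ ac ac' oy); congr (_ + _).
rewrite -mulmxA; congr (_ *m _); apply/row_matrixP => i.
apply: (etrans (row_XX (cF S c') (tr c c' y) i)); apply: (etrans (field_tr (frame S i) ac ac' oy)); apply: esym.
apply: (etrans (row_mul i (XX (cF S c) y) ('J (tr c c') y))).
exact: (f_equal (fun v => v *m 'J (tr c c') y) (row_XX (cF S c) y i)).
Qed.

Definition tpiece (a b : R) (u : R -> 'rV[R]_k) (x : R -> M) : Prop :=
  forall (c : ct) (a' b' : R), atlas M c -> a <= a' -> a' <= b' -> b' <= b ->
    (forall s, a' <= s <= b' -> cdom c (x s)) ->
    cmap c (x b') - cmap c (x a') = \row_j int a' b' (fun s => mvel c (x s) (u s) 0 j).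

(** Trajectories defined and continuous on the whole line, obtained from those on [[0, T]] by
    clamping time, so that gluing needs no relative topology. *)
Definition ctraj (T : R) (u : R -> 'rV[R]_k) (x : R -> M) : Prop :=
  [/\ continuous x, (forall i, bint 0 T (fun t => u t 0 i)) & tpiece 0 T u x].

Definition mact (a b : R) (u : R -> 'rV[R]_k) (x : R -> M) : R :=
  2^-1 * int a b (fun s => (\sum_(i < k) u s 0 i ^+ 2) - potential S (x s)).

Lemma potential_continuous (x' : M) : {for x', continuous (potential S)}.
Proof.
set c := chart_at x'; have ac : atlas M c by exact: chart_at_atlas.
have dx : cdom c x' by exact: chart_at_dom.
have Uy : ccod c (cmap c x') by exists x'.
have c1 := continuous_comp (cmap_continuous (atlas_chart ac) dx) (smooth_cont (scQ hS ac) Uy).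
move=> A hA; have e : cinv c (cmap c x') = x' by exact: (cmapK (atlas_chart ac) dx).
have n1 : nbhs x' ((cQ S c \o cmap c) @^-1` A) by apply: c1; rewrite /= /cQ /= e.
have n2 : nbhs x' (cdom c) by apply: open_nbhs_nbhs; split; [exact: cdom_open (atlas_chart ac)|].
apply: filterS2 n1 n2 => w h1 h2; move: h1; rewrite /= /cQ /=.
by rewrite (cmapK (atlas_chart ac) h2).
Qed.

Lemma bint_mlag a b (u : R -> 'rV[R]_k) (x : R -> M) : continuous x ->
  (forall i, bint a b (fun t => u t 0 i)) ->
  bint a b (fun s => (\sum_(i < k) u s 0 i ^+ 2) - potential S (x s)).
Proof.
move=> cx bu; apply: bintB; first by apply: bint_sum => i; exact: bint_sqr.
by apply: bint_cont => t _; exact: (continuous_comp (cx t) (@potential_continuous _)).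
Qed.

Lemma bint_mvel (c : ct) a b (u : R -> 'rV[R]_k) (x : R -> M) j : atlas M c -> continuous x ->
  (forall i, bint a b (fun t => u t 0 i)) -> (forall s, a <= s <= b -> cdom c (x s)) ->
  bint a b (fun s => mvel c (x s) (u s) 0 j).
Proof.
move=> ac cx bu dx; apply: (bint_ext (f := fun s => fld (cF0 S c) (cF S c) (cmap c (x s)) (u s) 0 j)).
  by move=> t ht; rewrite (mvelE _ ac (dx t ht)).
apply: (bint_fld (scF0 hS ac) (scF hS ac)) => // t ht; split; last by exists (x t) => //; exact: dx.
exact: (continuous_comp (cx t) (cmap_continuous (atlas_chart ac) (dx t ht))).
Qed.

(** An interval that contains the junction is split there. At time [s1] the glued control is [u1],
    but a single instant does not count in the integrals, hence the comparison on half-open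
    intervals. *)
Lemma ctraj_glue (s1 T : R) (u1 u2 : R -> 'rV[R]_k) (x1 x2 : R -> M) : 0 <= s1 -> s1 <= T -> continuous x1 -> continuous x2 ->
  x1 s1 = x2 s1 -> (forall i, bint 0 s1 (fun t => u1 t 0 i)) -> (forall i, bint s1 T (fun t => u2 t 0 i)) ->
  tpiece 0 s1 u1 x1 -> tpiece s1 T u2 x2 ->
  ctraj T (glue s1 u1 u2) (glue s1 x1 x2) /\
  mact 0 T (glue s1 u1 u2) (glue s1 x1 x2) = mact 0 s1 u1 x1 + mact s1 T u2 x2.
Proof.
move=> s10 s1T c1 c2 e b1 b2 t1 t2.
have cg := glue_continuous c1 c2 e.
have gl (X : Type) (f1 f2 : R -> X) t : t <= s1 -> glue s1 f1 f2 t = f1 t by rewrite /glue => ->.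
have gr (X : Type) (f1 f2 : R -> X) t : s1 < t -> glue s1 f1 f2 t = f2 t by rewrite /glue leNgt => ->.
have grx t : s1 <= t -> glue s1 x1 x2 t = x2 t.
  by rewrite le_eqVlt => /predU1P[<-|]; [rewrite gl|exact: gr].
have bg1 i : bint 0 s1 (fun t => glue s1 u1 u2 t 0 i).
  by apply: (bint_ext _ (b1 i)) => t /andP[_ h]; rewrite gl.
have bg2 i : bint s1 T (fun t => glue s1 u1 u2 t 0 i).
  by apply: (bint_ext_oc _ (b2 i)) => t /andP[h _]; rewrite gr.
have bg i : bint 0 T (fun t => glue s1 u1 u2 t 0 i) by exact: (bint_glue s10 s1T).
split.
  split=> // c a b ac a0 ab bT dx.
  have P1 a' b' : a <= a' -> a' <= b' -> b' <= b -> b' <= s1 ->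
    cmap c (glue s1 x1 x2 b') - cmap c (glue s1 x1 x2 a') =
      \row_j int a' b' (fun s => mvel c (glue s1 x1 x2 s) (glue s1 u1 u2 s) 0 j).
    move=> aa' ab' bb' bs; have as' := le_trans ab' bs.
    have dx1 s : a' <= s <= b' -> cdom c (x1 s).
      move=> /andP[h1 h2]; have h3 := le_trans h2 bs; rewrite -(gl _ x1 x2 _ h3); apply: dx.
      by rewrite (le_trans aa' h1) (le_trans h2 bb').
    rewrite (gl _ x1 x2 _ bs) (gl _ x1 x2 _ as').
    have E := t1 c a' b' ac (le_trans a0 aa') ab' bs dx1.
    apply: (etrans E); apply/rowP => j; rewrite [LHS]mxE [RHS]mxE; apply: Rint_ext => t /andP[h1 h2].
    have h3 := le_trans h2 bs; by rewrite (gl _ x1 x2 _ h3) (gl _ u1 u2 _ h3).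
  have P2 a' b' : a <= a' -> a' <= b' -> b' <= b -> s1 <= a' ->
    cmap c (glue s1 x1 x2 b') - cmap c (glue s1 x1 x2 a') =
      \row_j int a' b' (fun s => mvel c (glue s1 x1 x2 s) (glue s1 u1 u2 s) 0 j).
    move=> aa' ab' bb' sa; have sb' := le_trans sa ab'; have bT' := le_trans bb' bT.
    have dx2 s : a' <= s <= b' -> cdom c (x2 s).
      move=> /andP[h1 h2]; have h3 := le_trans sa h1; rewrite -(grx _ h3); apply: dx.
      by rewrite (le_trans aa' h1) (le_trans h2 bb').
    rewrite (grx _ sa) (grx _ sb').
    have E := t2 c a' b' ac sa ab' bT' dx2.
    apply: (etrans E); apply/rowP => j; rewrite [LHS]mxE [RHS]mxE; apply: Rint_ext_oc.
      by apply: (bint_mvel j ac c2 _ dx2) => i; exact: (bint_sub sa bT' (b2 i)).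
    move=> t /andP[h1 h2]; have h3 := le_lt_trans sa h1.
    by rewrite (gr _ u1 u2 _ h3) (gr _ x1 x2 _ h3).
  have [bs|sb] := leP b s1; first exact: P1.
  have [sa|as_] := leP s1 a; first exact: P2.
  have := f_equal2 +%R (P2 s1 b (ltW as_) (ltW sb) (lexx _) (lexx _)) (P1 a s1 (lexx _) (ltW as_) (ltW sb) (lexx _)).
  rewrite subrKA => ->; apply/rowP => j; rewrite !mxE addrC -Rint_split ?ltW //.
  apply: bint_mvel => // i; exact: (bint_sub a0 bT (bg i)).
rewrite /mact (Rint_split s10 s1T); last exact: bint_mlag.
rewrite mulrDr; congr (_ * _ + _ * _).
  by apply: Rint_ext => t /andP[_ h]; rewrite !gl.
apply/esym/Rint_ext_oc; first exact: bint_mlag.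
by move=> t /andP[h _]; rewrite !gr.
Qed.

Lemma ctraj_value T u x : 0 <= T -> ctraj T u x -> (value S T (x 0%R) (x T) <= (mact 0 T u x)%:E)%E.
Proof.
move=> T0 [cx bu tp]; apply: ereal_inf_lbound; exists u, x; split=> //.
- split; first by move=> i; case: (bu i).
  have [_ [B hB]] : bint 0 T (fun t => \sum_i `|u t 0 i|) by apply: bint_sum => i; exact: bint_norm.
  exists B; apply: (aeS hB) => t h ht; apply: le_trans (h ht); apply: le_trans (ler_norm _).
  apply: mx_norm_leP => [|i j]; first exact: sumr_ge0.
  by rewrite ord1 (bigD1 j) //= lerDl sumr_ge0.
- split; first by apply: continuous_in_subspaceT => t _; exact: cx.
  by move=> c a b ac a0 ab bT dx; exact: tp.
Qed.

Lemma trajectory_ctraj T u x : 0 <= T -> Linfty_control T u -> trajectory S T u x ->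
  ctraj T u (x \o clampI T) /\ mact 0 T u (x \o clampI T) = action S T u x.
Proof.
move=> T0 [mu [B hB]] [cx tp]; have cl t : 0 <= t <= T -> (x \o clampI T) t = x t.
  by move=> ht; rewrite /= clampI_id.
split.
  split; first exact: clampI_comp.
    move=> i; split; first exact: mu.
    by exists B; apply: (aeS hB) => t h ht; apply: le_trans (mx_entry_le _ _ _) (h ht).
  move=> c a b ac a0 ab bT dx.
  have in_ s : a <= s <= b -> 0 <= s <= T by move=> /andP[h1 h2]; rewrite (le_trans a0) ?(le_trans h2).
  rewrite !cl ?in_ ?lexx ?ab // (tp c a b ac a0 ab bT); last by move=> s hs; rewrite -cl ?in_ //; exact: dx.
  by apply/rowP => j; rewrite [LHS]mxE [RHS]mxE; apply: Rint_ext => s hs; rewrite /mvel (cl s (in_ s hs)).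
by rewrite /mact /action; congr (_ * _); apply: Rint_ext => t ht; rewrite cl.
Qed.

(* Smooth integral curves read in one chart are trajectories in all charts. *)
Lemma curve_piece (c : ct) T (yc : R -> 'rV[R]_n) (u : R -> 'rV[R]_k) : atlas M c -> 0 <= T ->
  (forall t, 0 <= t <= T -> ccod c (yc t) /\ is_derive t 1 yc (fld (cF0 S c) (cF S c) (yc t) (u t))) ->
  (forall t, 0 <= t <= T -> {for t, continuous u}) ->
  ctraj T u (cinv c \o yc \o clampI T).
Proof.
move=> ac T0 hy cu; have cl t : 0 <= t <= T -> (cinv c \o yc \o clampI T) t = cinv c (yc t).
  by move=> ht; rewrite /= clampI_id.
split.
- have h : continuous ((cinv c \o yc) \o clampI T).
    apply: clampI_comp => //; apply: continuous_in_subspaceT => t; rewrite inE /= in_itv /= => ht.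
    have [Uy D] := hy t ht.
    exact: (continuous_comp (is_derive_cont D) (cinv_continuous (atlas_chart ac) Uy)).
  exact: h.
- by move=> i; exact: bint_entry.
move=> c' a b ac' a0 ab bT dx.
have in_ s : a <= s <= b -> 0 <= s <= T by move=> /andP[h1 h2]; rewrite (le_trans a0) ?(le_trans h2).
have oy s : a <= s <= b -> ov c c' (yc s).
  move=> hs; have [Uy _] := hy s (in_ s hs); apply/(ovP ac ac'); split=> //.
  by have := dx s hs; rewrite cl ?in_.
have D s : a <= s <= b -> is_derive s 1 (tr c c' \o yc) (fld (cF0 S c') (cF S c') (tr c c' (yc s)) (u s)).
  move=> hs; have [Uy Dy] := hy s (in_ s hs); rewrite (fld_tr _ ac ac' (oy s hs)).
  exact: (is_derive_tr ac ac' (erefl _) (oy s hs) Dy).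
have cf s j : a <= s <= b -> {for s, continuous (fun s => fld (cF0 S c') (cF S c') (tr c c' (yc s)) (u s) 0 j)}.
  move=> hs; have U' := ccod_tr ac ac' (oy s hs).
  have ct' := is_derive_cont (D s hs).
  have e : (fun s => fld (cF0 S c') (cF S c') (tr c c' (yc s)) (u s) 0 j) =
    fun s => cF0 S c' (tr c c' (yc s)) 0 j + \sum_i u s 0 i * cF S c' i (tr c c' (yc s)) 0 j.
    apply/funext => w; rewrite /fld [LHS]mxE; congr (_ + _); rewrite mxE; apply: eq_bigr => i _.
    by congr (_ * _); rewrite [LHS]mxE.
  rewrite e; apply: continuousD; first exact: (continuous_comp ct' (smooth_cont (scF0 hS ac' j) U')).
  apply: continuous_sum_at => i; apply: continuousM.
    exact: (continuous_comp (cu s (in_ s hs)) (@coord_continuous _ _ _ 0 i _)).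
  exact: (continuous_comp ct' (smooth_cont (scF hS ac' i j) U')).
rewrite !cl ?in_ ?lexx ?ab //; apply/rowP => j; rewrite [RHS]mxE.
have -> : int a b (fun s => mvel c' ((cinv c \o yc \o clampI T) s) (u s) 0 j) =
    int a b (fun s => fld (cF0 S c') (cF S c') (tr c c' (yc s)) (u s) 0 j).
  apply: Rint_ext => s hs; rewrite cl ?in_ // mvelE //.
  by have [_] := (ovP ac ac' (yc s)).1 (oy s hs).
have h1 s : a <= s <= b -> is_derive s 1 (fun s => (tr c c' \o yc) s 0 j) (fld (cF0 S c') (cF S c') (tr c c' (yc s)) (u s) 0 j).
  by move=> hs; have /derive_mxP := D s hs; apply.
have h2 s : a <= s <= b -> {for s, continuous (fun s => fld (cF0 S c') (cF S c') (tr c c' (yc s)) (u s) 0 j)}.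
  by move=> hs; exact: cf.
by rewrite (Rint_FTC2 ab h1 h2) [LHS]mxE [X in _ + X = _]mxE.
Qed.

Lemma ctraj_etraj (c : ct) T s u x : atlas M c -> 0 <= s <= T -> ctraj T u x ->
  (forall t, 0 <= t <= s -> cdom c (x t)) -> etraj (cF0 S c) (cF S c) s u (cmap c \o x).
Proof.
move=> ac /andP[s0 sT] [cx bu tp] dx; split.
- by move=> t ht; exact: (continuous_comp (cx t) (cmap_continuous (atlas_chart ac) (dx t ht))).
- by move=> i; exact: (bint_sub (lexx 0) sT (bu i)).
move=> t j /andP[t0 ts].
have dx' a : 0 <= a <= t -> cdom c (x a) by move=> /andP[h1 h2]; apply: dx; rewrite h1 (le_trans h2).
have := tp c 0 t ac (lexx 0) t0 (le_trans ts sT) dx' => /rowP/(_ j).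
rewrite [LHS]mxE [X in _ + X = _]mxE [RHS]mxE => e.
have -> : int 0 t (fun a => fld (cF0 S c) (cF S c) ((cmap c \o x) a) (u a) 0 j) =
   int 0 t (fun a => mvel c (x a) (u a) 0 j).
  by apply: Rint_ext => a ha; rewrite (mvelE _ ac (dx' a ha)).
change (cmap c (x t) 0 j = cmap c (x 0) 0 j + int 0 t (fun a => mvel c (x a) (u a) 0 j)).
by apply/eqP; rewrite addrC -subr_eq; apply/eqP; exact: e.
Qed.

Lemma mact_eact (c : ct) s u x : atlas M c -> (forall t, 0 <= t <= s -> cdom c (x t)) ->
  mact 0 s u x = eact (cQ S c) s u (cmap c \o x).
Proof.
move=> ac dx; rewrite /mact /eact; congr (_ * _); apply: Rint_ext => t ht.
by rewrite /lagr /cQ /= (cmapK (atlas_chart ac) (dx t ht)).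
Qed.

(** The image of a compact set in a Hausdorff space. This is what prevents a path from leaving the
    chart without crossing the coordinate sphere. *)
Lemma closed_chart_ball (c : ct) (y0 : 'rV[R]_n) (rho : R) : atlas M c ->
  (forall y, `|y - y0| <= rho -> ccod c y) -> 0 <= rho -> closed (cinv c @` [set y | `|y - y0| <= rho]).
Proof.
move=> ac hb rho0; apply: compact_closed; first exact: manifold_hausdorff.
apply: continuous_compact.
  apply: continuous_in_subspaceT => y; rewrite inE /= => hy.
  exact: (cinv_continuous (atlas_chart ac) (hb y hy)).
have -> : [set y : 'rV[R]_n | `|y - y0| <= rho] =
   [set v : 'rV[R]_n | forall i, `[y0 0 i - rho, y0 0 i + rho]%classic (v ord0 i)].
  apply/seteqP; split=> y /= h.
    move=> i; have := le_trans (mx_entry_le (y - y0) 0 i) h.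
    by rewrite !mxE ler_norml in_itv /= => /andP[h1 h2]; apply/andP; split; lra.
  apply: mx_norm_leP => // i j; rewrite ord1; have := h j.
  by rewrite in_itv /= !mxE ler_norml => /andP[h1 h2]; apply/andP; split; lra.
by apply: (@rV_compact R n (fun i => `[y0 0 i - rho, y0 0 i + rho]%classic)) => i; exact: segment_compact.
Qed.
End Traj.

Lemma near_ball2 (R : realType) (V : normedModType R) (P : V -> Prop) (a : V) : (\forall u \near a, P u) ->
  exists2 d : R, 0 < d & forall u, `|u - a| <= d -> P u.
Proof.
move=> /nbhs_ballP[e /= e0 he]; exists (e / 2); first by rewrite divr_gt0.
move=> u hu; apply: he; rewrite -ball_normE /= distrC; apply: le_lt_trans hu _.
by rewrite ltr_pdivrMr // ltr_pMr // ltr1n.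
Qed.

Lemma near_pair_snd (X Y : topologicalType) (P : X * Y -> Prop) (x : X) (y : Y) :
  (\forall z \near (x, y), P z) -> \forall y' \near y, P (x, y').
Proof.
move=> [[A B] /= [hA hB] h]; apply: filterS hB => y' By'.
by apply: (h (x, y')); split=> //=; exact: nbhs_singleton hA.
Qed.

Lemma is_derive_close (R : realType) (G B : R -> R) (t be C : R) : 0 <= C -> G t = B t ->
  (\forall s \near t, `|G s - B s| <= C * `|s - t| ^+ 2) -> is_derive t (1 : R) B be -> is_derive t (1 : R) G be.
Proof.
move=> C0 e /near_ball2[d d0 hd] DB.
have h : e1 (fun u => G (t + u) - B (t + u)) (G (t + 0) - B (t + 0)) 0.
  exists d, C; split=> // u hu; rewrite addr0 e subrr mul0r addr0 subr0.
  by have := hd (t + u); rewrite addrAC subrr add0r; apply.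
have D0 := e1_is_derive h.
have D1 : is_derive t (1 : R) (fun u => G (t + (- t + u)) - B (t + (- t + u))) 0.
  by apply: (is_derive_shift (f := fun u => G (t + u) - B (t + u))); rewrite addNr.
have D2 : is_derive t (1 : R) (fun u => (G (t + (- t + u)) - B (t + (- t + u))) + B u) (0 + be).
  exact: is_deriveD.
rewrite add0r in D2; have -> : G = (fun u => (G (t + (- t + u)) - B (t + (- t + u))) + B u).
  by apply/funext => u; rewrite addrA subrr add0r subrK.
exact: D2.
Qed.

Lemma is_derive_small (R : realType) (f : R -> R) (l : R) : is_derive (0 : R) (1 : R) f l ->
  forall e : R, 0 < e -> exists2 d : R, 0 < d & forall u, `|u| <= d -> `|f u - f 0 - u * l| <= e * `|u|.
Proof.
move=> [df dl] e e0.
have cv : (fun h : R => h^-1 *: (f (h *: (1 : R) + 0) - f 0)) @ (0 : R)^' --> l by rewrite -dl; exact: df.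
have /cvgrPdist_le/(_ e e0) h := cv.
have h' : \forall u \near (0 : R), u != 0 -> `|l - u^-1 *: (f (u *: (1 : R) + 0) - f 0)| <= e by exact: h.
have [d d0 hd] := near_ball2 h'; exists d => // u hu.
have [->|u0] := eqVneq u 0; first by rewrite subrr mul0r subr0 normr0 mulr0.
have := hd u; rewrite subr0 => /(_ hu u0).
rewrite addr0 /GRing.scale /= mulr1 -(ler_pM2r (x := `|u|)) ?normr_gt0 // -normrM.
rewrite mulrBl mulrAC mulVf // mul1r distrC.
by rewrite (mulrC l).
Qed.

(** Passing to [g u + g (- u)] removes the first derivative at [0]. Its derivative is then compared
    with [2 u l] through differentiability of [derive1 g], and its values with [u^2 m] through the
    expansion. *)
Lemma second_derivative_unique (R : realType) (g : R -> R) (ka m l : R) :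
  (forall e : R, 0 < e -> exists2 d : R, 0 < d & forall u, `|u| <= d -> `|g u - ka - u ^+ 2 / 2 * m| <= e * u ^+ 2) ->
  has_second_derivative g 0 l -> l = m.
Proof.
move=> hg [/near_ball2[d1 d10 h1] D2].
have Dg u : `|u| <= d1 -> is_derive u (1 : R) g (derive1 g u).
  by move=> hu; rewrite derive1E; apply/derivableP; apply: h1; rewrite subr0.
have h2 (e : R) : 0 < e -> exists2 d : R, 0 < d & forall u, `|u| <= d ->
    `|derive1 g u - derive1 g 0 - u * l| <= e * `|u|.
  by move=> e0; exact: (is_derive_small D2 e0).
apply/eqP; rewrite -subr_eq0 -normr_le0 leNgt; apply/negP => ep.
set e := `|l - m| / 8; have e0 : 0 < e by rewrite /e divr_gt0.
have [d2 d20 H2] := h2 e e0; have [d3 d30 H3] := hg e e0.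
set u := Num.min d1 (Num.min d2 d3).
have u0 : 0 < u by rewrite !lt_min d10 d20 d30.
have [u1 [u2 u3]] : u <= d1 /\ u <= d2 /\ u <= d3 by rewrite !ge_min !lexx !orbT.
have small s : 0 <= s <= u -> `|s| <= u /\ `|- s| <= u by move=> /andP[h3 h4]; rewrite normrN ger0_norm.
have Dps s : 0 <= s <= u -> is_derive s (1 : R) (fun s => g s + g (- s) - s ^+ 2 * l)
   (derive1 g s - derive1 g (- s) - 2 * s * l).
  move=> hs; have [n1 n2] := small s hs.
  have D3 := Dg s (le_trans n1 u1); have D4 := Dg (- s) (le_trans n2 u1).
  have Dn : is_derive s (1 : R) (fun s : R => - s) (- 1) by exact: is_deriveN.
  have D5 := is_derive_comp1 (g := fun s : R => - s) D4 Dn.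
  have D6 : is_derive s (1 : R) (fun s : R => s ^+ 2 * l) (2 * s * l).
    have D7 : is_derive s (1 : R) (fun s : R => s * s * l) ((1 * s + 1 * s) * l).
      have Di : is_derive s (1 : R) (fun s : R => s) 1 by exact: is_derive_id.
      have D8 := is_deriveM Di Di; have D9 := is_deriveM D8 (is_derive_cst l s (1 : R)).
      apply: (is_derive_eq D9); rewrite /GRing.scale /=; ring.
    by apply: (is_derive_eq D7); ring.
  have D8 := is_deriveB (is_deriveD D3 D5) D6.
  apply: (is_derive_eq D8); ring.
have Bps s : between 0 u s -> is_derive s (1 : R) (fun s => (g s + g (- s) - s ^+ 2 * l)%:M : 'M[R]_1)
     ((derive1 g s - derive1 g (- s) - 2 * s * l)%:M) /\
     `|(derive1 g s - derive1 g (- s) - 2 * s * l)%:M : 'M[R]_1| <= 2 * e * u.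
  move=> /(between_le _ (ltW u0)) hs; have [n1 n2] := small s hs; split.
    apply/derive_mxP => i j; rewrite !ord1.
    have -> : (fun s => ((g s + g (- s) - s ^+ 2 * l)%:M : 'M[R]_1) 0 0) = (fun s => g s + g (- s) - s ^+ 2 * l).
      by apply/funext => w; rewrite mxE eqxx mulr1n.
    by rewrite mxE eqxx mulr1n; exact: Dps.
  apply: mx_norm_leP => [|i j]; first by rewrite !mulr_ge0 // ltW.
  rewrite !ord1 mxE eqxx mulr1n.
  have a1 := H2 s (le_trans n1 u2); have a2 := H2 (- s) (le_trans n2 u2).
  have a3 := ler_normB (derive1 g s - derive1 g 0 - s * l) (derive1 g (- s) - derive1 g 0 - (- s) * l).
  have e3 : derive1 g s - derive1 g 0 - s * l - (derive1 g (- s) - derive1 g 0 - (- s) * l) =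
    derive1 g s - derive1 g (- s) - 2 * s * l by ring.
  rewrite e3 in a3; have b1 : e * `|s| <= e * u by rewrite ler_wpM2l // ltW.
  have b2 : e * `|- s| <= e * u by rewrite ler_wpM2l // ltW.
  lra.
have := mvt_norm Bps; rewrite subr0 (gtr0_norm u0) oppr0 expr0n mul0r subr0 => H4.
have H5 : `|g u + g (- u) - u ^+ 2 * l - (g 0 + g 0)| <= 2 * e * u * u.
  apply: le_trans H4; have := mx_entry_le ((g u + g (- u) - u ^+ 2 * l)%:M - (g 0 + g 0)%:M : 'M[R]_1) 0 0.
  by rewrite !mxE eqxx !mulr1n.
have uu : 0 <= u <= u by rewrite lexx ltW.
have [n1 n2] := small u uu.
have a1 := H3 u (le_trans n1 u3); have a2 := H3 (- u) (le_trans n2 u3).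
have a0 : `|g 0 - ka| <= 0.
  have n0 : `|0 : R| <= d3 by rewrite normr0 ltW.
  by have := H3 0 n0; rewrite expr0n /= !mul0r subr0 mulr0.
have a00 : g 0 = ka by apply/eqP; rewrite -subr_eq0 -normr_le0.
rewrite sqrrN in a2; rewrite a00 in H5.
have v0 : 0 < u ^+ 2 by rewrite exprn_gt0.
have H6 : `|(l - m) * u ^+ 2| <= 4 * e * u ^+ 2.
  have c1 := ler_normB (g u - ka - u ^+ 2 / 2 * m) (g u + g (- u) - u ^+ 2 * l - (ka + ka) - (g (- u) - ka - u ^+ 2 / 2 * m)).
  have e4 : g u - ka - u ^+ 2 / 2 * m - (g u + g (- u) - u ^+ 2 * l - (ka + ka) - (g (- u) - ka - u ^+ 2 / 2 * m)) =
    (l - m) * u ^+ 2 by field.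
  rewrite e4 in c1; apply: (le_trans c1).
  have c2 := ler_normB (g u + g (- u) - u ^+ 2 * l - (ka + ka)) (g (- u) - ka - u ^+ 2 / 2 * m).
  have e5 : 2 * e * u * u = 2 * (e * u ^+ 2) by ring.
  rewrite e5 in H5; have -> : 4 * e * u ^+ 2 = 4 * (e * u ^+ 2) by ring.
  lra.
move: H6; rewrite normrM (gtr0_norm v0) ler_pM2r // /e => H6; lra.
Unshelve. all: by end_near. Qed.

(** * The value function near the geodesic *)

Section Loc.
Context {R : realType} {n k : nat} {M : manifold R n} (S : affine_system M k).
Local Notation int a b f := (\int[@lebesgue_measure R]_(s in `[a, b]) f s).
Local Opaque jacobian transition_jac field_in.
Hypothesis hS : smooth_system S.
Variables (c : chart R n M) (q0 y0 : 'rV[R]_n) (r K K' KX KL T : R)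
  (Phi : 'rV[R]_(n + n) -> R -> 'rV[R]_(n + n)).
Hypothesis ac : atlas M c.
Local Notation F0 := (cF0 S c).
Local Notation F := (cF S c).
Local Notation Qp := (cQ S c).
Local Notation U := (ccod c).
Local Notation hF := (hH F0 F Qp).
Local Notation z0 := (row_mx q0 y0).
Hypotheses (r0 : 0 < r) (K0 : 0 < K) (K'0 : 0 <= K') (KX0 : 0 <= KX) (KL0 : 0 <= KL) (T0 : 0 < T)
  (KT : K * T <= 2^-1) (KTr : K * T <= r / 4).
Hypothesis est : field_bounds (UU U) hF z0 r K.
Hypothesis HPhi : flow_bounds R hF z0 r K T Phi.
Hypothesis hHz : forall a b : 'rV[R]_(n + n), `|a - z0| <= r -> `|b - z0| <= r ->
  `|Hz F0 F Qp a - Hz F0 F Qp b - 'D_(a - b) (Hz F0 F Qp) b| <= K' * `|a - b| ^+ 2.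
Hypothesis hX : forall y, `|y - y0| <= r -> [/\ U y, (forall j, `|F0 y 0 j| <= KX),
     (forall i j, `|F i y 0 j| <= KX) & `|Qp y| <= KX].
Hypothesis hL : forall z, `|z - z0| <= r ->
  `|2^-1 * lagr Qp (rsubmx z) (ctrl F (lsubmx z) (rsubmx z))| <= KL.

Let oU : open U. Proof. exact: oc. Qed.
Let sF0 j : smooth U (fun y => F0 y 0 j). Proof. exact: scF0. Qed.
Let sF i j : smooth U (fun y => F i y 0 j). Proof. exact: scF. Qed.
Let sQ : smooth U Qp. Proof. exact: scQ. Qed.
Let lipH a b : `|a - z0| <= r -> `|b - z0| <= r -> UU U a /\ `|hF a - hF b| <= K * `|a - b|.
Proof. by move=> ha hb; have [h1 _ h2 _ _] := est ha hb ha. Qed.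

Local Ltac slra := have := r0; have := K0; have := KL0; have := KTr; lra.

(** With [xb] and [AA]: the control, position and action of the extremal issued from the state
    [z]. *)
Definition ub z (t : R) : 'rV[R]_k := ctrl F (lsubmx (Phi z t)) (rsubmx (Phi z t)).
Definition xb z (t : R) : 'rV[R]_n := rsubmx (Phi z t).
Definition AA z (t : R) : R := eact Qp t (ub z) (xb z).

Lemma Phi_r z (t : R) : `|z - z0| <= r / 2 -> `|t| < T ->
  [/\ `|Phi z t - z0| <= r, UU U (Phi z t) & is_derive t 1 (Phi z) (hF (Phi z t))].
Proof.
move=> hz tT; have [_ /(_ t tT)[_ [h1 h2]]] := HPhi hz; split=> //.
by have [] := lipH h1 h1.
Qed.

Lemma Phi_half z (t : R) : `|z - z0| <= r / 4 -> `|t| < T -> `|Phi z t - z0| <= r / 2.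
Proof.
move=> hz tT; have hz' : `|z - z0| <= r / 2 by apply: (le_trans hz); slra.
have [_ /(_ t tT)[h1 _]] := HPhi hz'.
have h2 : K * `|t| <= K * T by apply: ler_wpM2l; [exact: ltW|exact: ltW].
have h3 := ler_normD (Phi z t - z) (z - z0); rewrite subrKA in h3.
apply: le_trans h3 _; slra.
Qed.

Lemma z00 (e : R) : 0 <= e -> `|z0 - z0| <= e.
Proof. by rewrite subrr normr0. Qed.

Lemma ub_continuous z (t : R) : `|z - z0| <= r / 2 -> `|t| < T -> {for t, continuous (ub z)}.
Proof.
move=> hz tT; have [_ Ut D] := Phi_r hz tT.
apply: continuous_mx_at => i j.
have -> : (fun u => ub z u i j) = (fun w => pairing (lsubmx w) (F j (rsubmx w))) \o Phi z.
  by apply/funext => u; rewrite /= -ctrlE ord1.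
apply: (continuous_comp (is_derive_cont D)).
apply: (smooth_cont _ Ut); apply: (smooth_pairing oU (G := fun w => F j (rsubmx w))) => l.
exact: (smooth_rsub (sF j l)).
Qed.

Lemma xb_derive z (t : R) : `|z - z0| <= r / 2 -> `|t| < T -> is_derive t (1 : R) (xb z) (fld F0 F (xb z t) (ub z t)).
Proof.
move=> hz tT; have [_ Ut D] := Phi_r hz tT.
rewrite fld_ctrl -(rsub_hH oU sF0 sF sQ Ut); exact: is_derive_rsub.
Qed.

(** The shift by [a] allows an extremal that ends, rather than starts, at a given state; such an arc
    replaces the beginning of a competitor in [excursion_cost]. *)
Lemma extremal_ctraj z (a T' : R) : `|z - z0| <= r / 2 -> 0 <= T' ->
  (forall t, 0 <= t <= T' -> `|- a + t| < T) ->
  ctraj S T' (fun t => ub z (- a + t)) (cinv c \o (fun t => xb z (- a + t)) \o clampI T') /\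
  forall al be, 0 <= al -> al <= be -> be <= T' ->
   `|mact S al be (fun t => ub z (- a + t)) (cinv c \o (fun t => xb z (- a + t)) \o clampI T')| <= KL * (be - al).
Proof.
move=> hz T'0 hT.
have D t : 0 <= t <= T' -> U (xb z (- a + t)) /\
    is_derive t 1 (fun t => xb z (- a + t)) (fld F0 F (xb z (- a + t)) (ub z (- a + t))).
  move=> ht; have [_ Ut _] := Phi_r hz (hT t ht); split; first exact: Ut.
  exact: (is_derive_shift (xb_derive hz (hT t ht))).
have cu t : 0 <= t <= T' -> {for t, continuous (fun t => ub z (- a + t))}.
  move=> ht; have h1 : {for t, continuous (fun t : R => - a + t)}.
    by apply: continuousD; [exact: cst_continuous|exact: cvg_id].
  exact: (continuous_comp h1 (ub_continuous hz (hT t ht))).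
split; first exact: (curve_piece hS ac T'0 D cu).
move=> al be al0 ab bT.
set x := (_ \o clampI T').
have in_ t : al <= t <= be -> 0 <= t <= T' by move=> /andP[h1 h2]; rewrite (le_trans al0 h1) (le_trans h2 bT).
have e t : al <= t <= be -> 2^-1 * (\sum_(i < k) ub z (- a + t) 0 i ^+ 2 - potential S (x t)) =
    2^-1 * lagr Qp (xb z (- a + t)) (ub z (- a + t)).
  by move=> ht; rewrite /x /= clampI_id ?in_.
have bl : bint al be (fun t => lagr Qp (xb z (- a + t)) (ub z (- a + t))).
  apply: (bint_lagr sQ) => [t ht|i].
    have [Ut Dt] := D t (in_ t ht); exact: (conj (is_derive_cont Dt) Ut).
  by apply: bint_entry => t ht; exact: cu (in_ t ht).
have -> : mact S al be (fun t => ub z (- a + t)) x =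
    int al be (fun t => 2^-1 * lagr Qp (xb z (- a + t)) (ub z (- a + t))).
  rewrite (RintZ _ bl) /mact; congr (_ * _); apply: Rint_ext => t ht.
  by apply: (mulfI (x := 2^-1)); rewrite ?invr_neq0 ?pnatr_eq0 //; exact: e.
have bl2 := bintZ 2^-1 bl; apply: le_trans (Rint_norm bl2) _.
rewrite -(Rint_cst KL ab); apply: Rint_le; [exact: bint_norm|exact: bint_cst|].
by move=> t ht; have [h1 _ _] := Phi_r hz (hT t (in_ t ht)); exact: hL.
Qed.

Let sh0 (X : Type) (f : R -> X) : (fun t => f (- 0 + t)) = f.
Proof. by apply/funext => t; rewrite oppr0 add0r. Qed.

Lemma extremal0 z (t : R) : `|z - z0| <= r / 2 -> 0 <= t < T ->
  [/\ ctraj S t (ub z) (cinv c \o xb z \o clampI t),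
      (forall al be, 0 <= al -> al <= be -> be <= t ->
        `|mact S al be (ub z) (cinv c \o xb z \o clampI t)| <= KL * (be - al)),
      mact S 0 t (ub z) (cinv c \o xb z \o clampI t) = AA z t,
      (cinv c \o xb z \o clampI t) 0 = cinv c (rsubmx z) &
      (cinv c \o xb z \o clampI t) t = cinv c (xb z t)].
Proof.
move=> hz /andP[t0 tT].
have h s : 0 <= s <= t -> `|- 0 + s| < T.
  by move=> /andP[s0 st]; rewrite oppr0 add0r ger0_norm // (le_lt_trans st).
have [h1 h2] := extremal_ctraj hz t0 h; rewrite !sh0 in h1 h2; split=> //.
- rewrite /mact /AA /eact; congr (_ * _); apply: Rint_ext => s hs.
  by rewrite /lagr /= clampI_id.
- by rewrite /= clampI_id ?lexx // /xb; have [-> _] := HPhi hz.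
- by rewrite /= clampI_id ?lexx ?t0.
Qed.

Lemma value_upper z (t : R) : `|z - z0| <= r / 2 -> 0 <= t < T ->
  (value S t (cinv c (rsubmx z)) (cinv c (xb z t)) <= (AA z t)%:E)%E.
Proof.
move=> hz ht; have [h1 _ <- <- <-] := extremal0 hz ht.
by have /andP[t0 _] := ht; exact: (ctraj_value t0 h1).
Qed.

Lemma cmap_near (y : 'rV[R]_n) : U y -> cmap c (cinv c y) = y. Proof. exact: cinvK. Qed.

(* The first excursion of a path out of a coordinate ball; compactness of the
   closed ball prevents the path from leaving the chart without crossing it. *)
Lemma excursion (rho t : R) (x : R -> M) : 0 < rho -> rho <= r -> 0 <= t -> continuous x ->
  cdom c (x 0) -> `|cmap c (x 0) - y0| <= rho / 2 ->
  (forall s, 0 <= s <= t -> cdom c (x s) /\ `|cmap c (x s) - y0| <= rho) \/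
  exists2 sg, 0 <= sg <= t & rho / 2 <= `|cmap c (x sg) - y0| /\
    forall s, 0 <= s <= sg -> cdom c (x s) /\ `|cmap c (x s) - y0| <= rho.
Proof.
move=> rho0 rhor t0 cx d0 n0.
set G := fun s => cdom c (x s) /\ `|cmap c (x s) - y0| <= rho.
have [hex|hno] := pselect (exists2 sg, 0 <= sg <= t & rho / 2 <= `|cmap c (x sg) - y0| /\
    forall s, 0 <= s <= sg -> G s); first by right.
left; set I := fun s => cdom c (x s) /\ `|cmap c (x s) - y0| <= rho / 2.
have IG s : I s -> G s by move=> [h1 h2]; split=> //; apply: le_trans h2 _; slra.
have hb y : `|y - y0| <= rho / 2 -> U y.
  by move=> hy; have [] := hX (y := y); first by apply: le_trans hy _; slra.
suff : forall s, 0 <= s <= t -> I s by move=> h s /h /IG.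
have rho20 : 0 <= rho / 2 by slra.
have cl := closed_chart_ball ac hb rho20.
apply: (@real_ind R (fun a => forall s, 0 <= s <= a -> I s) t t0).
- by move=> s hs; have -> : s = 0 by apply/eqP; rewrite eq_le andbC.
- move=> a /andP[a0 at_] H s /andP[s0].
  rewrite le_eqVlt => /predU1P[->|sa]; last by apply: (H s); rewrite ?s0 ?lexx.
  have : (cinv c @` [set y | `|y - y0| <= rho / 2]) (x a).
    apply: cl => B hB; have nB : \forall u \near a, B (x u) by exact: (cx a B hB).
    have [d d0' hd] := near_ball2 nB.
    exists (x (Num.max 0 (a - d / 2))); split; last first.
      apply: hd; rewrite ler_norml; have [hm|hm] := leP 0 (a - d / 2).
        by apply/andP; split; slra.
      by apply/andP; split; slra.
    have hm0 : 0 <= Num.max 0 (a - d / 2) by rewrite le_max lexx.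
    have hma : Num.max 0 (a - d / 2) < a by rewrite gt_max a0 /=; slra.
    have [h1 h2] : I (Num.max 0 (a - d / 2)) by apply: (H (Num.max 0 (a - d / 2))); rewrite ?hm0 ?hma ?lexx.
    by exists (cmap c (x (Num.max 0 (a - d / 2)))) => //; exact: (cmapK (atlas_chart ac) h1).
  move=> [y hy exa]; have Uy := hb y hy.
  rewrite /I -exa (cmap_near Uy); split=> //; exact: (cinv_dom ac Uy).
- move=> a /andP[a0 at_] H.
  have lta : `|cmap c (x a) - y0| < rho / 2.
    rewrite ltNge; apply/negP => h; apply: hno; exists a; first by rewrite a0 ltW.
    by split=> // s hs; apply: IG; exact: H.
  have [da _] : I a by apply: H; rewrite a0 lexx.
  have n1 : \forall u \near a, cdom c (x u).
    by apply: cx; apply: open_nbhs_nbhs; split; [exact: cdom_open (atlas_chart ac)|].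
  have c2 : {for a, continuous (fun u => `|cmap c (x u) - y0|)}.
    have c3 := continuous_comp (cx a) (cmap_continuous (atlas_chart ac) da).
    exact: (continuous_comp (continuousB c3 (@cst_continuous _ _ y0 _)) (@norm_continuous _ _ _)).
  have n2 : \forall u \near a, `|cmap c (x u) - y0| < rho / 2.
    by exact: (c2 _ (lt_nbhsl lta)).
  have n12 : \forall u \near a, cdom c (x u) /\ `|cmap c (x u) - y0| < rho / 2.
    by apply: filterS2 n1 n2 => u h1 h2; split.
  have [d d0' hd] := near_ball2 n12.
  exists d => // s /andP[as_ sd] u /andP[u0 us].
  have [ua|au] := leP u a; first by apply: H; rewrite u0.
  have [h1 h2] : cdom c (x u) /\ `|cmap c (x u) - y0| < rho / 2.
    by apply: hd; rewrite ger0_norm ?subr_ge0 ?(ltW au) // lerBlDl (le_trans us).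
  by split=> //; exact: ltW.
Qed.

Variable l : cotangent M.
Hypotheses (l1 : l.1 = cinv c y0)
  (geo : forall t, `|t| < T -> geodesic S l t = cinv c (xb z0 t))
  (reg : \forall t \near (0 : R)^'+, cost_regular S l t).

(** Regularity of the cost at one small time [t1] gives finite values and a lower bound, uniform in
    the starting point. This controls trajectories that go far from [x], where the potential may be
    large. *)
Lemma cost_bound : exists t1 C1 rho1 : R, [/\ 0 < t1 < T, 0 < rho1, 0 <= C1 & forall y, `|y - y0| <= rho1 ->
  value S t1 (cinv c y) (cinv c (xb z0 t1)) \is a fin_num /\
  - C1 <= fine (value S t1 (cinv c y) (cinv c (xb z0 t1)))].
Proof.
have Uy0 : U y0 by have [] := hX (y := y0); rewrite // subrr normr0 ltW.
have [t1 [[ht reg1] t10 t1T]] : exists t1, [/\ cost_regular S l t1, 0 < t1 & t1 < T].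
  have hT : \forall t \near (0 : R)^'+, 0 < t < T.
    by near=> t; apply/andP; split; near: t; [exact: nbhs_right_gt|exact: nbhs_right_lt].
  have h12 : \forall t \near (0 : R)^'+, cost_regular S l t /\ 0 < t < T.
    by apply: filterS2 reg hT => u h1 h2; split.
  near (0 : R)^'+ => t1; exists t1.
  have [h1 /andP[h2 h3]] : cost_regular S l t1 /\ 0 < t1 < T by near: t1; exact: h12.
  by split.
have nT : `|t1| < T by rewrite gtr0_norm.
have [W [oW Ol sO _]] := reg1; rewrite l1 in Ol.
have ci := cinv_continuous (atlas_chart ac) Uy0.
have n1 : \forall y \near y0, value S t1 (cinv c y) (geodesic S l t1) \is a fin_num.
  rewrite l1 in ht; have := near_pair_snd ht => h.
  by have := ci _ h.
have cy : (cmap c @` (cdom c `&` W)) y0.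
  by exists (cinv c y0); [split=> //; exact: (cinv_dom ac Uy0)|exact: cmap_near].
have cc := smooth_cont (sO c ac) cy.
have n2 : \forall y \near y0, `|cost S l t1 (cinv c y)| < `|cost S l t1 (cinv c y0)| + 1.
  have c3 := continuous_comp cc (@norm_continuous _ _ _).
  apply: (c3 _ (lt_nbhsl _)); rewrite /= ltrDl; exact: ltr01.
have n12 : \forall y \near y0, value S t1 (cinv c y) (geodesic S l t1) \is a fin_num /\
    `|cost S l t1 (cinv c y)| < `|cost S l t1 (cinv c y0)| + 1.
  by apply: filterS2 n1 n2 => y h1 h2; split.
have [rho1 h0 h] := near_ball2 n12.
exists t1, (`|cost S l t1 (cinv c y0)| + 1), rho1; split=> //; first by rewrite t10.
move=> y /h[]; rewrite /cost (geo nT) => -> h2; split=> //.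
by move: h2; rewrite normrN ltr_norml => /andP[h2 _]; exact: ltW.
Unshelve. all: by end_near. Qed.

(** Surgery: the part of the path before [sg] is replaced by an extremal arc ending at the same
    point, and the reference geodesic is appended up to the fixed time [t1]. The new path starts
    near [y0], so its action is at least [- C1]; this bounds the rest of the path from below, while
    the discarded part was expensive by [crossing]. *)
Lemma excursion_cost : exists rho sb : R, [/\ 0 < rho, rho <= r / 2, 0 < sb, sb < T &
  forall t u (x : R -> M) sg, 0 < t <= sb -> ctraj S t u x -> x t = cinv c (xb z0 t) ->
    0 <= sg <= t -> (forall s, 0 <= s <= sg -> cdom c (x s) /\ `|cmap c (x s) - y0| <= rho) ->
    rho / 4 <= `|cmap c (x sg) - cmap c (x 0)| -> KL * t <= mact S 0 t u x].
Proof.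
have [t1 [C1 [rho1 [/andP[t10 t1T] rho10 C10 hC]]]] := cost_bound.
set rho := Num.min (rho1 / 2) (r / 2).
have rho0 : 0 < rho by rewrite lt_min !divr_gt0.
have rhor : rho <= r / 2 by rewrite ge_min lexx orbT.
have rho1h : rho <= rho1 / 2 by rewrite ge_min lexx.
have rho40 : 0 < rho / 4 by slra.
(* The threshold pays for the bound [- C1], for the two inserted arcs, each of action at most
   [KL * t1], and for the announced [KL * t]. *)
have [sb sb0 hsb] := crossing sF0 sF sQ (C1 + 3 * (KL * t1)) KX0 rho40 hX.
set sb' := Num.min (Num.min sb t1) (rho1 / (2 * K)).
have K20 : 0 < 2 * K by slra.
have sb'0 : 0 < sb' by rewrite !lt_min sb0 t10 divr_gt0.
exists rho, sb'; split=> //; first by rewrite (le_lt_trans _ t1T) // !ge_min lexx !orbT.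
move=> t u x sg /andP[t0 tsb] tx xt /andP[s0 st] stay far.
have [tsb1 [tt1 tK]] : t <= sb /\ t <= t1 /\ t <= rho1 / (2 * K).
  by move: tsb; rewrite !le_min => /andP[/andP[]].
have Ksg : K * sg <= rho1 / 2.
  have : K * sg <= K * (rho1 / (2 * K)) by rewrite ler_pM2l // (le_trans st).
  suff -> : K * (rho1 / (2 * K)) = rho1 / 2 by [].
  by field; exact: lt0r_neq0.
have dx s : 0 <= s <= sg -> cdom c (x s) by move=> /stay[].
have ex : mact S 0 sg u x = eact Qp sg u (cmap c \o x) by exact: mact_eact.
have etx : etraj F0 F sg u (cmap c \o x).
  by apply: (ctraj_etraj (T := t) ac _ tx) => //; rewrite s0.
have big : C1 + 3 * (KL * t1) <= mact S 0 sg u x.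
  rewrite ex; apply: hsb => //; first by rewrite s0 (le_trans st).
  by move=> s /stay[_ h]; apply: le_trans h _; slra.
have [cx bu tpx] := tx.
set y1 := cmap c (x sg).
have [dsg nsg] : cdom c (x sg) /\ `|y1 - y0| <= rho by apply: stay; rewrite s0 lexx.
(* The extremal with covector [q0] at the exit point, run backwards for the time [sg]; its speed
   bound keeps its starting point within [rho1] of [y0]. *)
set w := row_mx q0 y1.
have hw : `|w - z0| <= r / 2.
  rewrite /w row_mxB subrr; apply: le_trans (norm_row_mx _ _) _.
  by rewrite normr0 add0r (le_trans nsg).
have sgT : sg < T by apply: le_lt_trans st _; exact: le_lt_trans tt1 t1T.
have hsg s : 0 <= s <= sg -> `|- sg + s| < T.
  by move=> /andP[h1 h2]; rewrite ler0_norm; [slra|slra].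
have [tw mw] := extremal_ctraj hw s0 hsg.
set xw := (_ \o clampI sg) in tw mw; set uw := (fun t => ub w (- sg + t)) in tw mw.
have xw1 : xw sg = x sg.
  rewrite /xw /= clampI_id ?s0 ?lexx // addNr /xb; have [-> _] := HPhi hw.
  by rewrite row_mxKr; exact: (cmapK (atlas_chart ac) dsg).
have xw0 : xw 0 = cinv c (xb w (- sg)) by rewrite /xw /= clampI_id ?lexx ?s0 // addr0.
have nw : `|xb w (- sg) - y0| <= rho1.
  have h1 : `|- sg| < T by rewrite normrN ger0_norm.
  have [_ /(_ _ h1)[h2 _]] := HPhi hw.
  have h3 : `|xb w (- sg) - y1| <= K * sg.
    have -> : xb w (- sg) - y1 = rsubmx (Phi w (- sg) - w) by rewrite rsubB /w row_mxKr.
    by apply: le_trans (norm_rsubmx _) _; rewrite normrN (ger0_norm s0) in h2.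
  have h4 := ler_normD (xb w (- sg) - y1) (y1 - y0); rewrite subrKA in h4.
  apply: le_trans h4 _; slra.
have z0r : `|z0 - z0| <= r / 2 by apply: z00; slra.
have t1I : 0 <= t1 < T by rewrite (ltW t10).
have [tg mg _ _ g1] := extremal0 z0r t1I.
set xg := (_ \o clampI t1) in tg mg g1.
have xgt : xg t = cinv c (xb z0 t) by rewrite /xg /= clampI_id // (ltW t0).
have [cg bg tpg] := tg; have [cw bw tpw] := tw.
have xtg : x t = xg t by rewrite xt xgt.
have tpg' : tpiece S t t1 (ub z0) xg.
  by move=> c' a b ac' ta ab bt; apply: tpg => //; exact: le_trans (ltW t0) ta.
have bg' i : bint t t1 (fun s => ub z0 s 0 i) by apply: (bint_sub (ltW t0) (lexx _) (bg i)).
have [tG mG] := ctraj_glue hS (ltW t0) tt1 cx cg xtg bu bg' tpx tpg'.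
set xG := glue t x xg in tG mG; set uG := glue t u (ub z0) in tG mG.
have [cG bG tpG] := tG; have sgt1 := le_trans st tt1.
have tpG' : tpiece S sg t1 uG xG.
  by move=> c' a b ac' ta ab bt; apply: tpG => //; exact: le_trans s0 ta.
have bG' i : bint sg t1 (fun s => uG s 0 i) by apply: (bint_sub s0 (lexx _) (bG i)).
have xwG : xw sg = xG sg by rewrite xw1 /xG /glue st.
have [tH mH] := ctraj_glue hS s0 sgt1 cw cG xwG bw bG' tpw tpG'.
have split_ : mact S 0 t1 uG xG = mact S 0 sg uG xG + mact S sg t1 uG xG.
  by rewrite /mact (Rint_split s0 sgt1 (bint_mlag hS cG bG)) mulrDr.
have e0 : mact S 0 sg uG xG = mact S 0 sg u x.
  rewrite /mact; congr (_ * _); apply: Rint_ext => s /andP[h1 h2].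
  by rewrite /xG /uG /glue (le_trans h2 st).
have := ctraj_value (ltW t10) tH.
have -> : glue sg xw xG 0 = cinv c (xb w (- sg)) by rewrite /glue s0 xw0.
have -> : glue sg xw xG t1 = cinv c (xb z0 t1).
  rewrite -g1 /glue; case: ifP => h.
    have e1 : sg = t1 by apply/eqP; rewrite eq_le sgt1 h.
    have e2 : t = t1 by apply/eqP; rewrite eq_le tt1 -e1 st.
    transitivity (xw sg); first by rewrite e1.
    by rewrite xw1 e1 -e2.
  rewrite /xG /glue; case: ifP => h2 //.
  by have -> : t1 = t by apply/eqP; rewrite eq_le h2 tt1.
have [fin lo] := hC _ nw; rewrite -(fineK fin) lee_fin => hv.
have a1 := mw 0 sg (lexx _) s0 (lexx _).
have a2 := mg t t1 (ltW t0) tt1 (lexx _).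
move: a1 a2; rewrite !ler_norml subr0 => /andP[_ a1] /andP[_ a2].
have b1 : KL * sg <= KL * t1 by rewrite ler_wpM2l.
have b2 : KL * (t1 - t) <= KL * t1 by rewrite ler_wpM2l // gerBl ltW.
have b3 : KL * t <= KL * t1 by rewrite ler_wpM2l.
rewrite -/uw -/xw in a1; slra.
Qed.

(** The extremal is itself a competitor, which bounds the value from above. Conversely, a competitor
    either stays in the ball, where [local_min] applies, or makes an excursion and costs at least
    [KL * t], an upper bound for [AA z t]. *)
Lemma value_eq : exists tau d0 : R, [/\ 0 < tau, tau < T, 0 < d0 & forall t z, 0 < t <= tau ->
  `|z - z0| <= r / 4 -> `|rsubmx z - y0| <= d0 -> xb z t = xb z0 t ->
  value S t (cinv c (rsubmx z)) (geodesic S l t) = (AA z t)%:E].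
Proof.
have [rho [sb [rho0 rhor sb0 sbT hsb]]] := excursion_cost.
have k10 : 0 < (k%:R + 1 : R) by rewrite ltr_wpDl.
(* The constant of [local_min]; the choice of [tau] makes [B * t ^+ 2 <= 1]. *)
set B := 8 * K' * KX ^+ 2 * (k%:R + 1).
have B0 : 0 <= B by rewrite !mulr_ge0 // ?sqr_ge0 // ltW.
set tau := Num.min sb (Num.min 1 ((B + 1)^-1)).
have B1 : 0 < B + 1 by slra.
have tau0 : 0 < tau by rewrite !lt_min sb0 ltr01 invr_gt0.
exists tau, (rho / 4); split=> //; first by rewrite gt_min sbT.
  by slra.
move=> t z /andP[t0 tt] hz hy exz.
have [tsb [t1 tB]] : t <= sb /\ t <= 1 /\ t <= (B + 1)^-1.
  by move: tt; rewrite !le_min => /andP[? /andP[]].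
have tT : t < T by exact: le_lt_trans tsb sbT.
have nT : `|t| < T by rewrite gtr0_norm.
have hz2 : `|z - z0| <= r / 2 by apply: (le_trans hz); slra.
rewrite (geo nT) -exz; apply/eqP; rewrite eq_le; apply/andP; split.
  by apply: value_upper => //; rewrite (ltW t0).
apply: le_ereal_inf_tmp => _ [u [x [hu hx x0 xt ->]]]; rewrite lee_fin.
have [tx <-] := trajectory_ctraj (ltW t0) hu hx.
have ci0 : clampI t 0 = 0 by rewrite clampI_id // lexx ltW.
have cit : clampI t t = t by rewrite clampI_id // lexx ltW.
have [cx _ _] := tx; set x' := (x \o clampI t) in tx cx *.
have x'0 : x' 0 = cinv c (rsubmx z) by rewrite /x' /= ci0.
have x't : x' t = cinv c (xb z t) by rewrite /x' /= cit.
have Uz : U (rsubmx z) by have [] := hX (y := rsubmx z); first by apply: le_trans hy _; slra.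
have dz : cdom c (x' 0) by rewrite x'0; exact: (cinv_dom ac Uz).
have cz : cmap c (x' 0) = rsubmx z by rewrite x'0; exact: cmap_near.
have nz : `|cmap c (x' 0) - y0| <= rho / 2 by rewrite cz; apply: le_trans hy _; slra.
have rr : rho <= r by slra.
have [stay|[sg hsg [far stay]]] := excursion rho0 rr (ltW t0) cx dz nz; last first.
  have hm : KL * t <= mact S 0 t u x'.
    apply: (hsb t u x' sg _ tx _ hsg stay); [by rewrite t0|by rewrite x't exz|].
    have h3 := ler_normB (cmap c (x' sg) - y0) (cmap c (x' sg) - cmap c (x' 0)).
    rewrite opprB addrC addrA subrK in h3.
    have h4 := ler_normD (cmap c (x' sg) - cmap c (x' 0)) (cmap c (x' 0) - y0).
    by rewrite subrKA cz in h4 *; slra.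
  apply: le_trans hm; have ht : 0 <= t < T by rewrite (ltW t0).
  have [_ h _ _ _] := extremal0 hz2 ht.
  have [_ _ <- _ _] := extremal0 hz2 ht.
  by have := h 0 t (lexx _) (ltW t0) (lexx _); rewrite subr0 ler_norml => /andP[].
have dx s : 0 <= s <= t -> cdom c (x' s) by move=> /stay[].
have t00 : 0 <= t <= t by rewrite lexx ltW.
have etx : etraj F0 F t u (cmap c \o x') by apply: (ctraj_etraj (T := t) ac _ tx).
rewrite (mact_eact S u ac dx).
have inT s : 0 <= s <= t -> `|s| < T by move=> /andP[h1 h2]; rewrite ger0_norm // (le_lt_trans h2).
have rz0 : rsubmx z0 = y0 by rewrite row_mxKr.
have hX' y i j : `|y - rsubmx z0| <= r -> `|F i y 0 j| <= KX by rewrite rz0 => /hX[].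
have Hzb s : 0 <= s <= t -> is_derive s 1 (Phi z) (hF (Phi z s)).
  by move=> /inT h; have [] := Phi_r hz2 h.
have zbr s : 0 <= s <= t -> `|row_mx (lsubmx (Phi z s)) ((cmap c \o x') s) - z0| <= r /\ `|Phi z s - z0| <= r.
  move=> hs; have h1 := Phi_half hz (inT s hs); have [_ h2] := stay s hs.
  split; last by apply: le_trans h1 _; slra.
  rewrite row_mxB; apply: le_trans (norm_row_mx _ _) _.
  have -> : lsubmx (Phi z s) - q0 = lsubmx (Phi z s - z0) by rewrite lsubB row_mxKl.
  by have := norm_lsubmx (Phi z s - z0); rewrite /=; slra.
have xz0 : (cmap c \o x') 0 = rsubmx (Phi z 0) by have [-> _] := HPhi hz2; rewrite /= cz.
have xzt : (cmap c \o x') t = rsubmx (Phi z t).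
  have [_ Ut _] := Phi_r hz2 nT.
  by rewrite /= x't; exact: cmap_near.
have Kt : K * t <= 2^-1 by apply: le_trans KT; rewrite ler_pM2l // ltW.
have Bt : 8 * K' * KX ^+ 2 * (k%:R + 1) * t ^+ 2 <= 1.
  rewrite -/B; have h1 : (B + 1) * t <= 1.
    have h0 := mulfV (lt0r_neq0 B1); by rewrite -[leRHS]h0 ler_pM2l.
  have h2 : t ^+ 2 <= t by rewrite expr2 ger_pMl.
  have h3 : B * t ^+ 2 <= B * t by rewrite ler_wpM2l.
  slra.
exact: (local_min oU sF0 sF sQ K0 K'0 KX0 lipH hHz hX' (ltW t0) Hzb zbr etx xz0 Kt Bt xzt).
Qed.
Lemma is_derive_state z (t : R) : `|z - z0| <= r / 2 -> `|t| < T -> {for t, continuous (Phi z)}.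
Proof. by move=> hz tT; have [_ _ D] := Phi_r hz tT; exact: is_derive_cont D. Qed.

Lemma fld_hH z (t : R) j : `|z - z0| <= r / 2 -> `|t| < T ->
  fld F0 F (xb z t) (ub z t) 0 j = hF (Phi z t) 0 (rshift n j).
Proof.
by move=> hz tT; have [_ Ut _] := Phi_r hz tT; rewrite fld_ctrl -(rsub_hH oU sF0 sF sQ Ut) mxE.
Qed.

Lemma extremal_etraj z (s : R) : `|z - z0| <= r / 2 -> 0 <= s < T -> etraj F0 F s (ub z) (xb z).
Proof.
move=> hz /andP[s0 sT].
have inT t : 0 <= t <= s -> `|t| < T by move=> /andP[h1 h2]; rewrite ger0_norm // (le_lt_trans h2).
split.
- by move=> t /inT tT; exact: (is_derive_cont (xb_derive hz tT)).
- by move=> i; apply: bint_entry => t /inT tT; exact: ub_continuous.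
move=> t j /andP[t0 ts].
have inT' a : 0 <= a <= t -> `|a| < T by move=> /andP[h1 h2]; apply: inT; rewrite h1 (le_trans h2).
have h1 (a : R) : 0 <= a <= t -> is_derive a (1 : R) (fun a => xb z a 0 j) (hF (Phi z a) 0 (rshift n j)).
  move=> /inT' aT; rewrite -(fld_hH j hz aT).
  by have /derive_mxP := xb_derive hz aT; apply.
have h2 (a : R) : 0 <= a <= t -> {for a, continuous (fun a => hF (Phi z a) 0 (rshift n j))}.
  move=> /inT' aT; have [_ Ut _] := Phi_r hz aT.
  exact: (continuous_comp (is_derive_state hz aT) (smooth_cont (shH oU sF0 sF sQ (rshift n j)) Ut)).
have -> : int 0 t (fun a => fld F0 F (xb z a) (ub z a) 0 j) = int 0 t (fun a => hF (Phi z a) 0 (rshift n j)).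
  by apply: Rint_ext => a /inT' aT; exact: fld_hH.
by rewrite (Rint_FTC2 t0 h1 h2) addrC subrK.
Qed.

Definition LL (z : 'rV[R]_(n + n)) : R := 2^-1 * lagr Qp (rsubmx z) (ctrl F (lsubmx z) (rsubmx z)).

Lemma LLE z : LL z = pairing (lsubmx z) (rH F0 F z) - Hz F0 F Qp z.
Proof.
rewrite /LL (lagr_id F0 F Qp (lsubmx z) (rsubmx z)) fld_ctrl big1 ?mulr0 ?addr0 // => i _.
by rewrite subrr expr0n.
Qed.

Lemma LL_smooth : smooth (UU U) LL.
Proof.
apply: (smooth_ext (f := fun z => pairing (lsubmx z) (rH F0 F z) - Hz F0 F Qp z)).
- exact: oUU.
- by move=> z _; rewrite LLE.
apply: smoothB; first exact: oUU.
  by apply: (smooth_pairing oU) => j; exact: (smooth_rH oU sF0 sF sQ).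
exact: (sHz oU sF0 sF sQ).
Qed.

Lemma AA_derive z (t : R) : `|z - z0| <= r / 2 -> 0 < t < T -> is_derive t (1 : R) (AA z) (LL (Phi z t)).
Proof.
move=> hz /andP[t0 tT]; set T' := (t + T) / 2.
have T'0 : 0 <= T' by rewrite /T'; lra.
have [tT' T'T] : t < T' /\ T' < T by rewrite /T'; lra.
have cf (s : R) : `|s| < T -> {for s, continuous (fun s => LL (Phi z s))}.
  move=> sT; have [_ Us _] := Phi_r hz sT.
  exact: (continuous_comp (is_derive_state hz sT) (smooth_cont LL_smooth Us)).
have cg : continuous (fun s => LL (Phi z (clampI T' s))).
  move=> s; have /andP[c0 c1] := clampI_in s T'0.
  have hc : `|clampI T' s| < T by rewrite ger0_norm // (le_lt_trans c1).
  exact: (continuous_comp (@clampI_continuous R T' s) (cf _ hc)).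
have [G [_ dG]] := primitive T0 cg.
have e (s : R) : 0 <= s <= T' -> AA z s = G s - G 0.
  move=> /andP[s0 sT'].
  have in_ (a : R) : 0 <= a <= s -> 0 <= a <= T' by move=> /andP[h1 h2]; rewrite h1 (le_trans h2).
  have h1 (a : R) : 0 <= a <= s -> is_derive a (1 : R) G (LL (Phi z (clampI T' a))).
    move=> ha; apply: dG; have /andP[a0 aT'] := in_ a ha.
    by rewrite ger0_norm // (le_lt_trans aT').
  have h2 (a : R) : 0 <= a <= s -> {for a, continuous (fun a => LL (Phi z (clampI T' a)))} by move=> _; exact: cg.
  rewrite -(Rint_FTC2 s0 h1 h2) /AA /eact.
  have b : bint 0 s (fun t => lagr Qp (xb z t) (ub z t)).
    have sI : 0 <= s < T by rewrite s0 (le_lt_trans sT').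
    have [_ be _] := extremal_etraj hz sI.
    apply: (bint_lagr sQ); last exact: be.
    move=> a ha; have aT : `|a| < T.
      by have /andP[a0 aT'] := in_ a ha; rewrite ger0_norm // (le_lt_trans aT').
    have [_ Ua _] := Phi_r hz aT; exact: (conj (is_derive_cont (xb_derive hz aT)) Ua).
  by rewrite -(RintZ _ b); apply: Rint_ext => a /in_ ha; rewrite clampI_id.
have D : is_derive t (1 : R) (fun s => G s - G 0) (LL (Phi z t)).
  have tn : `|t| < T by rewrite gtr0_norm.
  have D1 := dG t tn; rewrite clampI_id ?(ltW t0) ?(ltW tT') // in D1.
  have D2 := is_deriveB D1 (is_derive_cst (G 0) t (1 : R)); rewrite subr0 in D2; exact: D2.
have nr : \forall s \near t, (fun s => G s - G 0) s = AA z s.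
  have : \forall s \near t, 0 < s < T' by apply: near_between; rewrite t0.
  by apply: filterS => s /andP[h1 h2]; rewrite e // !ltW.
exact: (near_eq_is_derive nr D).
Qed.

Lemma norm_row_le m (v : 'rV[R]_m) (B : R) : 0 <= B -> (forall j, `|v 0 j| <= B) -> `|v| <= B.
Proof. by move=> B0 h; apply: mx_norm_leP => // i j; rewrite ord1. Qed.

(** The first variation of [act_close] between two extremals from the same position; their distance,
    and that of their controls, is Lipschitz in the initial covectors. *)
Lemma AA_close z w (s : R) : `|z - z0| <= r / 4 -> `|w - z0| <= r / 4 -> rsubmx z = rsubmx w ->
  0 <= s < T -> s <= 1 ->
  `|AA z s - AA w s - pairing (lsubmx (Phi w s)) (xb z s - xb w s)| <=
    (K' + k%:R) * ((2 + 2 * n%:R * KX) * `|z - w|) ^+ 2.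
Proof.
move=> hz hw ezw /andP[s0 sT] s1; have e1' := K0.
have hz2 : `|z - z0| <= r / 2 by apply: (le_trans hz); slra.
have hw2 : `|w - z0| <= r / 2 by apply: (le_trans hw); slra.
have inT t : 0 <= t <= s -> `|t| < T by move=> /andP[h1 h2]; rewrite ger0_norm // (le_lt_trans h2).
have n0 : 0 <= n%:R * KX by rewrite mulr_ge0.
have nz : 0 <= `|z - w| by exact: normr_ge0.
have E0 : 0 <= (2 + 2 * n%:R * KX) * `|z - w| by rewrite mulr_ge0 // addr_ge0 // -mulrA mulr_ge0.
have lip t : 0 <= t <= s -> `|Phi z t - Phi w t| <= 2 * `|z - w|.
  by move=> /inT tT; exact: (Phi_lip K0 T0 KT est HPhi).
have Hzb t : 0 <= t <= s -> is_derive t 1 (Phi w) (hF (Phi w t)) by move=> /inT h; have [] := Phi_r hw2 h.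
have zbr t : 0 <= t <= s -> `|row_mx (lsubmx (Phi w t)) (xb z t) - z0| <= r /\ `|Phi w t - z0| <= r.
  move=> /inT tT; have h1 := Phi_half hz tT; have h2 := Phi_half hw tT.
  split; last by apply: (le_trans h2); slra.
  rewrite row_mxB; apply: le_trans (norm_row_mx _ _) _.
  have h3 := norm_lsubmx (Phi w t - z0); have h4 := norm_rsubmx (Phi z t - z0).
  rewrite lsubB row_mxKl in h3; rewrite rsubB row_mxKr in h4; rewrite /xb; slra.
have x00 : xb z 0 = rsubmx (Phi w 0).
  by rewrite /xb; have [-> _] := HPhi hz2; have [-> _] := HPhi hw2.
have sI : 0 <= s < T by rewrite s0.
apply: (act_close oU sF0 sF sQ K'0 lipH hHz s0 Hzb zbr (extremal_etraj hz2 sI) x00 E0 s1).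
  move=> t ht; rewrite /xb -rsubB; apply: le_trans (norm_rsubmx _) _; apply: le_trans (lip t ht) _.
  by rewrite ler_wpM2r // lerDl -mulrA mulr_ge0.
move=> t i ht; rewrite /vv mxE [X in _ + X]mxE /ub !ctrlE -pairingBl -lsubB.
apply: le_trans (pairing_norm _ _) _.
have h1 := norm_lsubmx (Phi z t - Phi w t); have h2 := lip t ht; have tT := inT t ht.
have h3 : `|F i (xb z t)| <= KX.
  have hb : `|xb z t - y0| <= r.
    have h4 := norm_rsubmx (Phi z t - z0); rewrite rsubB row_mxKr in h4; apply: (le_trans h4).
    by have [] := Phi_r hz2 tT.
  by apply: norm_row_le => // j; have [_ _ h _] := hX hb; exact: h.
apply: (@le_trans _ _ (n%:R * (2 * `|z - w|) * KX)).
  have h5 : n%:R * `|lsubmx (Phi z t - Phi w t)| <= n%:R * (2 * `|z - w|).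
    by apply: ler_wpM2l => //; exact: le_trans h1 h2.
  exact: (ler_pM (mulr_ge0 (ler0n _ _) (normr_ge0 _)) (normr_ge0 _) h5 h3).
have -> : n%:R * (2 * `|z - w|) * KX = 2 * n%:R * KX * `|z - w| by ring.
by rewrite ler_wpM2r // lerDr.
Qed.

(** * The Hessian of the time derivative of the geodesic cost *)

Section Family.
Variables (tau d0 : R).
Hypotheses (d00 : 0 < d0) (tau1 : tau <= 1) (tauT : tau < T)
 (Hval : forall t z, 0 < t <= tau ->
  `|z - z0| <= r / 4 -> `|rsubmx z - y0| <= d0 -> xb z t = xb z0 t ->
  value S t (cinv c (rsubmx z)) (geodesic S l t) = (AA z t)%:E).
Variables (t d C : R) (qf : 'rV[R]_n -> R -> 'rV[R]_n).
Hypotheses (t0 : 0 < t) (ttau : t < tau) (dd0 : 0 < d) (C0 : 0 <= C)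
  (Hq : forall y s, `|y - y0| <= d -> `|s - t| <= d ->
    [/\ `|s| < T, `|row_mx (qf y s) y - z0| <= r / 2,
        `|row_mx (qf y s) y - z0| <= C * `|y - y0|,
        rsubmx (Phi (row_mx (qf y s) y) s) = rsubmx (Phi z0 s) &
        `|qf y s - qf y t| <= C * `|s - t| ]).
Local Notation g s := (xb z0 s).
Local Notation zt y := (row_mx (qf y t) y).
Local Notation P y := (lsubmx (Phi (zt y) t)).
Local Notation p0 := (lsubmx (Phi z0 t)).

Let tT : `|t| < T. Proof. by rewrite gtr0_norm // (lt_trans ttau). Qed.
Let z0r2 : `|z0 - z0| <= r / 2. Proof. by apply: z00; slra. Qed.

Lemma pairing_derive (p : 'rV[R]_n) (v : R -> 'rV[R]_n) (s : R) dv : is_derive s (1 : R) v dv ->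
  is_derive s (1 : R) (fun u => pairing p (v u)) (pairing p dv).
Proof.
move=> /derive_mxP D; have -> : (fun u => pairing p (v u)) = fun u => \sum_j v u 0 j * p 0 j.
  by apply/funext => u; rewrite pairingC pairingE.
rewrite pairingC pairingE; apply: is_derive_lin => j; exact: D.
Qed.

(** A Hamilton-Jacobi formula. Near [t] the value is the action of the extremal with covector
    [qf y s]. Freezing this covector at [s = t] changes the action by the boundary pairing with the
    final covector, up to [O((s - t)^2)], so Lipschitz dependence of [qf] on [s] suffices to
    differentiate. *)
Lemma cost_dot_family y : `|y - y0| <= d -> `|y - y0| <= d0 -> C * `|y - y0| <= r / 4 ->
  cost_dot S l t (cinv c y) = Hz F0 F Qp (Phi (zt y) t) - pairing (P y) (rH F0 F (Phi z0 t)).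
Proof.
move=> yd yd0 yC; set G := fun s => AA (row_mx (qf y s) y) s.
have td : `|t - t| <= d by rewrite subrr normr0 ltW.
have [_ h2 h3 h4 _] := Hq yd td; have hz4 := le_trans h3 yC.
have nr : \forall s \near t, [/\ 0 < s, s < tau & `|s - t| <= d].
  have n1 : \forall s \near t, 0 < s < tau by apply: near_between; rewrite t0.
  have n2 : \forall s \near t, t - d < s < t + d by apply: near_between; have := dd0 => dd; apply/andP; split; lra.
  apply: filterS2 n1 n2 => s /andP[a1 a2] /andP[a3 a4]; split=> //.
  by rewrite ler_norml; apply/andP; split; lra.
have costE : \forall s \near t, - G s = cost S l s (cinv c y).
  apply: filterS nr => s [a1 a2 a3]; have [b1 b2 b3 b4 _] := Hq yd a3.
  have e : rsubmx (row_mx (qf y s) y) = y by rewrite row_mxKr.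
  have sI : 0 < s <= tau by rewrite a1 ltW.
  have hy : `|rsubmx (row_mx (qf y s) y) - y0| <= d0 by rewrite e.
  by have hv := Hval sI (le_trans b3 yC) hy b4; rewrite e in hv; rewrite /cost hv.
set w := zt y; set B := fun s => AA w s + pairing (P y) (g s - xb w s).
set be := LL (Phi w t) + pairing (P y) (rH F0 F (Phi z0 t) - rH F0 F (Phi w t)).
have DB : is_derive t (1 : R) B be.
  have tI : 0 < t < T by rewrite t0 (lt_trans ttau).
  have D1 := xb_derive z0r2 tT; have D2 := xb_derive h2 tT; rewrite !fld_ctrl in D1 D2.
  have D3 : is_derive t (1 : R) (fun s => xb z0 s - xb w s) (rH F0 F (Phi z0 t) - rH F0 F (Phi w t)).
    exact: (is_deriveB D1 D2).
  have D4 := pairing_derive (P y) D3.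
  exact: (is_deriveD (AA_derive h2 tI) D4).
have e0 : G t = B t by rewrite /B /G /xb -h4 subrr -(scale0r (0 : 'rV[R]_n)) pairingZr mul0r addr0.
(* The first term comes from [AA_close] and the Lipschitz bound on [qf]; the second from evaluating
   the final covector at [s] instead of [t]. *)
set Cc := (K' + k%:R) * ((2 + 2 * n%:R * KX) * C) ^+ 2 + n%:R * K * (2 * K).
have Cc0 : 0 <= Cc.
  by rewrite addr_ge0 // ?mulr_ge0 ?sqr_ge0 ?addr_ge0 ?mulr_ge0 // ltW.
have cl : \forall s \near t, `|G s - B s| <= Cc * `|s - t| ^+ 2.
  apply: filterS nr => s [a1 a2 a3]; have [b1 b2 b3 b4 b5] := Hq yd a3.
  set zs := row_mx (qf y s) y.
  have sI : 0 <= s < T by rewrite (ltW a1) (lt_trans a2).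
  have s1 : s <= 1 by apply: le_trans tau1; exact: ltW.
  have ezs : rsubmx zs = rsubmx w by rewrite !row_mxKr.
  have := AA_close (le_trans b3 yC) hz4 ezs sI s1.
  have -> : xb zs s = g s by exact: b4.
  have nzw : `|zs - w| <= C * `|s - t|.
    by rewrite /zs /w row_mxB subrr; apply: le_trans (norm_row_mx _ _) _; rewrite normr0 addr0.
  have v_t : g t - xb w t = 0 by rewrite /xb h4 subrr.
  have nv : `|g s - xb w s| <= 2 * K * `|s - t|.
    have p1 := Phi_time est HPhi z0r2 b1 tT; have p2 := Phi_time est HPhi h2 b1 tT.
    have p3 := norm_rsubmx (Phi z0 s - Phi z0 t); have p4 := norm_rsubmx (Phi w s - Phi w t).
    have -> : g s - xb w s = rsubmx (Phi z0 s - Phi z0 t) - rsubmx (Phi w s - Phi w t).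
      by rewrite !rsubB h4 /xb opprB addrA subrK.
    have p5 := ler_normB (rsubmx (Phi z0 s - Phi z0 t)) (rsubmx (Phi w s - Phi w t)).
    apply: (le_trans p5); lra.
  have nP : `|pairing (lsubmx (Phi w s) - P y) (g s - xb w s)| <= n%:R * K * (2 * K) * `|s - t| ^+ 2.
    apply: le_trans (pairing_norm _ _) _.
    have p2 := Phi_time est HPhi h2 b1 tT; have p4 := norm_lsubmx (Phi w s - Phi w t); rewrite lsubB in p4.
    have -> : n%:R * K * (2 * K) * `|s - t| ^+ 2 = n%:R * (K * `|s - t|) * (2 * K * `|s - t|) by ring.
    have h5 : n%:R * `|lsubmx (Phi w s) - P y| <= n%:R * (K * `|s - t|).
      by apply: ler_wpM2l => //; exact: le_trans p4 p2.
    exact: (ler_pM (mulr_ge0 (ler0n _ _) (normr_ge0 _)) (normr_ge0 _) h5 nv).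
  have sq : (K' + k%:R) * ((2 + 2 * n%:R * KX) * `|zs - w|) ^+ 2 <=
     (K' + k%:R) * ((2 + 2 * n%:R * KX) * C) ^+ 2 * `|s - t| ^+ 2.
    rewrite -[leRHS]mulrA -exprMn ler_wpM2l ?addr_ge0 // lerXn2r ?nnegrE //.
    - by rewrite !mulr_ge0 ?addr_ge0 ?mulr_ge0.
    - by rewrite !mulr_ge0 ?addr_ge0 ?mulr_ge0.
    by rewrite -[leRHS]mulrA ler_wpM2l // addr_ge0 ?mulr_ge0.
  move=> q1; rewrite /Cc mulrDl /G /B -/zs.
  have ring1 (a b x1 x2 : R) : a - (b + x1) = (a - b - x2) + (x2 - x1) by ring.
  rewrite (ring1 _ _ _ (pairing (lsubmx (Phi w s)) (g s - xb w s))) -pairingBl.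
  by apply: le_trans (ler_normD _ _) _; apply: lerD => //; exact: le_trans q1 sq.
have DG := is_derive_close Cc0 e0 cl DB.
have DN := is_deriveN DG.
have DC := near_eq_is_derive costE DN.
rewrite /cost_dot derive1E; have [_ ->] := DC.
have ring2 (a b x1 : R) : - (a - b + (x1 - a)) = b - x1 by ring.
by rewrite /be LLE pairingBr ring2.
Qed.

Local Notation ka := (Hz F0 F Qp (Phi z0 t) - pairing p0 (rH F0 F (Phi z0 t))).

(** All these extremals end at the same point, so only the covector varies in the Hamiltonian.
    [hamE_line] is exact, and its linear term cancels against the pairing with the velocity of the
    geodesic. *)
Lemma cost_dot_quadratic y : `|y - y0| <= d -> `|y - y0| <= d0 -> C * `|y - y0| <= r / 4 ->
  cost_dot S l t (cinv c y) = ka + 2^-1 * \sum_i pairing (P y - p0) (F i (g t)) ^+ 2.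
Proof.
move=> yd yd0 yC; rewrite cost_dot_family //.
have td : `|t - t| <= d by rewrite subrr normr0 ltW.
have [_ _ _ h4 _] := Hq yd td.
have hl := hamE_line F0 F Qp p0 (P y - p0) (g t) 1.
rewrite scale1r addrC subrK expr1n !mul1r in hl.
have -> : Hz F0 F Qp (Phi (zt y) t) = hamE F0 F Qp (P y) (g t) by rewrite /Hz h4.
rewrite hl pairingBl; have -> : rH F0 F (Phi z0 t) = p0 *m ((XX F (g t))^T *m XX F (g t)) + F0 (g t) by [].
have -> : Hz F0 F Qp (Phi z0 t) = hamE F0 F Qp p0 (g t) by [].
ring.
Qed.

Variable bi : 'M[R]_n.
Hypothesis Hb : forall e : R, 0 < e -> exists2 rho, 0 < rho & forall y, `|y - y0| <= rho ->
    `|P y - p0 + (y - y0) *m bi^T| <= e * `|y - y0|.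

Lemma sqr_close (A x eb u : R) : 0 <= eb <= 1 -> `|x + u * A| <= eb * `|u| ->
  `|x ^+ 2 - u ^+ 2 * A ^+ 2| <= (2 * `|A| + 1) * eb * u ^+ 2.
Proof.
move=> /andP[e0 e1] h; have -> : x ^+ 2 - u ^+ 2 * A ^+ 2 = (x + u * A) * ((x + u * A) - 2 * (u * A)) by ring.
rewrite normrM -(real_normK (num_real u)).
have h2 := ler_normB (x + u * A) (2 * (u * A)); rewrite !normrM (ger0_norm (_ : 0 <= 2)) // in h2.
apply: (@le_trans _ _ (eb * `|u| * (eb * `|u| + 2 * (`|u| * `|A|)))).
  apply: ler_pM => //; apply: (le_trans h2); by rewrite lerD2r.
have -> : (2 * `|A| + 1) * eb * `|u| ^+ 2 = eb * `|u| * (1 * `|u| + 2 * (`|u| * `|A|)) by ring.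
by rewrite ler_wpM2l ?mulr_ge0 // lerD2r ler_wpM2r.
Qed.

(** Inserts in [cost_dot_quadratic] the differential of the final covector, which is
    [- u *: (v *m bi^T)] along this line by [Hb]. *)
Lemma cost_dot_line (v : 'rV[R]_n) (e : R) : 0 < e -> exists2 dl : R, 0 < dl & forall u, `|u| <= dl ->
  `|cost_dot S l t (cinv c (y0 + u *: v)) - ka - u ^+ 2 / 2 * \sum_i pairing (v *m bi^T) (F i (g t)) ^+ 2| <= e * u ^+ 2.
Proof.
move=> e0; set A := fun i => pairing (v *m bi^T) (F i (g t)).
set N1 := n%:R * `|v| * KX + 1; set N2 := \sum_i (2 * `|A i| + 1) + 1.
have N10 : 0 < N1 by rewrite ltr_wpDl // !mulr_ge0.
have s0 : 0 <= \sum_i (2 * `|A i| + 1) by apply: sumr_ge0 => i _; rewrite addr_ge0 // mulr_ge0.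
have N20 : 0 < N2 by rewrite ltr_wpDl.
set eb := Num.min 1 (e / N2).
have eb0 : 0 < eb by rewrite lt_min ltr01 divr_gt0.
have eb1 : 0 <= eb <= 1 by rewrite ltW //= ge_min lexx.
have ebN : eb * N2 <= e by rewrite -ler_pdivlMr // ge_min lexx orbT.
have [rho rho0 hr] := Hb (divr_gt0 eb0 N10).
set D := Num.min (Num.min rho d) (Num.min d0 (r / 4 / (C + 1))).
have C10 : 0 < C + 1 by have := C0; lra.
have D0 : 0 < D by rewrite !lt_min rho0 dd0 d00 !divr_gt0.
have v10 : 0 < `|v| + 1 by rewrite ltr_wpDl.
exists (D / (`|v| + 1)); first by rewrite divr_gt0.
move=> u hu; set y := y0 + u *: v.
have ey : y - y0 = u *: v by rewrite /y addrAC subrr add0r.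
have ny : `|y - y0| <= D.
  rewrite ey normrZ; apply: (@le_trans _ _ (`|u| * (`|v| + 1))); first by rewrite ler_wpM2l // lerDl.
  by rewrite -ler_pdivlMr.
have [y1 [y2 [y3 y4]]] : `|y - y0| <= rho /\ `|y - y0| <= d /\ `|y - y0| <= d0 /\ `|y - y0| <= r / 4 / (C + 1).
  by move: ny; rewrite !le_min => /andP[/andP[? ?] /andP[? ?]].
have y5 : C * `|y - y0| <= r / 4.
  apply: (@le_trans _ _ ((C + 1) * `|y - y0|)); first by rewrite ler_wpM2r // lerDl.
  by rewrite mulrC -ler_pdivlMr.
have -> : cost_dot S l t (cinv c y) - ka - u ^+ 2 / 2 * \sum_i pairing (v *m bi^T) (F i (g t)) ^+ 2 =
    2^-1 * \sum_i (pairing (P y - p0) (F i (g t)) ^+ 2 - u ^+ 2 * A i ^+ 2).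
  rewrite (cost_dot_quadratic y2 y3 y5) sumrB -mulr_sumr -/A; move: (\sum_i pairing (P y - p0) _ ^+ 2) => X1.
  by rewrite [in RHS]/A; field.
rewrite normrM (ger0_norm (_ : 0 <= 2^-1)) ?invr_ge0 //.
have hs : `|\sum_i (pairing (P y - p0) (F i (g t)) ^+ 2 - u ^+ 2 * A i ^+ 2)| <= N2 * eb * u ^+ 2.
  apply: le_trans (ler_norm_sum _ _ _) _.
  apply: (@le_trans _ _ (\sum_i (2 * `|A i| + 1) * eb * u ^+ 2)).
    apply: ler_sum => i _; apply: sqr_close => //.
    have -> : pairing (P y - p0) (F i (g t)) + u * A i = pairing (P y - p0 + (y - y0) *m bi^T) (F i (g t)).
      have eA : u * A i = pairing ((y - y0) *m bi^T) (F i (g t)).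
        rewrite ey; apply: (etrans (esym (pairingZl u (v *m bi^T) (F i (g t))))).
        exact: (f_equal (fun w => pairing w (F i (g t))) (scalemxAl u v bi^T)).
      rewrite eA; exact: (esym (pairingDl _ _ _)).
    apply: le_trans (pairing_norm _ _) _; have h := hr y y1; rewrite [X in _ <= _ * `|X|]ey normrZ in h.
    have hF : `|F i (g t)| <= KX.
      have hb : `|g t - y0| <= r.
        have h4 := norm_rsubmx (Phi z0 t - z0); rewrite rsubB row_mxKr in h4; apply: (le_trans h4).
        by have [] := Phi_r z0r2 tT.
      by apply: norm_row_le => // j; have [_ _ hh _] := hX hb; exact: hh.
    apply: (@le_trans _ _ (n%:R * (eb / N1 * (`|u| * `|v|)) * KX)).
      have h5 := ler_wpM2l (ler0n R n) h.
      exact: (ler_pM (mulr_ge0 (ler0n _ _) (normr_ge0 _)) (normr_ge0 _) h5 hF).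
    have -> : n%:R * (eb / N1 * (`|u| * `|v|)) * KX = eb * `|u| * (n%:R * `|v| * KX / N1).
      by field; exact: lt0r_neq0.
    rewrite -[leRHS]mulr1 ler_wpM2l ?mulr_ge0 // ?(ltW eb0) //.
    by rewrite ler_pdivrMr // mul1r /N1 lerDl.
  by rewrite -!mulr_suml !ler_wpM2r ?sqr_ge0 ?(ltW eb0) // /N2 lerDl.
have h3 : N2 * eb * u ^+ 2 <= e * u ^+ 2 by rewrite ler_wpM2r ?sqr_ge0 // mulrC.
have h4 : 0 <= `|\sum_i (pairing (P y - p0) (F i (g t)) ^+ 2 - u ^+ 2 * A i ^+ 2)| by [].
apply: (@le_trans _ _ `|\sum_i (pairing (P y - p0) (F i (g t)) ^+ 2 - u ^+ 2 * A i ^+ 2)|).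
  by rewrite ler_piMl // invf_le1 // ler1n.
exact: le_trans hs h3.
Qed.

Hypothesis cc : chart_at l.1 = c.

Lemma smooth_arc_line (v : 'rV[R]_n) : exists2 e : R, 0 < e &
  smooth_arc e (fun u => cinv c (y0 + u *: v)) /\ velocity (fun u => cinv c (y0 + u *: v)) 0 = v.
Proof.
have v10 : 0 < `|v| + 1 by rewrite ltr_wpDl.
exists (r / (`|v| + 1)); first by rewrite divr_gt0.
have inU (s : R) : `|s| < r / (`|v| + 1) -> U (y0 + s *: v).
  move=> hs; have [] := hX (y := y0 + s *: v); rewrite // addrAC subrr add0r normrZ.
  apply: (@le_trans _ _ (`|s| * (`|v| + 1))); first by rewrite ler_wpM2l // lerDl.
  by rewrite -ler_pdivlMr // ltW.
have cA : continuous (fun s : R => y0 + s *: v).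
  by move=> s; exact: (is_derive_cont (line_derive y0 v s)).
split; first split.
- move=> s hs; have := inU s; rewrite ltr_norml hs => /(_ isT) Us.
  exact: (continuous_comp (cA s) (cinv_continuous (atlas_chart ac) Us)).
- move=> c' ac'.
  have s1 := smooth_affine (A := fun s : R => y0 + s *: v) (L := fun s : R => s *: v) _ cA (atlas_compatible ac ac').
  apply: (smooth_sub _ (s1 _)) => [s [hs dx]|y w h] /=.
    have := inU s; rewrite ltr_norml hs => /(_ isT) Us.
    exact: (proj2 (ovP ac ac' (y0 + s *: v)) (conj Us dx)).
  by rewrite scalerDl scalerA addrA.
rewrite /velocity scale0r addr0 -l1 cc derive1E.
have D := line_derive y0 v 0.
have nr : \forall s \near (0 : R), (fun u : R => y0 + u *: v) s = (cmap c \o (fun u => cinv c (y0 + u *: v))) s.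
  have : \forall s \near (0 : R), - (r / (`|v| + 1)) < s < r / (`|v| + 1).
    by apply: near_between; rewrite oppr_lt0 !divr_gt0.
  apply: filterS => s hs /=; rewrite cmap_near //; apply: inU; by rewrite ltr_norml.
by have [_ ->] := near_eq_is_derive nr D.
Qed.

(** On straight arcs in the direction [a *m XX F y0] the quadratic form is the squared length of
    [a *m Y]. Taking basis vectors for [a] gives the diagonal entries of [Q], which is all that the
    trace requires. *)
Lemma hessian_trace (Q : 'M[R]_k) : hessian_cost_dot S l t Q ->
  let Y := XX F y0 *m bi^T *m (XX F (g t))^T in \tr Q = \tr (Y *m Y^T).
Proof.
move=> [_ hQ] Y; have Uy0 : U y0 by have [] := hX (y := y0); rewrite // subrr normr0 ltW.
have Qa (a : 'rV[R]_k) : (a *m Q *m a^T) 0 0 = \sum_i ((a *m Y) 0 i) ^+ 2.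
  have eX : a *m frame_mx S l.1 = a *m XX F y0.
    congr (_ *m _); apply/row_matrixP => i; rewrite row_XX rowK.
    have ey : cmap c (cinv c y0) = y0 by exact: cmap_near.
    by rewrite -(field_in_at (frame S i) l.1) cc l1 ey.
  have [e e0 [sa ve]] := smooth_arc_line (a *m XX F y0).
  have eta0 : cinv c (y0 + 0 *: (a *m XX F y0)) = l.1 by rewrite scale0r addr0 l1.
  have h := hQ a e _ e0 sa eta0 (etrans ve (esym eX)).
  rewrite (second_derivative_unique (cost_dot_line (a *m XX F y0)) h).
  apply: eq_bigr => i _; congr (_ ^+ 2); by rewrite -ctrlE /ctrl /Y !mulmxA.
rewrite /mxtrace; apply: eq_bigr => i _.
have := Qa (delta_mx 0 i); rewrite -rowE => e.
have eQ : Q i i = (row i Q *m (delta_mx 0 i : 'rV[R]_k)^T) 0 0.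
  rewrite mxE (bigD1 i) //= !mxE !eqxx mulr1 big1 ?addr0 // => j ji.
  by rewrite !mxE eqxx (negbTE ji) mulr0.
rewrite eQ e mxE; apply: eq_bigr => j _; rewrite -rowE mxE expr2; congr (_ * _).
by rewrite [RHS]mxE.
Qed.
End Family.
End Loc.

Lemma near_right_radius (R : realType) (P : R -> Prop) : (\forall t \near (0 : R)^'+, P t) ->
  exists2 d : R, 0 < d & forall t, 0 < t <= d -> P t.
Proof.
move=> h; have h' : \forall t \near (0 : R), 0 < t -> P t by exact: h.
have [d d0 hd] := near_ball2 h'; exists d => // t /andP[t0 td].
by apply: hd => //; rewrite subr0 gtr0_norm.
Qed.

Section Jac.
Context {R : realType}.

Lemma est_of_diff m p (F : 'rV[R]_m -> 'rV[R]_p) (z : 'rV[R]_m) : differentiable F z ->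
  forall e : R, 0 < e -> exists2 r : R, 0 < r & forall v : 'rV[R]_m, `|v| <= r ->
     `|F (z + v) - F z - v *m 'J F z| <= e * `|v|.
Proof.
move=> /diff_locallyP[_ /eqaddoP h] e e0; have [d d0 hd] := near_ball2 (h e e0).
exists d => // v vd; have := hd v; rewrite subr0 => /(_ vd).
rewrite /jacobian mul_rV_lin1.
have -> : (F \o shift z - (cst (F z) + 'd F z)) v = F (v + z) - (F z + 'd F z v) by [].
by rewrite opprD addrA [v + z]addrC.
Qed.

Lemma jac_near m p (F G : 'rV[R]_m -> 'rV[R]_p) (z : 'rV[R]_m) (d : R) : 0 < d ->
  (forall w, `|w - z| <= d -> F w = G w) -> differentiable G z -> 'J F z = 'J G z.
Proof.
move=> d0 h DG; apply: (proj2 (diff_of_est _)) => e e0.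
have [r r0 hr] := est_of_diff DG e0; exists (Num.min d r); first by rewrite lt_min d0.
move=> v; rewrite le_min => /andP[vd vr]; rewrite !h ?subrr ?normr0 ?(ltW d0) //; first exact: hr.
by rewrite addrAC subrr add0r.
Qed.

Lemma jac_comp m p q (F : 'rV[R]_m -> 'rV[R]_p) (G : 'rV[R]_p -> 'rV[R]_q) (z : 'rV[R]_m) :
  differentiable F z -> differentiable G (F z) ->
  differentiable (G \o F) z /\ 'J (G \o F) z = 'J F z *m 'J G (F z).
Proof.
move=> DF DG; have D := differentiable_comp DF DG; split=> //.
by apply/row_matrixP => i; rewrite !rowE mulmxA /jacobian !mul_rV_lin1 diff_comp.
Qed.

Lemma jac_mulmx m p (B : 'M[R]_(m, p)) (z : 'rV[R]_m) :
  differentiable (fun q => q *m B) z /\ 'J (fun q => q *m B) z = B.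
Proof.
apply: diff_of_est => e e0; exists 1; first exact: ltr01.
by move=> v _; rewrite mulmxDl -addrA -opprD subrr normr0 mulr_ge0 // ltW.
Qed.
End Jac.

Lemma det_neq0_mul (R : fieldType) n (A B : 'M[R]_n) : A *m B = 1%:M -> \det A != 0.
Proof.
move=> /(congr1 determinant); rewrite det_mulmx det1 => e; apply/negP => /eqP e0.
by move: e; rewrite e0 mul0r => /esym/eqP; rewrite oner_eq0.
Qed.

Section FlagConst.
Context {R : realType} {n k : nat} {M : manifold R n} (S : affine_system M k).

(** A level is full exactly when its dimension is maximal, so [flag_step] is also determined by the
    dimensions. *)
Lemma geodesic_dim_eq V (x y : M) : (forall i, \dim (flag S V i x) = \dim (flag S V i y)) ->
  geodesic_dim S V x = geodesic_dim S V y.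
Proof.
move=> h.
have full z m : flag S V m z = fullv <-> \dim (flag S V m z) = \dim (fullv : {vspace 'rV[R]_n}).
  split=> [->//|e]; apply/eqP; rewrite -(dimv_leqif_eq (subvf _)); exact/eqP.
have e m : (flag S V m x = fullv) = (flag S V m y = fullv).
  by apply/propext; rewrite !full h.
have es : flag_step S V x = flag_step S V y.
  rewrite /flag_step; congr (xget _ _); apply/funext => m; apply/propext; rewrite /= e.
  by split=> -[h1 h2]; split=> // m'; [rewrite -e|rewrite e]; exact: h2.
by rewrite /geodesic_dim es; apply: eq_bigr => i _; rewrite !h.
Qed.
End FlagConst.

(** * The volume density along the extremal *)

Section Pull.
Context {R : realType} {n k : nat} {M : manifold R n} (S : affine_system M k).
Local Opaque jacobian transition_jac field_in.
Hypothesis hS : smooth_system S.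
Variables (c : chart R n M) (q0 y0 : 'rV[R]_n) (r K T : R)
  (Phi : 'rV[R]_(n + n) -> R -> 'rV[R]_(n + n)) (Ps : R -> 'M[R]_(n + n)).
Hypothesis ac : atlas M c.
Local Notation F0 := (cF0 S c).
Local Notation F := (cF S c).
Local Notation Qp := (cQ S c).
Local Notation U := (ccod c).
Local Notation hF := (hH F0 F Qp).
Local Notation z0 := (row_mx q0 y0).
Hypotheses (r0 : 0 < r) (K0 : 0 < K) (T0 : 0 < T) (KT : K * T <= 2^-1) (KTr : K * T <= r / 4).
Hypothesis est : field_bounds (UU U) hF z0 r K.
Hypothesis HPhi : flow_bounds R hF z0 r K T Phi.
Hypotheses (Ps0 : Ps 0 = 1%:M)
  (dPs : forall t : R, `|t| < T -> is_derive t 1 Ps (Ps t *m Dfield hF (Phi z0 t))).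

Let oU : open U. Proof. exact: oc. Qed.
Let sF0 j : smooth U (fun y => F0 y 0 j). Proof. exact: scF0. Qed.
Let sF i j : smooth U (fun y => F i y 0 j). Proof. exact: scF. Qed.
Let sQ : smooth U Qp. Proof. exact: scQ. Qed.
Local Notation zc := (Phi z0).
Local Notation yc t := (rsubmx (Phi z0 t)).

Let z0r : `|z0 - z0| <= r / 2. Proof. by rewrite subrr normr0 divr_ge0 // ltW. Qed.

Lemma Phi_dom z (t : R) : `|z - z0| <= r / 2 -> `|t| < T ->
  [/\ `|Phi z t - z0| <= r, UU U (Phi z t) & is_derive t 1 (Phi z) (hF (Phi z t))].
Proof.
move=> hz tT; have [_ /(_ t tT)[_ [h1 h2]]] := HPhi hz; split=> //.
by have [] := est h1 h1 h1.
Qed.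

Lemma zc_near (t : R) : `|t| < T -> `|zc t - z0| <= r / 4.
Proof.
move=> tT; have [_ /(_ t tT)[h _]] := HPhi z0r; apply: (le_trans h); apply: le_trans KTr.
by apply: ler_wpM2l; exact: ltW.
Qed.

Lemma flow_Phi z (t : R) : `|z - z0| <= r / 2 -> `|t| < T ->
  flow S t (cotangent_of c (lsubmx z) (rsubmx z)) = cotangent_of c (lsubmx (Phi z t)) (rsubmx (Phi z t)).
Proof.
move=> hz tT; have [e _] := HPhi hz; rewrite -{1 2}e.
apply: (flow_local hS ac _ tT) => u uT; have [_ h1 h2] := Phi_dom hz uT; exact: (conj h1 h2).
Qed.

Lemma between0_norm (t u : R) : between 0 t u -> `|u| <= `|t|.
Proof.
rewrite /between subr0 => h; have [->|u0] := eqVneq u 0; first by rewrite normr0.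
have u0' : 0 < `|u| by rewrite normr_gt0.
rewrite -(ler_pM2l u0') -!normrM (ger0_norm (_ : 0 <= u * u)); last by rewrite -expr2 sqr_ge0.
by apply: (@le_trans _ _ (u * t)); [rewrite mulrBr subr_le0 in h; exact: h|exact: ler_norm].
Qed.

Lemma is_derive_mulmxl m p q (A : 'M[R]_(m, p)) (f : R -> 'M[R]_(p, q)) (t : R) df :
  is_derive t (1 : R) f df -> is_derive t (1 : R) (fun u => A *m f u) (A *m df).
Proof.
move=> /derive_mxP D; apply/derive_mxP => i j.
have -> : (fun u => (A *m f u) i j) = (fun u => \sum_l f u l j * A i l).
  by apply/funext => u; rewrite mxE; apply: eq_bigr => l _; rewrite mulrC.
have -> : (A *m df) i j = \sum_l df l j * A i l by rewrite mxE; apply: eq_bigr => l _; rewrite mulrC.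
by apply: is_derive_lin => l; exact: D.
Qed.

Let zcU t : `|t| < T -> UU U (zc t). Proof. by move=> tT; have [] := Phi_dom z0r tT. Qed.
Let dzc t : `|t| < T -> is_derive t (1 : R) zc (hF (zc t)). Proof. by move=> tT; have [] := Phi_dom z0r tT. Qed.
Let zcr2 t : `|t| < T -> `|zc t - z0| <= r / 2.
Proof. by move=> tT; apply: (le_trans (zc_near tT)); have := r0; lra. Qed.

Section AtTimes.
Variables (s a : R).
Hypothesis sa : `|s| + `|a| < T.
Let sT : `|s| < T. Proof. by apply: le_lt_trans sa; rewrite lerDl. Qed.
Let aT : `|a| < T. Proof. by apply: le_lt_trans sa; rewrite lerDr. Qed.
Let Ka : K * `|a - 0| <= 2^-1.
Proof. by rewrite subr0; apply: le_trans KT; rewrite ler_wpM2l // ltW. Qed.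
Let shiftT u : between 0 a u -> `|s + u| < T.
Proof.
move=> /between0_norm h; apply: le_lt_trans (ler_normD _ _) _.
by apply: le_lt_trans sa; rewrite lerD2l.
Qed.

Let solves_ref : solves hF z0 r 0 a (fun u => zc (s + u)).
Proof.
move=> u hu; have h := shiftT hu; have [h1 _ h2] := Phi_dom z0r h; split=> //.
exact: is_derive_shift.
Qed.

Let solves_Phi z : `|z - z0| <= r / 2 -> solves hF z0 r 0 a (Phi z).
Proof.
move=> hz u /between0_norm h; have uT := le_lt_trans h aT.
by have [h1 _ h2] := Phi_dom hz uT; split.
Qed.

Lemma Phi_semigroup : Phi (zc s) a = zc (s + a).
Proof.
have [e _] := HPhi (zcr2 sT).
have := solves_lip K0 est Ka (solves_Phi (zcr2 sT)) solves_ref.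
rewrite e addr0 subrr normr0 mulr0 normr_le0 subr_eq0 => /eqP; exact.
Qed.

Let G (w : 'rV[R]_n) : 'rV[R]_n := rsubmx (Phi (row_mx w (yc s)) a).
Let Mm := Mst Ps s (s + a).

(** [solves_strict] is applied with the reference extremal restarted at time [s], whose
    linearization is [symp_inv Ps s *m Ps (s + u)]. The two compared states differ in their
    covectors only, so the upper right block [Mm] appears. *)
Lemma jac_flow : differentiable G (lsubmx (zc s)) /\ 'J G (lsubmx (zc s)) = Mm.
Proof.
set qs := lsubmx (zc s).
have ezs : row_mx qs (yc s) = zc s by rewrite hsubmxK.
have PsG : symp_inv Ps s *m Ps s = 1%:M by exact: (GsPs oU sF0 sF sQ T0 zcU Ps0 dPs sT).
apply: diff_of_est => e e0.
set D := Num.min (r / 4) (e / (8 * K * T)).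
have KT0 : 0 < 8 * K * T by rewrite !mulr_gt0.
have D0 : 0 < D by rewrite lt_min !divr_gt0.
exists D => // v; rewrite le_min => /andP[v1 v2].
set z1 := row_mx (qs + v) (yc s).
have ez1 : z1 - zc s = row_mx v 0 by rewrite -ezs /z1 row_mxB subrr addrAC subrr add0r.
have nz1 : `|z1 - zc s| <= `|v|.
  by rewrite ez1; apply: le_trans (norm_row_mx _ _) _; rewrite normr0 addr0.
have hz1 : `|z1 - z0| <= r / 2.
  have h := ler_normD (z1 - zc s) (zc s - z0); rewrite subrKA in h.
  have h2 := zc_near sT; apply: (le_trans h); have := le_trans nz1 v1; have := r0; lra.
have P0 : (fun u => symp_inv Ps s *m Ps (s + u)) 0 = 1%:M by rewrite addr0.
have dP u : between 0 a u -> is_derive u 1 (fun u => symp_inv Ps s *m Ps (s + u))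
    ((symp_inv Ps s *m Ps (s + u)) *m Dfield hF (zc (s + u))).
  by move=> hu; rewrite -mulmxA; apply: is_derive_mulmxl; apply: is_derive_shift; exact: dPs (shiftT hu).
have := solves_strict r0 K0 est Ka solves_ref (solves_Phi hz1) (solves_Phi (zcr2 sT)) P0 dP.
have [e1 _] := HPhi hz1; have [e2 _] := HPhi (zcr2 sT).
rewrite e1 e2 addr0 subrr normr0 addr0 subr0 ez1 => h.
have -> : G (qs + v) - G qs - v *m Mm = rsubmx (Phi z1 a - Phi (zc s) a - row_mx v 0 *m (symp_inv Ps s *m Ps (s + a))).
  by rewrite !rsubB rsub_mul mul0mx addr0 /G ezs.
apply: le_trans (norm_rsubmx _) _; apply: (le_trans h); rewrite -ez1.
apply: (@le_trans _ _ (8 * K * T * `|v| * `|v|)).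
  apply: ler_pM => //; first by rewrite !mulr_ge0 // ltW.
  apply: ler_pM => //; first by rewrite !mulr_ge0 // ltW.
  by rewrite ler_wpM2l ?mulr_ge0 // ltW.
rewrite ler_wpM2r // mulrC -ler_pdivlMr //.
Qed.

Local Notation xs := (cinv c (yc s)).
Local Notation ch u := (chart_at (cinv c (yc u))).
(** The coefficient of [mu] in the fixed chart [c], at the position of the extremal at time [u]. *)
Definition mm (mu : M -> R) (u : R) : R :=
  mu (cinv c (yc u)) * \det (transition_jac c (ch u) (cinv c (yc u))).

(** The map factors as: covector in the chart of its base point, covector in [c], final position in
    [c], final position in its own chart. The Jacobian of the last change of chart combines with
    [mu] into [mm]. *)
Lemma pullback_flow (mu : M -> R) :
  pullback_volume S mu a (cotangent_of c (lsubmx (zc s)) (yc s)) =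
  mm mu (s + a) * DD (index_enum (idx n)) (phiJ Ps) (psiJ Ps) s (s + a) * \det (transition_jac c (ch s) xs).
Proof.
have saT : `|s + a| < T by apply: le_lt_trans (ler_normD _ _) sa.
have Uys : U (yc s) := zcU sT; have Uya : U (yc (s + a)) := zcU saT.
set l := cotangent_of c (lsubmx (zc s)) (yc s).
have gl : geodesic S l a = cinv c (yc (s + a)) by rewrite /geodesic flow_Phi ?zcr2 // Phi_semigroup.
rewrite /pullback_volume gl; set b := ch (s + a); set B := (transition_jac c (ch s) xs)^T.
have ab : atlas M b by exact: chart_at_atlas.
have dxs : cdom c xs by exact: (cinv_dom ac Uys).
have lB : l.2 *m B = lsubmx (zc s) := covec_cotangent_id (lsubmx (zc s)) ac Uys.
have [DG JG] := jac_flow.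
have [DB JB] := jac_mulmx B l.2.
have oy : ov c b (yc (s + a)) by apply/(ovP ac ab); split=> //; exact: chart_at_dom.
have G1 : G (lsubmx (zc s)) = yc (s + a) by rewrite /G hsubmxK Phi_semigroup.
have [Dtr _] := tr_diff ac ab oy.
have DG' : differentiable G (l.2 *m B) by rewrite lB.
have [DGB JGB] := jac_comp DB DG'.
have Dtr' : differentiable (tr c b) ((G \o (fun q => q *m B)) l.2) by rewrite /= lB G1.
have [DH JH] := jac_comp DGB Dtr'.
have cB := differentiable_continuous DB.
have nB : \forall w \near l.2, `|w *m B - l.2 *m B| < r / 4.
  have c2 := continuous_comp (continuousB cB (@cst_continuous _ _ (l.2 *m B) _)) (@norm_continuous _ _ _).
  have h0 : `|l.2 *m B - l.2 *m B| < r / 4 by rewrite subrr normr0 divr_gt0.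
  exact: (c2 _ (lt_nbhsl h0)).
have [d d0 hd] := near_ball2 nB.
(* The flow is given by [Phi] only for covectors near that of the extremal, so the two maps are
   compared on a small ball. *)
have JF : 'J (fun q => cmap b (geodesic S (l.1, q) a)) l.2 = 'J (tr c b \o (G \o (fun q => q *m B))) l.2.
  apply: (jac_near d0 _ DH) => w /hd wd.
  have ew : (l.1, w) = cotangent_of c (w *m B) (yc s).
    have := @cotangent_covec _ _ _ c (l.1, w) ac dxs.
    by rewrite /covec_in /= (cinvK ac Uys) => <-.
  have hw : `|row_mx (w *m B) (yc s) - z0| <= r / 2.
    have h := ler_normD (row_mx (w *m B) (yc s) - zc s) (zc s - z0); rewrite subrKA in h.
    have h2 := zc_near sT; apply: (le_trans h).
    have : `|row_mx (w *m B) (yc s) - zc s| <= r / 4.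
      rewrite -[X in _ - X]hsubmxK row_mxB subrr; apply: le_trans (norm_row_mx _ _) _.
      by rewrite normr0 addr0 -lB ltW.
    have := r0; lra.
  rewrite ew; have := flow_Phi hw aT; rewrite row_mxKl row_mxKr => e.
  by rewrite /geodesic e.
have e3 := etrans (f_equal (fun w => 'J G w) lB) JG.
have e4 := f_equal (fun w => 'J (tr c b) w) (etrans (f_equal G lB) G1).
have EJ : 'J (tr c b \o (G \o (fun q => q *m B))) l.2 = B *m (Mm *m 'J (tr c b) (yc (s + a))).
  rewrite JH JGB JB -mulmxA; exact: (f_equal2 (fun X Y => B *m (X *m Y)) e3 e4).
rewrite JF EJ !det_mulmx -(trJE ac ab Uya) DD_det.
have eB : \det B = \det (transition_jac c (ch s) xs) by exact: det_tr.
have ringl (m1 d1 d2 d3 : R) : m1 * (d1 * (d2 * d3)) = m1 * d3 * d2 * d1 by ring.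
rewrite eB; exact: ringl.
Qed.
End AtTimes.

Variables (x : M) (p : 'rV[R]_n).
Hypotheses (xe : x = cinv c y0) (pe : cotangent_of c q0 y0 = (x, p)).

Lemma flow_lambda (t : R) : `|t| < T -> flow S t (x, p) = cotangent_of c (lsubmx (zc t)) (yc t).
Proof. by move=> tT; rewrite -pe; have := flow_Phi z0r tT; rewrite row_mxKl row_mxKr. Qed.

Lemma geodesic_lambda (t : R) : `|t| < T -> geodesic S (x, p) t = cinv c (yc t).
Proof. by move=> tT; rewrite /geodesic flow_lambda. Qed.

Lemma velocity_lambda (t : R) : `|t| < T ->
  velocity (geodesic S (x, p)) t *m transition_jac (chart_at (cinv c (yc t))) c (cinv c (yc t)) =
  rsubmx (hF (zc t)).
Proof.
move=> tT; rewrite /velocity geodesic_lambda //; set b := chart_at _.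
have ab : atlas M b by exact: chart_at_atlas.
have Uy : U (yc t) := zcU tT.
have oy : ov c b (yc t) by apply/(ovP ac ab); split=> //; exact: chart_at_dom.
have D := is_derive_tr ac ab (erefl _) oy (is_derive_rsub (dzc tT)).
have nr : \forall u \near t, (tr c b \o (fun u => yc u)) u = (cmap b \o geodesic S (x, p)) u.
  have : \forall u \near t, - T < u < T by apply: near_between; rewrite -ltr_norml.
  by apply: filterS => u; rewrite -ltr_norml => uT; rewrite /= geodesic_lambda.
rewrite derive1E; have [_ ->] := near_eq_is_derive nr D.
rewrite -(trJE ac ab Uy) -mulmxA.
rewrite (transition_inv ac ab (cinv_dom ac Uy)) ?mulmx1 //; exact: chart_at_dom.
Qed.

Lemma mm_smooth mu : volume_form mu -> smooth [set t : R | `|t| < T] (mm mu).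
Proof.
move=> [_ smu]; have h := smooth_rsub (smu c ac).
exact: (smooth_zc oU sF0 sF sQ zcU dzc h).
Qed.

Lemma mm_neq0 mu (t : R) : volume_form mu -> `|t| < T -> mm mu t != 0.
Proof.
move=> [mu0 _] tT; rewrite /mm mulf_neq0 ?mu0 //; have Uy : U (yc t) := zcU tT.
exact: (det_neq0_mul (transition_inv ac (chart_at_atlas (cinv c (yc t))) (cinv_dom ac Uy) (chart_at_dom _))).
Qed.

(** Dividing by [dual_volume] multiplies by [mu] at the starting point, and this turns the Jacobian
    of the fiber coordinates into [mm] at time [s]. *)
Lemma density_lambda mu (s a : R) : volume_form mu -> `|s| + `|a| < T ->
  volume_density S mu (flow S s (x, p)) a =
  mm mu (s + a) * DD (index_enum (idx n)) (phiJ Ps) (psiJ Ps) s (s + a) * mm mu s.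
Proof.
move=> [mu0 _] sa; have sT : `|s| < T by apply: le_lt_trans sa; rewrite lerDl.
have e := pullback_flow sa mu.
have ringl (A d m1 : R) : A * d / m1^-1 = A * (m1 * d) by rewrite invrK; ring.
rewrite /volume_density (flow_lambda sT).
apply: (etrans (f_equal (fun w => w / dual_volume mu (cinv c (yc s))) e)); exact: ringl.
Qed.
End Pull.

(** One set of constants for all local arguments: the order computation, the variational comparison
    and the density must concern the same flow [Phi] and linearization [Ps] on the same interval. *)
Record flow_box (R : realType) (n k : nat) (M : manifold R n) (S : affine_system M k)
    (c : chart R n M) (q0 y0 : 'rV[R]_n) (E : 'M[R]_(n, k)) (r K K' KX KL T : R)
    (Phi : 'rV[R]_(n + n) -> R -> 'rV[R]_(n + n)) (Ps : R -> 'M[R]_(n + n)) : Prop := FlowBox {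
  fb_r : 0 < r; fb_K : 0 < K; fb_K' : 0 <= K'; fb_KX : 0 <= KX; fb_KL : 0 <= KL; fb_T : 0 < T;
  fb_KT : K * T <= 2^-1; fb_KTr : K * T <= r / 4;
  fb_est : field_bounds (UU (ccod c)) (cH S c) (row_mx q0 y0) r K;
  fb_Phi : flow_bounds R (cH S c) (row_mx q0 y0) r K T Phi;
  fb_Ps0 : Ps 0 = 1%:M;
  fb_dPs : forall t : R, `|t| < T ->
    is_derive t 1 Ps (Ps t *m Dfield (cH S c) (Phi (row_mx q0 y0) t));
  fb_Hz : forall a b : 'rV[R]_(n + n), `|a - row_mx q0 y0| <= r -> `|b - row_mx q0 y0| <= r ->
    `|cHz S c a - cHz S c b -
       'D_(a - b) (cHz S c) b| <= K' * `|a - b| ^+ 2;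
  fb_X : forall y, `|y - y0| <= r -> [/\ ccod c y, (forall j, `|cF0 S c y 0 j| <= KX),
     (forall i j, `|cF S c i y 0 j| <= KX) & `|cQ S c y| <= KX];
  fb_L : forall z, `|z - row_mx q0 y0| <= r ->
    `|2^-1 * lagr (cQ S c) (rsubmx z) (ctrl (cF S c) (lsubmx z) (rsubmx z))| <= KL;
  fb_E : forall y, `|y - y0| <= r -> XX (cF S c) y *m E \in unitmx }.

Section Setup.
Context {R : realType} {n k : nat} {M : manifold R n} (S : affine_system M k).
Local Opaque jacobian transition_jac field_in.
Hypothesis hS : smooth_system S.

(** Each local estimate holds on some ball; [r] is the smallest radius, and the time is then chosen
    small with respect to [K] and [r]. *)
Lemma flow_box_exists (c : chart R n M) (q0 y0 : 'rV[R]_n) (E : 'M[R]_(n, k)) : atlas M c -> ccod c y0 ->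
  XX (cF S c) y0 *m E = 1%:M -> exists r K K' KX KL T Phi Ps, flow_box S c q0 y0 E r K K' KX KL T Phi Ps.
Proof.
move=> ac Uy0 hE; set z0 := row_mx q0 y0.
have oU : open (ccod c) by exact: oc.
have sF0 j : smooth (ccod c) (fun y => cF0 S c y 0 j) by exact: scF0.
have sF i j : smooth (ccod c) (fun y => cF S c i y 0 j) by exact: scF.
have sQ : smooth (ccod c) (cQ S c) by exact: scQ.
have Uz0 : UU (ccod c) z0 by rewrite /UU /= row_mxKr.
have [r1 [K [r10 K0 est1]]] := field_est (oUU oU) (shH oU sF0 sF sQ) Uz0.
have [r2 [K2 [r20 K20 h2]]] := loc_est (oUU oU) (sHz oU sF0 sF sQ) Uz0.
have [r3 r30 h3] := finite_radius (fun j => smooth_bound Uy0 (sF0 j)).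
have [r4 r40 h4] := finite_radius (fun ij : 'I_k * 'I_n => smooth_bound Uy0 (sF ij.1 ij.2)).
have [r5 r50 h5] := smooth_bound Uy0 sQ.
have [r6 r60 h6] := smooth_bound Uz0 (LL_smooth hS ac).
have n1 : \forall y \near y0, ccod c y by apply: open_nbhs_nbhs.
have [r7 r70 h7] := near_ball2 n1.
have sXE : smooth (ccod c) (fun y => \det (XX (cF S c) y *m E)).
  apply: (smooth_det oU); apply: (smooth_mulmx oU) => i j.
    by apply: (smooth_ext oU (f := fun y => cF S c i y 0 j)) => [y _|]; [rewrite [RHS]mxE|exact: sF].
  exact: (smooth_cst _ oU).
have n2 : \forall y \near y0, 0 < \det (XX (cF S c) y *m E).
  have d1 : 0 < \det (XX (cF S c) y0 *m E) by rewrite hE det1 ltr01.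
  have cd := smooth_cont sXE Uy0; exact: (cd _ (lt_nbhsr d1)).
have [r8 r80 h8] := near_ball2 n2.
set A3 := \sum_j (`|cF0 S c y0 0 j| + 1); set A4 := \sum_(ij : 'I_k * 'I_n) (`|cF S c ij.1 y0 0 ij.2| + 1).
have A30 : 0 <= A3 by apply: sumr_ge0 => j _; rewrite addr_ge0.
have A40 : 0 <= A4 by apply: sumr_ge0 => j _; rewrite addr_ge0.
have A50 : 0 <= `|cQ S c y0| by exact: normr_ge0.
set KX := A3 + A4 + (`|cQ S c y0| + 1).
have [r [r0 rr1 rr2 rr345 rr678]] : exists r : R, [/\ 0 < r, r <= r1, r <= r2, [/\ r <= r3, r <= r4 & r <= r5] &
    [/\ r <= r6, r <= r7 & r <= r8]].
  exists (Num.min (Num.min (Num.min r1 r2) (Num.min r3 r4)) (Num.min (Num.min r5 r6) (Num.min r7 r8))).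
  by rewrite !lt_min !ge_min !lexx !orbT r10 r20 r30 r40 r50 r60 r70 r80.
have [rr3 rr4 rr5] := rr345; have [rr6 rr7 rr8] := rr678.
have est a b d : `|a - z0| <= r -> `|b - z0| <= r -> `|d - z0| <= r -> _ :=
  fun ha hb hd => est1 a b d (le_trans ha rr1) (le_trans hb rr1) (le_trans hd rr1).
set T2 := Num.min (2 * K)^-1 (r / (4 * K)).
have K2p : 0 < 2 * K by rewrite mulr_gt0.
have K4p : 0 < 4 * K by rewrite mulr_gt0.
have T20 : 0 < T2 by rewrite lt_min invr_gt0 K2p divr_gt0.
have KT2 : K * T2 <= 2^-1.
  have h : T2 <= (2 * K)^-1 by rewrite ge_min lexx.
  apply: (@le_trans _ _ (K * (2 * K)^-1)); first by rewrite ler_wpM2l // ltW.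
  by rewrite invfM mulrCA mulfV ?mulr1 // lt0r_neq0.
have KT2r : K * T2 <= r / 4.
  have h : T2 <= r / (4 * K) by rewrite ge_min lexx orbT.
  apply: (@le_trans _ _ (K * (r / (4 * K)))); first by rewrite ler_wpM2l // ltW.
  have -> : K * (r / (4 * K)) = r / 4 by field; exact: lt0r_neq0.
  exact: lexx.
have KT2r2 : K * T2 <= r / 2 by apply: (le_trans KT2r); rewrite ler_pM2l // lef_pV2 ?posrE // ler_nat.
have [Phi HP] := local_flow r0 K0 est T20 KT2 KT2r2.
(* [variational] wants the reference solution on a closed interval, whereas [local_flow] provides an
   open one. *)
set T := T2 / 2; have T0 : 0 < T by rewrite divr_gt0.
have TT2 : T < T2 by rewrite ltr_pdivrMr // ltr_pMr // ltr1n.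
have KTT : K * T <= K * T2 by rewrite ler_wpM2l // ltW.
have HPhi : flow_bounds R (cH S c) z0 r K T Phi.
  by move=> z /HP[e h]; split=> // t tT; apply: h; exact: lt_trans tT TT2.
have z0r : `|z0 - z0| <= r / 2 by rewrite subrr normr0 divr_ge0 // ltW.
have hl t : `|t| <= T -> `|Phi z0 t - z0| <= r /\ is_derive t 1 (Phi z0) (cH S c (Phi z0 t)).
  by move=> tT; have [_ h] := HP z0 z0r; have [_ h'] := h t (le_lt_trans tT TT2).
have [Ps [Ps0 dPs]] := variational (shH oU sF0 sF sQ) r0 K0 est T0 (le_trans KTT KT2) hl.
exists r, K, K2, KX, (`|LL S c z0| + 1), T, Phi, Ps; split=> //.
- by rewrite !addr_ge0.
- exact: le_trans KTT KT2.
- exact: le_trans KTT KT2r.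
- move=> a b ha hb; have [_ _ _ _ h] := h2 a b b (le_trans ha rr2) (le_trans hb rr2) (le_trans hb rr2).
  by move: h; rewrite subrr normr0 addr0 -mulrA -expr2.
- move=> y hy; split.
  + exact: h7 (le_trans hy rr7).
  + move=> j; apply: (le_trans (h3 y (le_trans hy rr3) j)); rewrite /KX -addrA.
    apply: (@le_trans _ _ A3); last by rewrite lerDl !addr_ge0.
    by rewrite /A3 (bigD1 j) //= lerDl; apply: sumr_ge0 => i _; rewrite addr_ge0.
  + move=> i j; apply: (le_trans (h4 y (le_trans hy rr4) (i, j))).
    apply: (@le_trans _ _ A4); last by rewrite /KX -addrA addrCA lerDl !addr_ge0.
    by rewrite /A4 (bigD1 (i, j)) //= lerDl; apply: sumr_ge0 => l _; rewrite addr_ge0.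
  + by apply: (le_trans (h5 y (le_trans hy rr5))); rewrite /KX lerDr addr_ge0.
- by move=> z hz; exact: h6 (le_trans hz rr6).
- by move=> y hy; rewrite unitmxE unitfE lt0r_neq0 // h8 // (le_trans hy).
Qed.
End Setup.

Lemma lead_pos (R : realType) (N : nat) (c0 : R) (f : R -> R) : 0 < c0 -> lead N c0 f ->
  exists2 d : R, 0 < d & forall t, 0 < t <= d -> f t != 0.
Proof.
move=> c00 [K [d [K0 d0 h]]]; have K1 : 0 < K + 1 by rewrite ltr_wpDl.
exists (Num.min d (c0 / (2 * (K + 1)))); first by rewrite lt_min d0 divr_gt0 // mulr_gt0.
move=> t /andP[t0]; rewrite le_min => /andP[td tc].
have ht : 0 <= t <= d by rewrite ltW.
have h1 := h t ht; apply/negP => /eqP e; move: h1; rewrite e sub0r normrN normrM.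
rewrite (gtr0_norm c00) (ger0_norm (exprn_ge0 _ (ltW t0))) exprS mulrA [leRHS]mulrC.
rewrite ler_pM2l ?exprn_gt0 // => h2.
have h3 : t * (2 * (K + 1)) <= c0 by rewrite -ler_pdivlMr // mulr_gt0.
have h4 : K * t <= (K + 1) * t by rewrite ler_wpM2r ?ltW // ltrDl.
have h5 := t0; have h6 := c00; lra.
Qed.

Lemma mxtrace_norm (R : realType) k (A : 'M[R]_k) : `|\tr A| <= k%:R * `|A|.
Proof.
apply: le_trans (ler_norm_sum _ _ _) _.
apply: (@le_trans _ _ (\sum_(i < k) `|A|)); first by apply: ler_sum => i _; exact: mx_entry_le.
by rewrite sumr_const card_ord mulr_natl.
Qed.

(** * Assembly in the chart at the base point *)

Theorem theorem1p2 (R : realType) (n k : nat) (hkn : (k <= n)%N)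
    (M : manifold R n) (hM : connected [set: M])
    (S : affine_system M k) (hS : smooth_system S)
    (hfree : forall x : M, row_free (frame_mx S x))
    (hgen : bracket_generating S)
    (mu : M -> R) (hmu : volume_form mu)
    (x : M) (p : 'rV[R]_n)
    (T : R) (hT : 0 < T) (hflow : flow_defined S T (x, p))
    (V : vfield M) (hV : admissible_extension S T (x, p) V)
    (hample : ample S V T (x, p)) (hreg : equiregular S V T (x, p))
    (Rl : 'M[R]_k) (hRl : is_curvature S (x, p) Rl) :
  exists C : R, 0 < C /\
  exists r : R -> R, r t / t ^+ 2 @[t --> 0^'+] --> 0 /\
  \forall t \near 0^'+,
    pullback_volume S mu t (x, p) =
      C * t ^+ geodesic_dim S V x
      * expR (\int[lebesgue_measure]_(s in `[0, t]) rho S V mu (flow S s (x, p)))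
      * (1 - t ^+ 2 * (\tr Rl / 6) + r t)
      * dual_volume mu x.
Proof.
set c := chart_at x; set y0 := cmap c x.
have ac : atlas M c by exact: chart_at_atlas.
have dx : cdom c x by exact: chart_at_dom.
have xe : x = cinv c y0 by rewrite (cmapK (atlas_chart ac) dx).
have Uy0 : ccod c y0 by exists x.
have pe : cotangent_of c p y0 = (x, p).
  by rewrite /cotangent_of -xe (transition_id ac dx) trmx1 mulmx1.
have hc : chart_at (x, p).1 = c by [].
have xe1 : (x, p).1 = cinv c y0 by exact: xe.
have eX : XX (cF S c) y0 = frame_mx S x.
  apply/row_matrixP => i; rewrite row_XX rowK; exact: (field_in_at (frame S i) x).
(* A right inverse of the frame at [x]. The product [XX *m E] stays invertible nearby and yields
   smooth frame coordinates of sections. *)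
have [E hE] : exists E, XX (cF S c) y0 *m E = 1%:M by rewrite eX; exact/row_freeP.
have [r [K [K' [KX [KL [T1 [Phi [Ps fb]]]]]]]] := flow_box_exists hS p ac Uy0 hE.
have [r0 K0 K'0 KX0 KL0 T0 KT KTr est HPhi Ps0 dPs hHz hX hL hE'] := fb.
set z0 := row_mx p y0.
have oU : open (ccod c) by exact: oc.
have sF0 j : smooth (ccod c) (fun y => cF0 S c y 0 j) by exact: scF0.
have sF i j : smooth (ccod c) (fun y => cF S c i y 0 j) by exact: scF.
have sQ : smooth (ccod c) (cQ S c) by exact: scQ.
have z0r : `|z0 - z0| <= r / 2 by rewrite subrr normr0 divr_ge0 // ltW.
have dom t : `|t| < T1 -> [/\ `|Phi z0 t - z0| <= r, UU (ccod c) (Phi z0 t) &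
    is_derive t 1 (Phi z0) (cH S c (Phi z0 t))].
  by move=> tT; exact: (Phi_dom est HPhi z0r tT).
have zcU t : `|t| < T1 -> UU (ccod c) (Phi z0 t) by move=> /dom[].
have dzc (t : R) : `|t| < T1 -> is_derive t 1 (Phi z0) (cH S c (Phi z0 t)) by move=> /dom[].
have gl t : `|t| < T1 -> geodesic S (x, p) t = cinv c (rsubmx (Phi z0 t)).
  by move=> tT; exact: (geodesic_lambda hS ac r0 est HPhi pe tT).
have z00 : Phi z0 0 = z0 by have [] := HPhi z0 z0r.
have n0 : `|0 : R| < T1 by rewrite normr0.
have g0 : geodesic S (x, p) 0 = x by rewrite gl // z00 row_mxKr -xe.
have uE t : `|t| < T1 -> XX (cF S c) (rsubmx (Phi z0 t)) *m E \in unitmx.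
  move=> /dom[h _ _]; apply: hE'; have h2 := norm_rsubmx (Phi z0 t - z0).
  by rewrite rsubB row_mxKr in h2; exact: le_trans h2 h.
(* Strictly below [T1], so that closed intervals stay in the domain of [Phi], and at most [T], up to
   which the geodesic is ample and equiregular. *)
set eps := Num.min (T1 / 2) T.
have eps0 : 0 < eps by rewrite lt_min divr_gt0.
have epsT1 : eps < T1.
  by rewrite gt_min ltr_pdivrMr // ltr_pMr // ltr1n.
have epsT : eps <= T by rewrite ge_min lexx orbT.
have inT s : 0 <= s < eps -> `|s| < T1 by move=> /andP[h1 h2]; rewrite ger0_norm // (lt_trans h2).
have [[Xd sXd VE] hvel] := hV.
have velV (t : R) : 0 <= t < eps -> rsubmx (cH S c (Phi z0 t)) = field_in c V (rsubmx (Phi z0 t)).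
  move=> ht; have tT := inT t ht; have /andP[t0 te] := ht.
  have tI : 0 <= t <= T by rewrite t0 (le_trans (ltW te)).
  have := velocity_lambda hS ac r0 est HPhi pe tT; rewrite -(hvel t tI) (gl t tT) => <-.
  by rewrite field_inE.
set N := geodesic_dim S V x.
(* Equiregularity enters here: the exponent is the same at all times in [[0, eps)]. *)
have dimE s : 0 <= s < eps -> geodesic_dim S V (cinv c (rsubmx (Phi z0 s))) = N.
  move=> hs; have sT := inT s hs; have /andP[s0 se] := hs; apply: geodesic_dim_eq => i.
  have sI : 0 <= s <= T by rewrite s0 (le_trans (ltW se)).
  have zI : 0 <= (0 : R) <= T by rewrite lexx ltW.
  by have := hreg i s 0 sI zI; rewrite g0 gl.
have ord s : 0 <= s < eps -> exists2 c0 : R, 0 < c0 &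
    lead N c0 (fun t => DD (index_enum (idx n)) (phiJ Ps) (psiJ Ps) s (s + t)).
  move=> hs; have sT := inT s hs; have /andP[s0 se] := hs.
  have sI : 0 <= s <= T by rewrite s0 (le_trans (ltW se)).
  have hfull : exists m, flag S V m (cinv c (rsubmx (Phi z0 s))) = fullv.
    by have [m hm] := hample s sI; exists m; rewrite -gl.
  rewrite -(dimE s hs).
  exact: (order_manifold hS sXd VE ac T0 (ltW epsT1) zcU dzc Ps0 dPs uE velV hs hfull).
have sphi := smooth_phiJ oU sF0 sF sQ zcU dzc dPs.
have spsi := smooth_psiJ oU sF0 sF sQ zcU dzc dPs.
have smm : smooth (IT T1) (mm c p y0 Phi mu) by exact: (mm_smooth hS ac r0 est HPhi hmu).
have mm0 t : IT T1 t -> mm c p y0 Phi mu t != 0.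
  by move=> tT; exact: (mm_neq0 ac r0 est HPhi hmu tT).
have Ieps t : `|t| <= eps -> IT T1 t by move=> h; exact: le_lt_trans h epsT1.
have e00 : 0 <= (0 : R) < eps by rewrite lexx.
(* Small positive times are not conjugate, since [det b] has a positive leading coefficient. *)
have [dB dB0 hB] : exists2 d : R, 0 < d & forall t, 0 < t <= d -> `|t| < T1 -> ursubmx (Ps t) \in unitmx.
  have [c0 c00 hl] := ord 0 e00; have [d d0 hd] := lead_pos c00 hl; exists d => // t ht tT.
  by have := hd t ht; rewrite add0r (DD0E Ps0) unitmxE unitfE.
have [Q [Il [near1 IlT RlT [K1 near2]]]] := hRl.
have reg : \forall t \near (0 : R)^'+, cost_regular S (x, p) t.
  by apply: filterS near1 => t [].
have gl' t : `|t| < T1 -> geodesic S (x, p) t = cinv c (xb Phi z0 t) by exact: gl.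
have [tau0 [d0 [tau00 tau0T d00 Hval]]] := value_eq hS ac r0 K0 K'0 KX0 KL0 T0 KT KTr est HPhi hHz hX hL xe1 gl' reg.
set tau := Num.min tau0 1.
have tau0' : 0 < tau by rewrite lt_min tau00 ltr01.
have tau1 : tau <= 1 by rewrite ge_min lexx orbT.
have tauT : tau < T1 by rewrite gt_min tau0T.
have Hval' t z : 0 < t <= tau -> `|z - z0| <= r / 4 -> `|rsubmx z - y0| <= d0 -> xb Phi z t = xb Phi z0 t ->
    value S t (cinv c (rsubmx z)) (geodesic S (x, p) t) = (AA S c Phi z t)%:E.
  move=> /andP[h1 h2]; apply: Hval; rewrite h1 (le_trans h2) // ge_min lexx //.
have [dH dH0 hH'] := near_right_radius near1.
have [dR dR0 hR] := near_right_radius near2.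
set dQ := Num.min (Num.min dH dR) (Num.min dB (tau / 2)).
have dQ0 : 0 < dQ by rewrite !lt_min dH0 dR0 dB0 divr_gt0.
(* The two computations of the trace meet: the logarithmic derivative of the determinant and the
   Hessian of the cost are both the trace of [Y *m Y^T]. The expansion that defines the curvature
   then provides [tI = \tr Il] and [e = 3^-1 * \tr Rl]. *)
have HQ (t : R) : 0 < t <= dQ ->
    is_derive t 1 (fun u => D1 (index_enum (idx n)) (phiJ Ps) (psiJ Ps) u /
       DD (index_enum (idx n)) (phiJ Ps) (psiJ Ps) 0 u) (\tr (Q t)) /\
    `|\tr (Q t) - (\tr Il / t ^+ 2 + 3^-1 * \tr Rl)| <= k%:R * `|K1| * t.
  move=> /andP[t0]; rewrite !le_min => /andP[/andP[th tr_] /andP[tb tt]].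
  have ttau : t < tau by apply: (le_lt_trans tt); rewrite ltr_pdivrMr // ltr_pMr // ltr1n.
  have tT : `|t| < T1 by rewrite gtr0_norm // (lt_trans ttau).
  have tI d : t <= d -> 0 < t <= d by move=> h; rewrite t0.
  have bu := hB t (tI _ tb) tT.
  have sy := blocks_symp oU sF0 sF sQ T0 zcU Ps0 dPs tT bu.
  have [d [C [qf [dd0 C0 Hq] Hb]]] := extremal_family r0 K0 T0 KT est HPhi Ps0 dPs tT bu sy.
  have [_ hess] := hH' t (tI _ th).
  have := hessian_trace hS ac r0 K0 K'0 KX0 KL0 T0 KT KTr est HPhi hHz hX xe1 d00 tau1 tauT Hval' t0 ttau dd0 C0 Hq Hb hc hess.
  move=> /= trQ; split.
    have := trace_identity oU sF0 sF sQ T0 zcU dzc Ps0 dPs tT bu.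
    by rewrite /= z00 row_mxKr trQ.
  have := hR t (tI _ tr_) => hRt.
  have -> : \tr (Q t) - (\tr Il / t ^+ 2 + 3^-1 * \tr Rl) = \tr (Q t - (t ^- 2 *: Il + 3^-1 *: Rl)).
    by rewrite raddfB /= mxtraceD !mxtraceZ (mulrC (t ^- 2)).
  apply: le_trans (mxtrace_norm _) _; rewrite -mulrA ler_wpM2l //; apply: (le_trans hRt).
  by rewrite ler_wpM2r ?(ltW t0) // ler_norm.
have KQ0 : 0 <= k%:R * `|K1| by rewrite mulr_ge0.
have [C [C0 [rr [rr0 Hrr]]]] := asymptotics (@oIT R T1) eps0 Ieps sphi spsi smm mm0 ord KQ0 dQ0 HQ.
have m0E : mm c p y0 Phi mu 0 = mu x.
  by rewrite /mm z00 row_mxKr -xe -/c (transition_id ac dx) det1 mulr1.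
(* [rho] at [flow S s (x, p)] involves the density of a later covector; by [density_lambda] it is
   the same two-point determinant started at [s]. *)
have Hrho s : 0 <= s < eps -> rho S V mu (flow S s (x, p)) =
    rhot (index_enum (idx n)) (phiJ Ps) (psiJ Ps) (mm c p y0 Phi mu) N s.
  move=> hs; have sT := inT s hs.
  have gE : geodesic_dim S V (flow S s (x, p)).1 = N by rewrite -(dimE s hs) -gl.
  rewrite /rho gE; apply: (rho_formula (@oIT R T1) Ieps sphi smm mm0 ord hs).
  have : \forall a \near (0 : R), - (T1 - `|s|) < a < T1 - `|s|.
    by apply: near_between; rewrite oppr_lt0 subr_gt0 sT.
  apply: filterS => a; rewrite -ltr_norml ltrBrDl => sa.
  by rewrite (density_lambda hS ac r0 K0 T0 KT KTr est HPhi Ps0 dPs pe hmu sa).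
have := Hrr _ Hrho => Hfin.
exists C; split=> //; exists rr; split=> //.
have nT : \forall t \near (0 : R)^'+, `|t| < T1.
  near=> t; have t0 : 0 < t by near: t; exact: nbhs_right_gt.
  by rewrite gtr0_norm //; near: t; exact: nbhs_right_lt.
apply: filterS2 Hfin nT => t e tT.
have pl : pullback_volume S mu t (x, p) = mm c p y0 Phi mu t * DD (index_enum (idx n)) (phiJ Ps) (psiJ Ps) 0 t.
  have sa : `|0 : R| + `|t| < T1 by rewrite normr0 add0r.
  have := pullback_flow hS ac r0 K0 T0 KT KTr est HPhi Ps0 dPs sa mu.
  by rewrite z00 row_mxKl row_mxKr pe add0r -xe -/c (transition_id ac dx) det1 mulr1.
have mx0 : mu x != 0 by case: hmu.
(* The constant [1/6] is one half of the [1/3] in the definition of the curvature. *)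
have e3 : \tr Rl / 6 = 3^-1 * \tr Rl / 2 by field.
rewrite pl e3 /dual_volume -/N -e m0E; field; exact: mx0.
Unshelve. all: by end_near.
Qed.
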